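(* Let $\mu:\mathbb{R}^+\times A\to\mathbb{R}^d$, $\sigma:\mathbb{R}^+\times A\to\mathbb{R}^{d\times m}$ and $g:\Omega^d\to\mathbb{R}$ be uniformly bounded, and assume that: (i) $\mu,\sigma$ are continuous in $\alpha\in A$; (ii) $\mu,\sigma$ are $\delta_0$-Hölder continuous in $t$ for some constant $\delta_0\in(0,1]$; (iii) $g$ is uniformly continuous (with respect to the supremum norm). For $\alpha\in\mathcal{A}$ let $$X^\alpha_s:=\int_0^s\mu(t,\alpha_t)\,dt+\int_0^s\sigma(t,\alpha_t)\,dB_t,\qquad s\in[0,T]$$ (same notation for deterministic controls $a\in\mathcal{D}_h$), and define $$u_0:=\sup_{\alpha\in\mathcal{A}}\mathbb{E}^{\mathbb{P}_0}\big[g(X^\alpha_{T\wedge\cdot})\big],$$ $$v^h:=\inf_{\varphi\in\mathcal{U}}\mathbb{E}^{\mathbb{P}_0}\Big[\sup_{a\in\mathcal{D}_h}\Big\{g(X^a_{T\wedge\cdot})-\int_0^T\varphi_t(X^a)^{\intercal}\sigma(t,a_t)\,dB_t\Big\}\Big],\qquad h>0 .$$ Then $$u_0=\lim_{h\to0}v^h .$$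
   Context: Let $T>0$ and $d,m,k\in\mathbb{N}$. For $j\in\mathbb{N}$ let $\Omega^j:=\{\omega\in C([0,T],\mathbb{R}^j):\omega_0=0\}$. $B$ is the canonical process on $\Omega^m$, $\mathbb{F}$ the filtration it generates, and $\mathbb{P}_0$ the Wiener measure on $\Omega^m$ (so $B$ is an $m$-dimensional Brownian motion). $A$ is a nonempty compact subset of $\mathbb{R}^k$. For each $h>0$, fix a finite partition $0=t^h_0<t^h_1<\dots<t^h_{n_h}=T$ of $[0,T]$ with $t^h_{i+1}-t^h_i\le h$ for all $i$, and a finite $h$-net $N^h\subset A$ of $A$ (a finite set such that every point of $A$ is within distance $h$ of some point of $N^h$). $\mathcal{A}$ is the set of jointly measurable $\mathbb{F}$-adapted processes $\alpha$ on $[0,T]\times\Omega^m$ with values in $A$. $\mathcal{U}$ is the set of bounded jointly measurable functions $\varphi:[0,T]\times\Omega^d\to\mathbb{R}^d$ that are adapted to the canonical filtration of $\Omega^d$; $\varphi_t(X^a)$ denotes $\varphi$ evaluated along the path of $X^a$. $\mathcal{D}_h$ is the finite set of deterministic functions $[0,T]\to N^h$ that are constant on each $[t^h_i,t^h_{i+1})$. $X^\alpha_{T\wedge\cdot}$ denotes the whole path of $X^\alpha$ on $[0,T]$. *)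

(* Defs.v *)
From HB Require Import structures.
From mathcomp Require Import all_boot all_order all_algebra.
From mathcomp Require Import all_classical all_reals all_analysis.

Set Implicit Arguments.
Unset Strict Implicit.
Unset Printing Implicit Defensive.

Import Order.TTheory GRing.Theory Num.Theory.
Import numFieldNormedType.Exports.

Local Open Scope classical_set_scope.
Local Open Scope ring_scope.

(* Euclidean norm of a vector, Frobenius norm of a matrix; the library norm
   on matrices is the maximum norm. *)
Definition enorm (R : realType) (p q : nat) (x : 'M[R]_(p, q)) : R :=
  Num.sqrt (\sum_i \sum_j x i j ^+ 2).

(* Omega^j. A path on [0, T] is encoded as a function on R that vanishes
   outside [0, T], so that equality of encodings is equality of paths. *)
Record Omega (R : realType) (T : R) (j : nat) := MkOmega {
  path_fun :> R -> 'cV[R]_j ;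
  path_cont : {within `[0, T], continuous path_fun} ;
  path_start : path_fun 0 = 0 ;
  path_out : forall t, ~ (0 <= t <= T) -> path_fun t = 0 }.

Section PathSpace.
Variables (R : realType) (T : R) (j : nat).

HB.instance Definition _ := gen_eqMixin (Omega T j).
HB.instance Definition _ := gen_choiceMixin (Omega T j).

Definition zero_path : Omega T j :=
  MkOmega (@continuous_subspaceT _ _ _ _ (@cst_continuous _ _ (0 : 'cV[R]_j)))
    erefl (fun _ _ => erefl).

HB.instance Definition _ := isPointed.Build (Omega T j) zero_path.

Definition path_dist (w w' : Omega T j) : R :=
  sup [set enorm (w t - w' t) | t in `[0, T]].

Definition cylinders (t : R) : set (set (Omega T j)) :=
  [set E | exists s (i : 'I_j) (Y : set R),
    [/\ 0 <= s <= t, measurable Y & E = [set w : Omega T j | Y (w s i 0)]]].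

Definition path_filtration (t : R) : set (set (Omega T j)) := <<s cylinders t >>.

HB.instance Definition _ :=
  Measurable.copy (Omega T j) (g_sigma_algebraType (cylinders T)).

Definition F_measurable (t : R) (f : Omega T j -> R) :=
  forall Y : set R, measurable Y -> path_filtration t (f @^-1` Y).

Definition jointly_measurable (p q : nat)
    (H : R -> Omega T j -> 'M[R]_(p, q)) :=
  forall a b, measurable_fun (`[0, T]%classic `*` [set: Omega T j])
    (fun x : R * Omega T j => H x.1 x.2 a b).

Definition adapted (p q : nat) (H : R -> Omega T j -> 'M[R]_(p, q)) :=
  forall t, 0 <= t <= T -> forall a b, F_measurable t (fun w => H t w a b).

(* The path with values f on [0, T], if there is one. *)
Definition mkpath (f : R -> 'cV[R]_j) : Omega T j :=
  xget point [set w : Omega T j | forall t, 0 <= t <= T -> w t = f t].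

(* P is the Wiener measure: for s < t the increment of the canonical process
   over [s, t] is independent of path_filtration s with law N(0, (t - s) I_j). The second
   argument of normal_prob is the standard deviation. *)
Definition is_wiener (P : probability (Omega T j) R) :=
  forall s t, 0 <= s -> s < t -> t <= T ->
  forall (E : set (Omega T j)) (Y : 'I_j -> set R),
  path_filtration s E -> (forall i, measurable (Y i)) ->
  P (E `&` [set w : Omega T j | forall i, Y i ((w t - w s) i 0)]) =
  (P E * \prod_(i < j) normal_prob 0 (Num.sqrt (t - s)) (Y i))%E.

End PathSpace.

Section ItoIntegral.
Variables (R : realType) (T : R) (m : nat).

Record simple_process (d : nat) := SimpleProcess {
  sp_size : nat ;
  sp_start : 'I_sp_size -> R ;
  sp_stop : 'I_sp_size -> R ;
  sp_val : 'I_sp_size -> Omega T m -> 'M[R]_(d, m) ;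
  sp_times : forall i,
    [/\ 0 <= sp_start i, sp_start i <= sp_stop i & sp_stop i <= T] ;
  sp_adapted : forall i a b,
    F_measurable (sp_start i) (fun w => sp_val i w a b) ;
  sp_bounded : exists C : R, forall i w, enorm (sp_val i w) <= C }.

Definition sp_eval d (S : simple_process d) (t : R) (w : Omega T m)
    : 'M[R]_(d, m) :=
  \sum_i (if sp_start i < t <= sp_stop i then sp_val (s := S) i w else 0).

Definition sp_integral d (S : simple_process d) (t : R) (w : Omega T m)
    : 'cV[R]_d :=
  \sum_i (sp_val (s := S) i w
            *m (w (Num.min (sp_stop i) t) - w (Num.min (sp_start i) t))).

(* Y is a continuous version of the stochastic integral of H against the
   canonical process: the L^2 limit of integrals of simple processes that
   converge to H in L^2(dP (x) dt). Joint measurability of H is required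
   because the library integral of a nonmeasurable nonnegative function is
   only a lower integral. Simple processes adapted to the raw filtration also
   reach integrands adapted to its P-augmentation, such as phi_t(X^a). *)
Definition is_ito (P : probability (Omega T m) R) d
    (H : R -> Omega T m -> 'M[R]_(d, m)) (Y : Omega T m -> Omega T d) :=
  [/\ jointly_measurable H, measurable_fun setT Y &
    exists S : nat -> simple_process d,
      (\int[P]_w \int[lebesgue_measure]_(t in `[0%R, T])
         ((enorm (sp_eval (S n) t w - H t w)) ^+ 2)%:E)%E
        @[n --> \oo] --> 0%E
      /\ forall t, 0 <= t <= T ->
      (\int[P]_w ((enorm (sp_integral (S n) t w - Y w t)) ^+ 2)%:E)%E
        @[n --> \oo] --> 0%E].

(* Such a version is unique up to a P-null set when P is the Wiener measure,
   so the choice made by xget does not affect expectations. *)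
Definition ito (P : probability (Omega T m) R) d
    (H : R -> Omega T m -> 'M[R]_(d, m)) : Omega T m -> Omega T d :=
  xget (fun=> point) [set Y | is_ito P H Y].

End ItoIntegral.

Section ControlProblem.
Variables (R : realType) (T : R) (d m k : nat).

Definition admissible (A : set 'cV[R]_k)
    : set (R -> Omega T m -> 'cV[R]_k) :=
  [set alpha | [/\ jointly_measurable alpha, adapted alpha &
    forall t w, 0 <= t <= T -> A (alpha t w)]].

Definition dual_integrands : set (R -> Omega T d -> 'cV[R]_d) :=
  [set phi | [/\ jointly_measurable phi, adapted phi &
    exists C : R, forall t w, 0 <= t <= T -> enorm (phi t w) <= C]].

(* Deterministic controls with values in N, constant on each
   [tp i, tp i.+1); set to 0 outside [0, T] so that the set is finite
   when N is. *)
Definition det_controls (N : set 'cV[R]_k) (n : nat) (tp : nat -> R)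
    : set (R -> 'cV[R]_k) :=
  [set a | [/\ forall t, 0 <= t <= T -> N (a t),
    forall i, (i < n)%N ->
      forall s t, tp i <= s < tp i.+1 -> tp i <= t < tp i.+1 -> a s = a t &
    forall t, ~ (0 <= t <= T) -> a t = 0]].

Definition is_partition (h : R) (n : nat) (tp : nat -> R) :=
  [/\ tp 0%N = 0, tp n = T,
    forall i, (i < n)%N -> tp i < tp i.+1 &
    forall i, (i < n)%N -> tp i.+1 - tp i <= h].

Definition is_net (h : R) (A N : set 'cV[R]_k) :=
  [/\ finite_set N, N `<=` A &
    forall x, A x -> exists2 y, N y & enorm (x - y) <= h].

Variables (P : probability (Omega T m) R).
Variables (mu : R -> 'cV[R]_k -> 'cV[R]_d) (sigma : R -> 'cV[R]_k -> 'M[R]_(d, m)).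
Variable (g : Omega T d -> R).

(* X^alpha. The drift integral and the chosen version of the stochastic
   integral are continuous in s for every w, so mkpath packages their sum
   without changing it. *)
Definition controlled (alpha : R -> Omega T m -> 'cV[R]_k)
    (w : Omega T m) : Omega T d :=
  mkpath T (fun s =>
    \col_i (\int[lebesgue_measure]_(t in `[0, s]) mu t (alpha t w) i 0)
    + ito P (fun t w => sigma t (alpha t w)) w s).

Definition primal_value (A : set 'cV[R]_k) : \bar R :=
  ereal_sup
    [set 'E_P[fun w => g (controlled alpha w)]%E | alpha in admissible A].

(* int_0^T phi_t(X^a)^T sigma(t, a_t) dB_t, a 1 x 1 matrix before projection *)
Definition dual_martingale (phi : R -> Omega T d -> 'cV[R]_d)
    (a : R -> 'cV[R]_k) (w : Omega T m) : R :=
  ito P (fun t w =>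
    (phi t (controlled (fun t _ => a t) w))^T *m sigma t (a t)) w T 0 0.

Definition pathwise_sup (N : set 'cV[R]_k) (n : nat) (tp : nat -> R)
    (phi : R -> Omega T d -> 'cV[R]_d) (w : Omega T m) : R :=
  sup [set g (controlled (fun t _ => a t) w) - dual_martingale phi a w
      | a in det_controls N n tp].

Definition dual_value (N : set 'cV[R]_k) (n : nat) (tp : nat -> R) : \bar R :=
  ereal_inf [set 'E_P[pathwise_sup N n tp phi]%E | phi in dual_integrands].

End ControlProblem.

(* Main.v *)
(** For the lower bound, a nearly optimal control is approximated by controls that are constant on the cells of
the partition, take values in the net, and depend on the past only. By locality of the stochastic integral, the dual
martingale of such a control agrees, on the event where the control equals a given deterministic [a], with that of
[a]; as it has mean zero, the expected gain is at most the expected pathwise supremum, for every integrand [phi].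

The upper bound holds for every [h]. On a fine grid the problem becomes a finite dynamic program whose state is a
path that is piecewise linear on a coarse grid, and whose value exceeds the primal one by at most a small error.
Averaging the value functions over small shifts of the increments of the path gives them a gradient with an explicit
second order bound. This gradient, evaluated along the coarse polygon of the path, is the integrand [phi]: the
one-step remainders are martingale differences of order [dt] in L2, so their sum is small in L2. *)

Require Import Defs.
From HB Require Import structures.
From mathcomp Require Import all_boot all_order all_algebra.
From mathcomp Require Import all_classical all_reals all_analysis.
From mathcomp Require Import measurable_realfun.
From mathcomp Require Import ring lra zify.
Set Implicit Arguments.
Unset Strict Implicit.
Unset Printing Implicit Defensive.
Import Order.TTheory GRing.Theory Num.Theory.
Import numFieldNormedType.Exports.
Local Open Scope classical_set_scope.
Local Open Scope ring_scope.

Local Notation mfun := (measurable_fun setT).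
Local Notation mfunO T j := (measurable_fun [set: Omega T j]).
Local Notation via y := (@le_trans _ _ y).
Local Notation mcomp := measurableT_comp.
Local Notation EFinP := measurable_EFinP.
Local Notation mfunB := measurable_funB.
Local Notation mfunM := measurable_funM.
Local Notation mfunD := measurable_funD.
Local Notation mfunX := measurable_funX.
Local Notation mcst := measurable_cst.
Local Notation mfun_sum := measurable_sum.
Local Notation Rint P f := (P.-integrable setT (EFin \o f)).
Local Notation leb := lebesgue_measure.

(** The integrand [phi_t(X^a)] is only measurable in time, and adapted only after adding null sets
    that depend on the time. The integral is therefore built for bounded jointly measurable
    integrands that at each fixed time agree almost surely with an adapted variable. They are
    sampled at times supplied by Lebesgue differentiation; sampling two integrands at the same times
    makes locality visible on simple processes. Gaussian moments enter only through bounds of the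
    right order in the time step, hence generous constants in place of the isometry.

    In the upper bound the parameters come in a strict order: the number [K] of coarse cells from
    tightness of the Euler martingale, the smoothing width [eps] from [K] and the modulus of [g],
    the mesh from [K] and [eps], and last the lattice step [dl], which may depend on the number of
    time steps. The second order bound is of order [eps ^- 2], free of [dl] and of the mesh, because
    every direction is averaged twice: one average is spent on the gradient, the other on its
    Lipschitz constant. *)

Lemma heine_cantor (R : realType) (U V : normedModType R) (K : set U) (f : U -> V) :
  compact K -> {within K, continuous f} -> forall e : R, 0 < e -> exists2 dl : R, 0 < dl &
    forall x y, K x -> K y -> `|x - y| < dl -> `|f x - f y| < e.
Proof.
move=> cK /subspace_continuousP cf e e0.
have /compact_near_coveringP/(_ R 0^'+ (fun dl x => K x ->
   forall y, K y -> `|x - y| < dl -> `|f x - f y| < e) _) := cK.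
case.
  move=> x Kx. have /cvgrPdist_lt/(_ (e / 2)) := cf _ Kx.
  rewrite divr_gt0// => /(_ isT); rewrite near_withinE => /nbhs_ballP[r/= r0 hr].
  exists (ball x (r / 2), [set i | 0 < i < r / 2]) => /=.
    split; first by apply: nbhsx_ballx; rewrite divr_gt0.
    by near=> i; rewrite /=; apply/andP; split; near: i;
      [exact: nbhs_right_gt|apply: nbhs_right_lt; rewrite divr_gt0].
  move=> [x' i]/= [xx' /andP[i0 ir]] Kx' y Ky x'y. have h1 : `|f x - f x'| < e / 2.
    apply: hr => //; apply: le_ball xx'; rewrite ler_pdivrMr// ler_pMr// ler1n//.
  have h2 : `|f x - f y| < e / 2.
    apply: hr => //; rewrite -ball_normE /ball_/=. move: xx'; rewrite -ball_normE /ball_/= => xx'.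
    rewrite -(subrKA x' x) (le_lt_trans (ler_normD _ _))// (splitr r). by rewrite ltrD// (lt_trans x'y).
  rewrite -(subrKA (f x) (f x')) (le_lt_trans (ler_normD _ _))// (splitr e). by rewrite ltrD// distrC.
move=> dl /= dl0 h; exists (dl / 2); first by rewrite divr_gt0.
move=> x y Kx Ky xy; apply: (h (dl / 2)) => //=; last by rewrite divr_gt0.
by rewrite sub0r normrN gtr0_norm ?divr_gt0// ltr_pdivrMr// ltr_pMr// ltr1n.
Unshelve. all: by end_near. Qed.

(** * The squared Frobenius norm *)

Section SquareNorm.
Variable R : realType.

(** The square of [enorm]. Estimates are stated for it because it is polynomial in the entries,
    hence measurable and integrable term by term. *)
Definition n2 p q (x : 'M[R]_(p, q)) : R := \sum_i \sum_j x i j ^+ 2.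

Lemma n2_ge0 p q (x : 'M[R]_(p, q)) : 0 <= n2 x.
Proof. by apply: sumr_ge0 => i _; apply: sumr_ge0 => j _; apply: sqr_ge0. Qed.

Lemma enorm_sqr p q (x : 'M[R]_(p, q)) : enorm x ^+ 2 = n2 x.
Proof. by rewrite /enorm sqr_sqrtr// n2_ge0. Qed.

Lemma enorm_ge0 p q (x : 'M[R]_(p, q)) : 0 <= enorm x.
Proof. exact: sqrtr_ge0. Qed.

Lemma n2D p q (x y : 'M[R]_(p, q)) : n2 (x + y) <= 2 * n2 x + 2 * n2 y.
Proof.
rewrite /n2 !mulr_sumr -big_split; apply: ler_sum => i _ /=.
rewrite !mulr_sumr -big_split; apply: ler_sum => j _ /=.
rewrite !mxE; have := sqr_ge0 (x i j - y i j); nra.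
Qed.

Lemma n2N p q (x : 'M[R]_(p, q)) : n2 (- x) = n2 x.
Proof. by apply: eq_bigr => i _; apply: eq_bigr => j _; rewrite mxE sqrrN. Qed.

Lemma n2B p q (x y : 'M[R]_(p, q)) : n2 (x - y) <= 2 * n2 x + 2 * n2 y.
Proof. by rewrite -(n2N y) n2D. Qed.

Lemma n2BC p q (x y : 'M[R]_(p, q)) : n2 (x - y) = n2 (y - x).
Proof. by rewrite -(n2N (x - y)) opprB. Qed.

Lemma n2_tri p q (x y z : 'M[R]_(p, q)) : n2 (x - z) <= 2 * n2 (x - y) + 2 * n2 (y - z).
Proof. by have := n2D (x - y) (y - z); rewrite subrKA. Qed.

Lemma n20 p q : n2 (0 : 'M[R]_(p, q)) = 0.
Proof.
by rewrite /n2 big1// => i _; rewrite big1// => j _; rewrite mxE expr0n.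
Qed.

Lemma n2Z p q (c : R) (x : 'M[R]_(p, q)) : n2 (c *: x) = c ^+ 2 * n2 x.
Proof.
rewrite /n2 mulr_sumr; apply: eq_bigr => i _; rewrite mulr_sumr.
by apply: eq_bigr => j _; rewrite mxE exprMn.
Qed.

Lemma n2_entry p q (x : 'M[R]_(p, q)) i j : x i j ^+ 2 <= n2 x.
Proof.
rewrite /n2 (bigD1 i)//= (bigD1 j)//= -addrA lerDl addr_ge0// ?sumr_ge0//.
  by move=> k _; apply: sqr_ge0.
by move=> k _; apply: sumr_ge0 => l _; apply: sqr_ge0.
Qed.

Lemma n2_eq0 p q (x : 'M[R]_(p, q)) : n2 x = 0 -> x = 0.
Proof.
move=> x0; apply/matrixP => i j; rewrite mxE; apply/eqP.
by rewrite -sqrf_eq0 eq_le sqr_ge0 andbT -x0 n2_entry.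
Qed.

(** Cauchy-Schwarz: both sides expand into double sums, and twice their difference is the sum of the
    squares of [a i * b j - a j * b i]. *)
Lemma sum_cs n (a b : 'I_n -> R) : (\sum_i a i * b i) ^+ 2 <= (\sum_i a i ^+ 2) * (\sum_i b i ^+ 2).
Proof.
rewrite expr2 !big_distrlr /=.
suff h : (\sum_i \sum_j a i * b i * (a j * b j)) * 2 <=
    (\sum_i \sum_j a i ^+ 2 * b j ^+ 2) + (\sum_i \sum_j a j ^+ 2 * b i ^+ 2).
  by move: h; rewrite [X in _ + X]exchange_big /=; lra.
rewrite -big_split mulr_suml; apply: ler_sum => i _ /=.
rewrite -big_split mulr_suml; apply: ler_sum => j _ /=.
by have := sqr_ge0 (a i * b j - a j * b i); nra.
Qed.

Lemma n2M p q r (x : 'M[R]_(p, q)) (y : 'M[R]_(q, r)) : n2 (x *m y) <= n2 x * n2 y.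
Proof.
rewrite /n2 mulr_suml; apply: ler_sum => i _.
rewrite [\sum_i _ in leRHS]exchange_big mulr_sumr; apply: ler_sum => j _ /=.
by rewrite mxE sum_cs.
Qed.

Lemma n2_tr p q (x : 'M[R]_(p, q)) : n2 x^T = n2 x.
Proof.
rewrite /n2 exchange_big; apply: eq_bigr => i _; apply: eq_bigr => j _.
by rewrite mxE.
Qed.

Lemma mxnorm_le p q (x : 'M[R]_(p, q)) c : 0 <= c -> (forall i j, `|x i j| <= c) -> `|x| <= c.
Proof.
move=> c0 h; rewrite [`|x|]mx_normrE; apply/bigmax_leP; by split.
Qed.

Lemma entry_mxnorm p q (x : 'M[R]_(p, q)) i j : `|x i j| <= `|x|.
Proof. by rewrite [leRHS]mx_normrE; apply: (le_bigmax _ _ (i, j)). Qed.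

Lemma n2_le_mxnorm p q (x : 'M[R]_(p, q)) : n2 x <= (p * q)%:R * `|x| ^+ 2.
Proof.
have : n2 x <= \sum_(i < p) \sum_(j < q) `|x| ^+ 2.
  apply: ler_sum => i _; apply: ler_sum => j _.
  by rewrite -real_normK ?num_real// lerXn2r ?nnegrE// entry_mxnorm.
by move/le_trans; apply; rewrite !sumr_const !card_ord -mulrnA mulr_natl mulnC.
Qed.

Lemma mxnorm_n2 p q (x : 'M[R]_(p, q)) : `|x| ^+ 2 <= n2 x.
Proof.
rewrite -[leRHS]sqr_sqrtr ?n2_ge0// lerXn2r ?nnegrE ?sqrtr_ge0//.
apply: mxnorm_le; first exact: sqrtr_ge0.
by move=> i j; rewrite -sqrtr_sqr ler_wsqrtr// n2_entry.
Qed.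

Lemma mxnorm_enorm p q (x : 'M[R]_(p, q)) : `|x| <= enorm x.
Proof.
by rewrite -(ler_pXn2r (n := 2))// ?nnegrE ?enorm_ge0// enorm_sqr mxnorm_n2.
Qed.

Lemma enorm_le_mxnorm p q (x : 'M[R]_(p, q)) : enorm x <= (p * q)%:R * `|x|.
Proof.
rewrite -(ler_pXn2r (n := 2))// ?nnegrE ?enorm_ge0 ?mulr_ge0// enorm_sqr.
apply: le_trans (n2_le_mxnorm x) _; rewrite exprMn ler_wpM2r ?sqr_ge0//.
by rewrite -natrX ler_nat expnS expn1; case: (p * q)%N => // k; rewrite leq_pmulr.
Qed.

End SquareNorm.

(** * Paths, moduli of continuity and the canonical filtration *)

Section PathTools.
Variables (R : realType) (T : R) (j : nat).
Implicit Types (w : Omega T j).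

(** Outside [[0, T]] both encodings vanish by [path_out]; the proof fields are identified by proof
    irrelevance. *)
Lemma omega_eq w w' : (forall t : R, 0 <= t <= T -> w t = w' t) -> w = w'.
Proof.
move=> h; have : path_fun w = path_fun w'.
  apply/funext => t; have [ht|/negP ht] := boolP (0 <= t <= T); first exact: h.
  by rewrite (path_out w ht) (path_out w' ht).
case: w w' {h} => f c s o [f' c' s' o'] /= ff'; subst f'.
by rewrite (Prop_irrelevance c c') (Prop_irrelevance s s') (Prop_irrelevance o o').
Qed.

Lemma mkpathE (f : R -> 'cV[R]_j) : 0 <= T -> {within `[0, T], continuous f} -> f 0 = 0 ->
  forall t : R, 0 <= t <= T -> mkpath T f t = f t.
Proof.
move=> T0 cf f0; apply: (@xgetPex _ point [set w : Omega T j | forall t, 0 <= t <= T -> w t = f t]).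
(* The choice in [mkpath] needs an actual element of [Omega]: [f] is cut to zero outside [[0, T]],
   which keeps continuity within the interval. *)
pose h t := if 0 <= t <= T then f t else 0.
have hf t : `[0, T]%classic t -> h t = f t by rewrite /h/= in_itv/= => ->.
have ch : {within `[0, T], continuous h}.
  apply: subspace_eq_continuous cf => x; rewrite inE => /hf hx. exact: esym hx.
have h0 : h 0 = 0 by rewrite /h lexx T0.
have ho t : ~ (0 <= t <= T) -> h t = 0 by rewrite /h => /negP/negPf ->.
by exists (MkOmega ch h0 ho) => t ht /=; rewrite hf//= in_itv.
Qed.

Lemma path_unif w (e : R) : 0 < e -> exists2 dl : R, 0 < dl & forall s t : R,
  0 <= s <= T -> 0 <= t <= T -> `|s - t| < dl -> `|w s - w t| < e.
Proof.
move=> e0; have [dl d0 h] := heine_cantor (@segment_compact _ 0 T) (@path_cont _ _ _ w) e0.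
by exists dl => // s t hs ht st; apply: h => //=; rewrite in_itv.
Qed.

(** One fixed pair of the modulus of continuity, in the maximum norm and with weak inequalities. The
    same pair survives averages, maxima and expectations, so the value functions inherit the moduli
    of [g] without loss. *)
Definition mod_ok (f : Omega T j -> R) (e dl : R) :=
  forall w w', (forall t : R, 0 <= t <= T -> `|w t - w' t| <= dl) -> `|f w - f w'| <= e.

Definition UC (f : Omega T j -> R) := forall e : R, 0 < e -> exists2 dl : R, 0 < dl & mod_ok f e dl.

(** The factor [j.+1] pays for the passage from the maximum norm to the Euclidean one, and the
    factor 2 makes the inequality strict after taking the supremum. *)
Lemma path_dist_lt w w' (dl : R) : 0 <= T -> 0 < dl ->
  (forall t : R, 0 <= t <= T -> `|w t - w' t| <= dl / (2 * j.+1%:R)) -> path_dist w w' < dl.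
Proof.
move=> T0 d0 h; apply: (@le_lt_trans _ _ (dl / 2)); last first.
  by rewrite ltr_pdivrMr// ltr_pMr// ltr1n.
apply: ge_sup.
  by exists (enorm (w 0 - w' 0)); exists 0 => //=; rewrite in_itv/= lexx T0.
move=> _ [t ht <-]; move: ht; rewrite /= in_itv/= => ht.
apply: le_trans (enorm_le_mxnorm _) _; rewrite muln1.
apply: le_trans (ler_wpM2l _ (h _ ht)) _ => //.
have -> : j%:R * (dl / (2 * j.+1%:R)) = dl / 2 * (j%:R / j.+1%:R) by field; rewrite nat1r pnatr_eq0.
rewrite -[leRHS]mulr1 ler_wpM2l ?divr_ge0 ?ltW//.
by rewrite ltr_pdivrMr// mul1r ltr_nat.
Qed.

Lemma UC_path_dist (g : Omega T j -> R) : 0 <= T -> (forall e : R, 0 < e -> exists2 delta : R, 0 < delta &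
    forall w w' : Omega T j, path_dist w w' < delta -> `|g w - g w'| < e) -> UC g.
Proof.
move=> T0 h e /h[dl d0 hd]; exists (dl / (2 * j.+1%:R)).
  by rewrite divr_gt0// mulr_gt0.
by move=> w w' ww'; rewrite ltW// hd// path_dist_lt.
Qed.

Lemma measurable_coord (t : R) i : 0 <= t <= T -> mfunO T j (fun w : Omega T j => w t i 0).
Proof.
move=> ht _ Y mY; rewrite setTI; apply: sub_sigma_algebra.
by exists t, i, Y; split.
Qed.

Lemma path_sub_cont w w' : {within `[0, T], continuous (fun t => w t - w' t)}.
Proof.
by apply/subspace_continuousP => x hx; apply: cvgB; apply/(subspace_continuousP _ _).1: hx; exact: path_cont.
Qed.

End PathTools.

(* Omega with the sigma-algebra of the canonical filtration at time s. *)
Definition OmF (R : realType) (T : R) (j : nat) (s : R) := g_sigma_algebraType (@cylinders R T j s).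

Section PathMeasurability.
Variables (R : realType) (T : R) (j : nat).

Lemma measurable_OmF d (X : measurableType d) (F : X -> Omega T j) s :
  (forall (t : R) i, 0 <= t <= s -> mfun (fun x => F x t i 0)) -> mfun (F : X -> OmF T j s).
Proof.
move=> h; apply: (@measurability _ _ X (OmF T j s) setT F (cylinders s)) => //.
move=> _ [_ [t [i [Y [ht mY ->]]]] <-].
by have := h t i ht measurableT Y mY.
Qed.

Lemma measurable_Omega d (X : measurableType d) (F : X -> Omega T j) :
  (forall (t : R) i, 0 <= t <= T -> mfun (fun x => F x t i 0)) -> mfun F.
Proof. exact: measurable_OmF. Qed.

Lemma measurable_coordF (s t : R) i : 0 <= t <= s ->
  measurable_fun [set: OmF T j s] (fun w : OmF T j s => (w : Omega T j) t i 0).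
Proof.
move=> ht _ Y mY; rewrite setTI; apply: sub_sigma_algebra.
by exists t, i, Y; split.
Qed.

Lemma F_measurableP s (f : Omega T j -> R) : F_measurable s f <-> measurable_fun [set: OmF T j s] f.
Proof.
split => [h _ Y mY|h Y mY]; first by rewrite setTI; apply: h.
by have := h measurableT Y mY; rewrite setTI.
Qed.

Lemma measurable_OmF_le s s' : s <= s' -> measurable_fun [set: OmF T j s'] (id : OmF T j s' -> OmF T j s).
Proof.
move=> ss'; apply: (@measurable_OmF _ (OmF T j s') id s) => t i /andP[t0 ts].
by apply: measurable_coordF; rewrite t0 (le_trans ts).
Qed.

Lemma measurable_OmF_Omega s : s <= T -> mfunO T j (id : Omega T j -> OmF T j s).
Proof. exact: measurable_OmF_le. Qed.

Lemma F_measurable_le s s' (f : Omega T j -> R) : s <= s' -> F_measurable s f -> F_measurable s' f.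
Proof.
move=> ss' /F_measurableP h; apply/F_measurableP.
exact: (mcomp h (measurable_OmF_le ss')).
Qed.

Lemma F_measurableT s (f : Omega T j -> R) : s <= T -> F_measurable s f -> mfunO T j f.
Proof. by move=> sT /(F_measurable_le sT)/F_measurableP. Qed.

End PathMeasurability.

(** * Polygonal paths and shifts of one increment *)

Section Interpolation.
Variables (R : realType) (T : R) (j : nat).

Definition ramp (a b t : R) : R := (Num.min (Num.max t a) b - a) / (b - a).

Lemma continuous_ramp (a b : R) : continuous (ramp a b : R -> R).
Proof.
move=> t; rewrite /ramp; apply: cvgM; last exact: cvg_cst.
apply: (@cvgB _ R^o); last exact: cvg_cst.
apply: (@continuous_min R R (fun t => Num.max t a) (cst b)); last exact: cvg_cst.
by apply: (@continuous_max R R id (cst a)) => //; exact: cvg_cst.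
Qed.

Lemma ramp0 (a b t : R) : a <= b -> t <= a -> ramp a b t = 0.
Proof. by move=> ab ta; rewrite /ramp max_r// min_l// subrr mul0r. Qed.

Lemma ramp1 (a b t : R) : a < b -> b <= t -> ramp a b t = 1.
Proof.
move=> ab bt; rewrite /ramp max_l ?(le_trans (ltW ab))// min_r//.
by rewrite divff// subr_eq0 gt_eqF.
Qed.

Lemma ramp01 (a b t : R) : a < b -> 0 <= ramp a b t <= 1.
Proof.
move=> ab; rewrite /ramp divr_ge0 ?subr_ge0 ?(ltW ab)//=; last first.
  by rewrite le_min le_max lexx orbT ltW.
by rewrite ler_pdivrMr ?subr_gt0// mul1r lerB// ge_min lexx orbT.
Qed.

(* The polygonal path through the points (tau i, x i - x 0), i <= K. *)
Definition polygon (tau : nat -> R) (K : nat) (x : nat -> 'cV[R]_j) : Omega T j :=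
  mkpath T (fun t => \sum_(i < K) ramp (tau i) (tau i.+1) t *: (x i.+1 - x i)).

(** Adds [v] to the increment of the path over [[a, b]]: the part before [a] is unchanged and the
    part after [b] is translated by [v]. *)
Definition path_add (w : Omega T j) (a b : R) (v : 'cV[R]_j) : Omega T j :=
  mkpath T (fun t => w t + ramp a b t *: v).

Lemma path_addE w (a b : R) v (t : R) : 0 <= T -> 0 <= a -> a <= b ->
  0 <= t <= T -> path_add w a b v t = w t + ramp a b t *: v.
Proof.
move=> T0 a0 ab ht; rewrite mkpathE//; last first.
  by rewrite (path_start w) add0r ramp0 ?scale0r.
apply/subspace_continuousP => u hu; apply: cvgD.
  by have /subspace_continuousP := @path_cont _ _ _ w; apply.
apply: cvgZ; last exact: cvg_cst.
by apply: cvg_within_filter; exact: continuous_ramp.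
Qed.

Variables (tau : nat -> R) (K : nat).
Hypotheses (tau0 : tau 0%N = 0) (tauK : tau K = T) (tauS : forall i, (i < K)%N -> tau i < tau i.+1).

Lemma grid_le i l : (i <= l <= K)%N -> tau i <= tau l.
Proof.
move=> /andP[il lK]; rewrite -(subnKC il); move: lK; rewrite -{1}(subnKC il).
elim: (l - i)%N => [|n IH]; first by rewrite addn0.
by rewrite addnS => h; apply: le_trans (IH (ltnW h)) (ltW (tauS h)).
Qed.

Lemma grid_ge0 i : (i <= K)%N -> 0 <= tau i.
Proof. by move=> iK; rewrite -tau0; apply: grid_le. Qed.

Lemma grid_leT i : (i <= K)%N -> tau i <= T.
Proof. by move=> iK; rewrite -tauK; apply: grid_le; rewrite iK leqnn. Qed.

Let T0 : 0 <= T. Proof. by rewrite -tauK grid_ge0. Qed.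

Lemma grid_find (t : R) : 0 < T -> 0 <= t <= T -> exists2 i, (i < K)%N & tau i <= t <= tau i.+1.
Proof.
move=> Tgt /andP[t0 tT].
have : exists i, (i < K)%N && (t <= tau i.+1).
  have : (0 < K)%N by case: (K) tauK => //; rewrite tau0 => T_; move: Tgt; rewrite -T_ ltxx.
  by case: (K) tauK => // n tn _; exists n; rewrite ltnSn/= tn.
move=> ex; case: (ex_minnP ex) => i /andP[iK ti] mini.
exists i => //; rewrite ti andbT; case: i iK ti mini => [|i] iK ti mini.
  by rewrite tau0.
rewrite leNgt; apply/negP => /ltW h.
by have := mini i; rewrite (ltnW iK) h ltnn => /(_ isT).
Qed.

Lemma polygonE x (t : R) : 0 <= t <= T ->
  polygon tau K x t = \sum_(i < K) ramp (tau i) (tau i.+1) t *: (x i.+1 - x i).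
Proof.
move=> ht; rewrite mkpathE//.
  apply: continuous_subspaceT => u.
  have -> : (fun t0 => \sum_(i < K) ramp (tau i) (tau i.+1) t0 *: (x i.+1 - x i)) =
      \sum_(i < K) (fun t0 : R => ramp (tau i) (tau i.+1) t0 *: (x i.+1 - x i)).
    by apply/funext => v; rewrite fct_sumE.
  elim/big_ind: _ => [|f g|i _].
  - exact: cvg_cst.
  - exact: cvgD.
  - by apply: cvgZ; [exact: continuous_ramp|exact: cvg_cst].
rewrite big1// => i _; rewrite ramp0 ?scale0r//; first exact/ltW/tauS.
exact/grid_ge0/ltnW.
Qed.

(** The ramps of earlier cells equal 1, so their terms telescope to [x l - x 0]; those of later
    cells vanish. *)
Lemma polygon_itv x (t : R) l : (l < K)%N -> tau l <= t <= tau l.+1 ->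
  polygon tau K x t = (x l - x 0%N) + ramp (tau l) (tau l.+1) t *: (x l.+1 - x l).
Proof.
move=> lK /andP[lt tl].
have ht : 0 <= t <= T by rewrite (le_trans _ lt) ?grid_ge0 ?(ltnW lK)//= (le_trans tl)// grid_leT.
rewrite polygonE// -(big_mkord predT (fun i => ramp (tau i) (tau i.+1) t *: (x i.+1 - x i))).
rewrite (@big_cat_nat _ _ _ l.+1)//= big_nat_recr//=.
rewrite [X in _ + X = _]big_nat_cond [X in _ + X = _]big1 ?addr0; last first.
  move=> i /andP[/andP[li iK] _]; rewrite ramp0 ?scale0r//; first exact/ltW/tauS.
  by rewrite (le_trans tl)// grid_le// li ltnW.
congr (_ + _); rewrite -(telescope_sumr _ (leq0n l)) big_nat_cond [RHS]big_nat_cond.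
apply: eq_bigr => i /andP[/andP[_ il] _]; rewrite ramp1 ?scale1r//.
  by apply: tauS; apply: ltn_trans lK.
by rewrite (le_trans _ lt)// grid_le// il ltnW.
Qed.

(** Inside a cell the polygon is a convex combination of its two end values, so the distance to
    [w t] is at most the larger of the two distances. *)
Lemma polygon_close (w : Omega T j) x (r : R) : 0 < T -> x 0%N = 0 ->
  (forall l (t : R), (l < K)%N -> tau l <= t <= tau l.+1 -> `|x l - w t| <= r /\ `|x l.+1 - w t| <= r) ->
  forall t : R, 0 <= t <= T -> `|polygon tau K x t - w t| <= r.
Proof.
move=> Tgt x0 h t ht; have [l lK lt] := grid_find Tgt ht.
rewrite (polygon_itv x lK lt) x0 subr0.
have [h1 h2] := h _ _ lK lt; have := ramp01 t (tauS lK).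
move: (ramp _ _ _) => c /andP[c0 c1].
rewrite (_ : _ - w t = (1 - c) *: (x l - w t) + c *: (x l.+1 - w t)); last first.
  by apply/matrixP=> a b; rewrite !mxE; ring.
apply: le_trans (ler_normD _ _) _; rewrite !normrZ.
have -> : `|1 - c| = 1 - c by rewrite ger0_norm// subr_ge0.
have -> : `|c| = c by rewrite ger0_norm.
have h0 : 0 <= 1 - c by rewrite subr_ge0.
by have := ler_wpM2l h0 h1; have := ler_wpM2l c0 h2; lra.
Qed.

End Interpolation.

(** * Uniformly continuous functionals are measurable for the cylinder sigma-algebra *)

Section ContinuousFunctionals.
Variables (R : realType) (T : R) (j : nat).

Let tau n i : R := T * i%:R / n.+1%:R.

Lemma floor_itv_measurable d (X : measurableType d) (h : X -> R) (z : int) (c : R) :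
  mfun h -> d.-measurable [set x | Num.floor (h x / c) = z].
Proof.
move=> mh.
have -> : [set x | Num.floor (h x / c) = z] = (fun x => h x / c) @^-1` `[z%:~R, (z + 1)%:~R[.
  apply/seteqP; split => x /=; rewrite in_itv/=.
    by move=> <-; rewrite ge_floor floorD1_gt.
  by move=> hz; apply/eqP; rewrite floor_eq.
rewrite -[X in _.-measurable X]setTI.
by apply: (mfunM mh (mcst c^-1)) => //; exact: measurable_itv.
Qed.

(** [f] is the pointwise limit of functionals that look at the path through finitely many rounded
    coordinates. Such functionals take countably many values, each on a cylinder event. *)
Lemma UC_measurable (f : Omega T j -> R) : 0 < T -> UC f -> mfun f.
Proof.
move=> T0 fU.
(* [Z n] rounds the values at the times [tau n i] down to multiples of [1 / n.+1], and [P n]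
   rebuilds a polygon from these integers. *)
pose Z (n : nat) (w : Omega T j) : {ffun 'I_n.+2 * 'I_j -> int} :=
  [ffun p : 'I_n.+2 * 'I_j => Num.floor (w (tau n p.1) p.2 0 / n.+1%:R^-1)].
pose P n (z : {ffun 'I_n.+2 * 'I_j -> int}) : Omega T j :=
  polygon T (tau n) n.+1 (fun i => \col_a (n.+1%:R^-1 * (z (inord i, a))%:~R)).
have tau0 n : tau n 0 = 0 by rewrite /tau mulr0 mul0r.
have tauK n : tau n n.+1 = T by rewrite /tau mulfK.
have tauS n i : (i < n.+1)%N -> tau n i < tau n i.+1.
  by move=> _; rewrite /tau ltr_pM2r ?invr_gt0// ltr_pM2l// ltr_nat.
have tauI n i : (i <= n.+1)%N -> 0 <= tau n i <= T.
  by move=> h; rewrite (grid_ge0 (tau0 n) (@tauS n))// (grid_leT (tauK n) (@tauS n)).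
apply: (@measurable_realfun.measurable_fun_cvg _ _ _ _ (fun n w => f (P n (Z n w)))).
  move=> n _ Y mY; rewrite setTI.
  have -> : (fun w => f (P n (Z n w))) @^-1` Y =
      \bigcup_z (if `[< Y (f (P n z)) >] then Z n @^-1` [set z] else set0).
    apply/seteqP; split => w /=.
      by move=> h; exists (Z n w) => //; rewrite (asboolT h).
    by move=> [z _]; case: asboolP => // h; rewrite /preimage/= => ->.
  apply: countable_bigcupT_measurable; first exact: countableP. move=> z; case: asboolP => // _.
  have -> : Z n @^-1` [set z] = \bigcap_(p in [set: 'I_n.+2 * 'I_j])
      [set w : Omega T j | Num.floor (w (tau n p.1) p.2 0 / n.+1%:R^-1) = z p].
    apply/seteqP; split => w /=.
      by move=> <- p _ /=; rewrite ffunE.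
    by move=> h; apply/ffunP => p; rewrite ffunE; apply: h.
  apply: fin_bigcap_measurable => //. move=> p _; apply: floor_itv_measurable; apply: measurable_coord.
  by apply: tauI; rewrite -ltnS.
move=> w _; apply/cvgrPdist_le => e e0.
have [dl d0 hd] := fU e e0.
have d20 : 0 < dl / 2 by rewrite divr_gt0.
have [c c0 hc] := path_unif w d20.
near=> n.
(* Half of [dl] covers the rounding error, the other half the oscillation of [w] over one cell of
   length [T / n.+1]. *)
have n1 : n.+1%:R^-1 <= dl / 2 by apply: ltW; near: n; exact: (near_infty_natSinv_lt (PosNum d20)).
have n2 : T / n.+1%:R < c.
  rewrite -ltr_pdivlMl//. near: n; have cT : 0 < T^-1 * c by rewrite mulr_gt0// invr_gt0.
  exact: (near_infty_natSinv_lt (PosNum cT)).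
apply: hd => t ht; rewrite distrC.
have rd i : (i <= n.+1)%N -> `|\col_a (n.+1%:R^-1 * (Z n w (inord i, a))%:~R) - w (tau n i)| <= n.+1%:R^-1.
  move=> hi; apply: mxnorm_le => [|a b]; first by rewrite invr_ge0.
  rewrite !mxE ffunE/= inordK// ord1; set x := w _ _ _.
  have := ge_floor (x / n.+1%:R^-1); have := floorD1_gt (x / n.+1%:R^-1).
  rewrite intrD1; set q := (Num.floor _)%:~R; rewrite invrK => h1 h2.
  have -> : n.+1%:R^-1 * q - x = - (n.+1%:R^-1 * (x * n.+1%:R - q)) by field; rewrite gt_eqF.
  rewrite normrN ger0_norm; last by rewrite mulr_ge0 ?invr_ge0 ?subr_ge0// ltW.
  by rewrite -[leRHS]mulr1 ler_wpM2l ?invr_ge0// lerBlDl ltW// addrC.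
apply: polygon_close ht => //; first exact: tauS.
  apply/colP => a; rewrite !mxE ffunE/= inordK// tau0 path_start mxE mul0r. by rewrite floor0 mulr0.
move=> l s lK ls.
have hs : 0 <= s <= T.
  have /andP[a1 a2] := tauI _ _ (ltnW lK); have /andP[b1 b2] := tauI _ _ lK.
  by case/andP: ls => c1 c2; rewrite (le_trans a1)//= (le_trans c2).
have step : tau n l.+1 - tau n l = T / n.+1%:R by rewrite /tau -mulrBl -mulrBr -addn1 natrD addrAC subrr add0r mulr1.
have cl i : (i <= n.+1)%N -> `|tau n i - s| <= T / n.+1%:R ->
    `|\col_a (n.+1%:R^-1 * (Z n w (inord i, a))%:~R) - w s| <= dl.
  move=> hi h; rewrite -(subrKA (w (tau n i))) (splitr dl).
  apply: le_trans (ler_normD _ _) _; apply: lerD; first exact: le_trans (rd _ hi) _.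
  by apply: ltW; apply: hc => //; [exact: tauI|exact: le_lt_trans n2].
case/andP: ls => l1 l2.
by split; apply: cl => //; rewrite ?(ltnW lK)//; rewrite ler_norml; apply/andP; split; move: step l1 l2; set a := tau n l; set b := tau n l.+1; set q := T / _; lra.
Unshelve. all: by end_near. Qed.

End ContinuousFunctionals.

(** * Moments of the normal distribution *)

Section NormalMoments.
Context (R : realType).
Variable s : R.
Hypothesis s0 : 0 < s.
Local Notation la := (@lebesgue_measure R).
Local Notation nu := (normal_prob 0 s).

Let sn0 : s != 0. Proof. by rewrite gt_eqF. Qed.

(** The Radon-Nikodym derivative and the explicit density have the same integral over every
    measurable set, hence agree almost everywhere. *)
Lemma ge0_integral_normal (f : R -> \bar R) : mfun f -> (forall x, 0 <= f x)%E ->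
  (\int[nu]_x f x = \int[la]_x (f x * (normal_pdf 0 s x)%:E))%E.
Proof.
move=> mf f0; have dom := normal_prob_dominates (0 : R) s.
rewrite -(Radon_Nikodym_SigmaFinite.change_of_variables dom f0 measurableT mf).
have fi := Radon_Nikodym_SigmaFinite.f_integrable dom.
have mp : mfun (fun x : R => (normal_pdf 0 s x)%:E) by apply/EFinP; exact: measurable_normal_pdf.
apply: ae_eq_integral => //; try by apply: emeasurable_funM => //; exact: measurable_int fi.
apply: ae_eqe_mul2l; apply: integral_ae_eq => // E _ mE.
by rewrite -Radon_Nikodym_SigmaFinite.f_integral.
Qed.

Lemma ge0_integral_normalN (f : R -> \bar R) : mfun f -> (forall x, 0 <= f x)%E ->
  (\int[nu]_x f (- x)%R = \int[nu]_x f x)%E.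
Proof.
move=> mf f0.
have mN : mfun (-%R : measurableTypeR R -> measurableTypeR R) by exact: oppr_measurable.
have mg : mfun (fun x : measurableTypeR R => f x * (normal_pdf 0 s x)%:E)%E.
  by apply: emeasurable_funM => //; apply/EFinP; exact: measurable_normal_pdf.
rewrite !ge0_integral_normal//; last exact: (mcomp mf mN).
have g0 : {in [set: measurableTypeR R], forall x, 0 <= f x * (normal_pdf 0 s x)%:E}%E.
  by move=> x _; rewrite mule_ge0// lee_fin normal_pdf_ge0.
transitivity (\int[la]_x (f (- x)%R * (normal_pdf 0 s (- x))%:E))%E.
  by apply: eq_integral => x _; rewrite !normal_pdfE// /normal_fun !subr0 sqrrN.
have := ge0_integral_pushforward mN la measurableT mg g0; rewrite preimage_setT /comp => <-.
by apply: eq_measure_integral => A mA _; exact: lebesgue_measureN.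
Qed.

(** Completing the square: the exponential times the centred density is a constant times the density
    with mean [c * s ^+ 2]. *)
Lemma normal_mgf (c : R) : (\int[nu]_x (expR (c * x))%:E = (expR (c ^+ 2 * s ^+ 2 / 2))%:E)%E.
Proof.
have mE : measurable_fun (setT : set R) (fun x : R => (expR (c * x))%:E).
  by apply/EFinP; apply: mcomp => //; exact: mfunM.
rewrite ge0_integral_normal//.
under eq_integral => x _.
  rewrite -EFinM (_ : expR (c * x) * normal_pdf 0 s x =
      expR (c ^+ 2 * s ^+ 2 / 2) * normal_pdf (c * s ^+ 2) s x); last first.
    rewrite !normal_pdfE// /normal_fun mulrCA [RHS]mulrCA; congr (_ * _).
    by rewrite -!expRD; congr expR; field.
  rewrite EFinM; over.
rewrite ge0_integralZl//.
- by rewrite integral_normal_pdf mule1.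
- by apply/EFinP; exact: measurable_normal_pdf.
- by move=> x _; rewrite lee_fin normal_pdf_ge0.
Qed.

Lemma expR_half_le2 : expR (1 / 2) <= 2 :> R.
Proof.
rewrite -[leLHS]invrK -expRN -[leRHS]invrK lef_pV2 ?posrE ?expR_gt0 ?invr_gt0//.
by have := expR_ge1Dx (- (1 / 2) : R); lra.
Qed.

Lemma normal_exp_norm : (\int[nu]_x (expR (x / s) + expR (- (x / s)))%:E <= 4%:E)%E.
Proof.
under eq_integral do rewrite EFinD.
have mE c : mfun (fun x : R => (expR (c * x))%:E).
  by apply/EFinP; apply: mcomp => //; exact: mfunM.
have h1 : mfun (fun x : R => (expR (x / s))%:E).
  by move: (mE s^-1); congr measurable_fun; apply/funext => x; rewrite mulrC.
have h2 : mfun (fun x : R => (expR (- (x / s)))%:E).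
  by move: (mE (- s^-1)); congr measurable_fun; apply/funext => x; rewrite mulrC mulrN.
rewrite ge0_integralD//; try by move=> x _; rewrite lee_fin expR_ge0.
under eq_integral do rewrite mulrC.
rewrite normal_mgf.
under eq_integral do rewrite mulrC -mulNr.
rewrite normal_mgf sqrrN exprVn mulVf ?expf_neq0//.
by rewrite -EFinD lee_fin; have := expR_half_le2; lra.
Qed.

(** The bound [x <= expR x], taken at the absolute value of [y] divided by [n], is raised to the
    power [n]. *)
Lemma pow_le_exp n (y : R) : (0 < n)%N -> `|y| ^+ n <= n%:R ^+ n * (expR y + expR (- y)).
Proof.
move=> n0; have nn : 0 < n%:R :> R by rewrite ltr0n.
apply: (via (n%:R ^+ n * expR `|y|)); last first.
  apply: ler_wpM2l; first by rewrite exprn_ge0// ltW. have := expR_gt0 y; have := expR_gt0 (- y).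
  by have [_|_] := ger0P y; lra.
have -> : `|y| = n%:R * (`|y| / n%:R) by field; rewrite gt_eqF.
rewrite exprMn; apply: ler_wpM2l; first by rewrite exprn_ge0// ltW.
rewrite expRM_natl.
rewrite lerXn2r ?nnegrE ?expR_ge0//.
by have := expR_ge1Dx (`|y| / n%:R); lra.
Qed.

(** Exponential moments give all moments at once. The constant is crude, but the power of [s] is the
    right one; [n = 2] and [n = 4] produce the constants 16 and [2 ^+ 10] met below. *)
Lemma normal_moment n : (0 < n)%N -> (\int[nu]_x (`|x| ^+ n)%:E <= (4 * n%:R ^+ n * s ^+ n)%:E)%E.
Proof.
move=> n0.
have me : mfun (fun x : R => expR (x / s) + expR (- (x / s))).
  by apply: mfunD; apply: mcomp => //; [|apply: mcomp => //]; exact: mfunM.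
have mn : measurable_fun (setT : set R) (fun x : R => `|x| ^+ n).
  apply: mfunX; exact: normr_measurable.
apply: (via (\int[nu]_x ((n%:R ^+ n * s ^+ n)%:E * (expR (x / s) + expR (- (x / s)))%:E))%E).
  apply: ge0_le_integral => //.
  - exact/EFinP.
  - exact/EFinP/mfunM.
  - move=> x _; rewrite -EFinM lee_fin.
    have := pow_le_exp (x / s) n0; rewrite normrM exprMn normfV (gtr0_norm s0) => h.
    have -> : `|x| ^+ n = s ^+ n * (`|x| ^+ n * s^-1 ^+ n) by rewrite mulrCA -exprMn divff// expr1n mulr1.
    by rewrite [X in _ <= X * _]mulrC -mulrA ler_wpM2l// exprn_ge0// ltW.
rewrite ge0_integralZl//; last 2 first.
- exact/EFinP.
- by rewrite lee_fin mulr_ge0 ?exprn_ge0// ltW.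
rewrite (_ : 4 * _ * _ = (n%:R ^+ n * s ^+ n) * 4); last by ring.
rewrite [leRHS]EFinM; apply: lee_wpmul2l; last exact: normal_exp_norm.
by rewrite lee_fin mulr_ge0 ?exprn_ge0// ltW.
Qed.

Lemma normal_integrable : nu.-integrable setT EFin.
Proof.
apply/integrableP; split; first exact/EFinP.
have := normal_moment (ltn0Sn 0); under eq_integral do rewrite expr1.
by move=> h; apply: le_lt_trans h _; rewrite ltry.
Qed.

(** By symmetry the positive and the negative part have the same finite integral. *)
Lemma normal_mean : (\int[nu]_x x%:E = 0)%E.
Proof.
have mE : mfun (EFin : R -> \bar R) by exact/EFinP.
rewrite integralE -(ge0_integral_normalN (measurable_funepos mE))//.
have -> : (fun x : R => (EFin : R -> \bar R)^\+%E (- x)) = (EFin : R -> \bar R)^\-%E.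
  by apply/funext => x; rewrite funeposE funenegE.
exact/subee/(integrable_neg_fin_num measurableT normal_integrable).
Qed.

End NormalMoments.

Lemma measurable_mxB d (X : measurableType d) (R : realType) p q (F G : X -> 'M[R]_(p, q)) i j :
  mfun (fun x => F x i j) -> mfun (fun x => G x i j) -> mfun (fun x => (F x - G x) i j).
Proof. by move=> mF mG; under eq_fun do rewrite !mxE; exact: mfunB. Qed.

(** * Independence and moments of the increments of the canonical process *)

Section Increments.
Variables (R : realType) (T : R) (m : nat).

(** Exactly the events for which [is_wiener] states independence. They are stable under
    intersection, so statements extend from them to [Vbox]. *)
Definition boxes : set (set 'cV[R]_m) := [set E | exists2 Y : 'I_m -> set R, (forall i, measurable (Y i)) &
     E = [set y : 'cV[R]_m | forall i, Y i (y i 0)]].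

Definition Vbox := g_sigma_algebraType boxes.

Lemma measurable_Vbox d (X : measurableType d) (F : X -> Vbox) :
  (forall i, mfun (fun x => (F x : 'cV[R]_m) i 0)) -> mfun F.
Proof.
move=> h; apply: (@measurability _ _ X Vbox setT F boxes) => //.
move=> _ [_ [Y mY ->] <-]; rewrite setTI.
have -> : F @^-1` [set y : 'cV[R]_m | forall i, Y i (y i 0)] =
    \bigcap_(i in setT) ((fun x => (F x : 'cV[R]_m) i 0) @^-1` Y i).
  by apply/seteqP; split => x /= hx i; [move=> _|]; exact: hx.
apply: fin_bigcap_measurable => // i _.
by rewrite -[X in measurable X]setTI; apply: h => //; exact: mY.
Qed.

Lemma measurable_Vcoord i : measurable_fun [set: Vbox] (fun y : Vbox => (y : 'cV[R]_m) i 0).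
Proof.
move=> _ Y mY; rewrite setTI; apply: sub_sigma_algebra.
exists (fun l => if l == i then Y else setT).
  by move=> l; case: eqP.
apply/seteqP; split => y /=; last by move/(_ i); rewrite eqxx.
by move=> hy l; case: eqP => // ->.
Qed.

Variable P : probability (Omega T m) R.
Hypothesis WP : is_wiener P.
Variables (s t : R).
Hypotheses (s0 : 0 <= s) (st : s < t) (tT : t <= T).

Definition incr (w : Omega T m) : Vbox := w t - w s.

Lemma measurable_incr : mfun incr.
Proof.
apply: measurable_Vbox => i; rewrite /incr.
apply: measurable_mxB; apply: measurable_coord; rewrite ?s0 ?tT ?andbT ?(le_trans s0) ?(le_trans (ltW st))//; exact: ltW.
Qed.

Let sT : s <= T. Proof. by apply: le_trans tT; apply: ltW. Qed.

Lemma filtration_measurable E : path_filtration s E -> measurable (E : set (Omega T m)).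
Proof.
move=> mE; have := @measurable_OmF_Omega _ _ m _ sT measurableT E mE.
by rewrite setTI.
Qed.

(** For fixed [E] both sides are finite measures of [F]: the image of [P] restricted to [E], and a
    multiple of the law of the increment. They agree on boxes, which form a generating pi-system. *)
Lemma incr_indep E F : path_filtration s E -> measurable F ->
  P (E `&` incr @^-1` F) = (P E * P (incr @^-1` F))%E.
Proof.
move=> sE mF; have mE := filtration_measurable sE.
have PE : P E = (fine (P E))%:E by rewrite fineK// fin_num_measure.
have PE0 : 0 <= fine (P E) by apply: fine_ge0.
have mi := measurable_incr.
pose i2 : {mfun (Omega T m) >-> Vbox} := HB.pack incr (isMeasurableFun.Build _ _ _ _ _ mi).
pose m1_ := [the {measure set _ -> \bar R} of pushforward (mrestr P mE) incr].
pose m1 := m1_ mi.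
pose m2 := [the {measure set _ -> \bar R} of mscale (NngNum PE0)
   [the {measure set _ -> \bar R} of distribution P i2]].
suff : m1 F = m2 F by rewrite /m1 /m2 /= /mscale /distribution /pushforward /mrestr /= -PE setIC.
apply: (@measure_unique _ _ Vbox boxes (fun=> setT)) => //.
- move=> _ _ [Y mY ->] [Y' mY' ->]; exists (fun i => Y i `&` Y' i).
    by move=> i; apply: measurableI.
  apply/seteqP; split => y /=; first by move=> [h h'] i; split. by move=> h; split=> i; case: (h i).
- by move=> _; exists (fun=> setT) => //; apply/seteqP; split.
- by rewrite bigcup_const//; exists 0%N.
- move=> _ [Y mY ->].
  rewrite /m1 /m2 /= /mscale /distribution /pushforward /mrestr /= -PE setIC. have h := WP s0 st tT sE mY.
  have := WP s0 st tT (@measurableT _ (OmF T m s)) mY. rewrite setTI probability_setT mul1e => h2.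
  by rewrite [LHS]h -h2.
- move=> _; rewrite /m1 /= /pushforward /mrestr /= preimage_setT setTI.
  by rewrite ltey_eq fin_num_measure.
Qed.

Lemma measurable_pair_incr : mfun (fun w : Omega T m => ((w : OmF T m s), incr w)).
Proof.
apply: measurable_fun_pair; [exact: measurable_OmF_Omega|exact: measurable_incr].
Qed.

(** By independence the joint law of the past and the increment is a product measure, so Fubini
    allows the past to be frozen while the increment is integrated. This plays the role of
    conditional expectation throughout. *)
Lemma freeze (f : OmF T m s * Vbox -> \bar R) : mfun f -> (forall x, (0 <= f x)%E) ->
  (\int[P]_w f (w, incr w) = \int[P]_w \int[P]_w' f (w, incr w'))%E.
Proof.
move=> mf f0.
have mid := @measurable_OmF_Omega _ _ m _ sT.
have mi := measurable_incr; have mp := measurable_pair_incr.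
pose i1 : {mfun (Omega T m) >-> (OmF T m s)} :=
  HB.pack (id : Omega T m -> OmF T m s) (isMeasurableFun.Build _ _ _ _ _ mid).
pose i2 : {mfun (Omega T m) >-> Vbox} := HB.pack incr (isMeasurableFun.Build _ _ _ _ _ mi).
pose i3 : {mfun (Omega T m) >-> (OmF T m s * Vbox)%type} :=
  HB.pack (fun w : Omega T m => ((w : OmF T m s), incr w)) (isMeasurableFun.Build _ _ _ _ _ mp).
pose d1 : probability _ R := distribution P i1.
pose d2 : probability _ R := distribution P i2.
pose d3 : probability _ R := distribution P i3.
have E3 X : measurable X -> (d1 \x d2)%E X = d3 X.
  apply: product_measure_unique => A B mA mB.
  by rewrite /d1 /d2 /d3 /= /distribution /pushforward /= -incr_indep.
have -> : (\int[P]_w f (w, incr w) = \int[d3]_x f x)%E by rewrite ge0_integral_pushforward//.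
rewrite -(@eq_measure_integral _ _ _ setT d3 (d1 \x d2)%E); last first.
  by move=> A mA _; exact: E3.
rewrite fubini_tonelli1//= /d1 ge0_integral_pushforward//; last 2 first.
- exact: measurable_fun_fubini_tonelli_F.
- by move=> w _; apply: integral_ge0.
apply: eq_integral => w _ /=; rewrite /fubini_F /d2 ge0_integral_pushforward//.
exact: measurable_fun_pair2.
Qed.

(** [is_wiener] is used with the whole space as event and with a box that has a single nontrivial
    side. *)
Lemma ge0_integral_incr i (f : R -> \bar R) : mfun f -> (forall x, (0 <= f x)%E) ->
  (\int[P]_w f ((incr w : 'cV[R]_m) i 0%R) = \int[normal_prob 0 (Num.sqrt (t - s))]_x f x)%E.
Proof.
move=> mf f0.
have mc : mfun (fun w => (incr w : 'cV[R]_m) i 0) by exact: (mcomp (measurable_Vcoord i) measurable_incr).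
have mc' : @measurable_fun _ _ (Omega T m) (measurableTypeR R) setT
  (fun w => (incr w : 'cV[R]_m) i 0) by exact: mc.
pose i2 : {mfun (Omega T m) >-> (measurableTypeR R)} :=
  HB.pack (fun w : Omega T m => (incr w : 'cV[R]_m) i 0 : measurableTypeR R)
    (isMeasurableFun.Build _ _ _ _ _ mc').
pose d2 : probability (measurableTypeR R) R := distribution P i2.
have -> : (\int[P]_w f ((incr w : 'cV[R]_m) i 0%R) = \int[d2]_x f x)%E by rewrite ge0_integral_pushforward//.
apply: (@eq_measure_integral _ (measurableTypeR R) R setT (normal_prob 0 (Num.sqrt (t - s))) d2 f) => Y mY _.
rewrite /d2 /= /distribution /pushforward /=.
pose Z l := if l == i then Y else setT.
have mZ l : measurable (Z l) by rewrite /Z; case: eqP.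
have := WP s0 st tT (@measurableT _ (OmF T m s)) mZ.
rewrite setTI probability_setT mul1e (bigD1 i)//= big1 ?mule1; last first.
  by move=> l /negPf li; rewrite /Z li probability_setT.
rewrite {2}/Z eqxx => <-; congr (P _); apply/seteqP; split => w /=.
  by move=> hw l; rewrite /Z; case: eqP => // ->.
by move/(_ i); rewrite /Z eqxx.
Qed.

End Increments.

Section IntegralTools.
Context d (X : measurableType d) (R : realType) (mu : {measure set X -> \bar R}).
Local Open Scope ereal_scope.

Lemma int_le (f g : X -> R) : mfun f -> mfun g -> (forall x, (0 <= f x)%R) -> (forall x, (f x <= g x)%R) ->
  \int[mu]_x (f x)%:E <= \int[mu]_x (g x)%:E.
Proof.
move=> mf mg f0 fg; apply: ge0_le_integral => //.
- by move=> x _; rewrite lee_fin.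
- exact/EFinP.
- exact/EFinP.
- by move=> x _; rewrite lee_fin.
Qed.

Lemma intZ (a : R) (f : X -> R) : mfun f -> (0 <= a)%R ->
  (forall x, (0 <= f x)%R) -> \int[mu]_x (a * f x)%:E = a%:E * \int[mu]_x (f x)%:E.
Proof.
move=> mf a0 f0; under eq_integral do rewrite EFinM.
rewrite ge0_integralZl//; first exact/EFinP.
by move=> x _; rewrite lee_fin.
Qed.

Lemma intD (f g : X -> R) : mfun f -> mfun g -> (forall x, (0 <= f x)%R) -> (forall x, (0 <= g x)%R) ->
  \int[mu]_x (f x + g x)%:E = \int[mu]_x (f x)%:E + \int[mu]_x (g x)%:E.
Proof.
move=> mf mg f0 g0; under eq_integral do rewrite EFinD.
rewrite ge0_integralD//; try by move=> x _; rewrite lee_fin.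
- exact/EFinP.
- exact/EFinP.
Qed.

Lemma int_ge0 (f : X -> R) : (forall x, (0 <= f x)%R) -> 0 <= \int[mu]_x (f x)%:E.
Proof. by move=> f0; apply: integral_ge0 => x _; rewrite lee_fin. Qed.

Lemma int_sum (I : finType) (f : I -> X -> R) : (forall i, mfun (f i)) -> (forall i x, (0 <= f i x)%R) ->
  \int[mu]_x (\sum_i f i x)%:E = \sum_i \int[mu]_x (f i x)%:E.
Proof.
move=> mf f0; under eq_integral do rewrite -sumEFin.
rewrite ge0_integral_sum//; last by move=> i x _; rewrite lee_fin.
by move=> i; exact/EFinP.
Qed.

Lemma int_le2 (a b : R) (f g h : X -> R) : mfun f -> mfun g -> mfun h -> (0 <= a)%R -> (0 <= b)%R ->
  (forall x, (0 <= f x)%R) -> (forall x, (0 <= g x)%R) -> (forall x, (0 <= h x)%R) ->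
  (forall x, (f x <= a * g x + b * h x)%R) ->
  \int[mu]_x (f x)%:E <= a%:E * \int[mu]_x (g x)%:E + b%:E * \int[mu]_x (h x)%:E.
Proof.
move=> mf mg mh a0 b0 f0 g0 h0 hle.
have mag : mfun (fun x => (a * g x)%R) by exact: mfunM.
have mbh : mfun (fun x => (b * h x)%R) by exact: mfunM.
rewrite -intZ// -intZ// -intD//; try by move=> x; rewrite mulr_ge0.
by apply: int_le => //; exact: mfunD.
Qed.

Lemma markov_int (f : X -> R) (c : R) : mfun f -> (forall x, (0 <= f x)%R) -> (0 < c)%R ->
  mu [set x | (c <= f x)%R] <= c^-1%:E * \int[mu]_x (f x)%:E.
Proof.
move=> mf f0 c0.
have mE : measurable [set x | (c <= f x)%R].
  have -> : [set x | (c <= f x)%R] = setT `&` f @^-1` `[c, +oo[%classic.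
    by apply/seteqP; split => x /=; rewrite in_itv/= andbT// => -[].
  exact: mf.
rewrite -[X in mu X]setIT -integral_indic// -intZ//; last by rewrite invr_ge0 ltW.
apply: int_le => //.
- exact: mfunM.
- move=> x; rewrite indicE; have [h|_] := boolP (x \in _); last first.
    by rewrite mulr_ge0// invr_ge0 ltW.
  move: h; rewrite inE/= => h. by rewrite mulrC ler_pdivlMr// mul1r.
Qed.

End IntegralTools.

Section ProbabilityTools.
Context d (X : measurableType d) (R : realType) (P : probability X R).

Lemma int_prob_cst (c : R) : (\int[P]_w c%:E = c%:E)%E.
Proof. by rewrite integral_cst//= probability_setT mule1. Qed.

Lemma bounded_integrable (g : X -> R) (C : R) : mfun g -> (forall w, `|g w| <= C) -> Rint P g.
Proof.
move=> mg gC; have ic := @finite_measure_integrable_cst _ _ R P setT C measurableT.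
apply: (le_integrable measurableT _ _ ic); first exact/EFinP.
by move=> w _ /=; rewrite lee_fin (le_trans (gC w))// ler_norm.
Qed.

End ProbabilityTools.

Lemma measurable_n2 d (X : measurableType d) (R : realType) p q (F : X -> 'M[R]_(p, q)) :
  (forall a b, mfun (fun x => F x a b)) -> mfun (fun x => n2 (F x)).
Proof.
move=> h; apply: mfun_sum => a; apply: mfun_sum => b.
exact: mfunX.
Qed.

Lemma measurable_mulmx d (X : measurableType d) (R : realType) p q r
    (F : X -> 'M[R]_(p, q)) (G : X -> 'M[R]_(q, r)) : (forall a b, mfun (fun x => F x a b)) ->
  (forall a b, mfun (fun x => G x a b)) -> forall a b, mfun (fun x => (F x *m G x) a b).
Proof.
move=> hF hG a b; under eq_fun do rewrite mxE.
by apply: mfun_sum => c; exact: mfunM.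
Qed.

Section IncrementSteps.
Variables (R : realType) (T : R) (m : nat) (P : probability (Omega T m) R).
Hypothesis WP : is_wiener P.
Variables (s t : R).
Hypotheses (s0 : 0 <= s) (st : s < t) (tT : t <= T).
Local Notation incr := (incr s t).
Local Notation mincr := (measurable_incr s0 st tT).

Let sT : s <= T. Proof. by apply: le_trans tT; apply: ltW. Qed.
Let st0 : 0 < Num.sqrt (t - s). Proof. by rewrite sqrtr_gt0 subr_gt0. Qed.
Let mi i : mfun (fun w : Omega T m => (incr w : 'cV[R]_m) i 0).
Proof.
have := mcomp (@measurable_Vcoord R m i) mincr.
exact.
Qed.

Lemma incr_moment i n : (0 < n)%N -> (\int[P]_w (`|(incr w : 'cV[R]_m) i ord0| ^+ n)%:E <=
   (4 * n%:R ^+ n * Num.sqrt (t - s) ^+ n)%:E)%E.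
Proof.
move=> n0.
rewrite (ge0_integral_incr WP s0 st tT i (f := fun x => (`|x| ^+ n)%:E)).
- exact: normal_moment.
- by apply/EFinP; apply: mfunX; exact: normr_measurable.
- by [].
Qed.

Lemma incr_integrable i : P.-integrable setT (fun w => ((incr w : 'cV[R]_m) i ord0)%:E).
Proof.
apply/integrableP; split; first exact/EFinP.
have := incr_moment i (ltn0Sn 0); under eq_integral do rewrite expr1.
by move=> h; apply: le_lt_trans h _; rewrite ltry.
Qed.

Lemma incr_mean i : (\int[P]_w ((incr w : 'cV[R]_m) i ord0)%:E = 0)%E.
Proof.
rewrite integralE.
have h f : mfun f -> (forall x : R, (0 <= f x)%E) ->
   (\int[P]_w f ((incr w : 'cV[R]_m) i ord0) = \int[normal_prob 0 (Num.sqrt (t - s))]_x f x)%E.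
  exact: (ge0_integral_incr WP s0 st tT i).
have -> : (\int[P]_w (fun w => ((incr w : 'cV[R]_m) i ord0)%:E)^\+ w =
   \int[normal_prob 0 (Num.sqrt (t - s))]_x (EFin^\+ x))%E.
  transitivity (\int[P]_w (EFin^\+ ((incr w : 'cV[R]_m) i ord0)))%E.
    by apply: eq_integral => w _; rewrite !funeposE.
  by apply: h; [apply: measurable_funepos; exact/EFinP|move=> x; exact: funepos_ge0].
have -> : (\int[P]_w (fun w => ((incr w : 'cV[R]_m) i ord0)%:E)^\- w =
   \int[normal_prob 0 (Num.sqrt (t - s))]_x (EFin^\- x))%E.
  transitivity (\int[P]_w (EFin^\- ((incr w : 'cV[R]_m) i ord0)))%E.
    by apply: eq_integral => w _; rewrite !funenegE.
  by apply: h; [apply: measurable_funeneg; exact/EFinP|move=> x; exact: funeneg_ge0].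
by rewrite -integralE; exact: normal_mean.
Qed.

Lemma incr_n2 : (\int[P]_w (n2 (incr w : 'cV[R]_m))%:E <= (16 * m%:R * (t - s))%:E)%E.
Proof.
rewrite /n2.
have m2 i (j : 'I_1) : mfun (fun w : Omega T m => (incr w : 'cV[R]_m) i j ^+ 2).
  by rewrite ord1; apply: mfunX; exact: mi.
rewrite int_sum//; last by move=> i w; apply: sumr_ge0 => j _; apply: sqr_ge0.
  have -> : 16 * m%:R * (t - s) = \sum_(i < m) (4 * 2%:R ^+ 2 * Num.sqrt (t - s) ^+ 2).
    rewrite sumr_const card_ord sqr_sqrtr ?subr_ge0 ?ltW// -mulr_natl; ring.
  rewrite -sumEFin; apply: lee_sum => i _. apply: le_trans (incr_moment i (ltn0Sn 1)).
  under eq_integral do rewrite big_ord1 -real_normK ?num_real//. by [].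
by move=> i; apply: mfun_sum => j; exact: m2.
Qed.

Lemma sqr_sum_le n (a : 'I_n -> R) : (\sum_i a i) ^+ 2 <= n%:R * \sum_i a i ^+ 2.
Proof.
have := sum_cs (fun=> 1) a.
under eq_bigr do rewrite mul1r.
under [X in _ <= X * _]eq_bigr do rewrite expr1n.
by rewrite sumr_const card_ord.
Qed.

Lemma incr_n2_sqr : (\int[P]_w (n2 (incr w : 'cV[R]_m) ^+ 2)%:E <= (2 ^+ 10 * m%:R ^+ 2 * (t - s) ^+ 2)%:E)%E.
Proof.
have m4 i : mfun (fun w : Omega T m => `|(incr w : 'cV[R]_m) i 0| ^+ 4).
  by apply: mfunX; apply: mcomp => //; exact: mi.
apply: (via (\int[P]_w (m%:R * \sum_i `|(incr w : 'cV[R]_m) i ord0| ^+ 4)%:E)%E).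
  apply: int_le.
  - apply: mfunX; apply: measurable_n2 => a b; rewrite ord1; exact: mi.
  - by apply: mfunM => //; exact: mfun_sum.
  - by move=> w; rewrite sqr_ge0.
  - move=> w; rewrite /n2; apply: le_trans (sqr_sum_le _) _.
    rewrite ler_wpM2l//; apply: ler_sum => i _; rewrite big_ord1.
    by rewrite -exprM -normrX ger0_norm// (exprM _ 2 2) sqr_ge0.
rewrite intZ//; last by move=> w; apply: sumr_ge0 => i _; rewrite exprn_ge0.
  rewrite int_sum//.
  have -> : 2 ^+ 10 * m%:R ^+ 2 * (t - s) ^+ 2 = m%:R * \sum_(i < m) (4 * 4%:R ^+ 4 * Num.sqrt (t - s) ^+ 4).
    have -> : Num.sqrt (t - s) ^+ 4 = (t - s) ^+ 2 by rewrite (exprM _ 2 2) sqr_sqrtr ?subr_ge0 ?ltW.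
    by rewrite sumr_const card_ord -mulr_natl; ring.
  rewrite EFinM; apply: lee_wpmul2l; first by rewrite lee_fin.
  by rewrite -sumEFin; apply: lee_sum => i _; exact: incr_moment.
exact: mfun_sum.
Qed.

(** The nonnegative version applies to [f + C]; the constant is then cancelled on both sides, all
    integrals being finite. *)
Lemma freeze_bounded (f : OmF T m s * Vbox R m -> R) (C : R) : mfun f -> (forall x, `|f x| <= C) ->
  (\int[P]_w (f (w, incr w))%:E = \int[P]_w \int[P]_w' (f (w, incr w'))%:E)%E.
Proof.
move=> mf fC.
have C0 : 0 <= C by apply: le_trans (fC (point, point)).
have hb (g : Omega T m -> R) : mfun g -> (forall w, `|g w| <= C) ->
    Rint P g /\ (\int[P]_w (g w + C)%:E = \int[P]_w (g w)%:E + C%:E)%E.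
  move=> mg gC. have ic := @finite_measure_integrable_cst _ _ R P setT C measurableT.
  have ig := bounded_integrable P mg gC. split => //; under eq_integral do rewrite EFinD.
  rewrite (integralD measurableT ig ic); congr (_ + _)%E. exact: int_prob_cst.
have mi' : mfunO T m incr := measurable_incr s0 st tT.
have mw w : mfunO T m (fun w' : Omega T m => f (w, incr w')).
  exact: (mcomp (measurable_fun_pair2 w mf) mi').
have mF : mfunO T m (fun w => \int[P]_w' (f (w, incr w') + C)%:E)%E.
  have mid := @measurable_OmF_Omega _ _ m _ sT.
  have mg : mfun (fun x : OmF T m s * Omega T m => (f (x.1, incr x.2) + C)%:E).
    apply/EFinP; apply: mfunD => //. apply: (mcomp mf); apply: measurable_fun_pair => //. exact: (mcomp mi').
  have g0 (x : OmF T m s * Omega T m) : (0 <= (f (x.1, incr x.2) + C)%:E)%E.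
    rewrite lee_fin -lerBlDr sub0r; have := fC (x.1, incr x.2). by rewrite ler_norml => /andP[].
  have h' := @measurable_fun_fubini_tonelli_F _ _ _ _ _ P _ mg g0. exact: (mcomp h' mid).
have f0 (x : OmF T m s * Vbox R m) : (0 <= (f x + C)%:E)%E.
  by rewrite lee_fin -lerBlDr sub0r; have := fC x; rewrite ler_norml => /andP[].
have mfC : mfun (fun x : OmF T m s * Vbox R m => (f x + C)%:E) by exact/EFinP/mfunD.
have h := freeze WP s0 st tT mfC f0.
have [i1 e1] := hb (fun w => f (w, incr w)) (mcomp mf (measurable_pair_incr s0 st tT)) (fun w => fC _).
rewrite e1 in h.
have e2 (w : Omega T m) : (\int[P]_w' (f (w, incr w') + C)%:E = (fine (\int[P]_w' (f (w, incr w'))%:E) + C)%:E)%E.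
  have [i2 ->] := hb _ (mw w) (fun w' => fC _). by rewrite EFinD fineK//; exact: integrable_fin_num.
under [in RHS]eq_integral => w _.
  have [i2 _] := hb _ (mw w) (fun w' => fC _). rewrite -(fineK (integrable_fin_num measurableT i2)); over.
have mg : mfunO T m (fun w => fine (\int[P]_w' (f (w, incr w'))%:E)%E).
  apply/EFinP.
  have -> : EFin \o (fun w => fine (\int[P]_w' (f (w, incr w'))%:E)%E) =
      (fun w => \int[P]_w' (f (w, incr w') + C)%:E - C%:E)%E.
    by apply/funext => w /=; rewrite e2 -EFinB addrK.
  by apply: emeasurable_funB.
have gC (w : Omega T m) : `|fine (\int[P]_w' (f (w, incr w'))%:E)%E| <= C.
  have [i2 _] := hb _ (mw w) (fun w' => fC _).
  rewrite -lee_fin -[leLHS]/(`|(fine (\int[P]_w' (f (w, incr w'))%:E))%:E|)%E.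
  rewrite fineK ?integrable_fin_num//.
  apply: le_trans (le_abse_integral _ measurableT _) _; first exact: measurable_int i2.
  apply: le_trans (integral_le_bound C%:E measurableT _ _ _) _.
  - exact: measurable_int i2.
  - by [].
  - by apply: aeW => w' _ /=; rewrite lee_fin.
  - apply: (via (C%:E * 1)%E); last by rewrite mule1.
    by apply: lee_wpmul2l; [rewrite lee_fin|exact: probability_le1].
have [_ e3] := hb _ mg gC.
move: h; under [X in _ = X -> _]eq_integral do rewrite e2.
move=> h.
rewrite e3 in h.
have ifin := integrable_fin_num measurableT i1.
have [ig _] := hb _ mg gC.
have gfin := integrable_fin_num measurableT ig.
by rewrite -(fineK ifin) -(fineK gfin) -!EFinD in h *; case: h => /addIr ->.
Qed.

End IncrementSteps.

(** * One mean-zero step: second and fourth moments *)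

Section MartingaleSteps.
Variables (R : realType) (T : R) (m : nat) (P : probability (Omega T m) R).
Hypothesis WP : is_wiener P.
Variables (s t : R).
Hypotheses (s0 : 0 <= s) (st : s < t) (tT : t <= T).
Local Notation incr := (incr s t).

Let sT : s <= T. Proof. by apply: le_trans tT; apply: ltW. Qed.

Lemma measurable_FT d (Y : measurableType d) (f : OmF T m s -> Y) : mfun f -> mfunO T m f.
Proof. move=> mf; exact: (mcomp mf (measurable_OmF_Omega sT)). Qed.

Lemma freeze_le (f : OmF T m s * Vbox R m -> R) (V : OmF T m s -> R) :
  mfun f -> (forall x, 0 <= f x) -> mfun V -> (forall w, \int[P]_w' (f (w, incr w'))%:E <= (V w)%:E)%E ->
  (\int[P]_w (f (w, incr w))%:E <= \int[P]_w (V w)%:E)%E.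
Proof.
move=> mf f0 mV fV; have f0' x : (0 <= (f x)%:E)%E by rewrite lee_fin.
have mi : mfunO T m incr := measurable_incr s0 st tT.
rewrite (@freeze _ _ _ _ WP _ _ s0 st tT (fun x => (f x)%:E)) => [||//]; last exact/EFinP.
apply: ge0_le_integral => //; first by move=> w _; exact: int_ge0.
  apply: measurable_FT. have mg : mfun (fun x : OmF T m s * Omega T m => (f (x.1, incr x.2))%:E).
    apply/EFinP; apply: (mcomp mf); apply: measurable_fun_pair => //; exact: (mcomp mi).
  exact: (@measurable_fun_fubini_tonelli_F _ _ _ _ _ P _ mg (fun x => f0' _)).
by apply/EFinP; exact: measurable_FT.
Qed.

(** Orthogonality of a mean-zero step. With the past frozen, [Q w] is a constant and the cross term
    integrates to zero, so the inequality also covers [Q] with infinite second moment. *)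
Lemma sq_step p (Q : OmF T m s -> 'cV[R]_p) (r : OmF T m s -> Vbox R m -> 'cV[R]_p) (V : OmF T m s -> R) :
  (forall a b, mfun (fun w => Q w a b)) ->
  (forall a b, mfun (fun x : OmF T m s * Vbox R m => r x.1 x.2 a b)) -> mfun V -> (forall w, 0 <= V w) ->
  (forall w a, P.-integrable setT (fun w' => (r w (incr w') a ord0)%:E)) ->
  (forall w a, \int[P]_w' (r w (incr w') a ord0)%:E = 0)%E ->
  (forall w, \int[P]_w' (n2 (r w (incr w')))%:E <= (V w)%:E)%E -> (\int[P]_w (n2 (Q w + r w (incr w)))%:E <=
   \int[P]_w (n2 (Q w))%:E + \int[P]_w (V w)%:E)%E.
Proof.
move=> mQ mr mV V0 ir r0 rV.
have mi : mfunO T m incr := measurable_incr s0 st tT.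
have mrw w a b : mfunO T m (fun w' => r w (incr w') a b).
  exact: (mcomp (measurable_fun_pair2 w (mr a b)) mi).
have mnQ : mfun (fun w : OmF T m s => n2 (Q w)) by exact: measurable_n2.
rewrite -intD//; try exact: measurable_FT; last by move=> w; exact: n2_ge0.
apply: (freeze_le (f := fun x => n2 (Q x.1 + r x.1 x.2)) (V := fun w => n2 (Q w) + V w)) => [|x||w /=].
- apply: measurable_n2 => a b; under eq_fun do rewrite mxE.
  by apply: mfunD; [exact: (mcomp (mQ a b) measurable_fst)|exact: mr].
- exact: n2_ge0.
- exact: mfunD.
have n2E (w' : Omega T m) : (n2 (Q w + r w (incr w')))%:E = ((n2 (Q w))%:E +
   ((\sum_a (2 * Q w a ord0) * r w (incr w') a ord0)%:E + (n2 (r w (incr w')))%:E))%E.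
  rewrite -!EFinD; congr EFin; rewrite /n2 -!big_split/=; apply: eq_bigr => a _.
  by rewrite !big_ord1 !mxE; ring.
under eq_integral do rewrite n2E.
have i2 : P.-integrable setT (fun w' => (n2 (r w (incr w')))%:E).
  apply/integrableP; split.
    by apply/EFinP; apply: measurable_n2.
  under eq_integral do rewrite gee0_abs ?lee_fin ?n2_ge0//. by apply: le_lt_trans (rV w) _; rewrite ltry.
have ia a : P.-integrable setT (fun w' => (2 * Q w a ord0 * r w (incr w') a ord0)%:E).
  under [X in integrable _ _ X]eq_fun do rewrite EFinM. exact: integrableZl.
have is_ : P.-integrable setT (fun w' => (\sum_a (2 * Q w a ord0) * r w (incr w') a ord0)%:E).
  under [X in integrable _ _ X]eq_fun do rewrite -sumEFin. by apply: integrable_sum => //= a _; exact: ia.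
have ic := @finite_measure_integrable_cst _ _ R P setT (n2 (Q w)) measurableT.
have i3 := integrableD measurableT is_ i2.
rewrite (integralD measurableT ic i3) (integralD measurableT is_ i2).
have -> : (\int[P]_x (\sum_a (2 * Q w a ord0) * r w (incr x) a ord0)%:E = 0)%E.
  under eq_integral do rewrite -sumEFin. rewrite integral_sum//.
  rewrite big1// => a _; under eq_integral do rewrite EFinM. by rewrite integralZl// r0 mule0.
by rewrite add0e EFinD int_prob_cst leeD2l.
Qed.

Lemma sq_step_scalar (Q : OmF T m s -> R) (r : OmF T m s -> Vbox R m -> R) (v : R) :
  mfun Q -> mfun (fun x : OmF T m s * Vbox R m => r x.1 x.2) -> 0 <= v ->
  (forall w, P.-integrable setT (fun w' => (r w (incr w'))%:E)) ->
  (forall w, \int[P]_w' (r w (incr w'))%:E = 0)%E ->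
  (forall w, \int[P]_w' (r w (incr w') ^+ 2)%:E <= v%:E)%E ->
  (\int[P]_w ((Q w + r w (incr w)) ^+ 2)%:E <= \int[P]_w (Q w ^+ 2)%:E + v%:E)%E.
Proof.
move=> mQ mr v0 ir r0 rv.
have n2c (x : R) : n2 (const_mx x : 'cV[R]_1) = x ^+ 2 by rewrite /n2 !big_ord1 mxE.
have e1 w : (Q w + r w (incr w)) ^+ 2 = n2 (const_mx (Q w) + const_mx (r w (incr w)) : 'cV[R]_1).
  by rewrite -n2c; congr n2; apply/matrixP => i j; rewrite !mxE.
have e2 : v%:E = (\int[P]_w v%:E)%E by rewrite int_prob_cst.
under eq_integral do rewrite e1.
under [X in (_ <= X + _)%E]eq_integral do rewrite -n2c.
rewrite e2; apply: (@sq_step 1 (fun w => const_mx (Q w)) (fun w y => const_mx (r w y)) (fun=> v)) => //.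
- by move=> a b; under eq_fun do rewrite mxE.
- by move=> a b; under eq_fun do rewrite mxE.
- by move=> w a; under eq_fun do rewrite mxE.
- by move=> w a; under eq_integral do rewrite mxE.
- by move=> w; under eq_integral do rewrite n2c.
Qed.

(** Of the expansion of the fourth power only the term linear in the step has zero mean; the cubic
    term is absorbed by the quadratic and quartic ones. *)
Lemma quartic_step (Q : OmF T m s -> R) (r : OmF T m s -> Vbox R m -> R) (v2 v4 : R) : mfun Q ->
  mfun (fun x : OmF T m s * Vbox R m => r x.1 x.2) ->
  (forall w, P.-integrable setT (fun w' => (r w (incr w'))%:E)) ->
  (forall w, \int[P]_w' (r w (incr w'))%:E = 0)%E ->
  (forall w, \int[P]_w' (r w (incr w') ^+ 2)%:E <= v2%:E)%E ->
  (forall w, \int[P]_w' (r w (incr w') ^+ 4)%:E <= v4%:E)%E -> (\int[P]_w ((Q w + r w (incr w)) ^+ 4)%:E <=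
   \int[P]_w (Q w ^+ 4)%:E + ((8 * v2)%:E * \int[P]_w (Q w ^+ 2)%:E + (3 * v4)%:E))%E.
Proof.
move=> mQ mr ir r0 rv2 rv4.
have e4 (x : R) : 0 <= x ^+ 4 by rewrite (exprM _ 2 2) sqr_ge0.
have mi : mfunO T m incr := measurable_incr s0 st tT.
have mrw w : mfunO T m (fun w' => r w (incr w')) by exact: (mcomp (measurable_fun_pair2 w mr) mi).
have v20 : 0 <= v2 by have := rv2 point; rewrite -lee_fin; apply: le_trans;
  apply: int_ge0 => w; exact: sqr_ge0.
have v40 : 0 <= v4 by have := rv4 point; rewrite -lee_fin; apply: le_trans; apply: int_ge0 => w; exact: e4.
have mQT : mfunO T m Q by exact: measurable_FT.
have mQn n : mfunO T m (fun w => Q w ^+ n) by exact: mfunX.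
have mB : mfunO T m (fun w => 8 * v2 * Q w ^+ 2) by exact: mfunM.
have c0 : 0 <= 8 * v2 by rewrite mulr_ge0.
have Q2 w : 0 <= Q w ^+ 2 by exact: sqr_ge0.
rewrite -intZ//.
have mB' : mfunO T m (fun w => 8 * v2 * Q w ^+ 2 + 3 * v4) by exact: mfunD.
have B0 w : 0 <= 8 * v2 * Q w ^+ 2 by rewrite mulr_ge0.
have B1 w : 0 <= 8 * v2 * Q w ^+ 2 + 3 * v4 by rewrite addr_ge0// mulr_ge0.
have v43 : 0 <= 3 * v4 by rewrite mulr_ge0.
rewrite -(int_prob_cst P (3 * v4)) -intD// -intD//.
apply: (freeze_le (f := fun x => (Q x.1 + r x.1 x.2) ^+ 4)
  (V := fun w => Q w ^+ 4 + (8 * v2 * Q w ^+ 2 + 3 * v4))) => [|//||w /=].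
- by apply: mfunX; apply: mfunD => //; exact: (mcomp mQ measurable_fst).
- by apply: mfunD; [exact: mfunX|apply: mfunD => //; apply: mfunM => //; exact: mfunX].
set q := Q w.
have mn n : mfunO T m (fun w' => r w (incr w') ^+ n) by exact: mfunX.
have in_ n (v : R) : (forall w' : Omega T m, 0 <= r w (incr w') ^+ n) ->
    (\int[P]_w' (r w (incr w') ^+ n)%:E <= v%:E)%E -> P.-integrable setT (fun w' => (r w (incr w') ^+ n)%:E).
  move=> h0 hv; apply/integrableP; split; first by apply/EFinP.
  under eq_integral do rewrite gee0_abs ?lee_fin//. by apply: le_lt_trans hv _; rewrite ltry.
have i2 := in_ 2%N v2 (fun w' => sqr_ge0 _) (rv2 w).
have i4 := in_ 4%N v4 (fun w' => e4 _) (rv4 w).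
have ic := @finite_measure_integrable_cst _ _ R P setT (q ^+ 4) measurableT.
have i1' := integrableZl measurableT (4 * q ^+ 3) (ir w).
have i2' := integrableZl measurableT (8 * q ^+ 2) i2.
have i4' := integrableZl measurableT 3 i4.
have i24 := integrableD measurableT i2' i4'.
have i124 := integrableD measurableT i1' i24.
have iall := integrableD measurableT ic i124.
apply: (via (\int[P]_w' ((q ^+ 4)%:E + ((4 * q ^+ 3)%:E * (r w (incr w'))%:E +
  ((8 * q ^+ 2)%:E * (r w (incr w') ^+ 2)%:E + 3%:E * (r w (incr w') ^+ 4)%:E))))%E).
  apply: ge0_le_integral => //.
  - by move=> w' _; rewrite lee_fin.
  - apply/EFinP; apply: mfunX.
    by apply: mfunD => //; exact: mrw.
  - exact: measurable_int iall.
  (* From [(x * (q - x)) ^+ 2 >= 0] follows [4 * q * x ^+ 3 <= 2 * q ^+ 2 * x ^+ 2 + 2 * x ^+ 4],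
     which turns the coefficients 6 and 1 into 8 and 3. *)
  - move=> w' _; rewrite -!EFinM -!EFinD lee_fin; set x := r w _.
    have := sqr_ge0 (x * (q - x)); nra.
rewrite (integralD measurableT ic i124) (integralD measurableT i1' i24).
rewrite (integralD measurableT i2' i4') !integralZl// r0 mule0 add0e int_prob_cst.
rewrite !EFinD leeD2l// leeD//.
- rewrite (_ : 8 * v2 * q ^+ 2 = 8 * q ^+ 2 * v2); last by ring.
  by rewrite [leRHS]EFinM; apply: lee_wpmul2l => //; rewrite lee_fin mulr_ge0// sqr_ge0.
- by rewrite [leRHS]EFinM; apply: lee_wpmul2l => //; rewrite lee_fin.
Qed.

End MartingaleSteps.

(** * Discrete stochastic integrals and their maximal inequalities *)

Section GridSums.
Variables (R : realType) (T : R) (m d : nat) (P : probability (Omega T m) R).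
Hypothesis WP : is_wiener P.

Definition gsum (g : nat -> R) (h : nat -> Omega T m -> 'M[R]_(d, m)) (n : nat) (w : Omega T m) : 'cV[R]_d :=
  \sum_(i < n) h i w *m (w (g i.+1) - w (g i)).

Lemma gsumS g h n w : gsum g h n.+1 w = gsum g h n w + h n w *m (w (g n.+1) - w (g n)).
Proof. by rewrite /gsum big_ord_recr. Qed.

Variables (g : nat -> R) (N : nat).
Hypotheses (g0 : forall i, (i <= N)%N -> 0 <= g i <= T) (gS : forall i, (i < N)%N -> g i < g i.+1).

Lemma g_le i l : (i <= l <= N)%N -> g i <= g l.
Proof.
move=> /andP[il lK]; rewrite -(subnKC il); move: lK; rewrite -{1}(subnKC il).
elim: (l - i)%N => [|n IH]; first by rewrite addn0.
by rewrite addnS => h; apply: le_trans (IH (ltnW h)) (ltW (gS h)).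
Qed.

Definition gadapted (h : nat -> Omega T m -> 'M[R]_(d, m)) :=
  forall i, (i < N)%N -> forall a b, F_measurable (g i) (fun w => h i w a b).

Lemma gsum_F h n : gadapted h -> (n <= N)%N -> forall a b, F_measurable (g n) (fun w => gsum g h n w a b).
Proof.
move=> ah nN a b; apply/F_measurableP.
have -> : (fun w : OmF T m (g n) => gsum g h n w a b) =
   (fun w => \sum_(i < n) \sum_c h i w a c * (w (g i.+1) c b - w (g i) c b)).
  apply/funext => w; rewrite /gsum summxE; apply: eq_bigr => i _.
  by rewrite mxE; apply: eq_bigr => c _; rewrite !mxE.
apply: mfun_sum => i; apply: mfun_sum => c.
have iN : (i < N)%N by exact: leq_trans nN.
apply: mfunM.
  apply/F_measurableP; apply: (@F_measurable_le _ _ _ (g i)); last exact: ah.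
  by apply: g_le; rewrite nN (ltnW (ltn_ord i)).
rewrite ord1; apply: mfunB; apply: measurable_coordF.
  by case/andP: (g0 iN) => -> _ /=; apply: g_le; rewrite nN ltn_ord.
case/andP: (g0 (ltnW iN)) => -> _ /=; apply: g_le; rewrite nN ltnW//.
Qed.

Let meas (h : nat -> Omega T m -> 'M[R]_(d, m)) : gadapted h ->
  forall i, (i < N)%N -> forall a b, measurable_fun [set: OmF T m (g i)] (fun w => h i w a b).
Proof. by move=> ah i iN a b; apply/F_measurableP; exact: ah. Qed.

Let measT (h : nat -> Omega T m -> 'M[R]_(d, m)) : gadapted h ->
  forall i, (i < N)%N -> forall a b, mfunO T m (fun w => h i w a b).
Proof.
move=> ah i iN a b; apply: F_measurableT (ah _ iN a b).
by case/andP: (g0 (ltnW iN)).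
Qed.

Lemma measurable_gsum h n : gadapted h -> (n <= N)%N -> forall a b, mfunO T m (fun w => gsum g h n w a b).
Proof.
move=> ah nN a b; apply: F_measurableT (gsum_F ah nN a b).
by case/andP: (g0 nN).
Qed.

Section Step.
Variables (h : nat -> Omega T m -> 'M[R]_(d, m)) (n : nat).
Hypotheses (ah : gadapted h) (nN : (n < N)%N).
Local Notation incr := (incr (g n) (g n.+1)).

Let s0 : 0 <= g n. Proof. by case/andP: (g0 (ltnW nN)). Qed.
Let st : g n < g n.+1. Proof. exact: gS. Qed.
Let tT : g n.+1 <= T. Proof. by case/andP: (g0 nN). Qed.
Let mi : mfunO T m incr := measurable_incr s0 st tT.
Let mic i : mfunO T m (fun w => (incr w : 'cV[R]_m) i 0).
Proof. exact: (mcomp (measurable_Vcoord i) mi). Qed.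

Let mr a b : mfun (fun x : OmF T m (g n) * Vbox R m => (h n x.1 *m (x.2 : 'cV[R]_m)) a b).
Proof.
apply: (@measurable_mulmx _ (OmF T m (g n) * Vbox R m)%type R _ _ _
  (fun x => h n x.1) (fun x => x.2 : 'cV[R]_m)) => {a b} a b. exact: (mcomp (meas ah nN a b) measurable_fst).
by rewrite ord1; exact: (mcomp (measurable_Vcoord a) measurable_snd).
Qed.

Let ir (A : 'M[R]_(d, m)) a : P.-integrable setT (fun w' => ((A *m (incr w' : 'cV[R]_m)) a ord0)%:E).
Proof.
under [X in integrable _ _ X]eq_fun do rewrite mxE -sumEFin.
apply: integrable_sum => //= c _.
under [X in integrable _ _ X]eq_fun do rewrite EFinM.
exact: integrableZl (incr_integrable WP s0 st tT c).
Qed.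

Let r0 (A : 'M[R]_(d, m)) a : (\int[P]_w' ((A *m (incr w' : 'cV[R]_m)) a ord0)%:E = 0)%E.
Proof.
under eq_integral do rewrite mxE -sumEFin.
rewrite integral_sum//.
  rewrite big1// => c _; under eq_integral do rewrite EFinM.
  by rewrite integralZl// ?(incr_mean WP s0 st tT) ?mule0//; exact: incr_integrable.
move=> c; under [X in integrable _ _ X]eq_fun do rewrite EFinM.
exact: integrableZl (incr_integrable WP s0 st tT c).
Qed.

Let mAi (A : 'M[R]_(d, m)) a b : mfunO T m (fun w => (A *m (incr w : 'cV[R]_m)) a b).
Proof.
apply: (@measurable_mulmx _ _ _ _ _ _ (fun=> A) (fun w => incr w : 'cV[R]_m)) => // i j.
by rewrite ord1; exact: mic.
Qed.

Let D0 : 0 <= 16 * m%:R * (g n.+1 - g n).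
Proof. by apply: mulr_ge0; rewrite ?subr_ge0 ?mulr_ge0//; exact: ltW. Qed.

Lemma n2_mul_incr (A : 'M[R]_(d, m)) :
  (\int[P]_w' (n2 (A *m (incr w' : 'cV[R]_m)))%:E <= (16 * m%:R * (g n.+1 - g n) * n2 A)%:E)%E.
Proof.
apply: (via (\int[P]_w' (n2 A * n2 (incr w' : 'cV[R]_m))%:E)%E).
  apply: int_le => //.
  - by apply: measurable_n2 => a b; exact: mAi.
  - apply: mfunM => //; apply: measurable_n2 => a b; rewrite ord1; exact: mic.
  - by move=> w; exact: n2_ge0.
  - by move=> w; exact: n2M.
rewrite intZ//; last 3 first.
- by apply: measurable_n2 => a b; rewrite ord1; exact: mic.
- exact: n2_ge0.
- by move=> w; exact: n2_ge0.
rewrite [X in (_ <= X%:E)%E]mulrC EFinM; apply: lee_wpmul2l; first by rewrite lee_fin n2_ge0.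
exact: incr_n2.
Qed.

Lemma gsum_L2_step : (\int[P]_w (n2 (gsum g h n.+1 w))%:E <= \int[P]_w (n2 (gsum g h n w))%:E +
    (16 * m%:R * (g n.+1 - g n))%:E * \int[P]_w (n2 (h n w))%:E)%E.
Proof.
rewrite -intZ//; last 2 first.
- by apply: measurable_n2 => a b; exact: measT.
- by move=> w; exact: n2_ge0.
under [X in (X <= _)%E]eq_integral do rewrite gsumS.
apply: (sq_step WP s0 st tT (Q := gsum g h n) (r := fun w y => h n w *m (y : 'cV[R]_m))
   (V := fun w => 16 * m%:R * (g n.+1 - g n) * n2 (h n w))).
- by move=> a b; apply/F_measurableP; apply: gsum_F => //; exact: ltnW.
- exact: mr.
- by apply: mfunM => //; apply: measurable_n2 => a b; exact: meas.
- by move=> w; rewrite mulr_ge0 ?n2_ge0.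
- by [].
- by [].
- by move=> w; exact: n2_mul_incr.
Qed.

Lemma gsum_L4_step (c : R) (a : 'I_d) : (forall w, n2 (h n w) <= c) ->
  (\int[P]_w (gsum g h n.+1 w a ord0 ^+ 4)%:E <= \int[P]_w (gsum g h n w a ord0 ^+ 4)%:E +
   ((8 * (16 * m%:R * (g n.+1 - g n) * c))%:E * \int[P]_w (gsum g h n w a ord0 ^+ 2)%:E +
    (3 * (c ^+ 2 * (2 ^+ 10 * m%:R ^+ 2 * (g n.+1 - g n) ^+ 2)))%:E))%E.
Proof.
move=> hc; have c0 : 0 <= c by apply: le_trans (hc point); exact: n2_ge0.
have mn2i : mfunO T m (fun w => n2 (incr w : 'cV[R]_m)) by apply: measurable_n2 => i b; rewrite ord1; exact: mic.
under [X in (X <= _)%E]eq_integral do rewrite gsumS mxE.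
apply: (quartic_step WP s0 st tT (Q := fun w => gsum g h n w a ord0)
  (r := fun w y => (h n w *m (y : 'cV[R]_m)) a ord0)).
- by apply/F_measurableP; apply: gsum_F => //; exact: ltnW.
- exact: mr.
- by [].
- by [].
- move=> w; apply: le_trans (_ : (\int[P]_w' (n2 (h n w *m (incr w' : 'cV[R]_m)))%:E <= _)%E).
    apply: int_le => //.
    + by apply: mfunX; exact: mAi.
    + by apply: measurable_n2 => i b; exact: mAi.
    + by move=> w'; exact: sqr_ge0.
    + by move=> w'; exact: n2_entry.
  apply: le_trans (n2_mul_incr _) _; rewrite lee_fin. by apply: ler_wpM2l.
- move=> w; apply: (via (\int[P]_w' (c ^+ 2 * n2 (incr w' : 'cV[R]_m) ^+ 2)%:E)%E).
    apply: int_le => //.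
    + by apply: mfunX; exact: mAi.
    + by apply: mfunM => //; exact: mfunX.
    + by move=> w'; rewrite (exprM _ 2 2) sqr_ge0.
    + move=> w'; rewrite (exprM _ 2 2) -exprMn lerXn2r ?nnegrE ?sqr_ge0 ?mulr_ge0 ?n2_ge0//.
      apply: le_trans (n2_entry _ _ _) _; apply: le_trans (n2M _ _) _. by rewrite ler_wpM2r ?n2_ge0.
  rewrite intZ//; last 3 first.
  + exact: mfunX.
  + exact: sqr_ge0.
  + by move=> w'; exact: sqr_ge0.
  rewrite [leRHS]EFinM; apply: lee_wpmul2l; first by rewrite lee_fin sqr_ge0. exact: incr_n2_sqr.
Qed.

End Step.

Lemma gsum_L2 h n : gadapted h -> (n <= N)%N -> (\int[P]_w (n2 (gsum g h n w))%:E <=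
   \sum_(i < n) (16 * m%:R * (g i.+1 - g i))%:E * \int[P]_w (n2 (h i w))%:E)%E.
Proof.
move=> ah; elim: n => [|n IH] nN.
  rewrite big_ord0; under eq_integral do rewrite /gsum big_ord0 n20. by rewrite integral0.
rewrite big_ord_recr/=; apply: le_trans (gsum_L2_step ah nN) _.
by rewrite leeD2r// IH// ltnW.
Qed.

(** Induction on [n]. With [S] the elapsed time and [D] the new step, one step adds
    [2 ^+ 11 * S * D + 3 * 2 ^+ 10 * D ^+ 2] times the square of [m * c], which fits into
    [2 ^+ 12 * ((S + D) ^+ 2 - S ^+ 2)]. *)
Lemma gsum_L4 h n (c : R) (a : 'I_d) : gadapted h -> (n <= N)%N ->
  (forall i w, (i < N)%N -> n2 (h i w) <= c) -> 0 <= c -> (\int[P]_w (gsum g h n w a ord0 ^+ 4)%:E <=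
    (2 ^+ 12 * (m%:R * c * (g n - g 0%N)) ^+ 2)%:E)%E.
Proof.
move=> ah nN hc c0.
have L2 k : (k <= N)%N -> (\int[P]_w (gsum g h k w a ord0 ^+ 2)%:E <= (16 * m%:R * c * (g k - g 0%N))%:E)%E.
  move=> kN; apply: (via (\int[P]_w (n2 (gsum g h k w))%:E)%E).
    apply: int_le => //.
    - by apply: mfunX; exact: measurable_gsum.
    - by apply: measurable_n2 => i b; exact: measurable_gsum.
    - by move=> w; exact: sqr_ge0.
    - by move=> w; exact: n2_entry.
  apply: le_trans (gsum_L2 ah kN) _. apply: (via (\sum_(i < k) (16 * m%:R * (g i.+1 - g i) * c)%:E)%E).
    apply: lee_sum => i _; have iN : (i < N)%N by exact: leq_trans kN.
    rewrite [leRHS]EFinM; apply: lee_wpmul2l.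
      by rewrite lee_fin mulr_ge0 ?mulr_ge0// subr_ge0 ltW// gS.
    rewrite -[leRHS](int_prob_cst P); apply: int_le => //.
    - by apply: measurable_n2 => a' b; exact: measT.
    - by move=> w; exact: n2_ge0.
    - by move=> w; exact: hc.
  rewrite sumEFin lee_fin -mulr_suml -mulr_sumr.
  rewrite -(big_mkord xpredT (fun i => g i.+1 - g i)) telescope_sumr//.
  by rewrite le_eqVlt; apply/orP; left; apply/eqP; ring.
elim: n nN => [|n IH] nN.
  under eq_integral do rewrite /gsum big_ord0 mxE expr0n/=.
  by rewrite integral0 lee_fin; apply: mulr_ge0; [exact: exprn_ge0|exact: sqr_ge0].
have gn : g 0%N <= g n by apply: g_le; rewrite (ltnW nN).
have gn1 : g n < g n.+1 by exact: gS.
apply: le_trans (gsum_L4_step ah nN a (fun w => hc n w nN)) _.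
have K0 : 0 <= 8 * (16 * m%:R * (g n.+1 - g n) * c).
  have gD : 0 <= g n.+1 - g n by rewrite subr_ge0 ltW. by rewrite !mulr_ge0.
apply: (via ((2 ^+ 12 * (m%:R * c * (g n - g 0%N)) ^+ 2)%:E +
   ((8 * (16 * m%:R * (g n.+1 - g n) * c))%:E * (16 * m%:R * c * (g n - g 0%N))%:E +
    (3 * (c ^+ 2 * (2 ^+ 10 * m%:R ^+ 2 * (g n.+1 - g n) ^+ 2)))%:E))%E).
  apply: leeD; first by apply: IH; exact: ltnW. apply: leeD; last exact: lexx.
  apply: lee_wpmul2l; first by rewrite lee_fin. exact/L2/ltnW.
rewrite -EFinM -!EFinD lee_fin.
set S := g n - g 0%N; set D := g n.+1 - g n; set q := m%:R * c.
have -> : g n.+1 - g 0%N = S + D by rewrite /S /D; ring.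
have S0 : 0 <= S by rewrite subr_ge0.
have D0 : 0 <= D by rewrite subr_ge0 ltW.
have q2 : 0 <= q ^+ 2 by exact: sqr_ge0.
have h1 : 0 <= q ^+ 2 * (S * D) by rewrite mulr_ge0// mulr_ge0.
rewrite (_ : _ + _ = 2 ^+ 12 * (q * S) ^+ 2 + (2 ^+ 11 * (q ^+ 2 * (S * D)) + 3 * 2 ^+ 10 * (q ^+ 2 * D ^+ 2))).
  have h2 : 0 <= q ^+ 2 * D ^+ 2 by rewrite mulr_ge0 ?sqr_ge0. rewrite -subr_ge0.
  have -> : 2 ^+ 12 * (q * (S + D)) ^+ 2 - (2 ^+ 12 * (q * S) ^+ 2 +
      (2 ^+ 11 * (q ^+ 2 * (S * D)) + 3 * 2 ^+ 10 * (q ^+ 2 * D ^+ 2))) =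
    3 * 2 ^+ 11 * (q ^+ 2 * (S * D)) + 2 ^+ 10 * (q ^+ 2 * D ^+ 2) by ring.
  by apply: addr_ge0; apply: mulr_ge0 => //; apply: mulr_ge0.
by rewrite /q; ring.
Qed.

Variable lam : R.
Hypothesis lam0 : 0 < lam.

Definition exceeded (h : nat -> Omega T m -> 'M[R]_(d, m)) n (w : Omega T m) : bool :=
  has (fun k => lam <= n2 (gsum g h k w)) (iota 0 n.+1).

(** The integrand killed once the running sums have reached the level: Doob's stopping argument
    without stopping times. *)
Definition stopped h n w : 'M[R]_(d, m) := if exceeded h n w then 0 else h n w.

Lemma exceededS h n w : exceeded h n.+1 w = exceeded h n w || (lam <= n2 (gsum g h n.+1 w)).
Proof.
rewrite /exceeded (_ : iota 0 n.+2 = iota 0 n.+1 ++ [:: n.+1]).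
  by rewrite has_cat /= orbF.
by rewrite -[in LHS](addn1 n.+1) iotaD.
Qed.

(** After the level is reached all later summands vanish, so the stopped sum keeps the value with
    which it reached [lam]; before that nothing has been changed. *)
Lemma stopped_gsum h n w : (exceeded h n w -> lam <= n2 (gsum g (stopped h) n w)) /\
  (~~ exceeded h n w -> gsum g (stopped h) n w = gsum g h n w).
Proof.
elim: n => [|n [IH1 IH2]].
  by rewrite /exceeded/= orbF /gsum !big_ord0 n20 lt_geF.
rewrite exceededS !gsumS [stopped h n w]/stopped.
have [e|e] := boolP (exceeded h n w) => /=; first by rewrite mul0mx addr0; split=> // _; exact: IH1.
by rewrite (IH2 e).
Qed.

Lemma exceeded_F h n : gadapted h -> (n <= N)%N -> measurable_fun [set: OmF T m (g n)] (exceeded h n).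
Proof.
move=> ah; rewrite /exceeded; elim: n => [|n IH] nN.
  have -> : (fun w => has (fun k : nat => lam <= n2 (gsum g h k w)) (iota 0 1)) = (fun=> false).
    by apply/funext => w; rewrite /= orbF /gsum big_ord0 n20 lt_geF.
  exact: mcst.
have -> : (fun w => has (fun k => lam <= n2 (gsum g h k w)) (iota 0 n.+2)) =
    (fun w => exceeded h n w || (lam <= n2 (gsum g h n.+1 w))).
  by apply/funext => w; rewrite -exceededS.
apply: measurable_or.
  have := IH (ltnW nN) => mI. exact: (mcomp mI (measurable_OmF_le (ltW (gS nN)))).
apply: measurable_fun_ler => //; apply: measurable_n2 => a b.
by apply/F_measurableP; exact: gsum_F.
Qed.

Lemma stopped_adapted h : gadapted h -> gadapted (stopped h).
Proof.
move=> ah i iN a b; apply/F_measurableP.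
have -> : (fun w => stopped h i w a b) = (fun w => if exceeded h i w then 0 else h i w a b).
  by apply/funext => w; rewrite /stopped; case: ifP; rewrite ?mxE.
apply: measurable_fun_ifT => //; last exact: meas.
by apply: exceeded_F => //; exact: ltnW.
Qed.

Lemma n2_stopped h i w : n2 (stopped h i w) <= n2 (h i w).
Proof. by rewrite /stopped; case: ifP; rewrite ?n20 ?n2_ge0. Qed.

Lemma exceeded_subset h : [set w | exceeded h N w] `<=` [set w | lam <= n2 (gsum g (stopped h) N w)].
Proof. by move=> w /= hw; have [+ _] := stopped_gsum h N w; apply. Qed.

Lemma measurable_exceeded h : gadapted h -> measurable [set w : Omega T m | exceeded h N w].
Proof.
move=> ah; have NT : g N <= T by case/andP: (g0 (leqnn N)).
have := mcomp (exceeded_F ah (leqnn N)) (measurable_OmF_Omega NT).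
move=> /(_ measurableT [set true]) h1; rewrite -[X in measurable X]setTI.
by apply: h1.
Qed.

(** If some partial sum reaches the level then so does the final stopped sum, to which Markov's
    inequality and the second moment bound apply. *)
Lemma gsum_max2 h : gadapted h -> (P [set w | exceeded h N w] <= lam^-1%:E *
   \sum_(i < N) (16 * m%:R * (g i.+1 - g i))%:E * \int[P]_w (n2 (h i w))%:E)%E.
Proof.
move=> ah; have ash := stopped_adapted ah.
have mn : mfunO T m (fun w => n2 (gsum g (stopped h) N w)) by apply: measurable_n2 => a b; exact: measurable_gsum.
apply: (via (P [set w | lam <= n2 (gsum g (stopped h) N w)])).
  apply: le_measure; rewrite ?inE; [exact: measurable_exceeded| |exact: exceeded_subset].
  have := @measurable_fun_ler _ _ _ setT _ _ (mcst lam) mn measurableT [set true]. by rewrite setTI; apply.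
apply: le_trans (markov_int _ mn _ lam0) _; first by move=> w; exact: n2_ge0.
apply: lee_wpmul2l; first by rewrite lee_fin invr_ge0 ltW.
apply: le_trans (gsum_L2 ash (leqnn N)) _; apply: lee_sum => i _.
apply: lee_wpmul2l; first by rewrite lee_fin mulr_ge0 ?mulr_ge0// subr_ge0 ltW// gS.
apply: int_le.
- by apply: measurable_n2 => a b; exact: (measT ash).
- by apply: measurable_n2 => a b; exact: measT.
- by move=> w; exact: n2_ge0.
- by move=> w; exact: n2_stopped.
Qed.

(** The same argument with fourth moments. The bound is quadratic in the length of the time
    interval, so that the sum over [K] cells of length [T / K] still tends to zero. *)
Lemma gsum_max4 h (c : R) : gadapted h -> (forall i w, (i < N)%N -> n2 (h i w) <= c) -> 0 <= c ->
  (P [set w | exceeded h N w] <= (lam ^- 2 * (d%:R ^+ 2 * (2 ^+ 12 * (m%:R * c * (g N - g 0%N)) ^+ 2)))%:E)%E.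
Proof.
move=> ah hc c0; have ash := stopped_adapted ah.
have mn : mfunO T m (fun w => n2 (gsum g (stopped h) N w)) by apply: measurable_n2 => a b; exact: measurable_gsum.
have m4 a : mfunO T m (fun w => gsum g (stopped h) N w a ord0 ^+ 4) by apply: mfunX; exact: measurable_gsum.
have e4 (x : R) : 0 <= x ^+ 4 by rewrite (exprM _ 2 2) sqr_ge0.
apply: (via (P [set w | lam ^+ 2 <= n2 (gsum g (stopped h) N w) ^+ 2])).
  apply: le_measure; rewrite ?inE; first exact: measurable_exceeded.
    have := @measurable_fun_ler _ _ _ setT _ _ (mcst (lam ^+ 2)) (mfunX 2 mn) measurableT [set true].
    by rewrite setTI; apply.
  move=> w /exceeded_subset /= hl; rewrite lerXn2r ?nnegrE ?n2_ge0//; exact: ltW.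
apply: le_trans (markov_int _ (mfunX 2 mn) _ (exprn_gt0 2 lam0)) _.
  by move=> w; exact: sqr_ge0.
rewrite [leRHS]EFinM; apply: lee_wpmul2l; first by rewrite lee_fin invr_ge0 exprn_ge0// ltW.
apply: (via (\int[P]_w (d%:R * \sum_a gsum g (stopped h) N w a ord0 ^+ 4)%:E)%E).
  apply: int_le.
  - exact: mfunX.
  - by apply: mfunM => //; exact: mfun_sum.
  - by move=> w; exact: sqr_ge0.
  - move=> w; rewrite /n2; under eq_bigr do rewrite big_ord1.
    apply: le_trans (sqr_sum_le _) _. by under eq_bigr do rewrite -exprM.
rewrite intZ//; last 2 first.
- exact: mfun_sum.
- by move=> w; apply: sumr_ge0 => a _.
rewrite int_sum// expr2 -mulrA [leRHS]EFinM; apply: lee_wpmul2l; first by rewrite lee_fin.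
apply: (via (\sum_(a < d) (2 ^+ 12 * (m%:R * c * (g N - g 0%N)) ^+ 2)%:E)%E).
  apply: lee_sum => a _; apply: gsum_L4 => // i w iN. by apply: le_trans (n2_stopped _ _ _) _; exact: hc.
by rewrite sumEFin sumr_const card_ord lee_fin [leRHS]mulr_natl.
Qed.

End GridSums.

Section Grid.
Variables (R : realType) (T : R).

Definition is_grid (g : nat -> R) (N : nat) := [/\ g 0%N = 0, g N = T & forall i, (i < N)%N -> g i < g i.+1].

Lemma is_grid_bnd g N : is_grid g N -> forall i, (i <= N)%N -> 0 <= g i <= T.
Proof.
by case=> g0 gN gS i iN; rewrite (grid_ge0 g0 gS iN) (grid_leT gN gS iN).
Qed.

Lemma is_grid_ge0 g N : is_grid g N -> forall i, (i <= N)%N -> 0 <= g i.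
Proof. by move=> gr i /(is_grid_bnd gr)/andP[]. Qed.

Lemma is_grid_leT g N : is_grid g N -> forall i, (i <= N)%N -> g i <= T.
Proof. by move=> gr i /(is_grid_bnd gr)/andP[]. Qed.

Lemma is_grid_lt g N : is_grid g N -> forall i j, (i <= N)%N -> (j <= N)%N -> (g i < g j) = (i < j)%N.
Proof.
move=> [g0 gN gS] i j iN jN; apply/idP/idP => h; last first.
  apply: (@lt_le_trans _ _ (g i.+1)); first by apply: gS; exact: leq_trans jN.
  by apply: (grid_le gS); rewrite h.
by rewrite ltnNge; apply: contraTN h => ji; rewrite -leNgt; apply: (grid_le gS); rewrite ji.
Qed.

Lemma is_grid_le g N : is_grid g N -> forall i j, (i <= N)%N -> (j <= N)%N -> (g i <= g j) = (i <= j)%N.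
Proof. by move=> gr i j iN jN; rewrite leNgt (is_grid_lt gr)// -leqNgt. Qed.

(** The list together with 0 and [T], sorted and freed of repetitions. *)
Lemma ex_grid (L : seq R) : 0 < T -> {in L, forall x, 0 <= x <= T} ->
  exists g N, is_grid g N /\ forall x, x \in L -> exists2 k, (k <= N)%N & g k = x.
Proof.
move=> T0 hL.
pose s := sort <=%R (undup (0 :: T :: L)).
have ss : sorted <%R s by rewrite lt_sorted_uniq_le sort_uniq undup_uniq/= sort_le_sorted.
have ms x : (x \in s) = [|| x == 0, x == T | x \in L] by rewrite mem_sort mem_undup !inE.
have s_gt0 : (0 < size s)%N by have : 0 \in s by [rewrite ms eqxx]; case: (s).
have hs x : x \in s -> 0 <= x <= T by rewrite ms => /or3P[/eqP->|/eqP->|/hL//]; rewrite ?lexx ?ltW.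
have ltn i j : (i < size s)%N -> (j < size s)%N -> (i < j)%N -> nth 0 s i < nth 0 s j.
  by move=> hi hj ij; apply: (sorted_ltn_nth lt_trans).
have nths i : (i < size s)%N -> 0 <= nth 0 s i <= T by move=> hi; apply: hs; exact: mem_nth.
exists (nth 0 s), (size s).-1; split; first split.
- have /(nthP 0)[i hi e] : 0 \in s by rewrite ms eqxx.
  apply/eqP; rewrite eq_le; have /andP[-> _] := nths 0%N s_gt0; rewrite andbT.
  case: i hi e => [|i] hi e; first by rewrite e. by rewrite -[leRHS]e ltW// ltn.
- have /(nthP 0)[i hi e] : T \in s by rewrite ms eqxx orbT.
  have hp : ((size s).-1 < size s)%N by rewrite prednK.
  apply/eqP; rewrite eq_le; have /andP[_ ->] := nths _ hp; rewrite /=.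
  rewrite -{1}e; have : (i <= (size s).-1)%N by rewrite -ltnS prednK.
  by rewrite leq_eqVlt => /orP[/eqP->//|h]; rewrite ltW// ltn.
- by move=> i hi; apply: ltn => //; rewrite -(prednK s_gt0) ltnS// ltnW.
- move=> x xL; have /(nthP 0)[i hi e] : x \in s by rewrite ms xL !orbT.
  by exists i => //; rewrite -ltnS prednK.
Qed.

End Grid.

(** * Simple processes as grid sums *)

Section SimpleOnGrid.
Variables (R : realType) (T : R) (m d : nat).
Implicit Types S : simple_process T m d.

Definition refines (g : nat -> R) (N : nat) S :=
  forall i, (exists2 a, (a <= N)%N & g a = sp_start (s := S) i) /\
    (exists2 b, (b <= N)%N & g b = sp_stop (s := S) i).

(** Simple processes live on left-open intervals, so the value at the right end of a cell of a
    refining grid is the value on the whole cell. *)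
Definition grid_val (g : nat -> R) S (i : nat) (w : Omega T m) : 'M[R]_(d, m) := sp_eval S (g i.+1) w.

Definition endpoints S : seq R := [seq sp_start (s := S) i | i <- enum 'I_(sp_size S)] ++
  [seq sp_stop (s := S) i | i <- enum 'I_(sp_size S)].

Lemma endpoints_bnd S : {in endpoints S, forall x, 0 <= x <= T}.
Proof.
move=> x; rewrite mem_cat => /orP[] /mapP[i _ ->]; have [a b c] := sp_times (s := S) i.
  by rewrite a (le_trans b).
by rewrite c (le_trans a).
Qed.

Lemma endpoints_refines g N S :
  (forall x, x \in endpoints S -> exists2 k, (k <= N)%N & g k = x) -> refines g N S.
Proof.
move=> h i; split; apply: h; rewrite mem_cat; apply/orP; [left|right];
  by apply/mapP; exists i => //; rewrite mem_enum.
Qed.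

Variables (g : nat -> R) (N : nat).
Hypothesis gr : is_grid T g N.

(** On a refining grid an interval that starts strictly before [g i.+1] starts at or before [g i];
    hence the value is known at time [g i]. *)
Lemma grid_val_adapted S : refines g N S -> gadapted g N (grid_val g S).
Proof.
move=> rf i iN a b; apply/F_measurableP.
have -> : (fun w => grid_val g S i w a b) = (fun w => \sum_j
   (if sp_start (s := S) j < g i.+1 <= sp_stop (s := S) j then sp_val (s := S) j w a b else 0)).
  apply/funext => w; rewrite /grid_val /sp_eval summxE; apply: eq_bigr => j _.
  by case: ifP => // _; rewrite mxE.
apply: mfun_sum => j.
case: (boolP (sp_start (s := S) j < g i.+1 <= sp_stop (s := S) j)) => [/andP[h _]|_]; last exact: mcst.
apply/F_measurableP; apply: (F_measurable_le _ (@sp_adapted _ _ _ _ S j a b)).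
have [[l lN el] _] := rf j; rewrite -el in h *.
by rewrite (is_grid_le gr)// ?(ltnW iN)//; rewrite (is_grid_lt gr) in h.
Qed.

(** Every interval of the simple process is a run of grid cells, cut at index [k] by the minima; the
    increments over these cells telescope. *)
Lemma sp_integral_gsum S k w : refines g N S -> (k <= N)%N ->
  sp_integral S (g k) w = gsum g (grid_val g S) k w.
Proof.
move=> rf kN; rewrite /sp_integral /gsum /grid_val /sp_eval.
under [RHS]eq_bigr do rewrite mulmx_suml.
rewrite exchange_big/=; apply: eq_bigr => j _.
have [[a aN ea] [b bN eb]] := rf j.
have ab : (a <= b)%N by have [_ h _] := sp_times (s := S) j; rewrite -(is_grid_le gr)// ea eb.
rewrite -ea -eb.
have mn u : (u <= N)%N -> Num.min (g u) (g k) = g (minn u k).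
  by move=> uN; rewrite minEle minnE (is_grid_le gr)//; case: leqP => h; rewrite ?(subKn h)//;
     [congr g; lia|congr g; lia].
rewrite !mn// (eq_bigr (fun i : 'I_k => (if (a <= i < b)%N then 1 else 0) *: (sp_val (s := S) j w *m (w (g i.+1) - w (g i))))); last first.
  move=> i _; have iN : (i < N)%N by exact: leq_trans kN. rewrite (is_grid_lt gr)// (is_grid_le gr)// ltnS.
  by case: ifP; rewrite ?scale1r ?scale0r ?mul0mx.
transitivity (sp_val (s := S) j w *m \sum_(i < k) (if (a <= i < b)%N then w (g i.+1) - w (g i) else 0)).
  congr (_ *m _); elim: k {kN mn} => [|k IH].
    by rewrite big_ord0 !minn0 subrr.
  rewrite big_ord_recr/= -IH; case: ifP => [/andP[h1 h2]|/negbT h].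
    have -> : minn b k.+1 = k.+1 by lia. have -> : minn b k = k by lia.
    have -> : minn a k.+1 = minn a k by lia. by rewrite addrC addrA subrK.
  rewrite addr0; case: (leqP b k) => bk.
    have -> : minn b k.+1 = b by lia. have -> : minn a k.+1 = minn a k by lia. by [].
  have -> : minn b k.+1 = minn a k.+1 by lia. have -> : minn a k = k by lia. by rewrite !subrr.
rewrite mulmx_sumr; apply: eq_bigr => i _.
by case: ifP; rewrite ?scale1r ?scale0r ?mulmx0.
Qed.

End SimpleOnGrid.

(** * Integrals over time and probability *)

Section TimeIntegrals.
Variables (R : realType) (T : R) (m : nat) (P : probability (Omega T m) R).
Implicit Types K : R -> Omega T m -> R.

Definition jm K := measurable_fun (`[0, T]%classic `*` [set: Omega T m]) (fun x : R * Omega T m => K x.1 x.2).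

Definition D2 K : \bar R := (\int[P]_w \int[leb]_(t in `[0%R, T]) (K t w)%:E)%E.

(** Joint measurability is given only on [[0, T]]. The extension by zero, with the variables in the
    order required by the product measure, makes Fubini available on the whole product. *)
Definition onT K (x : Omega T m * measurableTypeR R) : R := if 0 <= x.2 <= T then K x.2 x.1 else 0.

Let mD : measurable (`[0, T]%classic `*` [set: Omega T m]).
Proof. by apply: measurableX => //; exact: measurable_itv. Qed.

Lemma mem_time (t : R) : (t \in `[0, T]%classic) = (0 <= t <= T).
Proof. by apply/idP/idP; rewrite inE/= in_itv. Qed.

Lemma onT_measurable K : jm K -> mfun (onT K).
Proof.
move=> mK; have := (measurable_restrictT (fun x : R * Omega T m => K x.1 x.2) mD).1 mK.
set f := _ \_ _ => mf.
have ms : mfun (fun x : Omega T m * measurableTypeR R => ((x.2 : R), x.1)).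
  by apply: measurable_fun_pair; [exact: measurable_snd|exact: measurable_fst].
have -> : onT K = f \o (fun x => ((x.2 : R), x.1)).
  apply/funext => x; rewrite /onT /f /= patchE /=; congr (if _ then _ else _).
  by apply/idP/idP; rewrite inE /= in_itv/= => // -[].
exact: (mcomp mf ms).
Qed.

Lemma onT_ge0 K : (forall t w, 0 <= t <= T -> 0 <= K t w) -> forall x, 0 <= onT K x.
Proof. by move=> h x; rewrite /onT; case: ifP => // /h. Qed.

Lemma inner_onT K w : (\int[leb]_(t in `[0%R, T]) (K t w)%:E = \int[leb]_t (onT K (w, t))%:E)%E.
Proof.
rewrite integral_mkcond; apply: eq_integral => t _; rewrite /onT patchE /=.
by rewrite mem_time; case: ifP.
Qed.

Lemma D2E K : jm K -> (forall t w, 0 <= t <= T -> 0 <= K t w) -> D2 K = (\int[P \x leb]_x (onT K x)%:E)%E.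
Proof.
move=> mK K0.
have mE : mfun (fun x => (onT K x)%:E) by apply/EFinP; exact: onT_measurable.
have E0 x : (0 <= (onT K x)%:E)%E by rewrite lee_fin onT_ge0.
rewrite (fubini_tonelli1 _ mE E0).
by apply: eq_integral => w _; rewrite inner_onT.
Qed.

Lemma D2_swap K : jm K -> (forall t w, 0 <= t <= T -> 0 <= K t w) ->
  D2 K = (\int[leb]_(t in `[0%R, T]) \int[P]_w (K t w)%:E)%E.
Proof.
move=> mK K0; rewrite D2E//.
have mE : mfun (fun x => (onT K x)%:E) by apply/EFinP; exact: onT_measurable.
have E0 x : (0 <= (onT K x)%:E)%E by rewrite lee_fin onT_ge0.
rewrite (fubini_tonelli2 _ mE E0).
rewrite [RHS]integral_mkcond; apply: eq_integral => t _; rewrite patchE /fubini_G /onT /=.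
rewrite mem_time; case: ifP => // _; exact: integral0.
Qed.

Lemma D2_ge0 K : (forall t w, 0 <= t <= T -> 0 <= K t w) -> (0 <= D2 K)%E.
Proof.
move=> K0; apply: integral_ge0 => w _; apply: integral_ge0 => t /=.
by rewrite in_itv/= lee_fin => /K0.
Qed.

Lemma D2_le2 (a b : R) K K1 K2 : jm K -> jm K1 -> jm K2 -> 0 <= a -> 0 <= b ->
  (forall t w, 0 <= t <= T -> 0 <= K t w) -> (forall t w, 0 <= t <= T -> 0 <= K1 t w) ->
  (forall t w, 0 <= t <= T -> 0 <= K2 t w) -> (forall t w, 0 <= t <= T -> K t w <= a * K1 t w + b * K2 t w) ->
  (D2 K <= a%:E * D2 K1 + b%:E * D2 K2)%E.
Proof.
move=> mK mK1 mK2 a0 b0 K0 K10 K20 h; rewrite !D2E//; apply: int_le2 => //.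
- exact: onT_measurable.
- exact: onT_measurable.
- exact: onT_measurable.
- exact: onT_ge0.
- exact: onT_ge0.
- exact: onT_ge0.
- by move=> x; rewrite /onT; case: ifP => [/h//|_]; rewrite !mulr0 addr0.
Qed.

Lemma jm_cst (c : R) : jm (fun _ _ => c).
Proof. exact: mcst. Qed.

Lemma D2_le K K1 : jm K -> jm K1 -> (forall t w, 0 <= t <= T -> 0 <= K t w) ->
  (forall t w, 0 <= t <= T -> K t w <= K1 t w) -> (D2 K <= D2 K1)%E.
Proof.
move=> mK mK1 K0 h.
have K10 t w : 0 <= t <= T -> 0 <= K1 t w by move=> ht; apply: le_trans (K0 t w ht) (h t w ht).
have := D2_le2 (a := 1) (b := 0) mK mK1 (jm_cst 0) ler01 (lexx _) K0 K10.
rewrite mul1e mul0e adde0; apply => //.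
by move=> t w ht; rewrite mul1r mul0r addr0 h.
Qed.

Lemma jm_n2 p q (H : R -> Omega T m -> 'M[R]_(p, q)) : jointly_measurable H -> jm (fun t w => n2 (H t w)).
Proof.
move=> mH; rewrite /jm /n2; apply: mfun_sum => i; apply: mfun_sum => j.
by apply: mfunX; exact: mH.
Qed.

Lemma jointly_measurableB p q (H H' : R -> Omega T m -> 'M[R]_(p, q)) :
  jointly_measurable H -> jointly_measurable H' -> jointly_measurable (fun t w => H t w - H' t w).
Proof.
move=> mH mH' a b.
have -> : (fun x : R * Omega T m => (H x.1 x.2 - H' x.1 x.2) a b) =
    (fun x => H x.1 x.2 a b - H' x.1 x.2 a b) by apply/funext => x; rewrite !mxE.
by apply: mfunB; [exact: mH|exact: mH'].
Qed.

Lemma jointly_measurable_sp_eval p (S : simple_process T m p) : jointly_measurable (sp_eval S).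
Proof.
move=> a b.
have -> : (fun x : R * Omega T m => sp_eval S x.1 x.2 a b) = (fun x => \sum_i
   (if (sp_start (s := S) i < x.1 <= sp_stop (s := S) i) then sp_val (s := S) i x.2 a b else 0)).
  apply/funext => x; rewrite /sp_eval summxE; apply: eq_bigr => i _. by case: ifP => //; rewrite mxE.
apply: mfun_sum => i; apply: measurable_funTS.
apply: measurable_fun_ifT => //.
  apply: measurable_and.
    by apply: measurable_fun_ltr => //; exact: measurable_fst.
  by apply: measurable_fun_ler => //; exact: measurable_fst.
have [_ h1 h2] := sp_times (s := S) i.
have mv := F_measurableT (le_trans h1 h2) (@sp_adapted _ _ _ _ S i a b).
exact: (mcomp mv measurable_snd).
Qed.

Lemma step_integral (F : R -> R) (g : nat -> R) N : is_grid T g N -> (forall t, 0 <= F t) -> mfun F ->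
  (forall i t, (i < N)%N -> g i < t <= g i.+1 -> F t = F (g i.+1)) ->
  (\sum_(i < N) ((g i.+1 - g i) * F (g i.+1))%:E = \int[leb]_(t in `[0%R, T]) (F t)%:E)%E.
Proof.
move=> gr F0 mF hF; have [g0 gN gS] := gr.
suff h n : (n <= N)%N -> (\sum_(i < n) ((g i.+1 - g i) * F (g i.+1))%:E =
    \int[leb]_(t in `[0%R, g n]) (F t)%:E)%E by rewrite h// gN.
elim: n => [|n IH] nN.
  by rewrite big_ord0 g0 set_itv1 integral_set1.
have gn0 : 0 <= g n by case/andP: (is_grid_bnd gr (ltnW nN)).
rewrite big_ord_recr/= IH ?(ltnW nN)//.
have -> : `[0, g n.+1]%classic = `[0, g n] `|` `]g n, g n.+1].
  apply/seteqP; split => t /=; rewrite !in_itv/=.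
    by move=> /andP[-> ->]; rewrite andbT; case: (leP t (g n)); [left|right].
  have gg := ltW (gS _ nN). move=> [/andP[-> h]|/andP[h ->]]; first by rewrite (le_trans h gg).
  by rewrite (ltW (le_lt_trans gn0 h)).
rewrite ge0_integral_setU//=; last 3 first.
- by apply/EFinP; apply: measurable_funTS.
- by move=> x _; rewrite lee_fin.
- apply/disj_setPS => x [] /=; rewrite !in_itv/= => /andP[_ h] /andP[h' _].
  by move: (lt_le_trans h' h); rewrite ltxx.
congr (_ + _)%E; rewrite (eq_integral (cst (F (g n.+1))%:E)).
  rewrite integral_cst//= lebesgue_measure_itv/= lte_fin gS// -EFinB -EFinM. by congr EFin; ring.
by move=> t /[!inE]/=; rewrite in_itv/= => ht; rewrite /= (hF n t nN ht).
Qed.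

End TimeIntegrals.

Section SimpleEstimates.
Variables (R : realType) (T : R) (m d : nat) (P : probability (Omega T m) R).
Hypotheses (T0 : 0 < T) (WP : is_wiener P).
Implicit Types S : simple_process T m d.

Lemma gsumB g (h h' : nat -> Omega T m -> 'M[R]_(d, m)) n w :
  gsum g h n w - gsum g h' n w = gsum g (fun i w => h i w - h' i w) n w.
Proof.
by rewrite /gsum -sumrB; apply: eq_bigr => i _; rewrite mulmxBl.
Qed.

Lemma gadaptedB g N (h h' : nat -> Omega T m -> 'M[R]_(d, m)) :
  gadapted g N h -> gadapted g N h' -> gadapted g N (fun i w => h i w - h' i w).
Proof.
move=> a1 a2 i iN a b; apply/F_measurableP.
have -> : (fun w : OmF T m (g i) => (h i w - h' i w) a b) = (fun w => h i w a b - h' i w a b).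
  by apply/funext => w; rewrite !mxE.
by apply: mfunB; apply/F_measurableP; [exact: a1|exact: a2].
Qed.

(** One grid carries both processes and all the listed times, so that differences of simple
    integrals become grid sums. *)
Lemma common_grid S S' (L : seq R) : {in L, forall x, 0 <= x <= T} ->
  exists g N, [/\ is_grid T g N, refines g N S, refines g N S' &
    forall x, x \in L -> exists2 k, (k <= N)%N & g k = x].
Proof.
move=> hL; have [|g [N [gr hg]]] := @ex_grid _ T (endpoints S ++ endpoints S' ++ L) T0.
  move=> x; rewrite mem_cat => /orP[|]; first exact: endpoints_bnd.
  by rewrite mem_cat => /orP[|]; [exact: endpoints_bnd|exact: hL].
exists g, N; split => //.
- by apply: endpoints_refines => x xS; apply: hg; rewrite mem_cat xS.
- by apply: endpoints_refines => x xS; apply: hg; rewrite mem_cat (mem_cat _ (endpoints S')) xS orbT.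
- by move=> x xL; apply: hg; rewrite mem_cat (mem_cat _ (endpoints S')) xL !orbT.
Qed.

Lemma measurable_sp_integral S t : 0 <= t <= T -> forall a b, mfunO T m (fun w => sp_integral S t w a b).
Proof.
move=> ht a b; have [|g [N [gr rf _ hk]]] := @common_grid S S [:: t].
  by move=> x; rewrite inE => /eqP ->.
have [|k kN <-] := hk t; first by rewrite inE.
under eq_fun do rewrite (sp_integral_gsum gr _ rf kN).
have [_ _ gS] := gr.
exact: (measurable_gsum (is_grid_bnd gr) gS (grid_val_adapted gr rf) kN).
Qed.

Lemma step_energy S S' g N : is_grid T g N -> refines g N S -> refines g N S' ->
  (\sum_(i < N) (16 * m%:R * (g i.+1 - g i))%:E * \int[P]_w (n2 (grid_val g S i w - grid_val g S' i w))%:E =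
   (16 * m%:R)%:E * D2 P (fun t w => n2 (sp_eval S t w - sp_eval S' t w)))%E.
Proof.
move=> gr rf rf'; have [g0 gN gS] := gr.
have hb i : (i < N)%N -> 0 <= g i.+1 - g i by move=> iN; rewrite subr_ge0 ltW// gS.
have mgv i : (i < N)%N -> mfunO T m (fun w => n2 (grid_val g S i w - grid_val g S' i w)).
  move=> iN; apply: measurable_n2 => a b.
  have := gadaptedB (grid_val_adapted gr rf) (grid_val_adapted gr rf') iN a b.
  by apply: F_measurableT; have /andP[] := is_grid_bnd gr (ltnW iN).
transitivity ((16 * m%:R)%:E * \sum_(i < N) \int[P]_w
    ((g i.+1 - g i) * n2 (grid_val g S i w - grid_val g S' i w))%:E)%E.
  rewrite ge0_sume_distrr; last first.
    move=> i _; apply: int_ge0 => w; apply: mulr_ge0; [exact: hb|exact: n2_ge0].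
  apply: eq_bigr => i _; rewrite intZ//; last 3 first.
  - exact: mgv.
  - exact: hb.
  - by move=> w; exact: n2_ge0.
  by rewrite muleA -EFinM.
congr (_ * _)%E; rewrite -ge0_integral_sum//; last 2 first.
- move=> i; apply/EFinP; apply: mfunM => //; exact: mgv.
- move=> i w _; rewrite lee_fin; apply: mulr_ge0; [exact: hb|exact: n2_ge0].
apply: eq_integral => w _.
apply: (step_integral (F := fun t => n2 (sp_eval S t w - sp_eval S' t w)) gr).
- by move=> t; exact: n2_ge0.
- apply: measurable_n2 => a b.
  have me S0 : mfun (fun t => sp_eval S0 t w a b).
    have -> : (fun t => sp_eval S0 t w a b) = (fun t => \sum_i
       (if (sp_start (s := S0) i < t <= sp_stop (s := S0) i) then sp_val (s := S0) i w a b else 0)).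
      apply/funext => t; rewrite /sp_eval summxE; apply: eq_bigr => i _. by case: ifP => //; rewrite mxE.
    apply: mfun_sum => i; apply: measurable_fun_ifT => //.
    by apply: measurable_and; [exact: measurable_fun_ltr|exact: measurable_fun_ler].
  by apply: measurable_mxB; exact: me.
- move=> i t iN /andP[h1 h2].
  have ce S0 : refines g N S0 -> sp_eval S0 t w = sp_eval S0 (g i.+1) w.
    move=> rf0; apply: eq_bigr => j _; have [[a aN <-] [b bN <-]] := rf0 j. congr (if _ then _ else _).
    rewrite (is_grid_lt gr)// (is_grid_le gr)// ltnS. apply/andP/andP => -[h3 h4]; split.
    - by rewrite -ltnS -(is_grid_lt gr)// ?ltnS ?(ltnW iN)//; exact: lt_le_trans h3 h2.
    - by rewrite -(is_grid_lt gr)// ?(ltnW iN)//; exact: lt_le_trans h1 h4.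
    - by apply: le_lt_trans h1; rewrite (is_grid_le gr)// ?(ltnW iN).
    - by apply: le_trans h2 _; rewrite (is_grid_le gr).
  by rewrite !ce.
Qed.

(** On a common grid the difference is one grid sum; the cells after [t] only increase the
    right-hand side. *)
Lemma simple_L2 S S' t : 0 <= t <= T -> (\int[P]_w (n2 (sp_integral S t w - sp_integral S' t w))%:E <=
   (16 * m%:R)%:E * D2 P (fun t w => n2 (sp_eval S t w - sp_eval S' t w)))%E.
Proof.
move=> ht; have [|g [N [gr rf rf' hk]]] := @common_grid S S' [:: t].
  by move=> x; rewrite inE => /eqP ->.
have [|k kN <-] := hk t; first by rewrite inE.
under eq_integral do rewrite (sp_integral_gsum gr _ rf kN) (sp_integral_gsum gr _ rf' kN) gsumB.
have [_ _ gS] := gr.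
have ga := gadaptedB (grid_val_adapted gr rf) (grid_val_adapted gr rf').
apply: le_trans (gsum_L2 WP (is_grid_bnd gr) gS ga kN) _.
rewrite -(step_energy gr rf rf').
rewrite -(big_mkord xpredT (fun i => (16 * m%:R * (g i.+1 - g i))%:E *
     \int[P]_w (n2 (grid_val g S i w - grid_val g S' i w))%:E)%E).
rewrite -[leRHS](big_mkord xpredT (fun i => (16 * m%:R * (g i.+1 - g i))%:E *
     \int[P]_w (n2 (grid_val g S i w - grid_val g S' i w))%:E)%E).
rewrite [leRHS](@big_cat_nat _ _ _ k)//= leeDl// big_nat_cond.
apply: sume_ge0 => i /andP[/andP[_ iN] _]; apply: mule_ge0.
  have : 0 <= g i.+1 - g i by rewrite subr_ge0 ltW// gS. by move=> h; rewrite lee_fin !mulr_ge0.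
by apply: int_ge0 => w; exact: n2_ge0.
Qed.

Lemma has_measurable (X : Omega T m -> R -> 'cV[R]_d) (L : seq R) (lam : R) :
  (forall t, t \in L -> forall a b, mfun (fun w => X w t a b)) ->
  measurable [set w | has (fun t => lam <= n2 (X w t)) L].
Proof.
elim: L => [|x L IH] hX.
  by rewrite (_ : [set w | _] = set0)//; apply/seteqP; split.
have -> : [set w | has (fun t => lam <= n2 (X w t)) (x :: L)] =
    [set w | lam <= n2 (X w x)] `|` [set w | has (fun t => lam <= n2 (X w t)) L].
  by apply/seteqP; split => w /= => [/orP|[->//|->]]; rewrite ?orbT.
apply: measurableU; last by apply: IH => t tL; apply: hX; rewrite inE tL orbT.
have mn : mfun (fun w => n2 (X w x)) by apply: measurable_n2 => a b; apply: hX; rewrite inE eqxx.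
have := @measurable_fun_ler _ _ _ setT _ _ (mcst lam) mn measurableT [set true].
by rewrite setTI; apply.
Qed.

Lemma simple_max S S' (L : seq R) (lam : R) : 0 < lam -> {in L, forall x, 0 <= x <= T} ->
  (P [set w | has (fun t => (lam <= n2 (sp_integral S t w - sp_integral S' t w))%R) L] <=
   lam^-1%:E * ((16 * m%:R)%:E * D2 P (fun t w => n2 (sp_eval S t w - sp_eval S' t w))))%E.
Proof.
move=> lam0 hL; have [g [N [gr rf rf' hk]]] := common_grid S S' hL.
have [_ _ gS] := gr.
have ga := gadaptedB (grid_val_adapted gr rf) (grid_val_adapted gr rf').
rewrite -(step_energy gr rf rf').
apply: le_trans (gsum_max2 WP (is_grid_bnd gr) gS lam0 ga).
apply: le_measure; rewrite ?inE.
- apply: has_measurable => t tL a b.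
  have -> : (fun w => (sp_integral S t w - sp_integral S' t w) a b) =
     (fun w => sp_integral S t w a b - sp_integral S' t w a b).
    by apply/funext => w; rewrite !mxE.
  by apply: mfunB; apply: measurable_sp_integral; exact: hL.
- exact: (measurable_exceeded (is_grid_bnd gr) gS lam0 ga).
- move=> w /= /hasP[t tL]; have [k kN <-] := hk t tL.
  rewrite (sp_integral_gsum gr _ rf kN) (sp_integral_gsum gr _ rf' kN) gsumB => h.
  by apply/hasP; exists k => //; rewrite mem_iota add0n ltnS.
Qed.

(** The fourth moment inequality localised to [[u, v]]; this is what gives tightness of the Euler
    martingale. *)
Lemma simple_max4 S (u v c lam : R) (L : seq R) : 0 < lam -> 0 <= u -> u < v -> v <= T ->
  (forall t w, n2 (sp_eval S t w) <= c) -> 0 <= c -> {in L, forall x, u <= x <= v} ->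
  (P [set w | has (fun t => (lam <= n2 (sp_integral S t w - sp_integral S u w))%R) L] <=
   (lam ^- 2 * (d%:R ^+ 2 * (2 ^+ 12 * (m%:R * c * (v - u)) ^+ 2)))%:E)%E.
Proof.
move=> lam0 u0 uv vT hc c0 hL.
have hL' x : x \in L -> 0 <= x <= T by move=> /hL/andP[h1 h2]; rewrite (le_trans u0 h1) (le_trans h2 vT).
have hLuv : {in u :: v :: L, forall x, 0 <= x <= T}.
  move=> x; rewrite !inE => /or3P[/eqP->|/eqP->|/hL'//].
    by rewrite u0 (le_trans (ltW uv)).
  by rewrite vT (le_trans u0 (ltW uv)).
have [g [N [gr rf _ hk]]] := common_grid S S hLuv.
have [_ _ gS] := gr; have ga := grid_val_adapted gr rf.
have [|a aN ga_] := hk u; first by rewrite inE eqxx.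
have [|b bN gb_] := hk v; first by rewrite !inE eqxx orbT.
have ab : (a < b)%N by rewrite -(is_grid_lt gr)// ga_ gb_.
(* The grid is restarted at the index of [u], so that the length entering the bound is [v - u] and
   not the time elapsed since 0. *)
pose g' i := g (a + i)%N; pose h' i := grid_val g S (a + i)%N.
pose N' := (b - a)%N.
have iN' i : (i <= N')%N -> (a + i <= N)%N by move=> hi; apply: leq_trans bN; rewrite -(subnKC (ltnW ab)) leq_add2l.
have g'0 i : (i <= N')%N -> 0 <= g' i <= T by move=> hi; apply: (is_grid_bnd gr); exact: iN'.
have g'S i : (i < N')%N -> g' i < g' i.+1 by move=> hi; rewrite /g' addnS; apply: gS; have := iN' _ hi; rewrite addnS.
have ga' : gadapted g' N' h' by move=> i hi; apply: ga; have := iN' _ hi; rewrite addnS.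
have hsum n w : gsum g' h' n w = gsum g (grid_val g S) (a + n) w - gsum g (grid_val g S) a w.
  rewrite /gsum -!(big_mkord xpredT (fun i => grid_val g S i w *m (w (g i.+1) - w (g i)))).
  rewrite (@big_cat_nat _ _ _ a 0 (a + n))//= ?leq_addr// addrAC subrr add0r.
  set F := fun i => grid_val g S i w *m (w (g i.+1) - w (g i)).
  have -> : \sum_(a <= i < a + n) F i = \sum_(0 <= i < n) F (i + a)%N by rewrite -{1}(add0n a) big_addn addKn.
  rewrite big_mkord; apply: eq_bigr => i _. by rewrite /h' /g' /F addnS addnC.
have hc' i w : (i < N')%N -> n2 (h' i w) <= c by move=> _; exact: hc.
have := gsum_max4 WP g'0 g'S lam0 ga' hc' c0.
have -> : g' N' - g' 0%N = v - u by rewrite /g' /N' addn0 subnKC ?(ltnW ab)// ga_ gb_.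
apply: le_trans.
apply: le_measure; rewrite ?inE.
- apply: has_measurable => t tL i j.
  have -> : (fun w => (sp_integral S t w - sp_integral S u w) i j) =
     (fun w => sp_integral S t w i j - sp_integral S u w i j).
    by apply/funext => w; rewrite !mxE.
  apply: mfunB; apply: measurable_sp_integral; first exact: hL'. by apply: hLuv; rewrite inE eqxx.
- exact: (measurable_exceeded g'0 g'S lam0 ga').
- move=> w /= /hasP[t tL]; have [|k kN gk] := hk t; first by rewrite !inE tL !orbT.
  have /andP[h1 h2] := hL t tL. have ak : (a <= k)%N by rewrite -(is_grid_le gr)// ga_ gk.
  have kb : (k <= b)%N by rewrite -(is_grid_le gr)// gb_ gk.
  rewrite -gk -ga_ (sp_integral_gsum gr _ rf kN) (sp_integral_gsum gr _ rf aN) => h.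
  apply/hasP; exists (k - a)%N; last by rewrite hsum subnKC. by rewrite mem_iota add0n ltnS /N' leq_sub2r.
Qed.

End SimpleEstimates.

(** * From finitely many times to a whole interval *)

Section Supremum.
Variables (R : realType) (T : R) (m d : nat) (P : probability (Omega T m) R).

Lemma continuous_n2 p q : continuous (@n2 R p q).
Proof.
move=> x; rewrite /n2.
have -> : (fun y : 'M[R]_(p, q) => \sum_i \sum_j y i j ^+ 2) =
    \sum_i \sum_j (fun y : 'M[R]_(p, q) => y i j ^+ 2).
  by apply/funext => y; rewrite fct_sumE; apply: eq_bigr => i _; rewrite fct_sumE.
elim/big_ind: _ => [|f g hf hg|i _]; [exact: cst_continuous|exact: continuousD|].
elim/big_ind: _ => [|f g hf hg|j _]; [exact: cst_continuous|exact: continuousD|].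
apply: (@cvg_comp _ _ _ (fun y : 'M[R]_(p, q) => y i j) (fun z : R => z ^+ 2)).
  exact: coord_continuous.
exact: exprn_continuous.
Qed.

Definition dyadics (u v : R) n : seq R := [seq u + (v - u) * i%:R / (2 ^ n)%:R | i <- iota 0 (2 ^ n).+1].

Lemma dyadics_bnd (u v : R) n : u < v -> {in dyadics u v n, forall x, u <= x <= v}.
Proof.
move=> uv x /mapP[i]; rewrite mem_iota add0n ltnS => /andP[_ hi] ->.
rewrite -mulrA; have q0 : 0 <= i%:R / (2 ^ n)%:R :> R by rewrite divr_ge0.
have q1 : i%:R / (2 ^ n)%:R <= 1 :> R by rewrite ler_pdivrMr// mul1r ler_nat.
by apply/andP; split; nra.
Qed.

Lemma dyadics_S (u v : R) n x : x \in dyadics u v n -> x \in dyadics u v n.+1.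
Proof.
move=> /mapP[i]; rewrite mem_iota add0n ltnS => /andP[_ hi] ->.
apply/mapP; exists (2 * i)%N; first by rewrite mem_iota add0n ltnS expnS leq_mul2l.
by rewrite expnS !natrM; field; rewrite pnatr_eq0 expn_eq0.
Qed.

(** A strict excess at [t] persists on a neighbourhood by continuity, and some dyadic point lies in
    it. *)
Lemma dense_exceed (u v lam : R) (f : R -> 'cV[R]_d) (t : R) : u < v ->
  {within `[u, v], continuous f} -> u <= t <= v -> lam < n2 (f t) ->
  exists n, has (fun s => lam <= n2 (f s)) (dyadics u v n).
Proof.
move=> uv /subspace_continuousP cf ht hl.
have vu : 0 < v - u by rewrite subr_gt0.
have tI : `[u, v]%classic t by rewrite /= in_itv.
have /cvgr_gt/(_ _ hl) : n2 (f s) @[s --> within `[u, v] (nbhs t)] --> n2 (f t).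
  exact: (cvg_comp _ _ (cf t tI) (@continuous_n2 _ _ _)).
rewrite near_withinE => /nbhs_ballP[r r0 hr]; rewrite /= in r0.
(* Since [n < 2 ^ n], this choice makes the dyadic mesh [(v - u) / 2 ^ n] smaller than the radius
   [r]. *)
have : \forall n \near \oo, n.+1%:R^-1 < r / (v - u).
  have rv : 0 < r / (v - u) by rewrite divr_gt0. exact: (near_infty_natSinv_lt (PosNum rv)).
case=> n _ /(_ n (leqnn n)) hn.
rewrite /= in hn.
exists n; pose i := Num.truncn ((t - u) / (v - u) * (2 ^ n)%:R).
have p0 : 0 < (2 ^ n)%:R :> R by rewrite ltr0n expn_gt0.
case/andP: ht => ut tv.
have x0 : 0 <= (t - u) / (v - u) * (2 ^ n)%:R by rewrite mulr_ge0 ?divr_ge0 ?subr_ge0// ltW.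
have /andP[i1 i2] := truncn_itv x0; rewrite -/i in i1 i2.
have iN : (i <= 2 ^ n)%N.
  rewrite -(ler_nat R); apply: le_trans i1 _; apply: ler_piMl; first exact: ltW p0.
  by rewrite ler_pdivrMr// mul1r lerD2r.
apply/hasP; exists (u + (v - u) * i%:R / (2 ^ n)%:R).
  by apply/mapP; exists i => //; rewrite mem_iota add0n ltnS.
have xi : u + (v - u) * i%:R / (2 ^ n)%:R \in dyadics u v n.
  by apply/mapP; exists i => //; rewrite mem_iota add0n ltnS.
apply/ltW/hr; last by rewrite /= in_itv/= (dyadics_bnd uv xi).
rewrite -ball_normE /ball_/=.
have e1 : t - (u + (v - u) * i%:R / (2 ^ n)%:R) =
   ((t - u) / (v - u) * (2 ^ n)%:R - i%:R) * ((v - u) / (2 ^ n)%:R).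
  by field; rewrite (gt_eqF p0) (gt_eqF vu).
rewrite e1 ger0_norm; last by rewrite mulr_ge0 ?subr_ge0// divr_ge0// ltW.
apply: (@le_lt_trans _ _ ((v - u) / (2 ^ n)%:R)).
  apply: ler_piMl; first by rewrite divr_ge0// ltW. by rewrite lerBlDl ltW// natr1.
have : (v - u) / (2 ^ n)%:R <= (v - u) * n.+1%:R^-1.
  by apply: ler_wpM2l; [exact: ltW|rewrite lef_pV2 ?posrE// ler_nat ltn_expl].
by move=> /le_lt_trans; apply; rewrite mulrC -ltr_pdivlMr.
Qed.

(** The dyadic sets are nested, so the events of an excess at level [n] increase and their union
    inherits the bound [b]. The result is stated with an exceptional event, which is the form used
    later for unions. *)
Lemma sup_bound (u v lam b : R) (X : Omega T m -> R -> 'cV[R]_d) : u < v ->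
  (forall t, u <= t <= v -> forall i j, mfun (fun w => X w t i j)) ->
  (forall w, {within `[u, v], continuous (X w)}) -> (forall L : seq R, {in L, forall x, u <= x <= v} ->
     (P [set w | has (fun t => (lam <= n2 (X w t))%R) L] <= b%:E)%E) ->
  exists U : set (Omega T m), [/\ measurable U, (P U <= b%:E)%E &
    forall w, ~ U w -> forall t, u <= t <= v -> n2 (X w t) <= lam].
Proof.
move=> uv mX cX hb.
pose B n := [set w | has (fun t => lam <= n2 (X w t)) (dyadics u v n)].
have mB n : measurable (B n) by apply: has_measurable => t tL; apply: mX; exact: (dyadics_bnd uv tL).
have mU : measurable (\bigcup_n B n) by exact: bigcupT_measurable.
exists (\bigcup_n B n); split => //.
- have hc : P (B n) @[n --> \oo] --> P (\bigcup_n B n).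
    apply: nondecreasing_cvg_mu => //. apply/nondecreasing_seqP => n; apply/subsetPset => w /hasP[s sD hs].
    by apply/hasP; exists s => //; exact: dyadics_S.
  rewrite -(cvg_lim _ hc)//; apply: lime_le; first by apply/cvg_ex; eexists; exact: hc.
  by apply: nearW => n; apply: hb; exact: dyadics_bnd.
- move=> w hU t ht; rewrite leNgt; apply/negP => h; apply: hU.
  by have [n hn] := dense_exceed uv (cX w) ht h; exists n.
Qed.

End Supremum.

(** * Small sequences and quadratic means *)

Section NullSequences.
Variable R : realType.
Implicit Types u v : nat -> \bar R.
Local Open Scope ereal_scope.

(* Sequences of extended reals whose limit superior is at most 0. *)
Definition null u := forall e : R, (0 < e)%R -> \forall n \near \oo, u n <= e%:E.

Lemma cvg_null u : u @ \oo --> 0 -> null u.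
Proof.
move=> h e e0; apply: (h [set x | x <= e%:E]).
have : nbhs (0 : \bar R) [set x | x < e%:E].
  by apply: open_nbhs_nbhs; split; [exact: open_ereal_lt_ereal|rewrite /= lte_fin].
by apply: filterS => x /= /ltW.
Qed.

Lemma null_cvg u : (forall n, 0 <= u n) -> null u -> u @ \oo --> 0.
Proof.
move=> u0 h; apply/cvg_ballP => e e0 /=.
have e20 : (0 < Num.min (e / 2) (1/2))%R by rewrite lt_min !divr_gt0.
have := h _ e20; apply: filterS => n hn.
have : u n \is a fin_num by rewrite ge0_fin_numE// (le_lt_trans hn)// ltry.
move=> /fineK ue; move: hn (u0 n); rewrite -ue !lee_fin le_min => /andP[h1 h2] h0.
rewrite /ball /= /ereal_ball /contract /= !normr0 addr0 mul0r sub0r normrN.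
rewrite ger0_norm ?divr_ge0// ?addr_ge0//.
apply: (@le_lt_trans _ _ (fine (u n))); last by rewrite (le_lt_trans h1)// ltr_pdivrMr// ltr_pMr// ltr1n.
by rewrite ler_pdivrMr ?ler_peMr// ?ltr_wpDr// ?lerDl.
Qed.

Lemma null_le u v : null v -> (forall n, u n <= v n) -> null u.
Proof. by move=> h uv e /h; apply: filterS => n; apply: le_trans. Qed.

Lemma nullD u v : null u -> null v -> null (fun n => u n + v n).
Proof.
move=> hu hv e e0; have e2 : (0 < e / 2)%R by rewrite divr_gt0.
near=> n; rewrite (splitr e) EFinD; apply: leeD; near: n; [exact: hu|exact: hv].
Unshelve. all: by end_near. Qed.

Lemma nullZ (c : R) u : (0 <= c)%R -> null u -> null (fun n => c%:E * u n).
Proof.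
move=> c0 hu e e0; have c1 : (0 < c + 1)%R by rewrite ltr_wpDl.
have ec : (0 < e / (c + 1))%R by rewrite divr_gt0.
near=> n; apply: (via (c%:E * (e / (c + 1))%:E)).
  by apply: lee_wpmul2l; [rewrite lee_fin|near: n; exact: hu].
rewrite -EFinM lee_fin mulrA ler_pdivrMr// mulrC; apply: ler_wpM2l; first exact: ltW.
by rewrite lerDl.
Unshelve. all: by end_near. Qed.

Lemma le_null (a c : \bar R) u : null u -> (forall n, a <= c + u n) -> a <= c.
Proof.
move=> hu h; apply/lee_addgt0Pr => e e0; have [N _ /(_ N (leqnn N)) hN] := hu e e0.
by apply: le_trans (h N) _; rewrite leeD2l.
Qed.

Lemma null_pick u (e : R) : null u -> (0 < e)%R -> exists n, u n <= e%:E.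
Proof. by move=> hu /hu[N _ /(_ N (leqnn N))]; exists N. Qed.

End NullSequences.

Lemma n2_3 (R : realType) p q (x a b y : 'M[R]_(p, q)) :
  n2 (x - y) <= 3 * n2 (x - a) + (3 * n2 (a - b) + 3 * n2 (b - y)).
Proof.
rewrite /n2 !mulr_sumr -!big_split; apply: ler_sum => i _ /=.
rewrite !mulr_sumr -!big_split; apply: ler_sum => j _ /=; rewrite !mxE.
have := sqr_ge0 (x i j - a i j - (a i j - b i j)).
have := sqr_ge0 (x i j - a i j - (b i j - y i j)).
have := sqr_ge0 (a i j - b i j - (b i j - y i j)); nra.
Qed.

Lemma int_le3 d (X : measurableType d) (R : realType) (mu : {measure set X -> \bar R})
    (a : R) (f g h k : X -> R) : mfun f -> mfun g -> mfun h -> mfun k -> 0 <= a -> (forall x, 0 <= f x) ->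
  (forall x, 0 <= g x) -> (forall x, 0 <= h x) -> (forall x, 0 <= k x) ->
  (forall x, f x <= a * g x + (a * h x + a * k x)) -> (\int[mu]_x (f x)%:E <= a%:E * \int[mu]_x (g x)%:E +
    (a%:E * \int[mu]_x (h x)%:E + a%:E * \int[mu]_x (k x)%:E))%E.
Proof.
move=> mf mg mh mk a0 f0 g0 h0 k0 hle.
have mah (F : X -> R) : mfun F -> mfun (fun x => a * F x) by move=> mF; exact: mfunM.
rewrite -!intZ// -!intD//.
- apply: int_le => //; apply: mfunD; [exact: mah|apply: mfunD; exact: mah].
- exact: mah.
- by apply: mfunD; exact: mah.
- by move=> x; rewrite mulr_ge0.
- by move=> x; rewrite addr_ge0// mulr_ge0.
- exact: mah.
- exact: mah.
- by move=> x; rewrite mulr_ge0.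
- by move=> x; rewrite mulr_ge0.
Qed.

Lemma norm_le_sqr (R : realType) (e x : R) : 0 < e -> `|x| <= e + e^-1 * x ^+ 2.
Proof.
move=> e0; rewrite -[x ^+ 2]real_normK ?num_real//; set y := `|x|.
have h : 0 <= e^-1 * (e - y) ^+ 2 by rewrite mulr_ge0 ?sqr_ge0// invr_ge0 ltW.
have e1 : e^-1 * (e - y) ^+ 2 = e - 2 * y + e^-1 * y ^+ 2 by field; rewrite gt_eqF.
have y0 : 0 <= y by exact: normr_ge0.
by rewrite e1 in h; lra.
Qed.

Section QuadraticMean.
Context d (X : measurableType d) (R : realType) (P : probability X R).

Lemma L2_integrable (f : X -> R) (V : R) : mfun f -> (\int[P]_w (f w ^+ 2)%:E <= V%:E)%E -> Rint P f.
Proof.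
move=> mf h; apply/integrableP; split; first exact/EFinP.
apply: (@le_lt_trans _ _ (\int[P]_w (1 + f w ^+ 2)%:E)%E).
  apply: ge0_le_integral => //.
  - by apply: mcomp => //; exact/EFinP.
  - by apply/EFinP; apply: mfunD => //; exact: mfunX.
  - move=> w _; rewrite /= lee_fin -[f w ^+ 2]real_normK ?num_real//.
    by have := sqr_ge0 (`|f w| - 1); have := normr_ge0 (f w); nra.
rewrite intD//; last by move=> w; rewrite sqr_ge0.
  by rewrite int_prob_cst lte_add_pinfty ?ltry//; apply: le_lt_trans h _; rewrite ltry.
exact: mfunX.
Qed.

(** Comparing the coefficients of [c]: the hypothesis leaves [2 * c * E[f] <= V] for all real [c],
    which forces the mean to vanish. *)
Lemma mean0_of_quadratic (f : X -> R) (V : R) : mfun f ->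
  (forall c, \int[P]_w ((c + f w) ^+ 2)%:E <= (c ^+ 2 + V)%:E)%E -> (\int[P]_w (f w)%:E = 0)%E.
Proof.
move=> mf h.
have h0 : (\int[P]_w (f w ^+ 2)%:E <= V%:E)%E.
  by have := h 0; rewrite expr0n add0r; under eq_integral do rewrite add0r.
have i1 := L2_integrable mf h0.
have hf := integrable_fin_num measurableT i1.
have V0 : 0 <= V by rewrite -lee_fin; apply: le_trans h0; apply: int_ge0 => w; exact: sqr_ge0.
have ic c : P.-integrable setT (fun _ : X => (c%:E : \bar R)) by exact: finite_measure_integrable_cst.
have hc c : c ^+ 2 + 2 * c * fine (\int[P]_w (f w)%:E) <= c ^+ 2 + V.
  rewrite -lee_fin; apply: le_trans (h c); rewrite EFinD (EFinM (2 * c)) fineK//.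
  have i2 := integrableZl measurableT (2 * c) i1. rewrite -(int_prob_cst P) -integralZl// -integralD//.
  apply: (via (\int[P]_w ((c ^+ 2 + 2 * c * f w + f w ^+ 2)%:E))%E); last first.
    rewrite le_eqVlt; apply/orP; left; apply/eqP; apply: eq_integral => w _; congr EFin; ring.
  apply: le_integral => //=.
  - exact: integrableD.
  - have i3 : Rint P (fun w => f w ^+ 2).
      apply/integrableP; split; first by apply/EFinP; exact: mfunX.
      under eq_integral do rewrite /= ger0_norm ?sqr_ge0//. by apply: le_lt_trans h0 _; rewrite ltry.
    have -> : (fun w => (c ^+ 2 + 2 * c * f w + f w ^+ 2)%:E) =
        (((fun=> (c ^+ 2)%:E) \+ (fun w => (2 * c)%:E * (EFin \o f) w)) \+ (EFin \o (fun w => (f w ^+ 2)%R)))%E.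
      by [].
    by apply: (integrableD measurableT _ i3); exact: integrableD.
  - by move=> w _; rewrite -EFinM -EFinD lee_fin lerDl sqr_ge0.
rewrite -(fineK hf); set e := fine _ in hc *; congr EFin.
apply/eqP/negPn/negP => e0.
(* With this [c] the linear term equals [2 * (V + 1)], which exceeds [V]. *)
have := hc ((V + 1) / e); have -> : 2 * ((V + 1) / e) * e = 2 * (V + 1) by field.
by rewrite lerD2l; lra.
Qed.

End QuadraticMean.

Lemma adde_shuffle (R : realType) (a b x y z : \bar R) : (a + ((x + (y + z)) + b) = y + (a + b + (x + z)))%E.
Proof. by rewrite (addeCA x) -!addeA (addeCA a y) (addeC b) -!addeA. Qed.

(** Extended real arithmetic behind the constant 144: a factor 3 from a triangle inequality for the
    integrals, 16 from the simple case, 3 from a triangle inequality for the integrands. *)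
Lemma quadratic_chain (R : realType) (c : R) (a1 a2 a3 b b1 b2 e : \bar R) :
  (0 <= e -> a2 <= (16 * c)%:E * b -> b <= 3%:E * b1 + (3%:E * e + 3%:E * b2) ->
  0 <= b1 -> 0 <= b2 -> 0 <= c%:E -> 3%:E * a1 + (3%:E * a2 + 3%:E * a3) <= (144 * c)%:E * e +
   (3%:E * a1 + 3%:E * a3 + ((144 * c)%:E * b1 + (144 * c)%:E * b2)))%E.
Proof.
move=> e0 h1 h2 b10 b20; rewrite lee_fin => c0.
have c16 : 0 <= 16 * c by rewrite mulr_ge0.
have h5 : (3%:E * a2 <= (144 * c)%:E * b1 + ((144 * c)%:E * e + (144 * c)%:E * b2))%E.
  apply: (via ((48 * c)%:E * (3%:E * b1 + (3%:E * e + 3%:E * b2)))%E).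
    have -> : (48 * c)%:E = (3%:E * (16 * c)%:E)%E :> \bar R by rewrite -EFinM; congr EFin; ring.
    rewrite -muleA; apply: lee_wpmul2l; first by rewrite lee_fin.
    by apply: le_trans h1 _; apply: lee_wpmul2l => //; rewrite lee_fin.
  have -> : (144 * c)%:E = ((48 * c)%:E * 3%:E)%E :> \bar R by rewrite -EFinM; congr EFin; ring.
  have p3 (x : \bar R) : (0 <= x -> 0 <= 3%:E * x)%E by move=> x0; rewrite mule_ge0// lee_fin.
  rewrite -!muleA -!ge0_muleDr//; by do ?[done|exact: adde_ge0|apply: p3].
apply: (via (3%:E * a1 + (((144 * c)%:E * b1 + ((144 * c)%:E * e + (144 * c)%:E * b2)) + 3%:E * a3))%E).
  by apply: leeD => //; exact: leeD.
by rewrite adde_shuffle.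
Qed.

(** * The stochastic integral: second moment, mean and maximal inequality *)

Section ItoBasics.
Variables (R : realType) (T : R) (m : nat) (P : probability (Omega T m) R).
Hypotheses (T0 : 0 < T) (WP : is_wiener P).

(** [sq_step] with a constant [Q] bounds the second moment of every translate, and
    [mean0_of_quadratic] reads the mean off these bounds. *)
Lemma mean_mul_incr (s t : R) (h : OmF T m s -> R) (C : R) (a : 'I_m) :
  0 <= s -> s < t -> t <= T -> mfun h -> (forall w, `|h w| <= C) ->
  P.-integrable setT (fun w : Omega T m => (h w * (w t a 0 - w s a 0))%:E) /\
  (\int[P]_w (h w * (w t a 0 - w s a 0))%:E = 0)%E.
Proof.
move=> s0 st tT mh hC.
have sT : s <= T by apply: le_trans tT; exact: ltW.
have C0 : 0 <= C by apply: le_trans (hC point).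
have mi : mfunO T m (incr s t) := measurable_incr s0 st tT.
have mic : mfunO T m (fun w => (incr s t w : 'cV[R]_m) a 0) by exact: (mcomp (measurable_Vcoord a) mi).
have mhT : mfunO T m h by exact: (mcomp mh (measurable_OmF_Omega sT)).
have eI (w : Omega T m) : (incr s t w : 'cV[R]_m) a 0 = w t a 0 - w s a 0 by rewrite !mxE.
have mf : mfunO T m (fun w => h w * (w t a 0 - w s a 0)).
  apply: mfunM; first exact: mhT. by under eq_fun do rewrite -eI.
pose V := C ^+ 2 * (16 * m%:R * (t - s)).
have key c : (\int[P]_w ((c + h w * (w t a 0 - w s a 0)) ^+ 2)%:E <= (c ^+ 2 + V)%:E)%E.
  have V0 : 0 <= V by rewrite /V !mulr_ge0 ?sqr_ge0// subr_ge0 ltW.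
  have := sq_step WP s0 st tT (p := 1) (Q := fun=> c%:M)
    (r := fun w y => (h w * (y : 'cV[R]_m) a 0)%:M) (V := fun=> V).
  have n21 (x : R)  : n2 (x%:M : 'M[R]_1) = x ^+ 2 by rewrite /n2 !big_ord1 !mxE eqxx mulr1n.
  under eq_integral do rewrite -raddfD n21 eI. rewrite !int_prob_cst n21 -EFinD; apply => //.
  - move=> i j; rewrite !ord1; under eq_fun do rewrite mxE eqxx mulr1n.
    apply: mfunM; first exact: (mcomp mh measurable_fst). exact: (mcomp (measurable_Vcoord a) measurable_snd).
  - move=> w i; rewrite ord1; under [X in integrable _ _ X]eq_fun do rewrite mxE eqxx mulr1n EFinM.
    exact: integrableZl (incr_integrable WP s0 st tT a).
  - move=> w i; rewrite ord1; under eq_integral do rewrite mxE eqxx mulr1n EFinM.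
    by rewrite integralZl// ?(incr_mean WP s0 st tT) ?mule0//; exact: incr_integrable.
  - move=> w; under eq_integral do rewrite n21 exprMn.
    rewrite intZ//; [|exact: mfunX|exact: sqr_ge0|by move=> w'; exact: sqr_ge0].
    rewrite /V [leRHS]EFinM; apply: lee_pmul; rewrite ?lee_fin ?sqr_ge0//.
    + by apply: int_ge0 => w'; exact: sqr_ge0.
    + by rewrite -real_normK ?num_real// lerXn2r ?nnegrE.
    + apply: le_trans (incr_n2 WP s0 st tT); apply: int_le.
      * exact: mfunX.
      * by apply: measurable_n2 => i j; rewrite ord1; exact: (mcomp (measurable_Vcoord i) mi).
      * by move=> w'; exact: sqr_ge0.
      * by move=> w'; exact: n2_entry.
split; last exact: mean0_of_quadratic mf key.
have := key 0; under eq_integral do rewrite add0r; rewrite expr0n add0r.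
exact: L2_integrable.
Qed.

Lemma bounded_entry d (h : 'M[R]_(d, m)) C i j : n2 h <= C -> `|h i j| <= C + 1.
Proof.
move=> hC; have := n2_entry h i j; rewrite -real_normK ?num_real//.
by have := normr_ge0 (h i j); have := sqr_ge0 (`|h i j| - 1); nra.
Qed.

Lemma sp_integral_mean d (S : simple_process T m d) t a : 0 <= t <= T ->
  P.-integrable setT (fun w => (sp_integral S t w a 0)%:E) /\ (\int[P]_w (sp_integral S t w a ord0)%:E = 0)%E.
Proof.
move=> ht; have [|g [N [gr rf _ hk]]] := common_grid T0 S S (L := [:: t]).
  by move=> x; rewrite inE => /eqP ->.
have [|k kN <-] := hk t; first by rewrite inE.
have [_ _ gS] := gr; have ga := grid_val_adapted gr rf.
have [C hC] : exists C, forall i w, `|sp_val (s := S) i w| <= C.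
  have [C hC] := sp_bounded S; exists C => i w; apply: le_trans (hC i w); exact: mxnorm_enorm.
have hv i w c : `|grid_val g S i w a c| <= \sum_(l < sp_size S) C.
  rewrite /grid_val /sp_eval summxE; apply: le_trans (ler_norm_sum _ _ _) _.
  apply: ler_sum => l _; have := le_trans (normr_ge0 _) (hC l w).
  by case: ifP => _; rewrite ?mxE ?normr0// => _; apply: le_trans (hC l w); exact: entry_mxnorm.
have e w : sp_integral S (g k) w a 0 = \sum_(i < k) \sum_(c < m) grid_val g S i w a c * (w (g i.+1) c 0 - w (g i) c 0).
  rewrite (sp_integral_gsum gr _ rf kN) /gsum summxE; apply: eq_bigr => i _.
  by rewrite mxE; apply: eq_bigr => c _; rewrite !mxE.
have H (i : 'I_k) c := @mean_mul_incr (g i) (g i.+1) (fun w => grid_val g S i w a c) _ c.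
have iN (i : 'I_k) : (i < N)%N by exact: leq_trans kN.
have {}H (i : 'I_k) c : P.-integrable setT (fun w : Omega T m => (grid_val g S i w a c * (w (g i.+1) c 0 - w (g i) c 0))%:E) /\
  (\int[P]_w (grid_val g S i w a c * (w (g i.+1) c ord0 - w (g i) c ord0))%:E = 0)%E.
  apply: (H _ i c _ _ _ _ (fun w => hv i w c)).
  - by have /andP[] := is_grid_bnd gr (ltnW (iN i)).
  - exact: gS.
  - by have /andP[] := is_grid_bnd gr (iN i).
  - by apply/F_measurableP; exact: ga.
under eq_fun do rewrite e -sumEFin.
have HI (i : 'I_k) : P.-integrable setT (fun w : Omega T m => (\sum_(c < m) grid_val g S i w a c * (w (g i.+1) c 0 - w (g i) c 0))%:E).
  under eq_fun do rewrite -sumEFin. by apply: integrable_sum => // c _; have [] := H i c.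
split; first by apply: integrable_sum => // i _; exact: HI.
rewrite integral_sum// big1// => i _.
under eq_integral do rewrite -sumEFin.
by rewrite integral_sum//; [rewrite big1// => c _; have [] := H i c|move=> c; have [] := H i c].
Qed.

Lemma is_ito_meas d (H : R -> Omega T m -> 'M[R]_(d, m)) (Y : Omega T m -> Omega T d) : is_ito P H Y -> forall t, 0 <= t <= T ->
  forall a b, mfunO T m (fun w => Y w t a b).
Proof.
case=> _ mY _ t ht a b; rewrite ord1.
exact: (mcomp (measurable_coord a ht) mY).
Qed.

Lemma is_ito_null d (H : R -> Omega T m -> 'M[R]_(d, m)) (Y : Omega T m -> Omega T d) : is_ito P H Y -> exists S : nat -> simple_process T m d,
  null (fun n => D2 P (fun t w => n2 (sp_eval (S n) t w - H t w))) /\ forall t, 0 <= t <= T ->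
    null (fun n => \int[P]_w (n2 (Y w t - sp_integral (S n) t w))%:E)%E.
Proof.
case=> _ _ [S [h1 h2]]; exists S; split.
  apply: cvg_null; rewrite /D2. under eq_fun do under eq_integral do under eq_integral do rewrite -enorm_sqr.
  exact: h1.
move=> t ht; apply: cvg_null.
under eq_fun do under eq_integral do rewrite n2BC -enorm_sqr.
exact: h2.
Qed.

Lemma D2_3 d (K1 K2 K3 K4 : R -> Omega T m -> 'M[R]_(d, m)) :
  jointly_measurable K1 -> jointly_measurable K2 -> jointly_measurable K3 -> jointly_measurable K4 ->
  (D2 P (fun t w => n2 (K1 t w - K4 t w)) <= 3%:E * D2 P (fun t w => n2 (K1 t w - K2 t w)) +
   (3%:E * D2 P (fun t w => n2 (K2 t w - K3 t w)) + 3%:E * D2 P (fun t w => n2 (K3 t w - K4 t w))))%E.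
Proof.
move=> m1 m2 m3 m4; rewrite !D2E; last 8 first.
all: try by move=> t w _; exact: n2_ge0.
all: try by apply: jm_n2; exact: jointly_measurableB.
have mo K K' : jointly_measurable K -> jointly_measurable K' ->
   mfun (onT (fun t (w : Omega T m) => n2 (K t w - K' t w : 'M[R]_(d, m)))).
  by move=> mK mK'; apply: onT_measurable; apply: jm_n2; exact: jointly_measurableB.
apply: int_le3 => //; try exact: mo; try by apply: onT_ge0 => *; exact: n2_ge0.
by move=> x; rewrite /onT; case: ifP => _; [exact: n2_3|rewrite !mulr0 !addr0].
Qed.

Lemma measurable_n2B dX (Z : measurableType dX) p q (F G : Z -> 'M[R]_(p, q)) :
  (forall a b, mfun (fun w => F w a b)) -> (forall a b, mfun (fun w => G w a b)) ->
  mfun (fun w => n2 (F w - G w)).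
Proof.
move=> mF mG; apply: measurable_n2 => a b; exact: measurable_mxB.
Qed.

Lemma int_n2_3 dX (Z : measurableType dX) (mu : {measure set Z -> \bar R}) p q (F A B G : Z -> 'M[R]_(p, q)) :
  (forall a b, mfun (fun w => F w a b)) -> (forall a b, mfun (fun w => A w a b)) ->
  (forall a b, mfun (fun w => B w a b)) -> (forall a b, mfun (fun w => G w a b)) ->
  (\int[mu]_w (n2 (F w - G w))%:E <= 3%:E * \int[mu]_w (n2 (F w - A w))%:E +
    (3%:E * \int[mu]_w (n2 (A w - B w))%:E + 3%:E * \int[mu]_w (n2 (B w - G w))%:E))%E.
Proof.
move=> mF mA mB mG; apply: int_le3 => //; try exact: measurable_n2B; try by move=> w; exact: n2_ge0.
by move=> w; exact: n2_3.
Qed.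

Lemma D2_n2BC p q (K K' : R -> Omega T m -> 'M[R]_(p, q)) :
  D2 P (fun t w => n2 (K t w - K' t w)) = D2 P (fun t w => n2 (K' t w - K t w)).
Proof. by congr (D2 P _); apply/funext => u; apply/funext => w; rewrite n2BC. Qed.

Lemma D2_n2_ge0 p q (K K' : R -> Omega T m -> 'M[R]_(p, q)) : (0 <= D2 P (fun t w => n2 (K t w - K' t w)))%E.
Proof. by apply: D2_ge0 => *; exact: n2_ge0. Qed.

(** Both integrals are approximated by simple ones with vanishing error. The comparison is between
    arbitrary versions, so the case of equal integrands also gives uniqueness at each time. *)
Lemma ito_L2 d (H H' : R -> Omega T m -> 'M[R]_(d, m)) (Y Y' : Omega T m -> Omega T d) t :
  is_ito P H Y -> is_ito P H' Y' -> 0 <= t <= T -> (\int[P]_w (n2 (Y w t - Y' w t))%:E <=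
   (144 * m%:R)%:E * D2 P (fun t w => n2 (H t w - H' t w)))%E.
Proof.
move=> hY hY' ht; have [S [hS hI]] := is_ito_null hY; have [S' [hS' hI']] := is_ito_null hY'.
have mY := is_ito_meas hY ht; have mY' := is_ito_meas hY' ht.
have [mH _ _] := hY; have [mH' _ _] := hY'.
have hI2 := hI t ht; have hI2' := hI' t ht.
have D0 := D2_n2_ge0 H H'; set D := D2 P _ in D0 *.
have c144 : 0 <= 144 * m%:R :> R := mulr_ge0 (ler0n R 144) (ler0n R m).
have hB := nullD (nullZ c144 hS) (nullZ c144 hS').
have hA := nullD (nullZ (ler0n R 3) hI2) (nullZ (ler0n R 3) hI2').
apply: (le_null (nullD hA hB)) => n.
have mI := measurable_sp_integral T0 (S n) ht; have mI' := measurable_sp_integral T0 (S' n) ht.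
have := int_n2_3 P mY mI mI' mY'.
under [X in (_ <= _ + (_ + _ * X))%E -> _]eq_integral do rewrite n2BC.
move=> h0; apply: le_trans h0 _.
have h1 := simple_L2 T0 WP (S n) (S' n) ht.
have h2 := D2_3 (jointly_measurable_sp_eval (S n)) mH mH' (jointly_measurable_sp_eval (S' n)).
rewrite (D2_n2BC H') -/D in h2.
have h3 := D2_n2_ge0 (sp_eval (S n)) H; have h4 := D2_n2_ge0 (sp_eval (S' n)) H'.
apply: (quadratic_chain _ _ D0 h1 h2 h3 h4); rewrite lee_fin.
exact: ler0n.
Qed.

Lemma int_n2_fin dX (Z : measurableType dX) (mu : {measure set Z -> \bar R}) p q (F : Z -> 'M[R]_(p, q)) a b :
  (forall a b, mfun (fun w => F w a b)) -> (\int[mu]_w (F w a b ^+ 2)%:E <= \int[mu]_w (n2 (F w))%:E)%E.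
Proof.
move=> mF; apply: int_le; first by apply: mfunX; exact: mF.
- exact: measurable_n2.
- by move=> w; exact: sqr_ge0.
- by move=> w; exact: n2_entry.
Qed.

(** Simple integrals have mean zero, and the mean of the error is small because its second moment
    is. *)
Lemma ito_mean d (H : R -> Omega T m -> 'M[R]_(d, m)) (Y : Omega T m -> Omega T d) t a :
  is_ito P H Y -> 0 <= t <= T ->
  P.-integrable setT (fun w => (Y w t a 0)%:E) /\ (\int[P]_w (Y w t a ord0)%:E = 0)%E.
Proof.
move=> hY ht; have [S [_ /(_ t ht) hI]] := is_ito_null hY.
have mY := is_ito_meas hY ht.
have mI n := measurable_sp_integral T0 (S n) ht.
have mD n a' b' : mfunO T m (fun w => (Y w t - sp_integral (S n) t w) a' b').
  by under eq_fun do rewrite !mxE; exact: mfunB.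
have iD n (V : R) : (\int[P]_w (n2 (Y w t - sp_integral (S n) t w))%:E <= V%:E)%E ->
    P.-integrable setT (fun w => (Y w t a 0 - sp_integral (S n) t w a 0)%:E) /\
    (\int[P]_w ((Y w t a 0 - sp_integral (S n) t w a ord0) ^+ 2)%:E <= V%:E)%E.
  move=> h; have h' := le_trans (int_n2_fin P a 0 (mD n)) h.
  have e : (fun w => (Y w t - sp_integral (S n) t w) a 0) = (fun w => Y w t a 0 - sp_integral (S n) t w a 0).
    by apply/funext => w; rewrite !mxE.
  have h2 := L2_integrable (mD n a 0) h'; rewrite e in h2; split => //.
  by apply: le_trans h'; under [leRHS]eq_integral do rewrite !mxE.
have iY : P.-integrable setT (fun w => (Y w t a 0)%:E).
  have [n hn] := null_pick hI ltr01; have [i1 _] := iD n _ hn. have [i2 _] := sp_integral_mean (S n) a ht.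
  have -> : (fun w => (Y w t a 0)%:E) = ((fun w => (Y w t a 0 - sp_integral (S n) t w a 0)%:E) \+
      (fun w => (sp_integral (S n) t w a 0)%:E))%E.
    by apply/funext => w; rewrite /= -EFinD subrK.
  exact: integrableD.
split=> //; apply/eqP; rewrite -abse_eq0 eq_le abse_ge0 andbT.
apply/lee_addgt0Pr => e e0; rewrite add0e.
have e2 : 0 < e / 2 by rewrite divr_gt0.
have [n hn] := null_pick hI (exprn_gt0 2 e2).
have [i1 h1] := iD n _ hn; have [i2 h2] := sp_integral_mean (S n) a ht.
have -> : (\int[P]_w (Y w t a 0)%:E = \int[P]_w (Y w t a 0 - sp_integral (S n) t w a 0)%:E)%E.
  rewrite -[RHS]adde0 -h2 -integralD//; apply: eq_integral => w _. by rewrite -EFinD subrK.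
apply: le_trans (le_abse_integral _ measurableT _) _; first exact: measurable_int i1.
have md : mfunO T m (fun w => Y w t a 0 - sp_integral (S n) t w a 0) by exact: mfunB.
(* The inequality [norm_le_sqr] passes from a first to a second moment; with a second moment at most
   [(e / 2) ^+ 2] the two terms are [e / 2] each. *)
apply: (via (\int[P]_w (e / 2 + (e / 2)^-1 * (Y w t a 0 - sp_integral (S n) t w a ord0) ^+ 2)%:E)%E).
  apply: ge0_le_integral => //.
  - by apply: mcomp => //; exact/EFinP.
  - apply/EFinP; apply: mfunD => //; apply: mfunM => //.
    exact: mfunX.
  - move=> w _; rewrite /= lee_fin; set x := _ - _.
    exact: norm_le_sqr.
have mq : mfunO T m (fun w => (Y w t a 0 - sp_integral (S n) t w a 0) ^+ 2) by exact: mfunX.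
have ei0 : 0 <= (e / 2)^-1 by rewrite invr_ge0 ltW.
rewrite intD//; last 3 first.
- exact: mfunM.
- by move=> w; exact: ltW.
- by move=> w; rewrite mulr_ge0// sqr_ge0.
rewrite int_prob_cst intZ//; last by move=> w; exact: sqr_ge0.
apply: (via ((e / 2)%:E + (e / 2)^-1%:E * ((e / 2) ^+ 2)%:E)%E).
  by rewrite leeD2l// lee_wpmul2l.
by rewrite -EFinM -EFinD lee_fin expr2 mulKf ?gt_eqF// -splitr.
Qed.

Lemma has_sum_bound d (X : Omega T m -> R -> 'cV[R]_d) (L : seq R) (lam : R) : 0 < lam ->
  (forall t, t \in L -> forall a b, mfun (fun w => X w t a b)) ->
  (P [set w | has (fun t => (lam <= n2 (X w t))%R) L] <=
   \sum_(t <- L) (lam^-1%:E * \int[P]_w (n2 (X w t))%:E))%E.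
Proof.
move=> lam0; elim: L => [|x L IH] hX.
  rewrite big_nil (_ : [set w | _] = set0) ?measure0//; by apply/seteqP; split.
have mn : mfun (fun w => n2 (X w x)) by apply: measurable_n2 => a b; apply: hX; rewrite inE eqxx.
have ml : measurable [set w | lam <= n2 (X w x)].
  have := @measurable_fun_ler _ _ _ setT _ _ (mcst lam) mn measurableT [set true]. by rewrite setTI; apply.
have hX' t : t \in L -> forall a b, mfun (fun w => X w t a b) by move=> tL; apply: hX; rewrite inE tL orbT.
have -> : [set w | has (fun t => lam <= n2 (X w t)) (x :: L)] =
    [set w | lam <= n2 (X w x)] `|` [set w | has (fun t => lam <= n2 (X w t)) L].
  by apply/seteqP; split => w /= => [/orP|[->//|->]]; rewrite ?orbT.
rewrite big_cons; apply: le_trans (measureU2 P ml (has_measurable lam hX')) _.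
apply: leeD; last exact: IH.
by apply: markov_int => // w; exact: n2_ge0.
Qed.

Lemma null_sum (I : eqType) (s : seq I) (u : I -> nat -> \bar R) :
  {in s, forall i, null (u i)} -> null (fun n => \sum_(i <- s) u i n)%E.
Proof.
elim: s => [_|i s IH h]; first by move=> e e0; apply: nearW => n; rewrite big_nil lee_fin ltW.
under eq_fun do rewrite big_cons; apply: nullD; first exact/h/mem_head.
by apply: IH => j js; apply: h; rewrite inE js orbT.
Qed.

(** The finite-list bound holds for simple processes. The two approximation errors are handled by a
    union bound over the list: they vanish in the limit for each fixed list, although not uniformly
    in it. *)
Lemma ito_max d (H H' : R -> Omega T m -> 'M[R]_(d, m)) (Y Y' : Omega T m -> Omega T d) (lam b : R) :
  is_ito P H Y -> is_ito P H' Y' -> 0 < lam ->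
  ((432 * m%:R / lam)%:E * D2 P (fun t w => n2 (H t w - H' t w)) <= b%:E)%E ->
  exists U, [/\ measurable U, (P U <= b%:E)%E &
    forall w, ~ U w -> forall t, 0 <= t <= T -> n2 (Y w t - Y' w t) <= lam].
Proof.
move=> hY hY' lam0 hb; apply: (sup_bound T0).
- move=> t ht i j. by apply: measurable_mxB; [exact: (is_ito_meas hY)|exact: (is_ito_meas hY')].
- move=> w; exact: path_sub_cont.
move=> L hL; apply: le_trans hb.
have [S [hS hI]] := is_ito_null hY; have [S' [hS' hI']] := is_ito_null hY'.
have [mH _ _] := hY; have [mH' _ _] := hY'.
have D0 := D2_n2_ge0 H H'; set D := D2 P _ in D0 *.
pose c := m%:R / lam.
have c0 : 0 <= c by rewrite divr_ge0// ltW.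
(* The triangle inequality for three squares costs a factor 3, and each of the three squares gets a
   third: hence [lam / 9], and [432 = 9 * 16 * 3]. *)
have l9 : 0 < lam / 9 by rewrite divr_gt0.
have l90 : 0 <= (lam / 9)^-1 by rewrite invr_ge0 ltW.
pose F1 n w t := Y w t - sp_integral (S n) t w.
pose F2 n w t := sp_integral (S n) t w - sp_integral (S' n) t w.
pose F3 n w t := sp_integral (S' n) t w - Y' w t.
have hA : null (fun n => (\sum_(t <- L) ((lam / 9)^-1%:E * \int[P]_w (n2 (F1 n w t))%:E)))%E.
  by apply: null_sum => t /hL tT; apply: nullZ => //; exact: hI.
have hA' : null (fun n => (\sum_(t <- L) ((lam / 9)^-1%:E * \int[P]_w (n2 (F3 n w t))%:E)))%E.
  apply: null_sum => t /hL tT; apply: nullZ => //; under eq_fun do under eq_integral do rewrite n2BC; exact: hI'.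
have c432 : 0 <= 432 * c := mulr_ge0 (ler0n R 432) c0.
have hB := nullD (nullZ c432 hS) (nullZ c432 hS').
have hAA := nullD hA hA'.
have -> : (432 * m%:R / lam)%:E = (432 * c)%:E by rewrite mulrA.
apply: (le_null (nullD hAA hB)) => n.
have hL' x : x \in L -> 0 <= x <= T by move=> /hL.
have mI x := @measurable_sp_integral _ _ _ _ T0 (S n) x.
have mI' x := @measurable_sp_integral _ _ _ _ T0 (S' n) x.
have m1 t : t \in L -> forall a b, mfun (fun w => F1 n w t a b).
  move=> /hL' ht a' b'. by apply: measurable_mxB; [exact: (is_ito_meas hY)|exact: mI].
have m2 t : t \in L -> forall a b, mfun (fun w => F2 n w t a b).
  move=> /hL' ht a' b'. by apply: measurable_mxB; [exact: mI|exact: mI'].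
have m3 t : t \in L -> forall a b, mfun (fun w => F3 n w t a b).
  move=> /hL' ht a' b'. by apply: measurable_mxB; [exact: mI'|exact: (is_ito_meas hY')].
pose A (F : Omega T m -> R -> 'cV[R]_d) := [set w | has (fun t => lam / 9 <= n2 (F w t)) L].
apply: (via (P (A (F1 n) `|` (A (F2 n) `|` A (F3 n))))).
  apply: le_measure; rewrite ?inE.
  - apply: has_measurable => t tL i j. by apply: measurable_mxB; [exact: (is_ito_meas hY (hL' _ tL))|exact: (is_ito_meas hY' (hL' _ tL))].
  - by apply: measurableU; [|apply: measurableU]; exact: has_measurable.
  - move=> w /hasP[t tL ht]; have := n2_3 (Y w t) (sp_integral (S n) t w) (sp_integral (S' n) t w) (Y' w t).
    rewrite -/(F1 n w t) -/(F2 n w t) -/(F3 n w t) => h.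
    case: (leP (lam / 9) (n2 (F1 n w t))) => [h1|h1]; first by left; apply/hasP; exists t.
    case: (leP (lam / 9) (n2 (F2 n w t))) => [h2|h2]; first by right; left; apply/hasP; exists t.
    case: (leP (lam / 9) (n2 (F3 n w t))) => [h3|h3]; first by right; right; apply/hasP; exists t. exfalso; lra.
have mA1 := has_measurable (lam / 9) m1; have mA2 := has_measurable (lam / 9) m2; have mA3 := has_measurable (lam / 9) m3.
apply: le_trans (measureU2 P mA1 (measurableU _ _ mA2 mA3)) _.
apply: le_trans (leeD (lexx _) (measureU2 P mA2 mA3)) _.
have hP1 := has_sum_bound l9 m1; have hP3 := has_sum_bound l9 m3.
have hP2 := simple_max T0 WP (S n) (S' n) l9 hL'.
have h2 := D2_3 (jointly_measurable_sp_eval (S n)) mH mH' (jointly_measurable_sp_eval (S' n)).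
rewrite (D2_n2BC H') -/D in h2.
have h3 := D2_n2_ge0 (sp_eval (S n)) H; have h4 := D2_n2_ge0 (sp_eval (S' n)) H'.
apply: le_trans (leeD hP1 (leeD hP2 hP3)) _.
move: h2 h3 h4 D0.
set s1 := (\sum_(t <- L) _)%E; set s3 := (\sum_(t <- L) _)%E.
set b1 := D2 P (fun t w => n2 (sp_eval (S n) t w - H t w)).
set b2 := D2 P (fun t w => n2 (sp_eval (S' n) t w - H' t w)).
set bb := D2 P _.
move: s1 s3 b1 b2 bb D => s1 s3 b1 b2 bb D h2 h3 h4 D0.
have hp2 : ((lam / 9)^-1%:E * ((16 * m%:R)%:E * bb) <= (432 * c)%:E * b1 + ((432 * c)%:E * D + (432 * c)%:E * b2))%E.
  apply: (via ((144 * c)%:E * (3%:E * b1 + (3%:E * D + 3%:E * b2)))%E).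
    have -> : (144 * c)%:E = ((lam / 9)^-1%:E * (16 * m%:R)%:E)%E.
      by rewrite -EFinM; congr EFin; rewrite /c; field; rewrite gt_eqF.
    by rewrite -muleA; do 2 (apply: lee_wpmul2l; first by rewrite lee_fin ?mulr_ge0).
  have -> : (432 * c)%:E = ((144 * c)%:E * 3%:E)%E :> \bar R by rewrite -EFinM; congr EFin; ring.
  have p3' (x : \bar R) : (0 <= x -> 0 <= 3%:E * x)%E by move=> x0; rewrite mule_ge0// lee_fin.
  rewrite -!muleA -!ge0_muleDr//; by do ?[done|exact: adde_ge0|apply: p3'].
apply: (via (s1 + (((432 * c)%:E * b1 + ((432 * c)%:E * D + (432 * c)%:E * b2)) + s3))%E).
  by apply: leeD => //; exact: leeD.
by rewrite adde_shuffle.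
Qed.

End ItoBasics.

(** * Existence of a continuous version *)

Section GeometricLimits.
Variable R : realType.

Lemma geo_dist (u : nat -> R) N : (forall n, (N <= n)%N -> `|u n - u n.+1| <= 2^-1 ^+ n) ->
  forall n k, (N <= n)%N -> `|u n - u (n + k)%N| <= 2 * 2^-1 ^+ n - 2 * 2^-1 ^+ (n + k).
Proof.
move=> h n k Nn; elim: k => [|k IH]; first by rewrite addn0 !subrr normr0.
rewrite addnS; apply: le_trans (ler_distD (u (n + k)%N) _ _) _.
have h2 := h (n + k)%N (leq_trans Nn (leq_addr _ _)).
apply: le_trans (lerD IH h2) _; rewrite exprS; lra.
Qed.

Lemma expr_half_cvg0 : (2 * 2^-1 ^+ n : R) @[n --> \oo] --> 0.
Proof.
rewrite -(mulr0 (2 : R)); apply: cvgMr; apply: cvg_expr.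
by rewrite ger0_norm ?invr_ge0// invf_lt1// ltr1n.
Qed.

Lemma geo_lim (u : nat -> R) N : (forall n, (N <= n)%N -> `|u n - u n.+1| <= 2^-1 ^+ n) ->
  cvgn u /\ forall n, (N <= n)%N -> `|u n - limn u| <= 2 * 2^-1 ^+ n.
Proof.
move=> h; have hd := geo_dist h.
have hb n k : (N <= n)%N -> `|u n - u (n + k)%N| <= 2 * 2^-1 ^+ n.
  by move=> Nn; apply: le_trans (hd n k Nn) _; rewrite lerBlDr lerDl mulr_ge0// exprn_ge0// invr_ge0.
have cu : cvgn u.
  apply/cauchy_cvgP; apply: cauchy_exP => e e0. have /cvgrPdist_lt/(_ e e0)[M _ hM] := expr_half_cvg0.
  pose n := maxn N M; exists (u n); exists n => // k /= nk. rewrite -ball_normE /ball_ /= -(subnKC nk).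
  apply: le_lt_trans (hb _ _ (leq_maxl _ _)) _.
  have := hM n (leq_maxr _ _); rewrite /= sub0r normrN ger0_norm//.
split=> // n Nn.
have hc : `|u n - u k| @[k --> \oo] --> `|u n - limn u| by apply: cvg_norm; apply: cvgB => //; exact: cvg_cst.
have := @cvgr_to_le _ _ _ _ _ _ _ hc; apply.
by exists n => // k /= nk; rewrite -(subnKC nk); exact: hb.
Qed.

End GeometricLimits.

Section PathLimit.
Variables (R : realType) (T : R) (d : nat).

Lemma n2_entry_le (x : 'cV[R]_d) (e : R) i : 0 <= e -> n2 x <= e ^+ 2 -> `|x i 0| <= e.
Proof.
move=> e0 h; rewrite -(ler_pXn2r (n := 2))// ?nnegrE// real_normK ?num_real//.
exact: le_trans (n2_entry x i 0) h.
Qed.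

(** Distances that decrease geometrically from index [N] on make the sequence uniformly Cauchy, so
    its coordinatewise limit is continuous and [mkpath] returns it unchanged. *)
Lemma path_limit (F : nat -> R -> 'cV[R]_d) N : 0 <= T ->
  (forall n, {within `[0, T], continuous (F n)}) -> (forall n, F n 0 = 0) ->
  (forall n (t : R), (N <= n)%N -> 0 <= t <= T -> n2 (F n t - F n.+1 t) <= (2^-1 ^+ n) ^+ 2) ->
  forall t : R, 0 <= t <= T -> forall i,
  F n t i 0 @[n --> \oo] --> mkpath T (fun t => \col_i limn (fun n => F n t i 0)) t i 0.
Proof.
move=> T0 cF F0 hF.
have hi (t : R) i : 0 <= t <= T -> forall n, (N <= n)%N -> `|F n t i 0 - F n.+1 t i 0| <= 2^-1 ^+ n.
  move=> ht n Nn; have := n2_entry_le i _ (hF n t Nn ht); rewrite !mxE; apply. by [].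
have hl (t : R) i (ht : 0 <= t <= T) := geo_lim (hi t i ht).
pose l (t : R) : 'cV[R]_d := \col_i limn (fun n => F n t i 0).
have hd (t : R) n : (N <= n)%N -> 0 <= t <= T -> `|F n t - l t| <= 2 * 2^-1 ^+ n.
  move=> Nn ht; apply: mxnorm_le; first by rewrite mulr_ge0// exprn_ge0// invr_ge0.
  by move=> i j; rewrite ord1 !mxE; have [_ h] := hl t i ht; exact: h.
have cl : {within `[0, T], continuous l}.
  apply/subspace_continuousP => x hx; apply/cvgrPdist_lt => e e0. have e3 : 0 < e / 3 by rewrite divr_gt0.
  have /cvgrPdist_lt/(_ _ e3)[M _ hM] := @expr_half_cvg0 R. pose n := maxn N M.
  have hn : 2 * 2^-1 ^+ n < e / 3.
    have := hM n (leq_maxr _ _); rewrite /= sub0r normrN ger0_norm//.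
  have /subspace_continuousP/(_ x hx)/cvgrPdist_lt/(_ _ e3) := cF n.
  have hT : \forall y \near within `[0, T] (nbhs x), 0 <= y <= T by apply: withinT => y /=; rewrite in_itv.
  apply: filterS2 hT => y hy hyx.
  have -> : l x - l y = (l x - F n x) + (F n x - F n y) + (F n y - l y) by rewrite !addrA !subrK.
  rewrite (splitr e) [X in _ < X](_ : _ = e / 3 + e / 3 + e / 3); last by field.
  apply: le_lt_trans (ler_normD _ _) _; apply: ltrD; last first.
    exact: le_lt_trans (hd y n (leq_maxl _ _) hy) hn.
  apply: le_lt_trans (ler_normD _ _) _; apply: ltrD => //.
  rewrite distrC; apply: le_lt_trans (hd x n (leq_maxl _ _) _) hn. by [].
move=> t ht i; rewrite mkpathE//; first by rewrite !mxE; have [c _] := hl t i ht.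
by apply/matrixP => a b; rewrite !mxE; under eq_fun do rewrite F0 mxE; rewrite lim_cst.
Qed.

End PathLimit.

Lemma cvg_bigsum (R : realType) (V : normedModType R) (U I : Type) (r : seq I) (F : set_system U)
    {FF : Filter F} (f : I -> U -> V) (l : I -> V) : (forall i, f i x @[x --> F] --> l i) ->
  \sum_(i <- r) f i x @[x --> F] --> \sum_(i <- r) l i.
Proof.
move=> h; elim: r => [|i r IH]; first by rewrite big_nil; under eq_fun do rewrite big_nil; exact: cvg_cst.
by rewrite big_cons; under eq_fun do rewrite big_cons; exact: cvgD.
Qed.

Section IntegralPaths.
Variables (R : realType) (T : R) (m d : nat).
Hypothesis T0 : 0 < T.

Lemma mulmx_continuous (A : 'M[R]_(d, m)) : continuous (fun v : 'cV[R]_m => A *m v).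
Proof.
move=> v; have -> : (fun v : 'cV[R]_m => A *m v) = \sum_j (fun v => v j 0 *: col j A).
  apply/funext => y; rewrite fct_sumE; apply/matrixP => i j; rewrite ord1 mxE summxE.
  by apply: eq_bigr => l _; rewrite !mxE mulrC.
elim/big_ind: _ => [|f g hf hg|j _]; [exact: cst_continuous|exact: continuousD|].
apply: (@cvgZ _ _ _ (nbhs v) _ (fun x : 'cV[R]_m => x j 0) (fun=> col j A)); last exact: cvg_cst.
exact: (@coord_continuous R m 1 j 0 v).
Qed.

Lemma min_path_continuous (w : Omega T m) (c : R) : 0 <= c <= T ->
  {within `[0, T], continuous (fun t => w (Num.min c t))}.
Proof.
move=> /andP[c0 cT]; apply/subspace_continuousP => x hx.
have hm (t : R) : 0 <= t <= T -> `[0, T]%classic (Num.min c t).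
  by move=> /andP[t0 tT]; rewrite /= in_itv/= le_min c0 t0/= ge_min cT.
have /subspace_continuousP/(_ _ (hm x _)) := @path_cont _ _ _ w.
rewrite /= in_itv/= in hx; move=> /(_ hx) h.
have hc : Num.min c t @[t --> x] --> Num.min c x.
  by apply: (@continuous_min R R (cst c) id); [exact: cvg_cst|exact: cvg_id].
move=> Q hQ; change (nbhs x (fun t => `[0, T]%classic t -> Q (w (Num.min c t)))).
have h3 : nbhs x (fun t => `[0, T]%classic (Num.min c t) -> Q (w (Num.min c t))) := hc _ (h Q hQ).
apply: filterS h3 => t ht; rewrite /= in_itv/= => h0T.
exact/ht/hm.
Qed.

Lemma sp_integral_continuous (S : simple_process T m d) (w : Omega T m) :
  {within `[0, T], continuous (fun t => sp_integral S t w)}.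
Proof.
apply/subspace_continuousP => x hx; rewrite /sp_integral.
have h i : (fun t => sp_val (s := S) i w *m (w (Num.min (sp_stop (s := S) i) t) - w (Num.min (sp_start (s := S) i) t))) t
   @[t --> within `[0, T] (nbhs x)] --> sp_val (s := S) i w *m (w (Num.min (sp_stop (s := S) i) x) - w (Num.min (sp_start (s := S) i) x)).
  have [h1 h2 h3] := sp_times (s := S) i. apply: continuous_cvg; first exact: mulmx_continuous. apply: cvgB.
    have c1 : 0 <= sp_stop (s := S) i <= T by rewrite h3 (le_trans h1).
    by have /subspace_continuousP := min_path_continuous (w := w) c1; apply.
  have c1 : 0 <= sp_start (s := S) i <= T by rewrite h1 (le_trans h2).
  by have /subspace_continuousP := min_path_continuous (w := w) c1; apply.
exact: (@cvg_bigsum _ _ _ _ _ _ _ _ _ h).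
Qed.

Lemma sp_integral0 (S : simple_process T m d) (w : Omega T m) : sp_integral S 0 w = 0.
Proof.
rewrite /sp_integral big1// => i _; have [h1 h2 h3] := sp_times (s := S) i.
by rewrite !min_r// ?(le_trans h1)// subrr mulmx0.
Qed.

End IntegralPaths.

Lemma limn_einf_le (R : realType) (u : (\bar R)^nat) (c : \bar R) N :
  (forall k, (N <= k)%N -> (u k <= c)%E) -> (limn_einf u <= c)%E.
Proof.
move=> h; rewrite limn_einf_lim; apply: lime_le; first exact: is_cvg_einfs.
apply: nearW => n; apply: (via (u (maxn n N))); last by apply: h; exact: leq_maxr.
by apply: ereal_inf_lbound; exists (maxn n N) => //=; exact: leq_maxl.
Qed.

Section ItoExistence.
Variables (R : realType) (T : R) (m d : nat) (P : probability (Omega T m) R).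
Hypotheses (T0 : 0 < T) (WP : is_wiener P).

Lemma half_sum (c : R) : 0 <= c -> (\big[+%E/0%R]_(0 <= n <oo) (c * 2^-1 ^+ n)%:E < +oo)%E.
Proof.
move=> c0; apply: (@le_lt_trans _ _ (2 * c)%:E); last exact: ltry.
apply: lime_le.
  by apply: is_cvg_nneseries => n _ _; rewrite lee_fin mulr_ge0// exprn_ge0// invr_ge0.
apply: nearW => n; rewrite sumEFin lee_fin.
have -> : \sum_(0 <= i < n) c * 2^-1 ^+ i = 2 * c - 2 * c * 2^-1 ^+ n.
  elim: n => [|n IH]; first by rewrite big_nil expr0 mulr1 subrr. by rewrite big_nat_recr//= IH exprS; field.
by rewrite gerBl mulr_ge0// ?mulr_ge0// exprn_ge0// invr_ge0.
Qed.

Lemma null_geo (c : R) : null (fun n => (c * 8^-1 ^+ n)%:E).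
Proof.
apply: cvg_null; apply: cvg_EFin; first exact: nearW.
by apply: cvg_geometric; rewrite ger0_norm ?invr_ge0// invf_lt1// ltr1n.
Qed.

(** A fast subsequence, the maximal inequality and Borel-Cantelli give almost surely uniform
    convergence of the simple integrals to a path; Fatou's lemma returns the convergence in L2 at
    each time. *)
Lemma ito_of_simple (H : R -> Omega T m -> 'M[R]_(d, m)) (S0 : nat -> simple_process T m d) :
  jointly_measurable H -> null (fun n => D2 P (fun t w => n2 (sp_eval (S0 n) t w - H t w))) ->
  exists Y, is_ito P H Y.
Proof.
move=> mH hS0.
have h8 n : 0 < 8^-1 ^+ n :> R by rewrite exprn_gt0// invr_gt0.
(* The rate [8 ^- n] beats the squared thresholds [4 ^- n] of the maximal inequality and leaves the
   summable [2 ^- n]. *)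
have hpick n : exists k, (D2 P (fun t w => n2 (sp_eval (S0 k) t w - H t w)) <= (8^-1 ^+ n)%:E)%E.
  exact: (null_pick hS0 (h8 n)).
have [s hs] := choice hpick.
pose S n := S0 (s n); pose I n := sp_integral (S n).
have mS n := jointly_measurable_sp_eval (S n).
have hSS n k : (n <= k)%N -> (D2 P (fun t w => n2 (sp_eval (S n) t w - sp_eval (S k) t w)) <= (4 * 8^-1 ^+ n)%:E)%E.
  move=> nk; have := @D2_le2 R T m P 2 2 _ _ _
    (jm_n2 (jointly_measurableB (mS n) (mS k))) (jm_n2 (jointly_measurableB (mS n) mH)) (jm_n2 (jointly_measurableB mH (mS k))).
  move=> /(_ _ _ _ _ _ _)/le_trans; apply => //; try by move=> *; exact: n2_ge0.
    by move=> t w _; exact: n2_tri.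
  rewrite (D2_n2BC _ H).
  have -> : (4 * 8^-1 ^+ n)%:E = (2%:E * (8^-1 ^+ n)%:E + 2%:E * (8^-1 ^+ n)%:E)%E :> \bar R.
    by rewrite -!EFinM -EFinD; congr EFin; ring.
  apply: leeD; apply: lee_wpmul2l; rewrite ?lee_fin//; first exact: hs.
  apply: le_trans (hs k) _; rewrite lee_fin; apply: ler_wiXn2l => //. by rewrite invf_le1// ler1n.
(* The product of [16 * m] and [4 * 8 ^- n], divided by the squared threshold, is
   [64 * m * 2 ^- n]. *)
pose c := 64 * m%:R : R.
have c0 : 0 <= c by rewrite mulr_ge0.
have hU n : exists U : set (Omega T m), [/\ measurable U, (P U <= (c * 2^-1 ^+ n)%:E)%E &
    forall w, ~ U w -> forall t, 0 <= t <= T -> n2 (I n t w - I n.+1 t w) <= (2^-1 ^+ n) ^+ 2].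
  have l0 : 0 < (2^-1 ^+ n) ^+ 2 :> R by rewrite !exprn_gt0// invr_gt0.
  apply: (sup_bound T0 (X := fun w t => I n t w - I n.+1 t w)).
  - move=> t ht i j. by apply: measurable_mxB; exact: measurable_sp_integral.
  - move=> w; apply/subspace_continuousP => x hx; apply: cvgB.
      by have /subspace_continuousP := @sp_integral_continuous _ _ _ _ (S n) w; apply.
    by have /subspace_continuousP := @sp_integral_continuous _ _ _ _ (S n.+1) w; apply.
  - move=> L hL; apply: le_trans (simple_max T0 WP (S n) (S n.+1) l0 hL) _.
    apply: (via (((2^-1 ^+ n) ^+ 2)^-1%:E * ((16 * m%:R)%:E * (4 * 8^-1 ^+ n)%:E))%E).
      apply: lee_wpmul2l; first by rewrite lee_fin invr_ge0 ltW.
      by apply: lee_wpmul2l; [rewrite lee_fin mulr_ge0|apply: hSS].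
    rewrite -!EFinM lee_fin /c. have -> : 8^-1 ^+ n = (2^-1 ^+ n) ^+ 2 * 2^-1 ^+ n :> R.
      have -> : 8^-1 = 2^-1 ^+ 2 * 2^-1 :> R by field. by rewrite exprMn -!exprM mulnC.
    move: l0; set x := 2^-1 ^+ n => l0.
    by rewrite le_eqVlt; apply/orP; left; apply/eqP; field; rewrite -(sqrf_eq0 x) gt_eqF.
have [U hU'] := choice hU.
have mU n : measurable (U n) by have [] := hU' n.
have PU : P (lim_sup_set U) = 0%E.
  apply: lim_sup_set_cvg0 => //; apply: (@le_lt_trans _ _ (\big[+%E/0%R]_(0 <= n <oo) (c * 2^-1 ^+ n)%:E)%E).
    by apply: lee_nneseries => // n _; have [] := hU' n.
  exact: half_sum.
pose G := ~` lim_sup_set U.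
have mG : measurable G.
  apply: measurableC; apply: bigcap_measurable => // n _; exact: bigcup_measurable.
have hG w : G w -> exists N, forall n, (N <= n)%N -> ~ U n w.
  move=> hGw; apply: contrapT => hN; apply: hGw => n _.
  apply: contrapT => hn; apply: hN; exists n => k nk Uk; apply: hn. by exists k.
(* On the null set where convergence may fail, [Y] is the zero path; this keeps it measurable as a
   limit of the simple integrals times an indicator. *)
pose Y w : Omega T d := if w \in G then mkpath T (fun t => \col_i limn (fun n => I n t w i 0)) else point.
have hY w (t : R) i : G w -> 0 <= t <= T -> I n t w i 0 @[n --> \oo] --> Y w t i 0.
  move=> Gw ht; rewrite /Y mem_set//; have [N hN] := hG w Gw.
  apply: (@path_limit _ _ _ (fun n t => I n t w) N (ltW T0)) => //.
  - by move=> n; exact: sp_integral_continuous.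
  - by move=> n; exact: sp_integral0.
  - by move=> n u Nn hu; have [_ _ h] := hU' n; apply: h => //; exact: hN.
have mI n t : 0 <= t <= T -> forall a b, mfunO T m (fun w => I n t w a b) by exact: measurable_sp_integral.
have m1 : mfunO T m (fun w => \1_G w : R) by exact: measurable_indic.
have mY (t : R) i : 0 <= t <= T -> mfunO T m (fun w => Y w t i 0).
  move=> ht; apply: (@measurable_realfun.measurable_fun_cvg _ _ _ _ (fun n w => I n t w i 0 * \1_G w)).
    by move=> n; apply: mfunM => //; exact: mI.
  move=> w _; rewrite indicE; have [Gw|nG] := boolP (w \in G).
    by under eq_fun do rewrite mulr1; apply: hY => //; rewrite inE in Gw.
  under eq_fun do rewrite mulr0; rewrite /Y (negbTE nG) mxE; exact: cvg_cst.
exists Y; split => //; first by apply: measurable_Omega => t i ht; exact: mY.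
exists S; split.
  under eq_fun do under eq_integral do under eq_integral do rewrite enorm_sqr.
  apply: null_cvg; first by move=> n; exact: D2_n2_ge0.
  have h1 := @null_geo 1; by apply: null_le h1 _ => n; rewrite mul1r; exact: hs.
move=> t ht; under eq_fun do under eq_integral do rewrite enorm_sqr.
apply: null_cvg; first by move=> n; apply: int_ge0 => w; exact: n2_ge0.
apply: (null_le (null_geo c)) => n.
pose f k (w : Omega T m) : R := n2 (I n t w - I k t w) * \1_G w.
have mn2 k : mfunO T m (fun w => n2 (I n t w - I k t w)) by apply: measurable_n2B => a b; exact: mI.
have mnY : mfunO T m (fun w => n2 (I n t w - Y w t)).
  by apply: measurable_n2B => a b; [exact: mI|rewrite ord1; exact: mY].
have hae : {ae P, forall w, G w}.
  exists (lim_sup_set U); split => //; first by rewrite -[X in measurable X]setCK; exact: measurableC.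
  by move=> w /= nG; apply: contrapT => h; apply: nG.
have e1 : (\int[P]_w (n2 (I n t w - Y w t))%:E = \int[P]_w (n2 (I n t w - Y w t) * \1_G w)%:E)%E.
  apply: ae_eq_integral => //.
  - exact/EFinP.
  - by apply/EFinP; exact: mfunM.
  - by apply: filterS hae => w Gw _; rewrite indicE mem_set// mulr1.
rewrite e1.
(* Fatou in the second index [k]: the distance of [I n] to the limit is bounded by the distances of
   [I n] to [I k] for [k >= n]. *)
apply: (via (\int[P]_w limn_einf (fun k => (f k w)%:E))%E).
  rewrite le_eqVlt; apply/orP; left; apply/eqP; apply: eq_integral => w _.
  rewrite /f indicE; have [Gw|nG] := boolP (w \in G); last first.
      rewrite mulr0; under [X in limn_einf X]eq_fun do rewrite mulr0.
      by rewrite (cvg_limn_einf_sup (cvg_cst _)).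
    rewrite mulr1; under [X in limn_einf X]eq_fun do rewrite mulr1.
    suff hc : (n2 (I n t w - I k t w))%:E @[k --> \oo] --> (n2 (I n t w - Y w t))%:E.
      by rewrite (cvg_limn_einf_sup hc).
    apply: cvg_EFin; first exact: nearW. rewrite /=. apply: cvg_bigsum => i; apply: cvg_bigsum => j.
    have -> : (fun k => (I n t w - I k t w) i j ^+ 2) = (fun k => (I n t w i j - I k t w i j) ^+ 2).
      by apply/funext => k; rewrite !mxE.
    rewrite !mxE ord1. have hc : I n t w i 0 - I k t w i 0 @[k --> \oo] --> I n t w i 0 - Y w t i 0.
      by apply: cvgB; [exact: cvg_cst|apply: hY => //; rewrite inE in Gw].
    exact: (cvgM hc hc).
apply: le_trans (fatou _ _ _ _) _ => //.
- by move=> k; apply/EFinP; exact: mfunM.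
- by move=> k w _; rewrite lee_fin mulr_ge0// n2_ge0.
apply: (@limn_einf_le _ _ _ n) => k nk.
apply: (via (\int[P]_w (n2 (I n t w - I k t w))%:E)%E).
  apply: int_le => //; first exact: mfunM.
  - by move=> w; rewrite mulr_ge0// n2_ge0.
  - by move=> w; rewrite /f indicE; case: (w \in G); rewrite ?mulr1// mulr0 n2_ge0.
apply: le_trans (simple_L2 T0 WP (S n) (S k) ht) _.
apply: (via ((16 * m%:R)%:E * (4 * 8^-1 ^+ n)%:E)%E).
  by apply: lee_wpmul2l; [rewrite lee_fin mulr_ge0|exact: hSS].
by rewrite -EFinM lee_fin /c le_eqVlt; apply/orP; left; apply/eqP; ring.
Qed.

End ItoExistence.

(** * Sampling measurable processes in time *)

Section TimeSampling.
Variables (R : realType) (T : R) (m : nat) (P : probability (Omega T m) R).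
Hypothesis T0 : 0 < T.
Variables (I : finType) (f : I -> R -> Omega T m -> R) (C : R).
Hypotheses (mf : forall i, jm (f i)) (C0 : 0 <= C) (fC : forall i t w, 0 <= t <= T -> `|f i t w| <= C).

Definition spread (s t : R) (w : Omega T m) : R := \sum_i `|f i s w - f i t w|.

(** The error made at time [t] when the processes are sampled at [s], counted only while [t] is
    within [rho] of [s]. *)
Definition window (rho s t : R) (w : Omega T m) : R := if `|s - t| < rho then spread s t w else 0.

Local Notation IT := (`[0, T]%classic : set (measurableTypeR R)).
Let mI0 : measurable IT. Proof. exact: measurable_itv. Qed.
Let F i := onT (f i).
Let mF i : mfun (F i). Proof. exact: onT_measurable. Qed.
Let FC i x : `|F i x| <= C.
Proof. by rewrite /F /onT; case: ifP => [/fC//|]; rewrite normr0. Qed.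

Let G rho s w : \bar R := (\int[leb]_(t in `[0%R, T]) (window rho s t w)%:E)%E.
(** Up to the normalisation, the mean oscillation around [s] at scale [rho]; it tends to zero at
    Lebesgue points. *)
Let K rho s w : R := rho^-1 * fine (G rho s w).

Lemma spread_ge0 s t w : 0 <= spread s t w.
Proof. by apply: sumr_ge0 => i _; exact: normr_ge0. Qed.

Lemma window_ge0 rho s t w : 0 <= window rho s t w.
Proof. by rewrite /window; case: ifP => // _; exact: spread_ge0. Qed.

Let c2 : R := 2 * C * #|I|%:R.
Let c20 : 0 <= c2. Proof. by rewrite !mulr_ge0. Qed.

Lemma spread_le s t w : 0 <= s <= T -> 0 <= t <= T -> spread s t w <= c2.
Proof.
move=> hs ht; rewrite /spread /c2 mulr_natr -sumr_const; apply: ler_sum => i _.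
by apply: le_trans (ler_normB _ _) _; have := fC i w hs; have := fC i w ht; lra.
Qed.

Let g rho (x : (R * Omega T m) * measurableTypeR R) : R :=
  if (0 <= x.1.1 <= T) && ((0 <= (x.2 : R) <= T) && (`|x.1.1 - x.2| < rho)) then
    \sum_i `|F i (x.1.2, x.1.1) - F i (x.1.2, x.2)| else 0.

Let mg rho : mfun (g rho).
Proof.
have m11 : mfun (fun x : (R * Omega T m) * measurableTypeR R => x.1.1).
  exact: (mcomp measurable_fst measurable_fst).
have m12 : mfun (fun x : (R * Omega T m) * measurableTypeR R => x.1.2).
  exact: (mcomp measurable_snd measurable_fst).
have m2 : mfun (fun x : (R * Omega T m) * measurableTypeR R => (x.2 : R)) by exact: measurable_snd.
apply: measurable_fun_ifT => //.
  apply: measurable_and; first by apply: measurable_and; apply: measurable_fun_ler.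
  apply: measurable_and; first by apply: measurable_and; apply: measurable_fun_ler.
  apply: measurable_fun_ltr => //; apply: mcomp => //; exact: mfunB.
apply: mfun_sum => i; apply: mcomp => //; apply: mfunB.
  by apply: (mcomp (mF i)); apply: measurable_fun_pair.
by apply: (mcomp (mF i)); apply: measurable_fun_pair.
Qed.

Let gE rho s w t : 0 <= s <= T -> 0 <= t <= T -> g rho ((s, w), t) = window rho s t w.
Proof.
move=> hs ht; rewrite /g /= hs ht /= /window; case: ifP => // _.
by apply: eq_bigr => i _; rewrite /F /onT /= hs ht.
Qed.

Let GE rho s w : 0 <= s <= T -> G rho s w = (\int[leb]_t (g rho ((s, w), t))%:E)%E.
Proof.
move=> hs; rewrite /G integral_mkcond; apply: eq_integral => t _; rewrite patchE mem_time.
by case: ifPn => [/(gE _ _ hs)->//|/negPf ht]; rewrite /g /= ht andbF.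
Qed.

Let mwin rho s w : 0 <= s <= T -> measurable_fun IT (fun t => (window rho s t w)%:E).
Proof.
move=> hs.
have h : mfun (fun t : measurableTypeR R => (g rho ((s, w), t))%:E).
  apply/EFinP; exact: (measurable_fun_pair2 (s, w) (mg rho)).
apply: (eq_measurable_fun (fun t : measurableTypeR R => (g rho ((s, w), t))%:E)); last exact: measurable_funTS.
by move=> t; rewrite mem_time => ht; rewrite gE.
Qed.

Let G_ge0 rho s w : (0 <= G rho s w)%E.
Proof. by apply: integral_ge0 => t _; rewrite lee_fin window_ge0. Qed.

Let G_le_ball rho s w (u : R -> \bar R) : 0 <= s <= T -> (forall t, 0 <= u t)%E -> mfun (u : measurableTypeR R -> _) ->
  (forall t : R, 0 <= t <= T -> `|s - t| < rho -> ((spread s t w)%:E <= u t)%E) ->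
  (G rho s w <= \int[leb]_(t in ball s rho) u t)%E.
Proof.
move=> hs u0 mu hu; rewrite /G integral_mkcond [leRHS]integral_mkcond; apply: ge0_le_integral => //.
- by move=> t _; rewrite patchE; case: ifP => // _; rewrite lee_fin window_ge0.
- exact: ((measurable_restrictT _ mI0).1 (mwin _ _ hs)).
- by apply: (measurable_restrictT _ (measurable_ball _ _)).1; exact: measurable_funTS.
- move=> t _; rewrite !patchE; case: ifP => [|_]; last by case: ifP.
  by rewrite mem_time => ht; rewrite /window; case: ifP => h; [rewrite mem_set ?hu|case: ifP].
Qed.

Let G_le rho s w : 0 < rho -> 0 <= s <= T -> (G rho s w <= (2 * rho * c2)%:E)%E.
Proof.
move=> r0 hs; have mb : measurable (ball s rho : set (measurableTypeR R)) by exact: measurable_ball.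
apply: (via (\int[leb]_(t in ball s rho) c2%:E)%E).
  by apply: G_le_ball => // t ht _; rewrite lee_fin spread_le.
rewrite integral_cst//.
apply: (via (c2%:E * (rho *+ 2)%:E)%E).
  by apply: lee_wpmul2l; [rewrite lee_fin|rewrite -(lebesgue_measure_ball s (ltW r0))].
by rewrite -EFinM lee_fin -mulr_natl; lra.
Qed.

Let G_fin rho s w : 0 < rho -> 0 <= s <= T -> G rho s w \is a fin_num.
Proof. by move=> r0 hs; rewrite ge0_fin_numE// (le_lt_trans (G_le w r0 hs))// ltry. Qed.

Let jmK rho : 0 < rho -> jm (K rho).
Proof.
move=> r0; apply: mfunM => //.
have h : mfun (fun x : R * Omega T m => \int[leb]_t (g rho (x, t))%:E)%E.
  have mE : mfun (fun x => (g rho x)%:E) by exact/EFinP.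
  have g0 x : (0 <= (g rho x)%:E)%E by rewrite lee_fin /g; case: ifP => // _; apply: sumr_ge0 => i _.
  exact: (@measurable_fun_fubini_tonelli_F _ _ _ _ _ leb _ mE g0).
apply/EFinP.
apply: (eq_measurable_fun (fun x : R * Omega T m => \int[leb]_t (g rho (x, t))%:E)%E); last exact: measurable_funTS.
move=> -[s w]; rewrite inE /= in_itv/= => -[hs _].
by rewrite -GE// fineK// G_fin.
Qed.

Let K_ge0 rho s w : 0 < rho -> 0 <= s <= T -> 0 <= K rho s w.
Proof. by move=> r0 hs; rewrite mulr_ge0 ?invr_ge0 ?(ltW r0)// fine_ge0. Qed.

Let K_le rho s w : 0 < rho -> 0 <= s <= T -> K rho s w <= 2 * c2.
Proof.
move=> r0 hs; rewrite /K ler_pdivrMl// -lee_fin fineK ?G_fin//.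
by apply: le_trans (G_le w r0 hs) _; rewrite lee_fin; lra.
Qed.

Let locint i w : locally_integrable [set: R] (fun t => F i (w, t)).
Proof.
have mFw : mfun (fun t : measurableTypeR R => F i (w, t)) by exact: (measurable_fun_pair2 w (mF i)).
split => //; first exact: openT.
move=> A _ cA; have mA : measurable (A : set (measurableTypeR R)) by exact: compact_measurable.
apply: (@le_lt_trans _ _ (C%:E * leb A)%E); last first.
  by rewrite lte_mul_pinfty// ?lee_fin//; have := compact_finite_measure cA; exact.
apply: (integral_le_bound (f := fun t => (F i (w, t))%:E)) => //.
- by apply/EFinP; exact: measurable_funTS.
- by apply: aeW => t _ /=; rewrite lee_fin.
Qed.

(** The factor 2 appears because [davg] divides by the length [2 * rho] of the ball. *)
Let K_davg rho s w : 0 < rho -> 0 <= s <= T ->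
  ((K rho s w)%:E <= 2%:E * \sum_i davg (fun t => F i (w, t)) s rho)%E.
Proof.
move=> r0 hs; rewrite EFinM fineK ?G_fin//.
have mb : measurable (ball s rho : set (measurableTypeR R)) by exact: measurable_ball.
have mFw i : mfun (fun t : measurableTypeR R => `|F i (w, t) - F i (w, s)|%:E).
  apply/EFinP; apply: mcomp => //; apply: mfunB => //. exact: (measurable_fun_pair2 w (mF i)).
have -> : (2%:E * \sum_i davg (fun t => F i (w, t)) s rho =
   (rho^-1)%:E * \int[leb]_(t in ball s rho) (\sum_i `|F i (w, t) - F i (w, s)|%:E))%E.
  rewrite ge0_integral_sum//; last first.
    by move=> i; exact: measurable_funTS.
  rewrite !ge0_sume_distrr//; last 2 first.
  - by move=> i _; apply: integral_ge0 => t _; rewrite lee_fin.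
  - by move=> i _; exact: davg_ge0.
  apply: eq_bigr => i _; rewrite /davg /iavg lebesgue_measure_ball ?ltW//.
  rewrite inver gt_eqF ?pmulrn_lgt0// muleA -EFinM; congr (_%:E * _)%E.
  by rewrite -(mulr_natl rho); field; rewrite gt_eqF.
apply: lee_wpmul2l; first by rewrite lee_fin invr_ge0 ltW.
apply: G_le_ball => // [t||t ht _]; first by apply: sume_ge0 => i _; rewrite lee_fin.
  by under eq_fun do rewrite sumEFin; apply/EFinP; apply: mfun_sum => i; apply/EFinP; exact: mFw.
rewrite sumEFin lee_fin; apply: ler_sum => i _; by rewrite /F /onT /= hs ht distrC.
Qed.

Let rho n : R := 4 * (T / n.+1%:R).
Let rho0 n : 0 < rho n. Proof. by rewrite mulr_gt0// divr_gt0. Qed.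
Let rho_cvg : rho n @[n --> \oo] --> 0^'+.
Proof.
move=> A [e /= e0 hA].
have : \forall n \near \oo, n.+1%:R^-1 < e / (4 * T).
  have eT : 0 < e / (4 * T) by rewrite divr_gt0// mulr_gt0. exact: (near_infty_natSinv_lt (PosNum eT)).
apply: filterS => n hn; apply: hA => /=; last exact: rho0.
rewrite sub0r normrN ger0_norm ?ltW//.
have -> : rho n = n.+1%:R^-1 * (4 * T) by rewrite /rho; ring.
by rewrite -ltr_pdivlMr// mulr_gt0.
Qed.

Let mKT n : mfun (fun x => (onT (K (rho n)) x)%:E).
Proof. by apply/EFinP; exact: onT_measurable (jmK (rho0 n)). Qed.

Let KT0 n x : (0 <= (onT (K (rho n)) x)%:E)%E.
Proof. by rewrite lee_fin onT_ge0// => *; exact: K_ge0. Qed.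

Let mKw n w : measurable_fun IT (fun s => (K (rho n) s w)%:E).
Proof.
have h : mfun (fun s : measurableTypeR R => (onT (K (rho n)) (w, s))%:E) by exact: (measurable_fun_pair2 w (mKT n)).
apply: (eq_measurable_fun (fun s : measurableTypeR R => (onT (K (rho n)) (w, s))%:E)); last exact: measurable_funTS.
by move=> s; rewrite mem_time => hs; rewrite /onT /= hs.
Qed.

(** Dominated convergence twice: in time for fixed [w], then in [w]. The processes are bounded by
    [C], so constants dominate. *)
Let D2K_null : null (fun n => D2 P (K (rho n))).
Proof.
have inner w : (\int[leb]_(s in `[0%R, T]) (K (rho n) s w)%:E)%E @[n --> \oo] --> 0%E.
  have [] := @dominated_convergence _ _ _ (@lebesgue_measure R) `[0, T]%classic mI0
    (fun n s => (K (rho n) s w)%:E) (cst 0%E) (cst (2 * c2)%:E) (fun n => mKw n w) (mcst _).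
  (* For fixed [w], almost every time is a Lebesgue point of all the finitely many processes at
     once. *)
  - have hae : {ae @lebesgue_measure R, forall s, forall i, lebesgue_pt (fun t => F i (w, t)) s}.
      by apply: filter_forall => i; exact: lebesgue_differentiation.
    case: hae => A [mA A0 hA]; exists A; split => // s nh; apply: hA => hs; apply: nh.
    rewrite /= in_itv/= => hsT. apply: null_cvg; first by move=> n; rewrite lee_fin K_ge0.
    apply: (null_le _ (fun n => K_davg w (rho0 n) hsT)).
    apply: nullZ => //; apply: null_sum => i _; apply: cvg_null.
    exact: (cvg_comp rho (davg (fun t => F i (w, t)) s) rho_cvg (hs i)).
  - apply/integrableP; split; first exact: mcst.
    rewrite integral_cst//= lebesgue_measure_itv /= lte_fin T0 -EFinB -EFinM; exact: ltry.
  - apply: aeW => s n; rewrite /= in_itv/= => hs; rewrite lee_fin ger0_norm ?K_ge0//.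
    exact: K_le.
  - by move=> _ _; rewrite integral0.
apply: cvg_null; rewrite /D2.
have [] := @dominated_convergence _ _ _ P setT measurableT
    (fun n w => \int[leb]_(s in `[0%R, T]) (K (rho n) s w)%:E)%E (cst 0%E) (cst (2 * c2 * T)%:E) _ (mcst _).
- move=> n; under eq_fun do rewrite inner_onT.
  exact: (@measurable_fun_fubini_tonelli_F _ _ _ _ _ leb _ (mKT n) (KT0 n)).
- by apply: aeW => w _; exact: inner.
- exact: finite_measure_integrable_cst.
- apply: aeW => w n _; rewrite gee0_abs; last first.
    by apply: integral_ge0 => s; rewrite /= in_itv/= => hs; rewrite lee_fin K_ge0.
  apply: (via (\int[leb]_(s in `[0%R, T]) (cst (2 * c2)%:E s))%E).
    apply: ge0_le_integral => //.
    - by move=> s; rewrite /= in_itv/= => hs; rewrite lee_fin K_ge0.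
    - by move=> s; rewrite /= in_itv/= => hs; rewrite lee_fin K_le.
  rewrite integral_cst//= lebesgue_measure_itv /= lte_fin T0 -EFinB subr0 -EFinM; exact: lexx.
- by move=> _ _; rewrite integral0.
Qed.

Let window_D2 n r : 0 <= r <= T -> (\int[P]_w (K (rho n) r w)%:E = (rho n)^-1%:E * D2 P (window (rho n) r))%E.
Proof.
move=> hr; rewrite /D2 -[X in (_ * X)%E]/(\int[P]_w G (rho n) r w)%E.
have e w : (K (rho n) r w)%:E = ((rho n)^-1%:E * G (rho n) r w)%E by rewrite /K EFinM fineK// G_fin.
under eq_integral do rewrite e.
rewrite ge0_integralZl//; last by rewrite lee_fin invr_ge0 ltW.
have h : mfunO T m (fun w => (rho n)%:E * (onT (K (rho n)) (w, r))%:E)%E.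
  by apply: emeasurable_funM => //; exact: (measurable_fun_pair1 r (mKT n)).
have -> : G (rho n) r = (fun w => (rho n)%:E * (onT (K (rho n)) (w, r))%:E)%E; last exact: h.
by apply/funext => w; rewrite /onT /= hr e muleA -EFinM divff ?gt_eqF// mul1e.
Qed.

(* The points r_j come from the Lebesgue differentiation theorem. *)
Lemma sample_points (eta : R) (n0 : nat) : 0 < eta -> exists2 n, (n0 <= n)%N & exists r : nat -> R,
    (forall j, (j <= n)%N -> T / n.+1%:R * j%:R <= r j < T / n.+1%:R * j.+1%:R) /\
    (\sum_(j < n.+1) D2 P (window (4 * (T / n.+1%:R)) (r j)) <= eta%:E)%E.
Proof.
move=> eta0; have e8 : 0 < eta / 8 by rewrite divr_gt0.
have [M _ hM] := D2K_null e8; pose n := maxn n0 M.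
exists n; first exact: leq_maxl.
have {hM} hn : (D2 P (K (rho n)) <= (eta / 8)%:E)%E by apply: hM; exact: leq_maxr.
pose dl := T / n.+1%:R; have dl0 : 0 < dl by rewrite divr_gt0.
pose h r : \bar R := (\int[P]_w (K (rho n) r w)%:E)%E.
have h0 r : 0 <= r <= T -> (0 <= h r)%E by move=> hr; apply: int_ge0 => w; exact: K_ge0.
have dlT j : (j <= n.+1)%N -> dl * j%:R <= T.
  by move=> jn; rewrite /dl mulrAC ler_pdivrMr// ler_wpM2l ?(ltW T0)// ler_nat.
pose cell j : set (measurableTypeR R) := `[dl * j%:R, dl * j.+1%:R[%classic.
have mcell j : measurable (cell j) by exact: measurable_itv.
have cellT j : (j <= n)%N -> cell j `<=` `[0, T]%classic.
  move=> jn t; rewrite /cell /= !in_itv/= => /andP[h1 h2].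
  apply/andP; split; first by apply: le_trans h1; rewrite mulr_ge0// ltW. exact: le_trans (ltW h2) (dlT _ _).
have cellP j r : (j <= n)%N -> cell j r -> 0 <= r <= T by move=> jn hr; have := cellT j jn _ hr; rewrite /= in_itv.
have mh : measurable_fun IT h.
  have hG := @measurable_fun_fubini_tonelli_G _ _ _ _ _ P _ (mKT n) (KT0 n).
  apply: (eq_measurable_fun (fubini_G P (fun x => (onT (K (rho n)) x)%:E))); last exact: measurable_funTS.
  move=> r; rewrite mem_time => hr; rewrite /fubini_G /h; apply: eq_integral => w _. by rewrite /onT /= hr.
have tot : (\sum_(j < n.+1) \int[leb]_(r in cell j) h r <= (eta / 8)%:E)%E.
  apply: le_trans hn; rewrite D2_swap//; [|exact: jmK|by move=> *; exact: K_ge0].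
  suff hk k : (k <= n.+1)%N -> (\sum_(j < k) \int[leb]_(r in cell j) h r <=
      \int[leb]_(r in `[0%R, (dl * k%:R)%R[) h r)%E.
    apply: le_trans (hk _ (leqnn _)) _; apply: ge0_subset_integral => // r.
    by rewrite /= !in_itv/= => /andP[-> h1]; exact: le_trans (ltW h1) (dlT _ (leqnn _)).
  elim: k => [|k IH] kn; first by rewrite big_ord0 mulr0 set_itvco0 integral_set0.
  have e : `[0, dl * k.+1%:R[%classic = `[0, dl * k%:R[ `|` cell k :> set R.
    apply/seteqP; split => r; rewrite /cell /= !in_itv/=.
      by move=> /andP[-> ->]; rewrite andbT; case: (ltP r (dl * k%:R)); [left|right].
    have kk : dl * k%:R <= dl * k.+1%:R by rewrite ler_wpM2l ?(ltW dl0)// ler_nat.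
    move=> [/andP[-> h1]|/andP[h1 ->]]; first by rewrite (lt_le_trans h1 kk).
    by rewrite (le_trans _ h1)// mulr_ge0// ltW.
  rewrite big_ord_recr/= e ge0_integral_setU//=; first by apply: leeD => //; exact: IH (ltnW kn).
  - rewrite -e; apply: measurable_funS mh => //.
    by move=> r; rewrite /= !in_itv/= => /andP[-> h1]; exact: le_trans (ltW h1) (dlT _ kn).
  - move=> r [|hr]; last exact: h0 (cellP k r kn hr).
    by rewrite /= in_itv/= => /andP[r0 h1]; apply: h0; rewrite r0/=; exact: le_trans (ltW h1) (dlT _ (ltnW kn)).
  - apply/disj_setPS => r [] /=; rewrite /cell /= !in_itv/= => /andP[_ h1] /andP[h2 _].
    by move: (lt_le_trans h1 h2); rewrite ltxx.
pose v j := (\int[leb]_(r in cell j) h r)%E.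
have v0 j : (j <= n)%N -> (0 <= v j)%E.
  by move=> jn; apply: integral_ge0 => r hr; exact: h0 (cellP j r jn hr).
pose ep := eta / 8 / n.+1%:R.
have ep0 : 0 < ep by rewrite divr_gt0.
(* Mean value argument: if [h] were above its average plus [ep / dl] on the whole cell, its integral
   would exceed [v j]. The excesses [ep] add up to [eta / 8]. *)
have pick j : (j <= n)%N -> exists r, cell j r /\ (dl%:E * h r <= v j + ep%:E)%E.
  move=> jn; apply: contrapT => hno. have vfin : v j \is a fin_num.
    rewrite ge0_fin_numE ?v0//; apply: (@le_lt_trans _ _ (eta / 8)%:E); last exact: ltry.
    apply: le_trans tot; rewrite (bigD1 (Ordinal (jn : (j < n.+1)%N)))//= leeDl//.
    by apply: sume_ge0 => i _; apply: v0; rewrite -ltnS.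
  pose a := (fine (v j) + ep) / dl. have hlow : (\int[leb]_(r in cell j) (cst a%:E r) <= v j)%E.
    apply: ge0_le_integral => //.
    - move=> r _; rewrite lee_fin divr_ge0 ?(ltW dl0)// addr_ge0 ?(ltW ep0)//.
      by rewrite fine_ge0// v0.
    - apply: measurable_funS mh; [exact: measurable_itv|exact: cellT].
    - move=> r hr; have hrT := cellP j r jn hr.
      rewrite leNgt; apply/negP => hlt; apply: hno; exists r; split => //.
      rewrite -(fineK vfin) -EFinD; apply: (via (dl%:E * a%:E)%E).
        by apply: lee_wpmul2l; [rewrite lee_fin ltW|exact: ltW].
      by rewrite -EFinM lee_fin /a mulrC divfK// gt_eqF.
  move: hlow; rewrite integral_cst//= /cell lebesgue_measure_itv/= lte_fin ltr_pM2l// ltr_nat ltnSn.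
  rewrite -EFinB -EFinM -(fineK vfin) lee_fin leNgt => /negP; apply.
  have -> : a * (dl * j.+1%:R - dl * j%:R) = fine (v j) + ep.
    by rewrite /a -mulrBr -natrB// subSnn mulr1 divfK// gt_eqF.
  by rewrite ltrDl.
have [r hr] : exists r : nat -> R, forall j, (j <= n)%N -> cell j (r j) /\ (dl%:E * h (r j) <= v j + ep%:E)%E.
  have pick' j : exists r, (j <= n)%N -> cell j r /\ (dl%:E * h r <= v j + ep%:E)%E.
    have [jn|jn] := boolP (j <= n)%N; last by exists 0. by have [r hr] := pick j jn; exists r.
  by have [r hr] := choice pick'; exists r.
exists r; split.
  by move=> j jn; have [h1 _] := hr j jn; move: h1; rewrite /cell /= in_itv.
have hw j : (j <= n)%N -> D2 P (window (4 * (T / n.+1%:R)) (r j)) = (4%:E * (dl%:E * h (r j)))%E.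
  move=> jn; have [h1 _] := hr j jn. have hrT := cellP j _ jn h1.
  rewrite /h window_D2// !muleA -!EFinM -/dl -/(rho n) /rho -/dl.
  have -> : 4 * dl * (4 * dl)^-1 = 1 by rewrite divff// mulf_neq0// gt_eqF. by rewrite mul1e.
apply: (via (\sum_(j < n.+1) (4%:E * (v j + ep%:E)))%E).
  apply: lee_sum => j _; have jn : (j <= n)%N by rewrite -ltnS.
  by rewrite hw//; apply: lee_wpmul2l => //; have [] := hr j jn.
rewrite -ge0_sume_distrr; last by move=> j _; rewrite adde_ge0 ?v0 ?lee_fin ?(ltW ep0)// -ltnS.
apply: (via (4%:E * ((eta / 8)%:E + (eta / 8)%:E))%E).
  apply: lee_wpmul2l => //; rewrite big_split/=; apply: leeD => //.
  rewrite sumEFin sumr_const card_ord lee_fin -(mulr_natr ep) /ep divfK// pnatr_eq0//.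
by rewrite -EFinD -EFinM lee_fin; lra.
Qed.

End TimeSampling.

Lemma measurable_ge d (X : measurableType d) (R : realType) (c : R) (f : X -> R) :
  mfun f -> measurable [set x | c <= f x].
Proof.
move=> mf; have := @measurable_fun_ler _ _ _ setT _ _ (mcst c) mf measurableT [set true].
by rewrite setTI; apply.
Qed.

Section TimeIntegralTools.
Variables (R : realType) (T : R) (m : nat) (P : probability (Omega T m) R).
Implicit Types K : R -> Omega T m -> R.

Lemma jm_section K w : jm K ->
  measurable_fun (`[0, T]%classic : set (measurableTypeR R)) (fun t => (K t w)%:E).
Proof.
move=> jK; have h : mfun (fun t : measurableTypeR R => (onT K (w, t))%:E).
  apply/EFinP; exact: (measurable_fun_pair2 w (onT_measurable jK)).
apply: (eq_measurable_fun (fun t : measurableTypeR R => (onT K (w, t))%:E)); last exact: measurable_funTS.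
by move=> t; rewrite mem_time => ht; rewrite /onT /= ht.
Qed.

Lemma measurable_inner K : jm K -> (forall t w, 0 <= t <= T -> 0 <= K t w) ->
  mfunO T m (fun w => \int[leb]_(t in `[0%R, T]) (K t w)%:E)%E.
Proof.
move=> jK K0; under eq_fun do rewrite inner_onT.
have mE : mfun (fun x => (onT K x)%:E) by apply/EFinP; exact: onT_measurable.
have E0 x : (0 <= (onT K x)%:E)%E by rewrite lee_fin onT_ge0.
exact: (@measurable_fun_fubini_tonelli_F _ _ _ _ _ leb _ mE E0).
Qed.

Lemma D2_le_ae K K1 : jm K -> jm K1 ->
  (forall t w, 0 <= t <= T -> 0 <= K t w) -> (forall t w, 0 <= t <= T -> 0 <= K1 t w) ->
  {ae P, forall w, forall t, 0 <= t <= T -> K t w <= K1 t w} -> (D2 P K <= D2 P K1)%E.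
Proof.
move=> jK jK1 K0 K10 h; apply: ae_ge0_le_integral => //.
- by move=> w _; apply: integral_ge0 => t; rewrite /= in_itv/= lee_fin => /K0.
- exact: measurable_inner.
- by move=> w _; apply: integral_ge0 => t; rewrite /= in_itv/= lee_fin => /K10.
- exact: measurable_inner.
apply: filterS h => w hw _; apply: ge0_le_integral => //.
- by move=> t; rewrite /= in_itv/= lee_fin => /K0.
- exact: jm_section.
- exact: jm_section.
Qed.

Lemma D2_sum (I : finType) (K : I -> R -> Omega T m -> R) : (forall i, jm (K i)) ->
  (forall i t w, 0 <= t <= T -> 0 <= K i t w) -> (D2 P (fun t w => (\sum_i K i t w)%R) = \sum_i D2 P (K i))%E.
Proof.
move=> jK K0; rewrite D2E; last 2 first.
- by apply: mfun_sum => i; exact: jK.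
- by move=> t w ht; apply: sumr_ge0 => i _; exact: K0.
have -> : (fun x => (onT (fun t w => \sum_i K i t w) x)%:E) = (fun x => (\sum_i onT (K i) x)%:E).
  by apply/funext => x; rewrite /onT; case: ifP => // _; rewrite big1.
rewrite int_sum.
- by apply: eq_bigr => i _; rewrite -D2E//; exact: K0.
- by move=> i; exact: onT_measurable.
- by move=> i; apply: onT_ge0; exact: K0.
Qed.

Lemma D2_cst (c : R) : 0 < T -> (D2 P (fun _ _ => c) = (c * T)%:E)%E.
Proof.
move=> T0; rewrite /D2; under eq_integral do rewrite integral_cst//= lebesgue_measure_itv/= lte_fin T0 -EFinB subr0 -EFinM.
exact: int_prob_cst.
Qed.

Lemma D2_initial (c : R) : 0 < T -> 0 <= c -> (D2 P (fun t _ => if (t <= c)%R then 1%R else 0%R) <= c%:E)%E.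
Proof.
move=> T0 c0; rewrite -(int_prob_cst P); apply: ge0_le_integral => //.
- by move=> w _; apply: integral_ge0 => t _; rewrite lee_fin; case: ifP.
- move=> w _; apply: (via (\int[leb]_(t in `[0%R, c]) (cst 1%E t))%E); last first.
    rewrite integral_cst//= lebesgue_measure_itv/= lte_fin; case: ifP => _; last by rewrite mule0 lee_fin.
    by rewrite -EFinB subr0 mul1e.
  rewrite integral_mkcond [leRHS]integral_mkcond; apply: ge0_le_integral => //.
  + by move=> t _; rewrite patchE; case: ifP => // _; rewrite lee_fin; case: ifP.
  + have mI0 : measurable (`[0, T]%classic : set (measurableTypeR R)) by exact: measurable_itv.
    apply: (measurable_restrictT _ mI0).1; apply/EFinP; apply: measurable_funTS.
    by apply: measurable_fun_ifT => //; exact: measurable_fun_ler.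
  + have mI0 : measurable (`[0, c]%classic : set (measurableTypeR R)) by exact: measurable_itv.
    exact: ((measurable_restrictT _ mI0).1 (mcst _)).
  + move=> t _; rewrite !patchE; case: ifP => [|_]; last by case: ifP.
    rewrite inE /= in_itv/= => /andP[t0 _]; case: ifP => [tc|_].
      by rewrite mem_set//= in_itv/= t0 tc.
    by case: ifP.
Qed.

End TimeIntegralTools.

(** * Existence, locality and adaptedness of the integral *)

Section GoodProcesses.
Variables (R : realType) (T : R) (m : nat) (P : probability (Omega T m) R).
Hypotheses (T0 : 0 < T) (WP : is_wiener P).

Definition bounded_by p q (H : R -> Omega T m -> 'M[R]_(p, q)) (C : R) :=
  forall (t : R) w, 0 <= t <= T -> n2 (H t w) <= C.

(** The null set may depend on [t]. This class contains both the coefficients along an admissible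
    control and the dual integrands composed with the controlled path. *)
Definition ae_adapted p q (H : R -> Omega T m -> 'M[R]_(p, q)) :=
  forall t : R, 0 <= t <= T -> exists G : Omega T m -> 'M[R]_(p, q),
    (forall a b, F_measurable t (fun w => G w a b)) /\ {ae P, forall w, H t w = G w}.

(** A simple process must be bounded for every [w]. Truncating the entries at [C + 1] does not alter
    them where the version agrees with [H]. *)
Lemma bounded_version p q (H : R -> Omega T m -> 'M[R]_(p, q)) (C t : R) :
  ae_adapted H -> bounded_by H C -> 0 <= t <= T -> exists G : Omega T m -> 'M[R]_(p, q),
    [/\ forall a b, F_measurable t (fun w => G w a b), {ae P, forall w, H t w = G w} &
      forall w, n2 (G w) <= (p * q)%:R * (C + 1) ^+ 2].
Proof.
move=> aH bH ht; have [G [mG eG]] := aH t ht.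
have C0 : 0 <= C by apply: le_trans (bH t point ht); exact: n2_ge0.
have C1 : 0 <= C + 1 by rewrite addr_ge0.
pose c := C + 1.
pose G' w : 'M[R]_(p, q) := \matrix_(a, b) Num.min (Num.max (G w a b) (- c)) c.
exists G'; split.
- move=> a b; apply/F_measurableP; under eq_fun do rewrite mxE.
  have := mG a b => /F_measurableP h. apply: measurable_minr => //; exact: measurable_maxr.
- apply: filterS eG => w e; apply/matrixP => a b; rewrite mxE -e.
  have := bounded_entry a b (bH t w ht); rewrite ler_norml => /andP[h1 h2]. by rewrite max_l// min_l.
- move=> w; apply: le_trans (n2_le_mxnorm _) _; apply: ler_wpM2l => //.
  rewrite lerXn2r ?nnegrE//; apply: mxnorm_le => // a b; rewrite mxE ler_norml.
  rewrite -/c le_min le_max lexx orbT/= ge_min lexx orbT andbT.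
  by apply: le_trans (C1 : 0 <= c); rewrite oppr_le0.
Qed.

Section Sampling.
Variables (n : nat) (r : nat -> R).
Local Notation dl := (T / n.+1%:R).
Hypothesis hr : forall j, (j <= n)%N -> dl * j%:R <= r j < dl * j.+1%:R.

(** The sample taken at [r j] is used on the interval from [r j] to [stop j]; the last interval is
    extended to [T]. *)
Definition stop j : R := if (j < n)%N then r j.+1 else T.

Let dl0 : 0 < dl. Proof. by rewrite divr_gt0. Qed.

Lemma sample_ge0 j : (j <= n)%N -> 0 <= r j.
Proof. by move=> /hr/andP[h _]; apply: le_trans h; rewrite mulr_ge0// ltW. Qed.

Lemma sample_leT j : (j <= n)%N -> r j <= T.
Proof.
move=> jn; have /andP[_ h] := hr jn; apply: le_trans (ltW h) _.
by rewrite mulrAC ler_pdivrMr// ler_wpM2l ?(ltW T0)// ler_nat ltnS.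
Qed.

Lemma sample_stop j : (j <= n)%N -> r j <= stop j.
Proof.
move=> jn; rewrite /stop; case: ifP => [jn1|_]; last exact: sample_leT.
have /andP[_ h] := hr jn; have /andP[h' _] := hr jn1.
exact: le_trans (ltW h) h'.
Qed.

Lemma stop_leT j : (j <= n)%N -> stop j <= T.
Proof. by move=> jn; rewrite /stop; case: ifP => // jn1; exact: sample_leT. Qed.

Lemma stop_window j (t : R) : (j <= n)%N -> r j < t -> t <= stop j -> `|r j - t| < 4 * dl.
Proof.
move=> jn h1 h2; rewrite ltr_norml; have /andP[h3 h4] := hr jn.
have h5 : t <= dl * j.+2%:R.
  apply: le_trans h2 _; rewrite /stop; case: ltnP => jn1.
    by have /andP[_ /ltW] := hr jn1.
  have -> : j = n by apply/eqP; rewrite eqn_leq jn jn1.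
  rewrite mulrAC ler_pdivlMr// ler_wpM2l ?(ltW T0)// ler_nat//.
move: h3 h5; rewrite -[j.+2]addn2 natrD mulrDr => h3 h5.
have := dl0; set x := dl in h3 h5 *; set y := x * j%:R in h3 h5 *.
by move=> x0; apply/andP; split; lra.
Qed.

Lemma stop_cover (t : R) : r 0%N < t -> t <= T -> exists2 j, (j <= n)%N & r j < t <= stop j.
Proof.
move=> h0 tT; have ex : exists j, (j <= n)%N && (r j < t) by exists 0%N.
have ub j : (j <= n)%N && (r j < t) -> (j <= n)%N by case/andP.
case: (ex_maxnP ex ub) => j /andP[jn jt] maxj; exists j => //; rewrite jt/= /stop.
case: ifP => // jn1; rewrite leNgt; apply/negP => h.
by have := maxj j.+1; rewrite jn1 h => /(_ isT); rewrite ltnn.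
Qed.

Lemma stop_uniq (t : R) i j : (i <= n)%N -> (j <= n)%N -> r i < t <= stop i -> r j < t <= stop j -> i = j.
Proof.
wlog: i j / (i <= j)%N => [hw|ij] iN jN hi hj.
  by case/orP: (leq_total i j) => h; [exact: hw|apply/esym; exact: hw].
apply/eqP; rewrite eqn_leq ij leqNgt; apply/negP => ij'.
have iN' : (i < n)%N by exact: leq_trans jN.
case/andP: hi => _; rewrite /stop iN' => h1; case/andP: hj => h2 _.
have : r i.+1 <= r j.
  have /andP[h3 _] := hr jN; have /andP[_ h4] := hr iN'. have [e|ne] := eqVneq i.+1 j; first by rewrite e.
  apply: le_trans (ltW h4) _; apply: le_trans h3; rewrite ler_wpM2l ?(ltW dl0)// ler_nat.
  by rewrite ltn_neqAle ne.
by move=> /le_lt_trans/(_ h2)/(le_lt_trans h1); rewrite ltxx.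
Qed.

(** Before the first sample, a time of at most [dl], the sampled process is zero; afterwards exactly
    one sample is active and it is close in time. *)
Lemma step_cases (V : zmodType) (v : nat -> V) (t : R) : 0 <= t <= T ->
  (t <= dl /\ \sum_(j < n.+1) (if r j < t <= stop j then v j else 0) = 0) \/
  exists j, [/\ (j <= n)%N, `|r j - t| < 4 * dl &
    \sum_(j < n.+1) (if r j < t <= stop j then v j else 0) = v j].
Proof.
move=> /andP[t0 tT]; have [t1|t1] := leP t (r 0%N); [left|right].
  have /andP[_ h1] := hr (leq0n n); rewrite mulr1 in h1; split; first exact: le_trans t1 (ltW h1).
  rewrite big1// => j _; case: ifP => // /andP[h _]. have h0 : r 0%N <= r j.
    case: (posnP (j : nat)) => [->//|jp]. have jn : (j <= n)%N by rewrite -ltnS.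
    have /andP[h2 _] := hr jn; apply: le_trans (ltW h1) _; apply: le_trans h2. by rewrite ler_pMr// ler1n.
  by have := le_lt_trans h0 (lt_le_trans h t1); rewrite ltxx.
have [j jn jt] := stop_cover t1 tT; exists j; split => //.
  by have /andP[h1 h2] := jt; exact: stop_window.
rewrite (bigD1 (Ordinal (jn : (j < n.+1)%N)))//= jt big1 ?addr0// => i ij.
case: ifP => // it; case/negP: ij; apply/eqP/val_inj => /=.
by apply: (stop_uniq _ jn it jt); rewrite -ltnS.
Qed.

Variables (I : finType) (f : I -> R -> Omega T m -> R).
Hypothesis mw : forall j, (j <= n)%N -> jm (window f (4 * dl) (r j)).

Lemma sample_D2 (F : R -> Omega T m -> R) (c1 c2 : R) :
  jm F -> (forall t w, 0 <= t <= T -> 0 <= F t w) -> 0 <= c1 -> 0 <= c2 ->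
  {ae P, forall w, forall t : R, 0 <= t <= T -> (t <= dl /\ F t w <= c1) \/
    exists j, [/\ (j <= n)%N, `|r j - t| < 4 * dl & F t w <= c2 * spread f (r j) t w]} ->
  (D2 P F <= (c1 * dl)%:E + c2%:E * \sum_(j < n.+1) D2 P (window f (4 * dl) (r j)))%E.
Proof.
move=> mF F0 c10 c20 hF.
pose K (t : R) (w : Omega T m) := c1 * (if t <= dl then 1 else 0) +
  c2 * \sum_(j < n.+1) window f (4 * dl) (r j) t w.
have mK1 : jm (fun (t : R) (_ : Omega T m) => (if t <= dl then 1 else 0 : R)).
  apply: measurable_funTS; apply: measurable_fun_ifT => //.
  by apply: measurable_fun_ler => //; exact: measurable_fst.
have mKs : jm (fun t w => \sum_(j < n.+1) window f (4 * dl) (r j) t w).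
  by apply: mfun_sum => j; apply: mw; rewrite -ltnS.
have mK : jm K by apply: mfunD; apply: mfunM => //.
have s0 t w : 0 <= \sum_(j < n.+1) window f (4 * dl) (r j) t w by apply: sumr_ge0 => j _; exact: window_ge0.
have i0 (t : R) : 0 <= (if t <= dl then 1 else 0 : R) by case: ifP.
have K0 t w : 0 <= t <= T -> 0 <= K t w by move=> _; rewrite addr_ge0// mulr_ge0.
apply: (via (D2 P K)).
  apply: D2_le_ae => //; apply: filterS hF => w hw t ht; rewrite /K.
  case: (hw t ht) => [[td hc]|[j [jn wj hc]]]; first by rewrite td mulr1 (le_trans hc)// lerDl mulr_ge0.
  apply: le_trans hc _; rewrite -[leLHS]add0r lerD ?mulr_ge0// ler_wpM2l//.
  rewrite (bigD1 (Ordinal (jn : (j < n.+1)%N)))//= {1}/window wj lerDl.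
  by apply: sumr_ge0 => i _; exact: window_ge0.
apply: le_trans (D2_le2 P mK mK1 mKs c10 c20 K0 _ _ _) _ => //.
apply: leeD; last by rewrite D2_sum// => [j|j t w _]; [apply: mw; rewrite -ltnS|exact: window_ge0].
rewrite EFinM; apply: lee_wpmul2l; first by rewrite lee_fin.
exact: (D2_initial P T0 (ltW dl0)).
Qed.

Variables (p : nat) (H : R -> Omega T m -> 'M[R]_(p, m)) (C : R).
Hypotheses (jH : jointly_measurable H) (bH : bounded_by H C) (aH : ae_adapted H).
Hypothesis hf : forall s t w, \sum_a \sum_b `|H s w a b - H t w a b| <= spread f s t w.

(** The samples are replaced by bounded, truly adapted versions to obtain a legitimate simple
    process. Only finitely many null sets are discarded, so the formula for the integral holds
    almost surely for all times together. *)
Lemma sample_simple : exists S : simple_process T m p, (D2 P (fun t w => n2 (sp_eval S t w - H t w)) <=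
    (C * dl)%:E + (2 * (C + 1))%:E * \sum_(j < n.+1) D2 P (window f (4 * dl) (r j)))%E /\
  {ae P, forall w, forall t : R, sp_integral S t w =
    \sum_(j < n.+1) H (r j) w *m (w (Num.min (stop j) t) - w (Num.min (r j) t))}.
Proof.
have hj0 (j : 'I_n.+1) : 0 <= r j <= T by rewrite sample_ge0 ?sample_leT// -ltnS.
have C0 : 0 <= C by apply: le_trans (bH point (hj0 ord0)); exact: n2_ge0.
have [G hG] := choice (fun j : 'I_n.+1 => bounded_version aH bH (hj0 j)).
have times (j : 'I_n.+1) : [/\ 0 <= r j, r j <= stop j & stop j <= T].
  by split; [exact: (andP (hj0 j)).1|apply: sample_stop; rewrite -ltnS|apply: stop_leT; rewrite -ltnS].
have ad (j : 'I_n.+1) a b : F_measurable (r j) (fun w => G j w a b) by have [h _ _] := hG j; exact: h.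
have bd : exists C : R, forall j w, enorm (G j w) <= C.
  exists (Num.sqrt ((p * m)%:R * (C + 1) ^+ 2)) => j w.
  by rewrite /enorm; apply: ler_wsqrtr; have [_ _ h] := hG j; exact: h.
pose S := SimpleProcess times ad bd.
have ae : {ae P, forall w, forall j : 'I_n.+1, H (r j) w = G j w} by apply: filter_forall => j; have [_ h _] := hG j.
exists S; split; last first.
  apply: filterS ae => w hw t; rewrite /sp_integral /=; apply: eq_bigr => j _. by rewrite hw.
have C1 : 0 <= 2 * (C + 1) by rewrite mulr_ge0// addr_ge0.
apply: sample_D2 => //.
- by apply: jm_n2; apply: jointly_measurableB => //; exact: jointly_measurable_sp_eval.
- by move=> *; exact: n2_ge0.
apply: filterS ae => w hw t ht.
have eS : sp_eval S t w = \sum_(j < n.+1) (if r j < t <= stop j then H (r j) w else 0).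
  by apply: eq_bigr => j _ /=; rewrite hw.
case: (@step_cases _ (fun j => H (r j) w) t ht) => [[t0]|[j [jn hw']]]; rewrite -eS => {}eS; rewrite eS; [left|right].
  by rewrite sub0r n2N; split=> //; exact: bH.
exists j; split=> //; have hrj : 0 <= r j <= T by rewrite sample_ge0// sample_leT.
apply: le_trans (ler_wpM2l C1 (hf (r j) t w)).
rewrite /n2 mulr_sumr; apply: ler_sum => a _; rewrite mulr_sumr; apply: ler_sum => b _.
(* The square of an entry of the error is at most [2 * (C + 1)] times its absolute value:
   boundedness turns the L1 estimate of the windows into an L2 estimate. *)
rewrite !mxE -[leLHS]ger0_norm ?sqr_ge0// normrX expr2; apply: ler_wpM2r => //.
apply: le_trans (ler_normB _ _) _.
by have := bounded_entry a b (bH w hrj); have := bounded_entry a b (bH w ht); lra.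
Qed.

End Sampling.

Definition entries p q (H : R -> Omega T m -> 'M[R]_(p, q)) (x : 'I_p * 'I_q) t w := H t w x.1 x.2.

Lemma spread_entries p q (H : R -> Omega T m -> 'M[R]_(p, q)) s t w :
  spread (entries H) s t w = \sum_a \sum_b `|H s w a b - H t w a b|.
Proof. by rewrite /spread pair_big. Qed.

Lemma jm_window (I : finType) (f : I -> R -> Omega T m -> R) (rho s : R) :
  (forall i, jm (f i)) -> 0 <= s <= T -> jm (window f rho s).
Proof.
move=> jf hs; apply: (eq_measurable_fun (fun x : R * Omega T m =>
    if `|s - x.1| < rho then \sum_i `|onT (f i) (x.2, s) - onT (f i) (x.2, x.1)| else 0)).
  move=> -[t w]; rewrite inE /= in_itv/= => -[ht _]; rewrite /window; case: ifP => // _.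
  by apply: eq_bigr => i _; rewrite /onT /= hs ht.
apply: measurable_funTS; apply: measurable_fun_ifT => //.
  apply: measurable_fun_ltr => //; apply: mcomp => //. by apply: mfunB => //; exact: measurable_fst.
apply: mfun_sum => i; apply: mcomp => //; apply: mfunB.
  have h : mfun (fun w : Omega T m => onT (f i) (w, s)) by exact: (measurable_fun_pair1 s (onT_measurable (jf i))).
  exact: (mcomp h measurable_snd).
apply: (mcomp (onT_measurable (jf i))); apply: measurable_fun_pair.
  exact: measurable_snd.
exact: measurable_fst.
Qed.

Record good p (H : R -> Omega T m -> 'M[R]_(p, m)) (C : R) : Prop := Good { good_jm : jointly_measurable H ;
  good_bnd : bounded_by H C ; good_ad : ae_adapted H }.

Lemma good_C p (H : R -> Omega T m -> 'M[R]_(p, m)) C : good H C -> 0 <= C.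
Proof.
case=> _ b _; apply: le_trans (b 0 point _); first exact: n2_ge0.
by rewrite lexx ltW.
Qed.

Lemma path_of_simple p (S : simple_process T m p) :
  exists Y, is_ito P (sp_eval S) Y /\ forall w (t : R), 0 <= t <= T -> Y w t = sp_integral S t w.
Proof.
pose Y w : Omega T p := mkpath T (fun t => sp_integral S t w).
have hY w (t : R) : 0 <= t <= T -> Y w t = sp_integral S t w.
  move=> ht; rewrite /Y mkpathE//; [exact: ltW|exact: sp_integral_continuous|exact: sp_integral0].
exists Y; split => //; split; first exact: jointly_measurable_sp_eval.
  apply: measurable_Omega => t i ht; under eq_fun do rewrite hY//. exact: measurable_sp_integral.
exists (fun=> S); split.
  under eq_fun do under eq_integral do under eq_integral do rewrite subrr enorm_sqr n20.
  under eq_fun do under eq_integral do rewrite integral0. under eq_fun do rewrite integral0. exact: cvg_cst.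
move=> t ht; under eq_fun do under eq_integral do rewrite hY// subrr enorm_sqr n20.
under eq_fun do rewrite integral0.
exact: cvg_cst.
Qed.

(** The source of locality: with common sampling times the two simple integrals use the same
    increments, and their samples agree almost surely on [E]. *)
Lemma common_samples p (H H' : R -> Omega T m -> 'M[R]_(p, m)) C C' (E : set (Omega T m)) (eta : R) :
  good H C -> good H' C' -> 0 < eta ->
  (forall t : R, 0 <= t <= T -> {ae P, forall w, E w -> H t w = H' t w}) ->
  exists S S' : simple_process T m p, [/\ (D2 P (fun t w => n2 (sp_eval S t w - H t w)) <= eta%:E)%E,
      (D2 P (fun t w => n2 (sp_eval S' t w - H' t w)) <= eta%:E)%E &
      {ae P, forall w, E w -> forall t : R, sp_integral S t w = sp_integral S' t w}].
Proof.
move=> gH gH' eta0 hE; have C0 := good_C gH; have C'0 := good_C gH'.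
have [jH bH aH] := gH; have [jH' bH' aH'] := gH'.
(* The entries of both processes form one finite family, so that one choice of times serves both. *)
pose f (i : 'I_p * 'I_m + 'I_p * 'I_m) := match i with inl x => entries H x | inr x => entries H' x end.
pose D := C + C' + 1; have D0 : 0 < D by rewrite ltr_wpDl// addr_ge0.
have jf i : jm (f i) by case: i => -[a b] /=; [exact: jH|exact: jH'].
have fD i t w : 0 <= t <= T -> `|f i t w| <= D.
  move=> ht; case: i => -[a b] /=; rewrite /entries /=.
    by have := bounded_entry a b (bH t w ht); rewrite /D; lra.
  by have := bounded_entry a b (bH' t w ht); rewrite /D; lra.
have e4 : 0 < eta / (4 * D) by rewrite divr_gt0// mulr_gt0.
have [N _ hN] : \forall n \near \oo, n.+1%:R^-1 < eta / (2 * D * T).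
  have eT : 0 < eta / (2 * D * T) by rewrite divr_gt0// !mulr_gt0. exact: (near_infty_natSinv_lt (PosNum eT)).
have [n Nn [r [hr hsum]]] := sample_points P T0 jf (ltW D0) fD N e4.
have hn := hN n Nn; rewrite /= in hn.
have hw j : (j <= n)%N -> jm (window f (4 * (T / n.+1%:R)) (r j)).
  by move=> jn; apply: jm_window => //; rewrite (sample_ge0 hr)// (sample_leT hr).
have s1 s t w : \sum_a \sum_b `|H s w a b - H t w a b| <= spread f s t w.
  rewrite -spread_entries /spread big_sumType/= lerDl. by apply: sumr_ge0.
have s2 s t w : \sum_a \sum_b `|H' s w a b - H' t w a b| <= spread f s t w.
  rewrite -spread_entries /spread big_sumType/= lerDr. by apply: sumr_ge0.
have [S [hS iS]] := sample_simple hr hw jH bH aH s1.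
have [S' [hS' iS']] := sample_simple hr hw jH' bH' aH' s2.
have fin (c : R) : 0 <= c -> c + 1 <= D -> ((c * (T / n.+1%:R))%:E + (2 * (c + 1))%:E *
    \sum_(j < n.+1) D2 P (window f (4 * (T / n.+1%:R)) (r j)) <= eta%:E)%E.
  move=> c0 cD; apply: (via ((eta / 2)%:E + (2 * (c + 1))%:E * (eta / (4 * D))%:E)%E).
    apply: leeD; last by apply: lee_wpmul2l => //; rewrite lee_fin mulr_ge0// addr_ge0.
    rewrite lee_fin; apply: (via (D * (T * (eta / (2 * D * T))))); last first.
      by rewrite le_eqVlt; apply/orP; left; apply/eqP; field; rewrite !gt_eqF.
    apply: ler_pM => //; first by rewrite divr_ge0// ltW.
      by apply: le_trans cD; rewrite lerDl.
    by apply: ler_wpM2l; [exact: ltW|exact: ltW].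
  rewrite -EFinM -EFinD lee_fin.
  have : 2 * (c + 1) * (eta / (4 * D)) <= 2 * D * (eta / (4 * D)) by apply: ler_wpM2r; [exact: ltW|exact: ler_wpM2l].
  have -> : 2 * D * (eta / (4 * D)) = eta / 2 by field; rewrite gt_eqF. lra.
exists S, S'; split.
- by apply: le_trans hS _; apply: fin => //; rewrite /D; lra.
- by apply: le_trans hS' _; apply: fin => //; rewrite /D; lra.
have hEj : {ae P, forall w, forall j : 'I_n.+1, E w -> H (r j) w = H' (r j) w}.
  by apply: filter_forall => j; apply: hE; rewrite (sample_ge0 hr) ?(sample_leT hr)// -ltnS.
apply: filterS3 hEj iS iS' => w h1 h2 h3 Ew t; rewrite h2 h3.
by apply: eq_bigr => j _; rewrite h1.
Qed.

Lemma ito_exists p (H : R -> Omega T m -> 'M[R]_(p, m)) C : good H C -> exists Y, is_ito P H Y.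
Proof.
move=> gH; have h n : exists S : simple_process T m p,
    (D2 P (fun t w => n2 (sp_eval S t w - H t w)) <= (1 * 8^-1 ^+ n)%:E)%E.
  have [|//|S [S' [hS _ _]]] := @common_samples _ H H C C setT (1 * 8^-1 ^+ n) gH gH.
    by rewrite mul1r exprn_gt0// invr_gt0. by move=> t _; apply: aeW.
  by exists S.
have [S hS] := choice h.
apply: (ito_of_simple T0 WP (S0 := S)); first exact: good_jm gH.
exact: null_le (null_geo 1) hS.
Qed.

Lemma itoP p (H : R -> Omega T m -> 'M[R]_(p, m)) C : good H C -> is_ito P H (ito P H).
Proof. move=> gH; rewrite /ito; exact: (@xgetPex _ (fun=> point) [set Y | is_ito P H Y] (ito_exists gH)). Qed.

(** On [E] the common simple integrals coincide, so there the distance of [Y] and [Y'] is at most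
    the sum of two approximation errors, each controlled by [ito_L2]. *)
Lemma ito_local_at p (H H' : R -> Omega T m -> 'M[R]_(p, m)) C C' Y Y' (E : set (Omega T m)) (t : R) :
  good H C -> good H' C' -> is_ito P H Y -> is_ito P H' Y' -> measurable E ->
  (forall t : R, 0 <= t <= T -> {ae P, forall w, E w -> H t w = H' t w}) ->
  0 <= t <= T -> {ae P, forall w, E w -> Y w t = Y' w t}.
Proof.
move=> gH gH' hY hY' mE hE ht.
have mY := is_ito_meas hY ht; have mY' := is_ito_meas hY' ht.
have m1 : mfunO T m (fun w => \1_E w : R) by exact: measurable_indic.
have mn : mfunO T m (fun w => n2 (Y w t - Y' w t)) by exact: measurable_n2B.
have mf : mfunO T m (fun w => \1_E w * n2 (Y w t - Y' w t)) by exact: mfunM.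
have f0 w : 0 <= \1_E w * n2 (Y w t - Y' w t) by rewrite mulr_ge0// n2_ge0.
suff h0 : (\int[P]_w (\1_E w * n2 (Y w t - Y' w t))%:E = 0)%E.
  have /(ae_eq_integral_abs P measurableT)[+ _] : mfunO T m (EFin \o (fun w => \1_E w * n2 (Y w t - Y' w t))).
    exact/EFinP.
  under eq_integral do rewrite /= ger0_norm ?f0//.
  move=> /(_ h0); apply: filterS => w /= /(_ I) [/eqP]; rewrite mulf_eq0 indicE => h Ew.
  move: h; rewrite mem_set// oner_eq0/= => /eqP/n2_eq0/eqP; rewrite subr_eq0 => /eqP //.
apply/eqP; rewrite eq_le; apply/andP; split; last exact: int_ge0.
apply/lee_addgt0Pr => e e0; rewrite add0e.
pose c : R := 4 * (144 * m%:R + 1).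
have c1 : 0 < 144 * m%:R + 1 :> R by rewrite ltr_wpDl// mulr_ge0.
have c0 : 0 < c by rewrite mulr_gt0.
have ec : 0 < e / c by rewrite divr_gt0.
have [S [S' [hS hS' hSS]]] := common_samples gH gH' ec hE.
have [Z [iZ eZ]] := path_of_simple S; have [Z' [iZ' eZ']] := path_of_simple S'.
have h1 := ito_L2 T0 WP hY iZ ht; have h2 := ito_L2 T0 WP hY' iZ' ht.
rewrite D2_n2BC in h1; rewrite D2_n2BC in h2.
have mZ := is_ito_meas iZ ht; have mZ' := is_ito_meas iZ' ht.
have mnZ : mfunO T m (fun w => n2 (Y w t - Z w t)) by exact: measurable_n2B.
have mnZ' : mfunO T m (fun w => n2 (Y' w t - Z' w t)) by exact: measurable_n2B.
apply: (via (\int[P]_w (2 * n2 (Y w t - Z w t) + 2 * n2 (Y' w t - Z' w t))%:E)%E).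
  apply: ae_ge0_le_integral => //.
  - by move=> w _; rewrite lee_fin.
  - exact/EFinP.
  - by move=> w _; rewrite lee_fin addr_ge0// mulr_ge0// n2_ge0.
  - by apply/EFinP; apply: mfunD; exact: mfunM.
  apply: filterS hSS => w hw _; rewrite lee_fin indicE.
  have [Ew|_] := boolP (w \in E); last by rewrite mul0r addr_ge0// mulr_ge0// n2_ge0.
  rewrite inE in Ew; rewrite mul1r; have := hw Ew t; rewrite -eZ// -eZ'// => eq.
  by apply: le_trans (n2_tri _ (Z w t) _) _; rewrite {2}eq (n2BC (Z' w t)).
have i2 (F : Omega T m -> R) : mfunO T m F -> (forall w, 0 <= F w) ->
    (\int[P]_w (F w)%:E <= (144 * m%:R)%:E * (e / c)%:E)%E -> (\int[P]_w (2 * F w)%:E <= (e / 2)%:E)%E.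
  move=> mF F0 hF; rewrite intZ//; apply: (via (2%:E * ((144 * m%:R)%:E * (e / c)%:E))%E).
    by apply: lee_wpmul2l.
  rewrite -!EFinM lee_fin. have : 144 * m%:R * (e / c) <= (144 * m%:R + 1) * (e / c).
    by apply: ler_wpM2r; [rewrite divr_ge0// ltW|rewrite lerDl].
  have -> : (144 * m%:R + 1) * (e / c) = e / 4 by rewrite /c; field; rewrite gt_eqF. lra.
have c144 : 0 <= 144 * m%:R :> R := mulr_ge0 (ler0n R 144) (ler0n R m).
rewrite intD//; try exact: mfunM; try by move=> w; rewrite mulr_ge0// n2_ge0.
rewrite (splitr e) EFinD; apply: leeD; apply: i2 => //; try by move=> w; exact: n2_ge0.
  by apply: le_trans h1 _; apply: lee_wpmul2l; [rewrite lee_fin|exact: hS].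
by apply: le_trans h2 _; apply: lee_wpmul2l; [rewrite lee_fin|exact: hS'].
Qed.

(** Equality holds almost surely at all dyadic times simultaneously, and continuity extends it to
    the interval. *)
Lemma ae_eq_path d (Y Y' : Omega T m -> Omega T d) (E : set (Omega T m)) :
  (forall t : R, 0 <= t <= T -> {ae P, forall w, E w -> Y w t = Y' w t}) ->
  {ae P, forall w, E w -> Y w = Y' w}.
Proof.
move=> h.
have h2 : {ae P, forall w, forall n i, (i <= 2 ^ n)%N ->
    E w -> Y w (0 + (T - 0) * i%:R / (2 ^ n)%:R) = Y' w (0 + (T - 0) * i%:R / (2 ^ n)%:R)}.
  apply: ae_foralln => n; apply: ae_foralln => i.
  have [hi|hi] := boolP (i <= 2 ^ n)%N; last by apply: aeW => w.
  have hx : 0 + (T - 0) * i%:R / (2 ^ n)%:R \in dyadics 0 T n.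
    by apply/mapP; exists i => //; rewrite mem_iota add0n ltnS.
  by apply: filterS (h _ (dyadics_bnd T0 hx)) => w.
apply: filterS h2 => w hw Ew; apply: omega_eq => t ht; apply/eqP; rewrite -subr_eq0; apply/eqP.
apply: n2_eq0; apply/eqP; rewrite eq_le n2_ge0 andbT leNgt; apply/negP => pos.
pose lam := n2 (Y w t - Y' w t) / 2.
have lam0 : 0 < lam by rewrite divr_gt0.
have [] := @dense_exceed _ _ 0 T lam (fun t => Y w t - Y' w t) t T0 _ ht.
- exact: path_sub_cont.
- by rewrite /lam ltr_pdivrMr// ltr_pMr// ltr1n.
move=> n /hasP[s /mapP[i]]; rewrite mem_iota add0n ltnS => /andP[_ hi] -> .
by rewrite hw// subrr n20 leNgt lam0.
Qed.

Lemma ito_local p (H H' : R -> Omega T m -> 'M[R]_(p, m)) C C' Y Y' (E : set (Omega T m)) :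
  good H C -> good H' C' -> is_ito P H Y -> is_ito P H' Y' -> measurable E ->
  (forall t : R, 0 <= t <= T -> {ae P, forall w, E w -> H t w = H' t w}) ->
  {ae P, forall w, E w -> Y w = Y' w}.
Proof.
move=> gH gH' hY hY' mE hE; apply: ae_eq_path => t ht.
exact: (ito_local_at gH gH').
Qed.

(** The upper limit of the sequence is measurable at time [t] for every [w], and equals the limit
    where that exists. *)
Lemma ae_limit_version (t : R) (g : nat -> Omega T m -> R) (f : Omega T m -> R) :
  (forall n, F_measurable t (g n)) -> {ae P, forall w, g n w @[n --> \oo] --> f w} ->
  exists2 h, F_measurable t h & {ae P, forall w, f w = h w}.
Proof.
move=> mg hg; exists (fun w => fine (limn_esup (fun n => (g n w)%:E))).
  apply/F_measurableP; apply: mcomp; first exact: fine_measurable.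
  apply: (@measurable_fun_limn_esup _ (OmF T m t) R setT (fun n w => (g n w)%:E)) => n.
  by apply/EFinP; apply/F_measurableP; exact: mg.
apply: filterS hg => w hw; have hc : (g n w)%:E @[n --> \oo] --> (f w)%:E.
  by apply: cvg_EFin; [exact: nearW|exact: hw].
by rewrite (cvg_limn_einf_sup hc).2.
Qed.

Lemma F_measurable_sp_integral p (S : simple_process T m p) t : 0 <= t <= T ->
  forall a b, F_measurable t (fun w => sp_integral S t w a b).
Proof.
move=> ht a b; have [|g [N [gr rf _ hk]]] := @common_grid _ _ _ _ T0 S S [:: t].
  by move=> x; rewrite inE => /eqP ->.
have [|k kN <-] := hk t; first by rewrite inE.
have [_ _ gS] := gr.
have := gsum_F (is_grid_bnd gr) gS (grid_val_adapted gr rf) kN a b.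
by congr (F_measurable _ _); apply/funext => w; rewrite (sp_integral_gsum gr _ rf kN).
Qed.

Definition aeF (t : R) (f : Omega T m -> R) := exists2 h, F_measurable t h & {ae P, forall w, f w = h w}.

(** Closedness under L2 limits: a sequence with errors [8 ^- n] converges almost surely by
    Borel-Cantelli. *)
Lemma aeF_closed (t : R) (f : Omega T m -> R) : mfunO T m f ->
  (forall e, 0 < e -> exists g, [/\ aeF t g, mfunO T m g &
    (\int[P]_w ((f w - g w) ^+ 2)%:E <= e%:E)%E]) -> aeF t f.
Proof.
move=> mf hf.
have h8 n : 0 < 8^-1 ^+ n :> R by rewrite exprn_gt0// invr_gt0.
have [g hg] := choice (fun n => hf _ (h8 n)).
have [h hh] : exists h : nat -> Omega T m -> R, forall n, F_measurable t (h n) /\ {ae P, forall w, g n w = h n w}.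
  have ex n : exists h, F_measurable t h /\ {ae P, forall w, g n w = h w} by have [[h mh eh] _ _] := hg n; exists h.
  by have [h hh] := choice ex; exists h.
have mg n : mfunO T m (g n) by have [] := hg n.
have mn n : mfunO T m (fun w => (f w - g n w) ^+ 2) by apply: mfunX; exact: mfunB.
apply: (@ae_limit_version t h) => [n|]; first exact: (hh n).1.
(* Markov's inequality gives this event a probability of at most [4 ^ n * 8 ^- n = 2 ^- n]. *)
pose U n := [set w | (2^-1 ^+ n) ^+ 2 <= (f w - g n w) ^+ 2].
have mU n : measurable (U n) by have := measurable_ge ((2^-1 ^+ n) ^+ 2) (mn n).
have h2 n : 0 < (2^-1 ^+ n : R) by rewrite exprn_gt0// invr_gt0.
have PU : P (lim_sup_set U) = 0%E.
  apply: lim_sup_set_cvg0 => //; apply: (@le_lt_trans _ _ (\big[+%E/0%R]_(0 <= n <oo) (1 * 2^-1 ^+ n)%:E)%E).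
    apply: lee_nneseries => // n _.
    apply: le_trans (markov_int _ (mn n) _ _) _; first by move=> w; exact: sqr_ge0.
      by rewrite exprn_gt0.
    apply: (via (((2^-1 ^+ n) ^+ 2)^-1%:E * (8^-1 ^+ n)%:E)%E).
      by apply: lee_wpmul2l; [rewrite lee_fin invr_ge0 exprn_ge0// ltW|have [] := hg n].
    have -> : 8^-1 = 2^-1 ^+ 2 * 2^-1 :> R by field.
    rewrite exprMn -exprM mulnC exprM -EFinM mulrA mulVf ?lexx//.
  exact: half_sum.
have hU : {ae P, forall w, ~ lim_sup_set U w}.
  exists (lim_sup_set U); split => //.
    by apply: bigcap_measurable => // n _; exact: bigcup_measurable.
  by move=> w /= /contrapT.
have hgh : {ae P, forall w, forall n, g n w = h n w} by apply: ae_foralln => n; exact: (hh n).2.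
apply: filterS2 hU hgh => w nU egh.
have [N hN] : exists N, forall n, (N <= n)%N -> (f w - g n w) ^+ 2 <= (2^-1 ^+ n) ^+ 2.
  apply: contrapT => hno; apply: nU => N _; apply: contrapT => hU'; apply: hno; exists N => n Nn.
  rewrite leNgt; apply/negP => hlt; apply: hU'; exists n => //; exact: ltW.
apply/cvgrPdist_le => e e0.
have /cvgrPdist_lt/(_ e e0)[M _ hM] := @expr_half_cvg0 R.
exists (maxn N M) => // n /=; rewrite geq_max => /andP[Nn Mn]; rewrite -egh.
have h3 : `|f w - g n w| <= 2^-1 ^+ n.
  by rewrite -(ler_pXn2r (n := 2))// ?nnegrE ?(ltW (h2 n))// real_normK ?num_real//; exact: hN.
apply: le_trans h3 _.
have := hM n Mn; rewrite /= sub0r normrN ger0_norm ?mulr_ge0 ?(ltW (h2 n))//.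
by move/ltW; apply: le_trans; rewrite ler_peMl ?(ltW (h2 n))// ler1n.
Qed.

Lemma ito_adapted p (H : R -> Omega T m -> 'M[R]_(p, m)) Y (t : R) : is_ito P H Y -> 0 <= t <= T ->
  forall i, aeF t (fun w => Y w t i 0).
Proof.
move=> hY ht i; have [S [_ /(_ t ht) hI]] := is_ito_null hY.
have mY := is_ito_meas hY ht.
apply: aeF_closed => // e e0; have [n hn] := null_pick hI e0.
have mI a b : mfunO T m (fun w => sp_integral (S n) t w a b) by exact: measurable_sp_integral.
exists (fun w => sp_integral (S n) t w i 0); split => //.
  exists (fun w => sp_integral (S n) t w i 0); [exact: F_measurable_sp_integral|exact: aeW].
apply: le_trans hn; apply: int_le => //.
- by apply: mfunX; exact: mfunB.
- exact: measurable_n2B.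
- by move=> w; exact: sqr_ge0.
- by move=> w; have := n2_entry (Y w t - sp_integral (S n) t w) i 0; rewrite !mxE.
Qed.

End GoodProcesses.

Lemma int_close dX (X : measurableType dX) (R : realType) (P : probability X R) (u v : X -> R)
    (U : set X) (c p e : R) : mfun u -> mfun v ->
  (forall w, `|u w| <= c) -> (forall w, `|v w| <= c) -> measurable U -> (P U <= p%:E)%E ->
  0 <= e -> (forall w, ~ U w -> `|u w - v w| <= e) -> (\int[P]_w (`|u w - v w|)%:E <= (e + 2 * c * p)%:E)%E.
Proof.
move=> mu mv uc vc mU PU e0 h.
have c0 : 0 <= c by apply: le_trans (uc point).
apply: (via (\int[P]_w (e + (2 * c) * \1_U w)%:E)%E).
  apply: int_le => //.
  - by apply: mcomp => //; exact: mfunB.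
  - by apply: mfunD => //; apply: mfunM => //; exact: measurable_indic.
  - move=> w; rewrite indicE; case: (boolP (w \in U)) => hw.
      rewrite mulr1; apply: le_trans (ler_normB _ _) _. by apply: (via (c + c)); [exact: lerD|lra].
    by rewrite mulr0 addr0; apply: h => Uw; move: hw; rewrite mem_set.
rewrite intD//; last 2 first.
- by apply: mfunM => //; exact: measurable_indic.
- by move=> w; rewrite !mulr_ge0.
rewrite int_prob_cst intZ//; last by rewrite mulr_ge0.
rewrite integral_indic// setIT EFinD [(2 * c * p)%:E]EFinM.
by apply: leeD => //; apply: lee_wpmul2l => //; rewrite lee_fin mulr_ge0.
Qed.

(** * Processes with a drift and their stability *)

Section DriftProcesses.
Variables (R : realType) (T : R) (m : nat) (P : probability (Omega T m) R).
Hypotheses (T0 : 0 < T) (WP : is_wiener P).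
Variable d : nat.
Implicit Types (b : R -> Omega T m -> 'cV[R]_d) (H : R -> Omega T m -> 'M[R]_(d, m)).

Definition drift b (w : Omega T m) (s : R) : 'cV[R]_d := \col_i (\int[leb]_(t in `[0, s]) b t w i 0).

(** The shape of [controlled] with the coefficients given as processes; it also covers Euler
    processes, whose coefficients are step processes. *)
Definition dproc b H (w : Omega T m) : Omega T d := mkpath T (fun s => drift b w s + ito P H w s).

Definition n1 p q (x : 'M[R]_(p, q)) : R := \sum_i \sum_j `|x i j|.

Lemma n1_ge0 p q (x : 'M[R]_(p, q)) : 0 <= n1 x.
Proof. by apply: sumr_ge0 => i _; apply: sumr_ge0. Qed.

Lemma n1_entry p q (x : 'M[R]_(p, q)) i j : `|x i j| <= n1 x.
Proof.
rewrite /n1 (bigD1 i)//= (bigD1 j)//= -addrA lerDl addr_ge0// sumr_ge0// => k _.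
by apply: sumr_ge0.
Qed.

Lemma jm_n1 p q (F : R -> Omega T m -> 'M[R]_(p, q)) : jointly_measurable F -> jm (fun t w => n1 (F t w)).
Proof.
move=> mF; rewrite /jm /n1; apply: mfun_sum => i; apply: mfun_sum => j.
by apply: mcomp => //; exact: mF.
Qed.

Lemma inner_restrict (F : R -> R) (s : R) : s <= T -> (\int[leb]_(t in `[0%R, s]) (F t)%:E =
   \int[leb]_(t in `[0%R, T]) (if (t <= s)%R then F t else 0%R)%:E)%E.
Proof.
move=> sT; rewrite integral_mkcond [RHS]integral_mkcond; apply: eq_integral => t _.
rewrite !patchE !mem_time.
case: (leP 0 t) => //= t0; case: (leP t s) => ts; last by case: ifP.
by rewrite (le_trans ts sT).
Qed.

Lemma jm_cut (K : R -> Omega T m -> R) (s : R) : jm K -> jm (fun t w => if t <= s then K t w else 0).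
Proof.
move=> jK; apply: (eq_measurable_fun (fun x : R * Omega T m => if x.1 <= s then onT K (x.2, x.1) else 0)).
  by move=> -[t w]; rewrite inE /= in_itv/= => -[ht _]; rewrite /onT /= ht.
apply: measurable_funTS; apply: measurable_fun_ifT => //.
  by apply: measurable_fun_ler => //; exact: measurable_fst.
apply: (mcomp (onT_measurable jK)).
by apply: measurable_fun_pair; [exact: measurable_snd|exact: measurable_fst].
Qed.

Section OneDrift.
Variables (b : R -> Omega T m -> 'cV[R]_d) (C : R).
Hypotheses (jb : jointly_measurable b) (bb : bounded_by b C).

Lemma bound_ge0 : 0 <= C.
Proof.
apply: le_trans (bb (t := 0) point _); first exact: n2_ge0.
by rewrite lexx ltW.
Qed.

Lemma jm_entry i : jm (fun t w => b t w i 0). Proof. exact: jb. Qed.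

Lemma integrable_entry w i (s : R) : s <= T ->
  (@lebesgue_measure R).-integrable `[0, s] (fun t => (b t w i 0)%:E).
Proof.
move=> sT.
have mI0 : measurable (`[0, T]%classic : set (measurableTypeR R)) by exact: measurable_itv.
have ms : measurable (`[0, s]%classic : set (measurableTypeR R)) by exact: measurable_itv.
have sub : `[0, s]%classic `<=` (`[0, T]%classic : set (measurableTypeR R)).
  by move=> t /=; rewrite !in_itv/= => /andP[-> h]; exact: le_trans h sT.
apply: (integrableS mI0 ms sub).
apply: (le_integrable mI0 (g := cst (C + 1)%:E)).
- exact: (jm_section w (jm_entry i)).
- move=> t; rewrite /= in_itv/= => ht; rewrite lee_fin.
  by apply: le_trans (bounded_entry i 0 (bb w ht)) _; exact: ler_norm.
- apply/integrableP; split; first exact: mcst.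
  rewrite integral_cst//= lebesgue_measure_itv /= lte_fin T0 -EFinB -EFinM; exact: ltry.
Qed.

Lemma drift0 w : drift b w 0 = 0.
Proof.
by apply/matrixP => i j; rewrite !mxE set_itv1 Rintegral_set1.
Qed.

Lemma drift_continuous w : {within `[0, T], continuous (drift b w)}.
Proof.
apply/subspace_continuousP => x hx; apply/cvgrPdist_le => e e0.
have hi i : \forall y \near within `[0, T] (nbhs x), `|drift b w x i 0 - drift b w y i 0| <= e.
  have /subspace_continuousP/(_ x hx)/cvgrPdist_le/(_ e e0) := parameterized_integral_continuous (ltW T0) (integrable_entry w i (lexx T)).
  by apply: filterS => y; rewrite !mxE.
have h : \forall y \near within `[0, T] (nbhs x), forall i, `|drift b w x i 0 - drift b w y i 0| <= e.
  by apply: filter_forall; exact: hi.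
apply: filterS h => y hy.
apply: mxnorm_le; first exact: ltW.
move=> i j; change (`|(drift b w x - drift b w y) i j| <= e).
by have := hy i; rewrite ord1 !mxE.
Qed.

Lemma measurable_drift (s : R) i : 0 <= s <= T -> mfunO T m (fun w => drift b w s i 0).
Proof.
move=> /andP[s0 sT]; under eq_fun do rewrite mxE /Rintegral integralE.
have jc (F : R -> R) : mfun F -> jm (fun t (w : Omega T m) => if t <= s then F (b t w i 0) else 0).
  by move=> mF; apply: (jm_cut (K := fun t w => F (b t w i 0))); exact: (mcomp mF (jm_entry i)).
have mp : mfun (fun x : R => Num.max x 0) by exact: measurable_maxr.
have mn : mfun (fun x : R => Num.max (- x) 0) by apply: measurable_maxr => //; exact: mcomp.
apply: mcomp; first exact: fine_measurable.
have ge0F (F : R -> R) : (forall x, 0 <= F x) -> forall (t : R) (w : Omega T m), 0 <= t <= T -> 0 <= (if t <= s then F (b t w i 0) else 0).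
  by move=> F0 t w _; case: ifP.
apply: emeasurable_funB.
- have := measurable_inner (jc _ mp) (ge0F _ (fun x => _)).
  under eq_fun do rewrite -(inner_restrict _ sT); move=> h.
  by under eq_fun do under eq_integral do rewrite funeposE -EFin_max; apply: h => x; rewrite le_max lexx orbT.
- have := measurable_inner (jc _ mn) (ge0F _ (fun x => _)).
  under eq_fun do rewrite -(inner_restrict _ sT); move=> h.
  by under eq_fun do under eq_integral do rewrite funenegE -EFinN -EFin_max; apply: h => x; rewrite le_max lexx orbT.
Qed.

End OneDrift.

Lemma dprocE b H Cb C : jointly_measurable b -> bounded_by b Cb -> good P H C ->
  forall w (t : R), 0 <= t <= T -> dproc b H w t = drift b w t + ito P H w t.
Proof.
move=> jb bb gH w t ht; rewrite /dproc mkpathE//; first exact: ltW.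
- apply/subspace_continuousP => x hx; apply: cvgD.
    by have /subspace_continuousP := drift_continuous jb bb (w := w); apply.
  by have /subspace_continuousP := @path_cont _ _ _ (ito P H w); apply.
- by rewrite drift0 path_start addr0.
Qed.

Lemma measurable_dproc b H Cb C : jointly_measurable b -> bounded_by b Cb -> good P H C ->
  mfunO T m (dproc b H).
Proof.
move=> jb bb gH; apply: measurable_Omega => t i ht.
under eq_fun do rewrite (dprocE jb bb gH)// mxE.
have h : mfunO T m (fun w => drift b w t i 0) := measurable_drift jb i ht.
apply: mfunD; first exact: h.
exact: (is_ito_meas (itoP T0 WP gH) ht).
Qed.

Lemma drift_diff b b' Cb Cb' w (s : R) i : jointly_measurable b -> bounded_by b Cb ->
  jointly_measurable b' -> bounded_by b' Cb' -> 0 <= s <= T ->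
  (`|drift b w s i ord0 - drift b' w s i ord0|%:E <= \int[leb]_(t in `[0%R, T]) (n1 (b t w - b' t w))%:E)%E.
Proof.
move=> jb bb jb' bb' /andP[s0 sT]; rewrite !mxE.
have i1 := integrable_entry jb bb w i sT; have i2 := integrable_entry jb' bb' w i sT.
have ms : measurable (`[0, s]%classic : set (measurableTypeR R)) by exact: measurable_itv.
rewrite -RintegralB// EFin_normr_Rintegral//; last first.
  by have := integrableB ms i1 i2; apply: eq_integrable.
apply: le_trans (le_abse_integral _ ms _) _.
  by have := measurable_int _ (integrableB ms i1 i2); exact.
have jn : jm (fun t w => n1 (b t w - b' t w)) by apply: jm_n1; exact: jointly_measurableB.
rewrite (inner_restrict (fun t => `|b t w i 0 - b' t w i 0|) sT).
apply: ge0_le_integral => //.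
- by move=> t _; rewrite lee_fin; case: ifP.
- apply: (jm_section w (K := fun t w => if t <= s then `|b t w i 0 - b' t w i 0| else 0)).
  apply: (jm_cut (K := fun t w => `|b t w i 0 - b' t w i 0|)).
  apply: mcomp => //; apply: mfunB; [exact: jb|exact: jb'].
- exact: (jm_section w jn).
- move=> t _; rewrite lee_fin; case: ifP => _; last exact: n1_ge0.
  by have := n1_entry (b t w - b' t w) i 0; rewrite !mxE.
Qed.

Lemma norm_sum_le (lam : R) (x y a a' u u' : 'cV[R]_d) : 0 < lam -> x = a + u -> y = a' + u' ->
  (forall i, `|a i 0 - a' i 0| <= lam / 2) -> n2 (u - u') <= (lam / 2) ^+ 2 -> `|x - y| <= lam.
Proof.
move=> lam0 -> -> ha hu; apply: mxnorm_le; first exact: ltW.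
move=> i j; rewrite ord1.
have -> : (a + u - (a' + u')) i 0 = (a i 0 - a' i 0) + (u - u') i 0 by rewrite !mxE opprD addrACA.
apply: le_trans (ler_normD _ _) _; rewrite (splitr lam); apply: lerD => //.
by apply: n2_entry_le => //; rewrite divr_ge0// ltW.
Qed.

(** Half of [lam] goes to the stochastic part, through [ito_max] at level [(lam / 2) ^+ 2], and half
    to the drift, through Markov's inequality for its L1 distance. A single majorant [K] serves
    both. *)
Lemma dproc_close b b' H H' Cb Cb' C C' (K : R -> Omega T m -> R) (lam q : R) :
  jointly_measurable b -> bounded_by b Cb -> jointly_measurable b' -> bounded_by b' Cb' ->
  good P H C -> good P H' C' -> jm K -> (forall (t : R) w, 0 <= t <= T -> n2 (H t w - H' t w) <= K t w) ->
  (forall (t : R) w, 0 <= t <= T -> n1 (b t w - b' t w) <= K t w) -> 0 < lam -> (D2 P K <= q%:E)%E ->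
  exists U : set (Omega T m), [/\ measurable U,
    (P U <= (((432 * m%:R) / (lam / 2) ^+ 2 + (lam / 2)^-1) * q)%:E)%E &
    forall w, ~ U w -> forall t : R, 0 <= t <= T -> `|dproc b H w t - dproc b' H' w t| <= lam].
Proof.
move=> jb bb jb' bb' gH gH' jK hK hK' lam0 hq.
have l2 : 0 < lam / 2 by rewrite divr_gt0.
have l22 : 0 < (lam / 2) ^+ 2 by rewrite exprn_gt0.
have iH := itoP T0 WP gH; have iH' := itoP T0 WP gH'.
have [jH _ _] := gH; have [jH' _ _] := gH'.
have K0 t w : 0 <= t <= T -> 0 <= K t w by move=> ht; apply: le_trans (hK t w ht); exact: n2_ge0.
have q0 : 0 <= q by rewrite -lee_fin; apply: le_trans hq; exact: D2_ge0.
have c0 : 0 <= 432 * m%:R / (lam / 2) ^+ 2.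
  apply: divr_ge0; last exact: ltW. exact: (mulr_ge0 (ler0n R 432) (ler0n R m)).
have h1 : ((432 * m%:R / (lam / 2) ^+ 2)%:E * D2 P (fun t w => n2 (H t w - H' t w)) <=
    (432 * m%:R / (lam / 2) ^+ 2 * q)%:E)%E.
  rewrite [leRHS]EFinM; apply: lee_wpmul2l; first by rewrite lee_fin.
  apply: le_trans hq; apply: D2_le => //; last by move=> *; exact: n2_ge0.
  by apply: jm_n2; exact: jointly_measurableB.
have [U1 [mU1 PU1 hU1]] := ito_max T0 WP iH iH' l22 h1.
pose F w := fine (\int[leb]_(t in `[0%R, T]) (n1 (b t w - b' t w))%:E)%E.
have jn : jm (fun t w => n1 (b t w - b' t w)) by apply: jm_n1; exact: jointly_measurableB.
have n0 t w : 0 <= t <= T -> 0 <= n1 (b t w - b' t w) by move=> _; exact: n1_ge0.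
have In0 w : (0 <= \int[leb]_(t in `[0%R, T]) (n1 (b t w - b' t w))%:E)%E.
  by apply: integral_ge0 => t _; rewrite lee_fin n1_ge0.
have mI := measurable_inner jn n0.
have hbig : (D2 P (fun t w => n1 (b t w - b' t w)) <= q%:E)%E by apply: le_trans hq; exact: D2_le.
pose U2 := [set w | ((lam / 2)%:E <= \int[leb]_(t in `[0%R, T]) (n1 (b t w - b' t w))%:E)%E].
have mU2 : measurable U2.
  have := emeasurable_fun_c_infty measurableT mI (lam / 2)%:E.
  by rewrite setTI => h; rewrite /U2; move: h; congr measurable.
have PU2 : (P U2 <= ((lam / 2)^-1 * q)%:E)%E.
  have -> : P U2 = (\int[P]_w (\1_U2 w)%:E)%E by rewrite integral_indic// setIT.
  rewrite EFinM -[leLHS](mul1e) -[1%E](_ : (((lam / 2)^-1)%:E * (lam / 2)%:E = 1)%E); last first.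
    by rewrite -EFinM mulVf// gt_eqF.
  rewrite -muleA; apply: lee_wpmul2l; first by rewrite lee_fin invr_ge0 ltW.
  apply: le_trans hbig; rewrite -ge0_integralZl//; last 2 first.
  - by apply/EFinP; exact: measurable_indic.
  - by rewrite lee_fin ltW.
  apply: ge0_le_integral => //.
  - by move=> w _; rewrite -EFinM lee_fin mulr_ge0// ltW.
  - by apply/EFinP; apply: mfunM => //; exact: measurable_indic.
  - move=> w _; rewrite -EFinM indicE; case: (boolP (w \in U2)) => [|_]; last by rewrite mulr0.
    by rewrite inE mulr1.
exists (U1 `|` U2); split; first exact: measurableU.
  apply: le_trans (measureU2 P mU1 mU2) _; rewrite mulrDl EFinD. by apply: leeD.
move=> w hw t ht.
have hw1 : ~ U1 w by move=> h; apply: hw; left.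
have hw2 : ~ U2 w by move=> h; apply: hw; right.
apply: (norm_sum_le lam0 (dprocE jb bb gH w ht) (dprocE jb' bb' gH' w ht)); last exact: hU1.
move=> i; rewrite -lee_fin; apply: le_trans (drift_diff w i jb bb jb' bb' ht) _.
by apply: ltW; rewrite ltNge; apply/negP.
Qed.

(** Off a small event the two paths are within the modulus of [gf]; on it the boundedness of [gf] is
    used. The threshold depends only on [gf], its bound and [e], not on the coefficients. *)
Lemma expectation_close (gf : Omega T d -> R) (Cg e : R) : UC gf -> (forall w, `|gf w| <= Cg) -> 0 < e ->
  exists2 k : R, 0 < k & forall b b' H H' Cb Cb' C C' (K : R -> Omega T m -> R),
  jointly_measurable b -> bounded_by b Cb -> jointly_measurable b' -> bounded_by b' Cb' ->
  good P H C -> good P H' C' -> jm K -> (forall (t : R) w, 0 <= t <= T -> n2 (H t w - H' t w) <= K t w) ->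
  (forall (t : R) w, 0 <= t <= T -> n1 (b t w - b' t w) <= K t w) -> (D2 P K <= k%:E)%E ->
  (\int[P]_w (`|gf (dproc b H w) - gf (dproc b' H' w)|)%:E <= e%:E)%E.
Proof.
move=> gU gC e0; have e2 : 0 < e / 2 by rewrite divr_gt0.
have [dl dl0 hdl] := gU _ e2.
have Cg0 : 0 <= Cg by apply: le_trans (gC point).
pose c := (432 * m%:R) / (dl / 2) ^+ 2 + (dl / 2)^-1.
have d2 : 0 < dl / 2 by rewrite divr_gt0.
have c0 : 0 < c.
  apply: ltr_wpDl; last by rewrite invr_gt0. apply: divr_ge0; last by rewrite exprn_ge0// ltW.
  exact: (mulr_ge0 (ler0n R 432) (ler0n R m)).
(* [Cg + 1] in place of [Cg] keeps the denominator positive when the bound is zero. *)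
have C1 : 0 < 4 * (Cg + 1) * c by rewrite !mulr_gt0// ltr_wpDl.
exists (e / (4 * (Cg + 1) * c)); first by rewrite divr_gt0.
move=> b b' H H' Cb Cb' C C' K jb bb jb' bb' gH gH' jK hK hK' hD.
have [U [mU PU hU]] := dproc_close jb bb jb' bb' gH gH' jK hK hK' dl0 hD.
have mg : mfunO T d gf by exact: UC_measurable.
have mX := measurable_dproc jb bb gH; have mX' := measurable_dproc jb' bb' gH'.
have mgX : mfunO T m (fun w => gf (dproc b H w)) by exact: (mcomp mg mX).
have mgX' : mfunO T m (fun w => gf (dproc b' H' w)) by exact: (mcomp mg mX').
have hoff w : ~ U w -> `|gf (dproc b H w) - gf (dproc b' H' w)| <= e / 2 by move=> Uw; apply: hdl => t ht; exact: hU.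
apply: le_trans (int_close mgX mgX' (fun w => gC _) (fun w => gC _) mU PU (ltW e2) hoff) _.
rewrite lee_fin.
have -> : 2 * Cg * (c * (e / (4 * (Cg + 1) * c))) = (Cg / (Cg + 1)) * (e / 2) by field; rewrite !gt_eqF// ltr_wpDl.
have : Cg / (Cg + 1) <= 1 by rewrite ler_pdivrMr ?ltr_wpDl// mul1r lerDl.
by move=> h; have := ler_wpM2r (ltW e2) h; rewrite mul1r; lra.
Qed.

End DriftProcesses.

(** * Adaptedness up to null sets *)

Section AeAdapted.
Variables (R : realType) (T : R) (m : nat) (P : probability (Omega T m) R).
Hypotheses (T0 : 0 < T) (WP : is_wiener P).
Local Notation aeF := (aeF P).

Lemma aeF_raw (t : R) (f : Omega T m -> R) : F_measurable t f -> aeF t f.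
Proof. by move=> mf; exists f => //; exact: aeW. Qed.

Lemma aeF_le (s t : R) (f : Omega T m -> R) : s <= t -> aeF s f -> aeF t f.
Proof. by move=> st [h mh eh]; exists h => //; exact: F_measurable_le mh. Qed.

Lemma aeF_cst (t c : R) : aeF t (fun=> c).
Proof. by apply: aeF_raw; apply/F_measurableP; exact: mcst. Qed.

Lemma aeFD (t : R) (f g : Omega T m -> R) : aeF t f -> aeF t g -> aeF t (fun w => f w + g w).
Proof.
move=> [h mh eh] [k mk ek]; exists (fun w => h w + k w).
  by apply/F_measurableP; apply: mfunD; apply/F_measurableP.
by apply: filterS2 eh ek => w -> ->.
Qed.

Lemma aeFM (t : R) (f g : Omega T m -> R) : aeF t f -> aeF t g -> aeF t (fun w => f w * g w).
Proof.
move=> [h mh eh] [k mk ek]; exists (fun w => h w * k w).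
  by apply/F_measurableP; apply: mfunM; apply/F_measurableP.
by apply: filterS2 eh ek => w -> ->.
Qed.

Lemma aeF_sum (I : Type) (r : seq I) (t : R) (f : I -> Omega T m -> R) :
  (forall i, aeF t (f i)) -> aeF t (fun w => \sum_(i <- r) f i w).
Proof.
move=> h; elim: r => [|i r IH]; first by under eq_fun do rewrite big_nil; exact: aeF_cst.
by under eq_fun do rewrite big_cons; exact: aeFD.
Qed.

Lemma ae_adaptedP p q (H : R -> Omega T m -> 'M[R]_(p, q)) :
  ae_adapted P H <-> forall (t : R), 0 <= t <= T -> forall a b, aeF t (fun w => H t w a b).
Proof.
split=> h t ht.
  have [G [mG eG]] := h t ht => a b; exists (fun w => G w a b); first exact: mG. by apply: filterS eG => w ->.
have ex (x : 'I_p * 'I_q) : exists g, F_measurable t g /\ {ae P, forall w, H t w x.1 x.2 = g w}.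
  by have [g mg eg] := h t ht x.1 x.2; exists g.
have [g hg] := choice ex; exists (fun w => \matrix_(a, b) g (a, b) w); split.
  by move=> a b; under eq_fun do rewrite mxE; have [] := hg (a, b).
have hae : {ae P, forall w, forall x : 'I_p * 'I_q, H t w x.1 x.2 = g x w}.
  by apply: filter_forall => x; have [] := hg x.
by apply: filterS hae => w hw; apply/matrixP => a b; rewrite mxE (hw (a, b)).
Qed.

Lemma Rintegral_lin dX (X : measurableType dX) (mu : {measure set X -> \bar R}) (D : set X)
    (I : Type) (r : seq I) (v : I -> R) (h : I -> X -> R) : measurable D ->
  (forall i, mu.-integrable D (EFin \o h i)) ->
  \int[mu]_(x in D) (\sum_(i <- r) v i * h i x) = \sum_(i <- r) v i * \int[mu]_(x in D) h i x.
Proof.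
move=> mD ih; have iv i : mu.-integrable D (EFin \o (fun x => v i * h i x)).
  by apply: (eq_integrable mD (fun x => (v i)%:E * (EFin \o h i) x)%E) => //; exact: integrableZl.
have is_ (s : seq I) : mu.-integrable D (EFin \o (fun x => \sum_(i <- s) v i * h i x)).
  apply: (eq_integrable mD (fun x => \sum_(i <- s) (v i * h i x)%:E)%E).
    by move=> x _; rewrite /= sumEFin.
  by apply: integrable_sum => // i _; exact: iv.
elim: r => [|i r IH].
  rewrite big_nil; under eq_Rintegral do rewrite big_nil. by rewrite /Rintegral integral0.
under eq_Rintegral do rewrite big_cons.
by rewrite RintegralD// IH big_cons RintegralZl.
Qed.

(** The null sets of [ae_adapted] depend on time, so Fubini alone does not yield measurability at
    time [t]. The drift is approximated by that of a sampled step process, which is a finite sum of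
    samples taken before [t]. *)
Lemma drift_adapted d (b : R -> Omega T m -> 'cV[R]_d) C (t : R) i :
  jointly_measurable b -> bounded_by b C -> ae_adapted P b -> 0 <= t <= T -> aeF t (fun w => drift b w t i 0).
Proof.
move=> jb bb /ae_adaptedP ab ht.
have C0 := bound_ge0 T0 bb; have C1 : 0 <= C + 1 by rewrite addr_ge0.
apply: aeF_closed; first exact: measurable_drift.
move=> e e0.
pose B := (d%:R * (C + 1) + 1) * T.
have dC : 0 <= d%:R * (C + 1) by rewrite mulr_ge0.
have dC1 : 0 < d%:R * (C + 1) + 1 by rewrite ltr_wpDl.
have B0 : 0 < B by rewrite mulr_gt0.
pose M := d%:R * (2 * (C + 1)) * T + 1.
have M0 : 0 < M by rewrite ltr_wpDl// !mulr_ge0// ltW.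
have eM : 0 < e / (2 * M) by rewrite divr_gt0// mulr_gt0.
have je x : jm (entries b x) by move: x => [a c]; exact: jb.
have fe x (s : R) w : 0 <= s <= T -> `|entries b x s w| <= C + 1 by move=> hs; apply: bounded_entry; exact: bb.
have [N _ hN] : \forall n \near \oo, n.+1%:R^-1 < e / (2 * M * B).
  have eT : 0 < e / (2 * M * B) by rewrite divr_gt0// !mulr_gt0. exact: (near_infty_natSinv_lt (PosNum eT)).
have [n Nn [r [hr hsum]]] := sample_points P T0 je C1 fe N eM.
have hn := hN n Nn; rewrite /= in hn.
pose dl := T / n.+1%:R.
have rT j : (j <= n)%N -> 0 <= r j <= T by move=> jn; rewrite (sample_ge0 T0 hr jn) (sample_leT T0 hr jn).
(* The process sampled at the points of [sample_points]; its values are values of [b] or zero, so it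
   keeps the bound [C]. *)
pose St (s : R) w : 'cV[R]_d := \sum_(j < n.+1) (if r j < s <= stop T n r j then b (r j) w else 0).
have bSt : bounded_by St C.
  move=> s w hs; case: (step_cases T0 hr (fun j => b (r j) w) hs) => [[_ e1]|[j [jn _ e1]]].
    by rewrite /St e1 n20.
  by rewrite /St e1; apply: bb; exact: rT.
have jSt : jointly_measurable St.
  move=> a c; apply: (eq_measurable_fun (fun x : R * Omega T m => \sum_(j < n.+1)
     (if r j < x.1 <= stop T n r j then b (r j) x.2 a c else 0))).
    by move=> x _; rewrite /St summxE; apply: eq_bigr => j _; case: ifP => //; rewrite mxE.
  apply: mfun_sum => j; apply: measurable_funTS; apply: measurable_fun_ifT => //.
    apply: measurable_and.
      by apply: measurable_fun_ltr => //; exact: measurable_fst.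
    by apply: measurable_fun_ler => //; exact: measurable_fst.
  have h1 : mfunO T m (fun w => b (r j) w a c).
    have h2 : jm (fun t w => b t w a c) by exact: jb. have := measurable_fun_pair1 (r j) (onT_measurable h2).
    by rewrite /onT /= rT// -ltnS.
  exact: (mcomp h1 measurable_snd).
exists (fun w => drift St w t i 0); split.
(* Each sample is multiplied by the length of its interval inside [[0, t]], a deterministic number
   that vanishes when [r j] is after [t]. *)
- have eS w : drift St w t i 0 = \sum_(j < n.+1) b (r j) w i 0 *
      \int[leb]_(s in `[0, t]) (if r j < s <= stop T n r j then 1 else 0).
    rewrite mxE -Rintegral_lin//.
    - apply: eq_Rintegral => s _; rewrite /St summxE; apply: eq_bigr => j _.
      by case: ifP; rewrite ?mulr1// mxE mulr0.
    - move=> j; apply/integrableP; split.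
        apply/EFinP; apply: measurable_funTS; apply: measurable_fun_ifT => //.
        by apply: measurable_and; [exact: measurable_fun_ltr|exact: measurable_fun_ler].
      apply: (@le_lt_trans _ _ (\int[leb]_(s in `[0%R, t]) (cst 1%E s))%E).
        apply: ge0_le_integral => //; last by move=> s _; rewrite /= lee_fin; case: ifP; rewrite ?normr1 ?normr0.
        apply/EFinP; apply: mcomp => //; apply: measurable_funTS; apply: measurable_fun_ifT => //.
        by apply: measurable_and; [exact: measurable_fun_ltr|exact: measurable_fun_ler].
      rewrite integral_cst//= lebesgue_measure_itv/=; case: ifP => _; rewrite ?mule0 ?mul1e ?ltry//.
  have -> : (fun w => drift St w t i 0) = (fun w => \sum_(j < n.+1) b (r j) w i 0 *
      \int[leb]_(s in `[0, t]) (if r j < s <= stop T n r j then 1 else 0)).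
    by apply/funext => w; exact: eS.
  apply: aeF_sum => j; case: (leP (r j) t) => rt.
    by apply: aeFM; [apply: aeF_le rt _; apply: ab; rewrite rT// -ltnS|exact: aeF_cst].
  rewrite (_ : \int[leb]_(s in `[0, t]) _ = 0); last first.
    rewrite (eq_Rintegral _ (g := fun=> 0)); first by rewrite /Rintegral integral0.
    move=> s; rewrite inE/= in_itv/= => /andP[_ st]; case: ifP => // /andP[h _].
    by have := lt_le_trans (lt_trans rt h) st; rewrite ltxx.
  by under eq_fun do rewrite mulr0; exact: aeF_cst.
- exact: measurable_drift.
have hsmall : (D2 P (fun s w => n1 (b s w - St s w)) <= (e / M)%:E)%E.
  have mw j : (j <= n)%N -> jm (window (entries b) (4 * dl) (r j)) by move=> jn; apply: jm_window => //; exact: rT.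
  apply: le_trans (sample_D2 T0 mw _ _ dC ler01 _) _.
  - by apply: jm_n1; exact: jointly_measurableB.
  - by move=> *; exact: n1_ge0.
  - apply: aeW => w s hs; case: (step_cases T0 hr (fun j => b (r j) w) hs) => [[sd e1]|[j [jn wj e1]]]; rewrite /St e1; [left|right].
      split=> //; rewrite subr0 /n1; under eq_bigr do rewrite big_ord1.
      apply: (via (\sum_(a < d) (C + 1))); last by rewrite sumr_const card_ord mulr_natl.
      by apply: ler_sum => a _; apply: bounded_entry; exact: bb.
    exists j; split=> //; rewrite mul1r spread_entries /n1; apply: ler_sum => a _; apply: ler_sum => c _.
    by rewrite !mxE distrC.
  have dl0 : 0 <= dl by rewrite divr_ge0// ltW.
  apply: (via ((d%:R * (C + 1) * dl)%:E + (e / (2 * M))%:E)%E); first by rewrite leeD2l// mul1e.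
  rewrite -EFinD lee_fin. have : d%:R * (C + 1) * dl <= B * (e / (2 * M * B)).
    have h1 : dl <= T * (e / (2 * M * B)) by apply: ler_wpM2l; exact: ltW.
    have h2 : d%:R * (C + 1) <= d%:R * (C + 1) + 1 by rewrite lerDl.
    by have h3 := ler_pM dC dl0 h2 h1; rewrite /B -[X in _ <= X]mulrA; exact: h3.
  have -> : B * (e / (2 * M * B)) = e / M - e / (2 * M) by field; rewrite !gt_eqF. lra.
have mD : mfunO T m (fun w => drift b w t i 0 - drift St w t i 0) by apply: mfunB; exact: measurable_drift.
have hMb w : `|drift b w t i 0 - drift St w t i 0| <= M.
  rewrite -lee_fin; apply: le_trans (drift_diff T0 w i jb bb jSt bSt ht) _.
  apply: (via (\int[leb]_(s in `[0%R, T]) (cst (d%:R * (2 * (C + 1)))%:E s))%E).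
    apply: ge0_le_integral => //.
    - by move=> s _; rewrite lee_fin n1_ge0.
    - by apply: (jm_section w (K := fun s w => n1 (b s w - St s w))); apply: jm_n1; exact: jointly_measurableB.
    - move=> s; rewrite /= in_itv/= => hs; rewrite lee_fin /n1; under eq_bigr do rewrite big_ord1.
      apply: (via (\sum_(a < d) (2 * (C + 1)))); last by rewrite le_eqVlt; apply/orP; left; apply/eqP; rewrite sumr_const card_ord; exact: esym (mulr_natl _ _).
      apply: ler_sum => a _; rewrite !mxE; apply: le_trans (ler_normB _ _) _.
      by have := bounded_entry a 0 (bb s w hs); have := bounded_entry a 0 (bSt s w hs); lra.
  rewrite integral_cst//= lebesgue_measure_itv/= lte_fin T0 -EFinB subr0 -EFinM lee_fin /M. by rewrite lerDl.
have ma : mfunO T m (fun w => `|drift b w t i 0 - drift St w t i 0|) by apply: mcomp.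
(* Both drifts are bounded, so the second moment of the difference is at most [M] times its first
   moment. *)
apply: (via (\int[P]_w (M * `|drift b w t i ord0 - drift St w t i ord0|)%:E)%E).
  apply: int_le.
  - exact: mfunX.
  - exact: mfunM.
  - by move=> w; exact: sqr_ge0.
  - move=> w; rewrite -[X in X <= _]ger0_norm ?sqr_ge0// normrX expr2; exact: ler_wpM2r.
rewrite intZ//; last exact: ltW.
apply: (via (M%:E * (e / M)%:E)%E); last first.
  by rewrite -EFinM lee_fin mulrC divfK// gt_eqF.
apply: lee_wpmul2l; first by rewrite lee_fin ltW.
apply: le_trans hsmall; apply: ge0_le_integral => //.
- exact/EFinP.
- apply: measurable_inner; last by move=> *; exact: n1_ge0.
  by apply: jm_n1; exact: jointly_measurableB.
- by move=> w _; exact: (drift_diff T0 w i jb bb jSt bSt ht).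
Qed.

Lemma dproc_adapted d (b : R -> Omega T m -> 'cV[R]_d) H Cb C (t : R) i :
  jointly_measurable b -> bounded_by b Cb -> ae_adapted P b -> good P H C -> 0 <= t <= T ->
  aeF t (fun w => dproc P b H w t i 0).
Proof.
move=> jb bb ab gH ht.
have e : (fun w => dproc P b H w t i 0) = (fun w => drift b w t i 0 + ito P H w t i 0).
  by apply/funext => w; rewrite (dprocE T0 jb bb gH w ht) mxE.
rewrite e; apply: aeFD; first exact: (drift_adapted i jb bb ab ht).
exact: (ito_adapted T0 (itoP T0 WP gH) ht).
Qed.

Definition asF (t : R) (E : set (Omega T m)) :=
  exists2 E', path_filtration t E' & {ae P, forall w, E w <-> E' w}.

(** The sets whose preimage is almost surely an event of time [t] form a sigma-algebra; the
    cylinders belong to it by the hypothesis on the coordinates. *)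
Lemma asF_preimage d (X : Omega T m -> Omega T d) (t : R) (B : set (Omega T d)) :
  (forall s i, 0 <= s <= t -> aeF t (fun w => X w s i 0)) -> path_filtration t B -> asF t (X @^-1` B).
Proof.
move=> hX; pose D : set (set (Omega T d)) := [set B | asF t (X @^-1` B)].
suff : <<s cylinders t >> `<=` D by apply.
apply: smallest_sub.
  split.
  - exists set0; first exact: (@measurable0 _ (OmF T m t)).
    by apply: aeW => w.
  - move=> E [E' mE' eE']; exists (~` E').
      exact: (@measurableC _ (OmF T m t)).
    apply: filterS eE' => w /= h; split => [[_ h1] h2|h1]; first by apply: h1; apply/h.
    by split => // h2; apply: h1; apply/h.
  - move=> E hE; have ex n : exists E', path_filtration t E' /\ {ae P, forall w, E n (X w) <-> E' w}.
      by have [E' mE' eE'] := hE n; exists E'.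
    have [E' hE'] := choice ex; exists (\bigcup_n E' n).
      by apply: (@bigcupT_measurable _ (OmF T m t)) => n; have [] := hE' n.
    have hae : {ae P, forall w, forall n, E n (X w) <-> E' n w} by apply: ae_foralln => n; have [] := hE' n.
    by apply: filterS hae => w hw; split => -[n _ h]; exists n => //; apply/hw.
move=> _ [s [i [Y [hs mY ->]]]]; have [h mh eh] := hX s i hs.
exists (h @^-1` Y); first exact: mh.
by apply: filterS eh => w /= ->.
Qed.

Lemma asF_indic (t : R) (E : set (Omega T m)) : asF t E -> aeF t (fun w => \1_E w).
Proof.
move=> [E' mE' eE']; exists (fun w => \1_E' w).
  by apply/F_measurableP; apply: (@measurable_indic _ (OmF T m t)).
apply: filterS eE' => w h; rewrite !indicE; congr (_%:R); congr nat_of_bool.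
by apply/idP/idP; rewrite !inE => /h.
Qed.

(** [f] is replaced by a step function over its level sets, whose preimages are covered by
    [asF_preimage]. This gives the adaptedness of a dual integrand along the controlled path. *)
Lemma aeF_comp d (X : Omega T m -> Omega T d) (t C : R) (f : Omega T d -> R) : t <= T -> mfunO T m X ->
  (forall s i, 0 <= s <= t -> aeF t (fun w => X w s i 0)) ->
  F_measurable t f -> (forall w, `|f w| <= C) -> aeF t (fun w => f (X w)).
Proof.
move=> tT mX hX mf fC.
have mfT : mfunO T d f by exact: F_measurableT mf.
apply: aeF_closed; first exact: (mcomp mfT mX).
(* Levels have height [ep], and the cap at 1 gives [ep ^+ 2 <= e] for the squared error. *)
move=> e e0; pose ep := Num.min e 1.
have ep0 : 0 < ep by rewrite lt_min e0 ltr01.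
have C0 : 0 <= C by apply: le_trans (fC point).
pose N := (Num.truncn (2 * C / ep)).+1.
pose B k : set (Omega T d) := f @^-1` `[- C + k%:R * ep, - C + k.+1%:R * ep[%classic.
have mB k : path_filtration t (B k) by apply: mf; exact: measurable_itv.
have mS : mfunO T m (fun w => \sum_(k < N) (- C + k%:R * ep) * \1_(B k) (X w)).
  apply: mfun_sum => k; apply: mfunM => //. have mBT : measurable (B k : set (Omega T d)).
    by have := @measurable_OmF_Omega _ _ d _ tT measurableT (B k) (mB k); rewrite setTI.
  have m1 : mfunO T d (fun x => \1_(B k) x : R) by exact: measurable_indic. exact: (mcomp m1 mX).
exists (fun w => \sum_(k < N) (- C + k%:R * ep) * \1_(B k) (X w)); split => //.
- apply: aeF_sum => k; apply: aeFM; first exact: aeF_cst.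
  have := asF_indic (asF_preimage hX (mB k)).
  suff -> : (fun w => \1_(X @^-1` B k) w) = (fun w => \1_(B k) (X w)) :> (Omega T m -> R) by [].
  by apply/funext => w; rewrite !indicE; congr (_%:R); congr nat_of_bool; apply/idP/idP; rewrite !inE.
have close w : (f (X w) - \sum_(k < N) (- C + k%:R * ep) * \1_(B k) (X w)) ^+ 2 <= e.
  set x := X w; have /andP[fl fu] : - C <= f x <= C by rewrite -ler_norml.
  have x0 : 0 <= (f x + C) / ep by rewrite divr_ge0 ?(ltW ep0)//; lra. pose k0 := Num.truncn ((f x + C) / ep).
  have /andP[k1 k2] := truncn_itv x0; rewrite -/k0 in k1 k2. have k0N : (k0 < N)%N.
    rewrite ltnS; apply: le_truncn; apply: ler_wpM2r; first by rewrite invr_ge0 ltW. by lra.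
  rewrite ler_pdivlMr// in k1; rewrite ltr_pdivrMr// in k2. have inB k : (x \in B k) = (k == k0).
    apply/idP/eqP => [|->]; last first.
      by rewrite inE /B /= in_itv/=; apply/andP; split; lra.
    rewrite inE /B /= in_itv/= => /andP[h1 h2]; apply/eqP; rewrite eqn_leq; apply/andP; split.
      rewrite -ltnS -(ltr_nat R) -(ltr_pM2r ep0); lra.
    rewrite -ltnS -(ltr_nat R) -(ltr_pM2r ep0); lra.
  rewrite (bigD1 (Ordinal k0N))//= big1 => [|k kk]; last first.
    rewrite indicE inB; case: eqP => [ek|_]; last by rewrite mulr0. by case/negP: kk; apply/eqP/val_inj.
  rewrite addr0 indicE inB eqxx mulr1. have h1 : 0 <= f x - (- C + k0%:R * ep) <= ep.
    by move: k2; rewrite -natr1 mulrDl mul1r => k2; apply/andP; split; lra.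
  have [e1 e2] : ep <= e /\ ep <= 1 by rewrite /ep !ge_min !lexx orbT. by move: h1 => /andP[h1 h2]; nra.
rewrite -(int_prob_cst P); apply: int_le => //; last by move=> w; exact: sqr_ge0.
by apply: mfunX; apply: mfunB; [exact: (mcomp mfT mX)|exact: mS].
Qed.

End AeAdapted.

(** * Coefficients along a control *)

Section MeasurableComposition.
Variable R : realType.

Lemma compact_net (V : normedModType R) (K : set V) (dl : R) : compact K -> 0 < dl ->
  exists s : seq V, (forall a, a \in s -> K a) /\ forall a, K a -> exists2 b, b \in s & `|a - b| < dl.
Proof.
rewrite compact_cover => cK dl0.
have [|a Ka|D hD hK] := cK V K (fun a => ball a dl).
- by move=> a _; exact: ball_open.
- by exists a => //; exact: ballxx.
exists (finmap.enum_fset D); split => [a aD|a Ka]; first by have := hD a aD; rewrite inE.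
by have [b bD hb] := hK a Ka; exists b => //; rewrite distrC; move: hb; rewrite -ball_normE.
Qed.

(** The function [h] is continuous only within [K] and need not be measurable elsewhere. Its values
    at the points of finite nets of [K], selected by distance, approximate the composition
    uniformly. *)
Lemma measurable_comp_compact dX (X : measurableType dX) (V : normedModType R) (K : set V)
    (u : X -> V) (h : V -> R) : compact K -> (forall x, K (u x)) ->
  (forall a, K a -> mfun (fun x => `|u x - a|)) -> {within K, continuous h} -> mfun (fun x => h (u x)).
Proof.
move=> cK Ku mu ch.
have ex n : exists s : seq V, (forall a, a \in s -> K a) /\ exists dl : R,
    (forall a, K a -> exists2 b, b \in s & `|a - b| < dl) /\
    forall a b, K a -> K b -> `|a - b| < dl -> `|h a - h b| < n.+1%:R^-1.
  have e0 : 0 < n.+1%:R^-1 :> R by rewrite invr_gt0. have [dl dl0 hdl] := heine_cantor (V := R^o) cK ch e0.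
  by have [s [h1 h2]] := compact_net cK dl0; exists s; split => //; exists dl.
have [s hs] := choice ex.
have [dl hdl] := choice (fun n => (hs n).2).
(* The value of [h] at the first net point within [dl]; the default 0 is never reached for arguments
   in [K]. *)
pose sel (l : seq V) (dl : R) (a : V) : R := foldr (fun b r => if `|a - b| < dl then h b else r) 0 l.
apply: (@measurable_realfun.measurable_fun_cvg _ _ _ _ (fun n x => sel (s n) (dl n) (u x))).
  move=> n; have : forall a, a \in s n -> K a by exact: (hs n).1.
  elim: (s n) => [|b l IH] hl; first exact: mcst. apply: measurable_fun_ifT => //.
    by apply: measurable_fun_ltr => //; apply: mu; apply: hl; rewrite inE eqxx.
  by apply: IH => a al; apply: hl; rewrite inE al orbT.
move=> x _; apply/cvgrPdist_lt => e e0.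
have := near_infty_natSinv_lt (PosNum e0); apply: filterS => n /= hn.
apply: lt_trans hn.
have [h1 h2] := hdl n; have [b bs hb] := h1 _ (Ku x).
have : forall a, a \in s n -> K a by exact: (hs n).1.
elim: (s n) bs => // c l IH; rewrite inE => hbl hl /=.
case: ifP => [hc|hc]; first by apply: h2 => //; apply: hl; rewrite inE eqxx.
case/orP: hbl => [/eqP e1|bl]; first by rewrite -e1 hb in hc.
by apply: IH => // a al; apply: hl; rewrite inE al orbT.
Qed.

End MeasurableComposition.

Lemma n1_le_n2 (R : realType) p q (x : 'M[R]_(p, q)) : n1 x <= (p * q)%:R * (1 + n2 x).
Proof.
have h i j : `|x i j| <= 1 + n2 x.
  apply: le_trans (norm_le_sqr (x i j) ltr01) _; rewrite invr1 mul1r lerD2l; exact: n2_entry.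
apply: (via (\sum_(i < p) \sum_(j < q) (1 + n2 x))); first by do 2!apply: ler_sum => ? _.
by rewrite !sumr_const !card_ord -mulrnA mulr_natl mulnC.
Qed.

Section Coefficients.
Variables (R : realType) (T : R) (m k : nat) (P : probability (Omega T m) R).
Hypotheses (T0 : 0 < T) (WP : is_wiener P).
Variable A : set 'cV[R]_k.
Hypotheses (cA : compact A).

Lemma measurable_mxnorm dX (X : measurableType dX) p q (F : X -> 'M[R]_(p, q)) :
  (forall a b, mfun (fun x => F x a b)) -> mfun (fun x => `|F x|).
Proof.
move=> mF; under eq_fun do rewrite [`|_|]mx_normrE.
elim: (index_enum _) => [|i r IH]; first by under eq_fun do rewrite big_nil; exact: mcst.
under eq_fun do rewrite big_cons.
apply: measurable_maxr => //; apply: mcomp => //; exact: mF.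
Qed.

Section OneCoefficient.
Variables (p q : nat) (f : R -> 'cV[R]_k -> 'M[R]_(p, q)) (C L delta0 : R).
Hypotheses (fC : forall t a, 0 <= t -> A a -> enorm (f t a) <= C)
  (fA : forall t, 0 <= t -> {within A, continuous (f t)}) (d0 : 0 < delta0 <= 1)
  (fL : forall s t a, 0 <= s -> 0 <= t -> A a -> enorm (f t a - f s a) <= L * (`|t - s| `^ delta0)).

Local Notation D := ((`[0, T]%classic `*` A) : set (R * 'cV[R]_k)%type).

Lemma coef_compact : compact D.
Proof. by apply: compact_setX => //; exact: segment_compact. Qed.

(** Continuity in the control at a fixed time, together with a Hölder bound in time that is uniform
    in the control, gives joint continuity. *)
Lemma coef_continuous : {within D, continuous (fun x : (R * 'cV[R]_k)%type => f x.1 x.2)}.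
Proof.
apply/subspace_continuousP => -[s b] [/= hs Ab]; apply/cvgrPdist_lt => e e0.
rewrite in_itv/= in hs; have /andP[s0 sT] := hs.
have e2 : 0 < e / 2 by rewrite divr_gt0.
have [r1 r10 h1] : exists2 r1 : R, 0 < r1 & forall a, A a -> `|b - a| < r1 -> `|f s b - f s a| < e / 2.
  have /subspace_continuousP/(_ b Ab)/cvgrPdist_lt/(_ _ e2) := fA s0.
  rewrite near_withinE => /nbhs_ballP[r1 r10 h]; exists r1 => // a Aa ha.
  by apply: h => //; rewrite -ball_normE.
pose L1 := `|L| + 1; have L10 : 0 < L1 by rewrite ltr_wpDl.
(* The radius at which the Hölder bound with constant [L1] equals [e / 4]. *)
pose r2 : R := (e / (4 * L1)) `^ delta0^-1.
have /andP[dp _] := d0.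
have eL : 0 < e / (4 * L1) by rewrite divr_gt0// mulr_gt0.
have r20 : 0 < r2 by rewrite powR_gt0.
have h2 (t : R) a : 0 <= t -> A a -> `|s - t| < r2 -> `|f s a - f t a| < e / 2.
  move=> t0 Aa ht; apply: le_lt_trans (mxnorm_enorm _) _. apply: le_lt_trans (fL t0 s0 Aa) _.
  apply: (@le_lt_trans _ _ (L1 * `|s - t| `^ delta0)).
    by apply: ler_wpM2r; [exact: powR_ge0|apply: le_trans (ler_norm L) _; rewrite /L1 lerDl].
  have h3 : `|s - t| `^ delta0 <= e / (4 * L1).
    have -> : e / (4 * L1) = r2 `^ delta0 by rewrite /r2 -powRrM mulVf ?gt_eqF// powRr1// ltW.
    by apply: ge0_ler_powR; rewrite ?nnegrE ?(ltW dp) ?(ltW r20)//; exact: ltW.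
  apply: (@le_lt_trans _ _ (L1 * (e / (4 * L1)))); first by apply: ler_wpM2l => //; exact: ltW.
  have -> : L1 * (e / (4 * L1)) = e / 4 by field; rewrite gt_eqF. lra.
apply/nbhs_ballP; exists (Num.min r1 r2); first by rewrite /= lt_min r10.
move=> [t a] [/= ht ha] [/= tI Aa]; rewrite in_itv/= in tI.
have -> : f s b - f t a = (f s b - f s a) + (f s a - f t a) by rewrite addrA subrK.
move: ht ha; rewrite -!ball_normE /ball_/= !lt_min => /andP[_ ht] /andP[ha _].
rewrite (splitr e); apply: le_lt_trans (ler_normD _ _) _; apply: ltrD; first exact: h1.
by apply: h2 => //; case/andP: tI.
Qed.

Lemma coef_unif (e : R) : 0 < e -> exists2 dl : R, 0 < dl & forall (s t : R) a b,
  0 <= s <= T -> 0 <= t <= T -> A a -> A b -> `|s - t| < dl -> `|a - b| < dl ->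
  n1 (f s a - f t b) <= e /\ n2 (f s a - f t b) <= e.
Proof.
move=> e0; pose c : R := (p * q)%:R + 1.
have c0 : 0 < c by rewrite ltr_wpDl.
pose e1 := Num.min 1 (e / c).
have e10 : 0 < e1 by rewrite lt_min ltr01 divr_gt0.
have [dl dl0 h] := heine_cantor coef_compact coef_continuous e10.
exists dl => // s t a b hs ht Aa Ab st ab.
have hn : `|f s a - f t b| < e1.
  apply: (h (s, a) (t, b)); [by split => //=; rewrite in_itv|by split => //=; rewrite in_itv|].
  by rewrite prod_normE /= gt_max st ab.
have le1 : e1 <= e / c by rewrite ge_min lexx orbT.
have le2 : e1 <= 1 by rewrite ge_min lexx.
have ce : (p * q)%:R * e1 <= e.
  apply: (via (c * (e / c))); last by rewrite mulrC divfK// gt_eqF.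
  by apply: ler_pM => //; [exact: ltW|rewrite /c lerDl].
split.
  apply: le_trans ce; apply: (via (\sum_(i < p) \sum_(j < q) e1)); last first.
    by rewrite !sumr_const !card_ord -mulrnA -(mulr_natl e1) mulnC.
  apply: ler_sum => i _; apply: ler_sum => j _. by apply: le_trans (entry_mxnorm _ _ _) (ltW hn).
apply: le_trans (n2_le_mxnorm _) _; apply: le_trans ce; apply: ler_wpM2l => //.
apply: (via (e1 * e1)); first by rewrite expr2; apply: ler_pM => //; exact: ltW.
by rewrite ler_piMr// ltW.
Qed.

(** The form needed to integrate over time: a small error where the two controls are close, and a
    fixed bound where they are not, so that only the size of the second set matters. *)
Lemma coef_gap : exists2 B : R, 0 <= B & forall e : R, 0 < e -> exists2 dl : R, 0 < dl &
  forall (t : R) a b, 0 <= t <= T -> A a -> A b ->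
    n1 (f t a - f t b) <= e + (if `|a - b| < dl then 0 else B) /\
    n2 (f t a - f t b) <= e + (if `|a - b| < dl then 0 else B).
Proof.
pose B2 := 4 * C ^+ 2.
have B20 : 0 <= B2 by rewrite mulr_ge0// sqr_ge0.
have B0 : 0 <= (p * q)%:R * (1 + B2) :> R by rewrite mulr_ge0// addr_ge0.
exists ((p * q)%:R * (1 + B2) + B2); first by rewrite addr_ge0.
move=> e e0; have [dl dl0 hdl] := coef_unif e0.
exists dl => // t a b ht Aa Ab; case: ifPn => [ab|_].
  by rewrite !addr0; apply: hdl => //; rewrite subrr normr0.
have t0 : 0 <= t by case/andP: ht.
have n2C c : A c -> n2 (f t c) <= C ^+ 2.
  move=> Ac; have h := fC t0 Ac; rewrite -enorm_sqr lerXn2r ?nnegrE ?enorm_ge0//.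
  exact: le_trans (enorm_ge0 _) h.
have h2 : n2 (f t a - f t b) <= B2.
  by apply: le_trans (n2B _ _) _; rewrite /B2; have := n2C a Aa; have := n2C b Ab; lra.
split; last by apply: le_trans h2 _; rewrite addrA lerDr addr_ge0// ltW.
apply: le_trans (n1_le_n2 _) _; apply: (via ((p * q)%:R * (1 + B2))).
  by rewrite ler_wpM2l// lerD2l.
by rewrite addrCA lerDl addr_ge0// ltW.
Qed.

Variables (alpha : R -> Omega T m -> 'cV[R]_k).
Hypothesis hal : @admissible R T m k A alpha.

Lemma coef_bounded : bounded_by (fun t w => f t (alpha t w)) (C ^+ 2).
Proof.
move=> t w ht; have [_ _ hA] := hal; rewrite -enorm_sqr.
have h := fC (andP ht).1 (hA t w ht).
by rewrite lerXn2r ?nnegrE ?enorm_ge0// (le_trans (enorm_ge0 _) h).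
Qed.

Lemma coef_jm : jointly_measurable (fun t w => f t (alpha t w)).
Proof.
move=> i j; have [jal _ hA] := hal.
have z0 : 0 <= (0 : R) <= T by rewrite lexx ltW.
(* Outside [[0, T]] the control may leave [A]; there the pair is replaced by a fixed point of the
   compact domain. *)
pose u (x : R * Omega T m) : (R * 'cV[R]_k)%type :=
  if 0 <= x.1 <= T then (x.1, alpha x.1 x.2) else (0, alpha 0 point).
have uD x : D (u x).
  rewrite /u; case: ifP => hx; split => //=; rewrite ?in_itv//; exact: hA.
have mu' (y : R * 'cV[R]_k) : D y -> mfun (fun x => `|u x - y|).
  move=> _; apply: (eq_measurable_fun (fun x : R * Omega T m =>
    if 0 <= x.1 <= T then Num.max `|x.1 - y.1| `|\col_l onT (fun t w => alpha t w l 0) (x.2, x.1) - y.2|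
    else `|((0 : R), alpha 0 point) - y|)).
    move=> x _; rewrite /u; case: ifP => // hx; rewrite prod_normE /=; congr (Num.max _ `|_ - _|).
    by apply/matrixP => a b; rewrite mxE ord1 /onT /= hx.
  apply: measurable_fun_ifT => //.
  - by apply: measurable_and; apply: measurable_fun_ler => //; exact: measurable_fst.
  - apply: measurable_maxr.
      by apply: mcomp => //; apply: mfunB => //; exact: measurable_fst.
    apply: measurable_mxnorm => a b; apply: measurable_mxB => //; under eq_fun do rewrite mxE.
    have h : jm (fun t w => alpha t w a 0) by exact: jal. apply: (mcomp (onT_measurable h)).
    by apply: measurable_fun_pair; [exact: measurable_snd|exact: measurable_fst].
have ch : {within D, continuous (fun x : (R * 'cV[R]_k)%type => f x.1 x.2 i j)}.
  apply/subspace_continuousP => x hx. have /subspace_continuousP/(_ x hx) := coef_continuous.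
  by move=> h; apply: (continuous_cvg _ (@coord_continuous R p q i j _)) h.
have := measurable_comp_compact coef_compact uD mu' ch.
move=> h; apply: (eq_measurable_fun (fun x => f (u x).1 (u x).2 i j)); last exact: measurable_funTS.
by move=> x; rewrite inE => -[/=]; rewrite in_itv/= => hx _; rewrite /u hx.
Qed.

Lemma coef_adapted : ae_adapted P (fun t w => f t (alpha t w)).
Proof.
move=> t ht; exists (fun w => f t (alpha t w)); split; last exact: aeW.
move=> i j; apply/F_measurableP; have [_ aal hA] := hal.
apply: (@measurable_comp_compact _ _ (OmF T m t) _ A (fun w => alpha t w) (fun a => f t a i j)) => //.
- by move=> w; exact: hA.
- move=> a _; apply: measurable_mxnorm => b c. by apply: measurable_mxB => //; apply/F_measurableP; exact: aal.
apply/subspace_continuousP => x hx.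
have /subspace_continuousP/(_ x hx) := fA (andP ht).1.
by move=> h; apply: (continuous_cvg _ (@coord_continuous R p q i j _)) h.
Qed.

End OneCoefficient.
End Coefficients.

(** * Step controls and the finite set of deterministic controls *)

Section StepControls.
Variables (R : realType) (T : R) (m k : nat).
Variables (tp : nat -> R) (n : nat).
Hypothesis gr : is_grid T tp n.
Implicit Types (t : R) (v : nat -> 'cV[R]_k).

(* The last cell is the single point T. *)
Definition in_cell (l : nat) (t : R) := (tp l <= t) && (if (l < n)%N then t < tp l.+1 else t <= T).
Definition step v (t : R) : 'cV[R]_k := \sum_(l < n.+1) (if in_cell l t then v l else 0).

Lemma cell_uniq i l (t : R) : (i <= n)%N -> (l <= n)%N -> in_cell i t -> in_cell l t -> i = l.
Proof.
wlog il : i l / (i <= l)%N.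
  by move=> h hi hl ci cl; case/orP: (leq_total i l) => ?; [|symmetry]; apply: h.
move=> hi hl /andP[_ +] /andP[+ _]; move: il; rewrite leq_eqVlt => /orP[/eqP//|il].
rewrite (leq_trans il hl) => h1 h2.
have : tp i.+1 <= tp l by rewrite (is_grid_le gr) // (leq_trans il).
by move=> h3; move: (lt_le_trans (le_lt_trans h2 h1) h3); rewrite ltxx.
Qed.

Lemma cell_cover (t : R) : 0 <= t <= T -> exists2 l, (l <= n)%N & in_cell l t.
Proof.
move=> /andP[t0 tT]; have [g0 gn gS] := gr.
have ex : exists l, (l <= n)%N && (tp l <= t) by exists 0%N; rewrite g0 t0.
have ub : forall l, (l <= n)%N && (tp l <= t) -> (l <= n)%N by move=> l /andP[].
case: (ex_maxnP ex ub) => l /andP[ln lt] hl; exists l => //.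
rewrite /in_cell lt /=; case: ifPn => // lln; rewrite ltNge; apply/negP => h.
by have := hl l.+1; rewrite lln h ltnn => /(_ isT).
Qed.

Lemma cell_bnd l (t : R) : (l <= n)%N -> in_cell l t -> 0 <= t <= T.
Proof.
move=> ln /andP[h1 h2]; have /andP[a b] := is_grid_bnd gr ln; rewrite (le_trans a h1) /=.
case: ifPn h2 => // lln h2; apply: le_trans (ltW h2) _.
by have /andP[] := is_grid_bnd gr lln.
Qed.

Lemma stepE v l (t : R) : (l <= n)%N -> in_cell l t -> step v t = v l.
Proof.
move=> ln h; have l1 : (l < n.+1)%N by [].
rewrite /step (bigD1 (Ordinal l1))//= h big1 ?addr0// => i il; case: ifPn => // ci.
by case/eqP: il; apply/val_inj; exact: (cell_uniq (ltn_ord i) ln ci h).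
Qed.

Lemma step_out v (t : R) : ~ (0 <= t <= T) -> step v t = 0.
Proof. by move=> h; rewrite /step big1// => i _; case: ifPn => // /(cell_bnd (ltn_ord i)). Qed.

Lemma eq_step v v' : (forall l, (l <= n)%N -> v l = v' l) -> step v = step v'.
Proof. by move=> h; apply/funext => t; apply: eq_bigr => l _; case: ifP => // _; rewrite h// -ltnS. Qed.

Lemma step_jm (v : nat -> Omega T m -> 'cV[R]_k) :
  (forall l, (l <= n)%N -> forall i j, mfunO T m (fun w => v l w i j)) ->
  jointly_measurable (fun t w => step (fun l => v l w) t).
Proof.
move=> mv i j; apply: measurable_funTS.
rewrite (_ : (fun x => _) = (fun x : R * Omega T m =>
    \sum_(l < n.+1) (if in_cell l x.1 then v l x.2 i j else 0))); last first.
  by apply/funext => x; rewrite /step summxE; apply: eq_bigr => l _; case: ifP => // _; rewrite mxE.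
apply: mfun_sum => l; apply: measurable_fun_ifT.
- apply: measurable_and; first by apply: measurable_fun_ler => //; exact: measurable_fst.
  case: (l < n)%N; [apply: measurable_fun_ltr|apply: measurable_fun_ler]; try exact: measurable_fst.
    exact: mcst.
  exact: mcst.
- by apply: (mcomp (mv l _ i j) measurable_snd); rewrite -ltnS.
- exact: mcst.
Qed.

Lemma step_adapted (v : nat -> Omega T m -> 'cV[R]_k) :
  (forall l, (l <= n)%N -> forall i j, F_measurable (tp l) (fun w => v l w i j)) ->
  adapted (fun t w => step (fun l => v l w) t).
Proof.
move=> mv t ht i j; have [l ln cl] := cell_cover ht.
rewrite (_ : (fun w => _) = (fun w => v l w i j)); last by apply/funext => w; rewrite (stepE _ ln cl).
by apply: F_measurable_le (mv l ln i j); case/andP: cl.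
Qed.

Lemma step_admissible (A : set 'cV[R]_k) (v : nat -> Omega T m -> 'cV[R]_k) :
  (forall l, (l <= n)%N -> forall i j, F_measurable (tp l) (fun w => v l w i j)) ->
  (forall l w, (l <= n)%N -> A (v l w)) -> admissible A (fun t w => step (fun l => v l w) t).
Proof.
move=> mv Av; split.
- apply: step_jm => l ln i j; apply: F_measurableT (mv l ln i j).
  by have /andP[] := is_grid_bnd gr ln.
- exact: step_adapted.
- by move=> t w ht; have [l ln cl] := cell_cover ht; rewrite (stepE _ ln cl); exact: Av.
Qed.

Lemma det_controls_step (N : set 'cV[R]_k) (a : R -> 'cV[R]_k) :
  det_controls T N n tp a <-> exists2 v, (forall l, (l <= n)%N -> N (v l)) & a = step v.
Proof.
split=> [[aN aS aout]|[v vN ->]].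
  exists (fun l => a (tp l)); first by move=> l ln; exact/aN/(is_grid_bnd gr).
  apply/funext => t; have [ht|ht] := boolP (0 <= t <= T); last first.
    by rewrite step_out ?aout//; exact/negP.
  have [l ln cl] := cell_cover ht; rewrite (stepE _ ln cl). move: cl; rewrite /in_cell; case: ifPn => [lln|].
    move=> h; apply: (aS l lln t (tp l) h); rewrite lexx /=. by case: gr => _ _; exact.
  rewrite -leqNgt => nl /andP[h1 h2]. have e : l = n by apply/eqP; rewrite eqn_leq ln.
  by congr a; apply/eqP; rewrite eq_le h1 andbT e; case: gr => _ -> _.
split.
- by move=> t ht; have [l ln cl] := cell_cover ht; rewrite (stepE _ ln cl); exact: vN.
- move=> i ni s t hs ht.
  have c (u : R) : tp i <= u < tp i.+1 -> in_cell i u by rewrite /in_cell ni.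
  by rewrite (stepE _ (ltnW ni) (c _ hs)) (stepE _ (ltnW ni) (c _ ht)).
- by move=> t; exact: step_out.
Qed.

(** Values are coded by positions in an enumeration of [N]. The extra position in ['I_(size s).+1]
    makes the code type inhabited and is decoded as a default point of [N]. *)
Lemma finite_det_controls (N : set 'cV[R]_k) : finite_set N -> N !=set0 ->
  exists (F : finType) (f0 : F) (c : F -> nat -> 'cV[R]_k),
    [/\ forall f l, N (c f l), forall f, det_controls T N n tp (step (c f)) &
     forall v, (forall l, (l <= n)%N -> N (v l)) -> exists2 f, (forall l, (l <= n)%N -> v l = c f l) & step v = step (c f)].
Proof.
move=> /finite_seqP[s sN] [y Ny]; have ys : y \in s by move: Ny; rewrite sN.
pose F : finType := {ffun 'I_n.+1 -> 'I_(size s).+1}.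
pose c (f : F) (l : nat) : 'cV[R]_k := nth y s (f (inord l)).
have cN f l : N (c f l).
  rewrite sN /= /c; case: (ltnP (f (inord l)) (size s)) => h; first exact: mem_nth. by rewrite nth_default.
exists F, [ffun=> ord0], c; split => //.
  by move=> f; apply/det_controls_step; exists (c f).
move=> v vN.
have e l : (l <= n)%N -> v l = c [ffun i : 'I_n.+1 => inord (index (v i) s)] l.
  move=> ln; rewrite /c ffunE. have vs : v l \in s by have := vN l ln; rewrite sN.
  by rewrite (inordK (ln : l < n.+1)%N) inordK ?nth_index// ltnS index_size.
by exists [ffun i : 'I_n.+1 => inord (index (v i) s)] => //; exact: eq_step.
Qed.

End StepControls.

Section Nearest.
Variables (R : realType) (k : nat).

(** Despite the name, the first point of [s] within distance [h]: any such point serves, and a first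
    hit is a measurable choice. The default is again a point of [s] unless [s] is empty. *)
Definition nearest (h : R) (s : seq 'cV[R]_k) (x : 'cV[R]_k) : 'cV[R]_k :=
  foldr (fun y z => if enorm (x - y) <= h then y else z) (head 0 s) s.

Lemma nearest_mem h s x : s != [::] -> nearest h s x \in s.
Proof.
have sub (z0 : 'cV[R]_k) r : foldr (fun y z => if enorm (x - y) <= h then y else z) z0 r \in z0 :: r.
  elim: r => [|y r ih] /=; first exact: mem_head.
  by case: ifP => _; rewrite !inE ?eqxx ?orbT//; move: ih; rewrite inE => /orP[->|->]; rewrite ?orbT.
rewrite /nearest; case: s => // y0 s _; rewrite /head /=.
by case: ifP => _; [exact: mem_head|exact: sub].
Qed.

Lemma nearest_close h s x y : y \in s -> enorm (x - y) <= h -> enorm (x - nearest h s x) <= h.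
Proof.
rewrite /nearest; move: (head 0 s) => z0.
move=> + hy; elim: s => [//|y' s ih]; rewrite inE /= => /orP[/eqP<-|ys]; first by rewrite hy.
by case: ifP => // _; exact: ih.
Qed.

Lemma measurable_nearest d (X : measurableType d) (F : X -> 'cV[R]_k) h s :
  (forall i j, mfun (fun x => F x i j)) -> forall i j, mfun (fun x => nearest h s (F x) i j).
Proof.
move=> mF i j; rewrite /nearest; move: (head 0 s) => z0; elim: s => [|y s ih] /=; first exact: mcst.
rewrite (_ : (fun x => _) = (fun x => if enorm (F x - y) <= h then y i j else
   (foldr (fun y z => if enorm (F x - y) <= h then y else z) z0 s) i j)); last by apply/funext => x; case: ifP.
apply: measurable_fun_ifT => //; apply: measurable_fun_ler; last exact: mcst.
apply: mcomp; first exact: (continuous_measurable_fun (@sqrt_continuous R)).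
apply: (@measurable_n2 _ _ _ _ _ (fun x => F x - y)) => a b.
by apply: measurable_mxB => //; exact: mF.
Qed.

End Nearest.

Lemma mkpath_ext (R : realType) (T : R) j (f f' : R -> 'cV[R]_j) :
  (forall t : R, 0 <= t <= T -> f t = f' t) -> mkpath T f = mkpath T f'.
Proof.
move=> h; congr (xget _ _); apply/seteqP; split=> w /= hw t ht; first by rewrite -h// hw.
by rewrite h// hw.
Qed.

Lemma dproc_ext (R : realType) (T : R) m (P : probability (Omega T m) R) d
    (b b' : R -> Omega T m -> 'cV[R]_d) H H' w :
  (forall t : R, 0 <= t <= T -> b t w = b' t w) -> ito P H w = ito P H' w -> dproc P b H w = dproc P b' H' w.
Proof.
move=> hb hH; apply: mkpath_ext => t /andP[t0 tT]; rewrite hH; congr (_ + _).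
apply/matrixP => i j; rewrite !mxE; apply: eq_Rintegral => s; rewrite inE/= in_itv/= => /andP[s0 st].
have e : b s w = b' s w by apply: hb; rewrite s0 (le_trans st tT).
exact: (f_equal (fun z : 'cV[R]_d => z i 0) e).
Qed.

(** Replacing [g] by the pointwise maximum with [f] does not change its integral and makes the
    inequality hold everywhere. *)
Lemma int_le_ae d (X : measurableType d) (R : realType) (P : probability X R) (f g : X -> R) :
  Rint P f -> Rint P g -> {ae P, forall w, f w <= g w} -> (\int[P]_w (f w)%:E <= \int[P]_w (g w)%:E)%E.
Proof.
move=> fi gi fg.
have mf : mfun f by apply/EFinP; exact: measurable_int fi.
have mg : mfun g by apply/EFinP; exact: measurable_int gi.
have mm : mfun (fun w => Num.max (f w) (g w)) by exact: measurable_maxr.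
have e : (\int[P]_w (g w)%:E = \int[P]_w (Num.max (f w) (g w))%:E)%E.
  apply: ae_eq_integral => //; try by apply/EFinP. by apply: filterS fg => w hw _; rewrite max_r.
rewrite e; apply: le_integral => //; last by move=> w _; rewrite lee_fin le_max lexx.
have gi' := integrableD measurableT (integrable_abse fi) (integrable_abse gi).
apply: le_integrable gi' => //; first by apply/EFinP.
move=> w _; rewrite /= lee_fin (ger0_norm (addr_ge0 _ _))//.
by rewrite /Num.max; case: ifP => _; rewrite ?lerDl ?lerDr.
Qed.

Lemma sup_bigmax (R : realType) (U : Type) (D : set U) (h : U -> R) (F : finType) (f0 : F) (c : F -> U) :
  (forall f, D (c f)) -> (forall a, D a -> exists f, a = c f) ->
  sup [set h a | a in D] = \big[Num.max/h (c f0)]_f h (c f).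
Proof.
move=> Dc cD.
have ub x : [set h a | a in D] x -> x <= \big[Num.max/h (c f0)]_f h (c f).
  by move=> [a /cD[f ->] <-]; exact: le_bigmax.
have bnd : has_sup [set h a | a in D] by split; [exists (h (c f0)), (c f0)|exists (\big[Num.max/h (c f0)]_f h (c f))].
apply/eqP; rewrite eq_le; apply/andP; split.
  by apply: ge_sup; [case: bnd|exact: ub].
have hle f : h (c f) <= sup [set h a | a in D] by apply: ub_le_sup; [case: bnd|exists (c f)].
by apply/bigmax_leP; split=> [|f _]; exact: hle.
Qed.

Lemma bigmax_integrable d (X : measurableType d) (R : realType) (P : probability X R) (F : finType) (f0 : F) (z : F -> X -> R) :
  (forall f, Rint P (z f)) -> P.-integrable setT (fun w => (\big[Num.max/z f0 w]_f z f w)%:E).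
Proof.
move=> iz.
elim: (index_enum F) => [|f s ih].
  by apply: eq_integrable (iz f0) => // w _; rewrite big_nil.
have mz f' : mfun (z f') by apply/EFinP; exact: measurable_int (iz f').
have mi : mfun (fun w => \big[Num.max/z f0 w]_(f <- s) z f w) by apply/EFinP; exact: measurable_int ih.
have gi' := integrableD measurableT (integrable_abse (iz f)) (integrable_abse ih).
apply: le_integrable gi' => //.
  by apply/EFinP; under eq_fun do rewrite big_cons; exact: measurable_maxr.
move=> w _; rewrite /= big_cons lee_fin (ger0_norm (addr_ge0 _ _))//.
by rewrite /Num.max; case: ifP => _; rewrite ?lerDl ?lerDr.
Qed.

(** * Averaging over commuting shifts *)

Section Smoothing.
Variables (R : realType) (X : Type) (D : eqType) (sh : D -> R -> X -> X).
Hypotheses (shC : forall a b s t x, sh a s (sh b t x) = sh b t (sh a s x))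
  (shD : forall a s t x, sh a s (sh a t x) = sh a (s + t) x) (sh0 : forall a x, sh a 0 x = x).
Variables (q : nat) (dl : R).
Hypotheses (q0 : (0 < q)%N) (dl0 : 0 < dl).
Implicit Types (a b : D) (f : X -> R) (L : seq D) (C : R).
Local Notation eps := (q%:R * dl).

Let qR : 0 < q%:R :> R. Proof. by rewrite ltr0n. Qed.
Let eps0 : 0 < eps. Proof. exact: mulr_gt0. Qed.

Let qn0 : q%:R != 0 :> R. Proof. by rewrite gt_eqF. Qed.
Let dn0 : dl != 0. Proof. by rewrite gt_eqF. Qed.

Definition Avg a f x : R := q%:R^-1 * \sum_(u < q) f (sh a (u%:R * dl) x).
Definition Sm L f : X -> R := foldr Avg f L.
(** The difference quotient at the scale [eps] of the function from which one average in direction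
    [a] has been removed. That average makes this quotient an exact derivative on the lattice of
    step [dl]. *)
Definition grad L a f x : R := (Sm (rem a L) f (sh a eps x) - Sm (rem a L) f x) / eps.

Lemma AvgC a b f : Avg a (Avg b f) = Avg b (Avg a f).
Proof.
apply/funext => x; rewrite /Avg; congr (_ * _).
under eq_bigr do rewrite mulr_sumr; rewrite exchange_big /=.
by apply: eq_bigr => u _; rewrite mulr_sumr; apply: eq_bigr => v _; rewrite shC.
Qed.

Lemma Sm_front a L f : a \in L -> Sm L f = Avg a (Sm (rem a L) f).
Proof.
elim: L => //= b L ih; rewrite inE eq_sym; case: eqVneq => [->//|ba] /= aL.
by rewrite /= -/(Sm L f) ih// AvgC.
Qed.

Lemma Avg_ball a f x c e : (forall u, 0 <= u -> u <= eps -> `|f (sh a u x) - c| <= e) ->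
  `|Avg a f x - c| <= e.
Proof.
move=> h; rewrite /Avg.
have -> : c = q%:R^-1 * \sum_(u < q) c by rewrite sumr_const card_ord -(mulr_natl c) mulKf.
rewrite -mulrBr -sumrB normrM gtr0_norm ?invr_gt0//.
rewrite mulrC ler_pdivrMr//; apply: le_trans (ler_norm_sum _ _ _) _.
apply: (via (\sum_(u < q) e)); last by rewrite sumr_const card_ord mulr_natr.
apply: ler_sum => u _; apply: h; first by rewrite mulr_ge0// ltW.
by rewrite ler_wpM2r ?(ltW dl0)// ler_nat ltnW.
Qed.

Lemma Avg_bound a f C : (forall x, `|f x| <= C) -> forall x, `|Avg a f x| <= C.
Proof. by move=> fC x; rewrite -[Avg a f x]subr0; apply: Avg_ball => u _ _; rewrite subr0. Qed.

Lemma Sm_bound L f C : (forall x, `|f x| <= C) -> forall x, `|Sm L f x| <= C.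
Proof. by move=> fC; elim: L => //= a L ih; exact: Avg_bound. Qed.

(** A discrete fundamental theorem of calculus: shifting the average by one lattice step telescopes
    to the two end values. *)
Lemma Avg_step a h x : Avg a h (sh a dl x) - Avg a h x = q%:R^-1 * (h (sh a eps x) - h x).
Proof.
rewrite /Avg -mulrBr; congr (_ * _).
under eq_bigr do rewrite shD -[X in _ + X]mul1r -mulrDl natr1.
rewrite -[in LHS]sumrB -(big_mkord xpredT (fun u => h (sh a (u.+1%:R * dl) x) - h (sh a (u%:R * dl) x))).
by rewrite telescope_sumr// mul0r sh0.
Qed.

Lemma Avg_step_le a h C x : (forall x, `|h x| <= C) -> `|Avg a h (sh a dl x) - Avg a h x| <= 2 * C / eps * dl.
Proof.
move=> hC; rewrite Avg_step normrM gtr0_norm ?invr_gt0//.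
have -> : 2 * C / eps * dl = q%:R^-1 * (2 * C) by field; rewrite qn0 dn0.
rewrite ler_wpM2l ?invr_ge0 ?(ltW qR)//; apply: le_trans (ler_normB _ _) _.
by have := hC (sh a eps x); have := hC x; lra.
Qed.

Lemma Sm_step L a f x : a \in L -> Sm L f (sh a dl x) - Sm L f x = dl * grad L a f x.
Proof.
move=> aL; by rewrite (Sm_front f aL) Avg_step /grad; field; rewrite qn0 dn0.
Qed.

Lemma grad_bound L a f C x : (forall x, `|f x| <= C) -> `|grad L a f x| <= 2 * C / eps.
Proof.
move=> fC; rewrite /grad normrM [`|eps^-1|]gtr0_norm ?invr_gt0// ler_wpM2r ?invr_ge0 ?(ltW eps0)//.
apply: le_trans (ler_normB _ _) _; have h := Sm_bound (rem a L) fC.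
by have := h (sh a eps x); have := h x; lra.
Qed.

(** After the removal of one copy of [a] the list still contains [b], so one more average is left to
    absorb the shift in direction [b]. This is why directions are listed twice. *)
Lemma grad_step L a b f C x : (forall x, `|f x| <= C) -> b \in rem a L ->
  `|grad L a f (sh b dl x) - grad L a f x| <= 4 * C / eps ^+ 2 * dl.
Proof.
move=> fC bL; rewrite /grad -mulrBl normrM [`|eps^-1|]gtr0_norm ?invr_gt0//.
have h y : `|Sm (rem a L) f (sh b dl y) - Sm (rem a L) f y| <= 2 * C / eps * dl.
  by rewrite (Sm_front f bL); apply: Avg_step_le; exact: Sm_bound.
rewrite shC; set y := sh a eps x.
have -> : 4 * C / eps ^+ 2 * dl = (2 * C / eps * dl + 2 * C / eps * dl) / eps by field; rewrite qn0 dn0.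
rewrite ler_wpM2r ?invr_ge0 ?(ltW eps0)//.
have := h y; have := h x; rewrite !ler_norml => /andP[? ?] /andP[? ?]; apply/andP; split; lra.
Qed.

Definition sgn (s : bool) : R := if s then dl else - dl.
Definition walk (st : seq (bool * D)) x : X := foldr (fun s y => sh s.2 (sgn s.1) y) x st.

Lemma sh_back a x : sh a dl (sh a (- dl) x) = x.
Proof. by rewrite shD subrr sh0. Qed.

Section Walks.
Variables (L : seq D) (f : X -> R) (C : R) (E : pred D).
Hypotheses (fC : forall x, `|f x| <= C) (EL : forall a, E a -> a \in L)
  (E2 : forall a b, E a -> E b -> b \in rem a L).
Local Notation B := (4 * C / eps ^+ 2).

Lemma grad_step2 a s b x : E a -> E b -> `|grad L a f (sh b (sgn s) x) - grad L a f x| <= B * dl.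
Proof.
move=> Ea Eb; case: s; first exact: grad_step (E2 Ea Eb).
by rewrite distrC -{1}(sh_back b x); exact: grad_step (E2 Ea Eb).
Qed.

Lemma grad_walk st a x : E a -> all (fun s => E s.2) st ->
  `|grad L a f (walk st x) - grad L a f x| <= B * dl * (size st)%:R.
Proof.
move=> Ea; elim: st => [|s st ih] /=; first by rewrite subrr normr0 mulr0.
move=> /andP[Es /ih h]; have := grad_step2 s.1 (walk st x) Ea Es.
rewrite -[(size st).+1%:R]natr1 mulrDr mulr1; move: h; rewrite !ler_norml => /andP[? ?] /andP[? ?]; apply/andP; split; lra.
Qed.

Lemma B_ge0 (x : X) : 0 <= B.
Proof. by rewrite divr_ge0 ?sqr_ge0// mulr_ge0// (le_trans _ (fC x)). Qed.

(** A second order Taylor bound along a lattice walk. Forward steps are exact to first order, and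
    the gradient moves by at most [B * dl] per step. *)
Lemma Sm_walk st x : all (fun s => E s.2) st ->
  `|Sm L f (walk st x) - Sm L f x - \sum_(s <- st) sgn s.1 * grad L s.2 f x| <= B * (dl * (size st)%:R) ^+ 2.
Proof.
elim: st => [|s st ih] /=; first by rewrite big_nil !subrr normr0 !mulr0 expr0n mulr0.
move=> /andP[Es hst]; have {ih} h1 := ih hst; have h2 := grad_walk x Es hst.
rewrite big_cons; set y := walk st x in h1 h2 *; set n : R := (size st)%:R in h1 h2 *.
have n0 : 0 <= n by exact: ler0n.
have step : `|Sm L f (sh s.2 (sgn s.1) y) - Sm L f y - sgn s.1 * grad L s.2 f y| <= B * dl ^+ 2.
  rewrite /sgn; case: ifP => _.
    by rewrite (Sm_step _ _ (EL Es)) subrr normr0 mulr_ge0 ?sqr_ge0// (B_ge0 x).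
  (* A backward step is a forward step from the shifted point; replacing the gradient there by the
     one at [y] costs [B * dl]. *)
  have e := Sm_step f (sh s.2 (- dl) y) (EL Es); rewrite sh_back in e.
  have -> : Sm L f (sh s.2 (- dl) y) - Sm L f y - - dl * grad L s.2 f y =
     dl * (grad L s.2 f y - grad L s.2 f (sh s.2 (- dl) y)).
    by rewrite -(opprB (Sm L f y)) e mulNr opprK mulrBr addrC.
  rewrite normrM (gtr0_norm dl0) distrC expr2 mulrCA ler_wpM2l ?(ltW dl0)//. exact: (@grad_step2 s.2 false).
have h3 : `|sgn s.1 * (grad L s.2 f y - grad L s.2 f x)| <= dl * (B * dl * n).
  rewrite normrM; have -> : `|sgn s.1| = dl by rewrite /sgn; case: ifP => _; rewrite ?normrN gtr0_norm.
  by rewrite ler_wpM2l// ltW.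
rewrite -[(size st).+1%:R]natr1 -/n.
have b0 := B_ge0 x.
have -> : Sm L f (sh s.2 (sgn s.1) y) - Sm L f x -
  (sgn s.1 * grad L s.2 f x + \sum_(j <- st) sgn j.1 * grad L j.2 f x) =
  (Sm L f (sh s.2 (sgn s.1) y) - Sm L f y - sgn s.1 * grad L s.2 f y) +
  ((Sm L f y - Sm L f x - \sum_(j <- st) sgn j.1 * grad L j.2 f x) + sgn s.1 * (grad L s.2 f y - grad L s.2 f x)) by ring.
apply: le_trans (ler_normD _ _) _; apply: le_trans (lerD step (le_trans (ler_normD _ _) (lerD h1 h3))) _.
(* With [n] steps behind, the error count grows by [1 + n], which is at most the growth [2 * n + 1]
   of the square. *)
have -> : B * dl ^+ 2 + (B * (dl * n) ^+ 2 + dl * (B * dl * n)) = B * dl ^+ 2 * (1 + n ^+ 2 + n) by ring.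
have -> : B * (dl * (n + 1)) ^+ 2 = B * dl ^+ 2 * (1 + n ^+ 2 + 2 * n) by ring.
apply: ler_wpM2l; [exact: mulr_ge0 b0 (sqr_ge0 _)|lra].
Qed.

End Walks.
End Smoothing.

(** * Shifts of the increments of a path over coarse cells *)

Section PathShifts.
Variables (R : realType) (T : R) (d : nat).
Hypothesis T0 : 0 < T.
Implicit Types (w : Omega T d) (v : 'cV[R]_d).

Lemma path_addC w (a b a' b' : R) v v' : 0 <= a -> a <= b -> 0 <= a' -> a' <= b' ->
  path_add (path_add w a b v) a' b' v' = path_add (path_add w a' b' v') a b v.
Proof.
move=> a0 ab a0' ab'; apply: omega_eq => t ht.
by rewrite !path_addE// ?(ltW T0)// addrAC.
Qed.

Lemma path_addD w (a b : R) v v' : 0 <= a -> a <= b ->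
  path_add (path_add w a b v) a b v' = path_add w a b (v + v').
Proof. by move=> a0 ab; apply: omega_eq => t ht; rewrite !path_addE// ?(ltW T0)// scalerDr addrA. Qed.

Lemma path_add0 w (a b : R) : 0 <= a -> a <= b -> path_add w a b 0 = w.
Proof. by move=> a0 ab; apply: omega_eq => t ht; rewrite !path_addE// ?(ltW T0)// scaler0 addr0. Qed.

Lemma path_add_dist w w' (a b : R) v (t : R) : 0 <= a -> a <= b -> 0 <= t <= T ->
  path_add w a b v t - path_add w' a b v t = w t - w' t.
Proof. by move=> a0 ab ht; rewrite !path_addE// ?(ltW T0)// opprD addrACA subrr addr0. Qed.

Variable K : nat.
Hypothesis K0 : (0 < K)%N.
Definition coarse (l : nat) : R := T * l%:R / K%:R.

Let KR : 0 < K%:R :> R. Proof. by rewrite ltr0n. Qed.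

Lemma coarse_ge0 l : 0 <= coarse l.
Proof. by rewrite divr_ge0// mulr_ge0// ltW. Qed.

Lemma coarse_lt l : coarse l < coarse l.+1.
Proof. by rewrite /coarse ltr_pM2r ?invr_gt0// ltr_pM2l// ltr_nat. Qed.

Lemma coarse_le l : coarse l <= coarse l.+1. Proof. exact/ltW/coarse_lt. Qed.

Lemma coarse_grid : is_grid T coarse K.
Proof.
split; rewrite /coarse ?mulr0 ?mul0r//; first by rewrite mulfK// gt_eqF.
by move=> i _; exact: coarse_lt.
Qed.

Lemma coarse_gap l : coarse l.+1 - coarse l = T / K%:R.
Proof. by rewrite /coarse -mulrBl -mulrBr -natr1 addrAC subrr add0r mulr1. Qed.

Definition celladd w (l : nat) v : Omega T d := path_add w (coarse l) (coarse l.+1) v.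
(** The commuting shifts of the previous section: one for each coarse cell and each coordinate. *)
Definition psh (a : (nat * 'I_d)%type) (t : R) w : Omega T d := celladd w a.1 (t *: delta_mx a.2 0).

Lemma celladdC w l l' v v' : celladd (celladd w l v) l' v' = celladd (celladd w l' v') l v.
Proof. by apply: path_addC; rewrite ?coarse_ge0 ?coarse_le. Qed.

Lemma celladdD w l v v' : celladd (celladd w l v) l v' = celladd w l (v + v').
Proof. by apply: path_addD; rewrite ?coarse_ge0 ?coarse_le. Qed.

Lemma celladd0 w l : celladd w l 0 = w.
Proof. by apply: path_add0; rewrite ?coarse_ge0 ?coarse_le. Qed.

Lemma celladd_dist w w' l v (t : R) : 0 <= t <= T -> celladd w l v t - celladd w' l v t = w t - w' t.
Proof. by move=> ht; apply: path_add_dist; rewrite ?coarse_ge0 ?coarse_le. Qed.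

Lemma celladd_move w l v v' (t : R) : 0 <= t <= T -> `|celladd w l v t - celladd w l v' t| <= `|v - v'|.
Proof.
move=> ht; rewrite !path_addE ?coarse_ge0 ?coarse_le ?(ltW T0)// opprD addrACA subrr add0r -scalerBr normrZ.
have /andP[r0 r1] := ramp01 t (coarse_lt l).
by rewrite ger0_norm// ler_piMl.
Qed.

Lemma pshC a b (s t : R) w : psh a s (psh b t w) = psh b t (psh a s w).
Proof. exact: celladdC. Qed.

Lemma pshD a (s t : R) w : psh a s (psh a t w) = psh a (s + t) w.
Proof. by rewrite /psh celladdD addrC scalerDl. Qed.

Lemma psh0 a w : psh a 0 w = w.
Proof. by rewrite /psh scale0r celladd0. Qed.

Definition dirs : seq (nat * 'I_d)%type := [seq (l, j) | l <- iota 0 K, j <- enum 'I_d].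
(** Each direction twice, so that any direction is still present after one copy of any other, or of
    itself, has been removed. *)
Definition dirs2 := dirs ++ dirs.

Lemma mem_dirs l j : (l < K)%N -> (l, j) \in dirs.
Proof. by move=> lK; apply/allpairsP; exists (l, j); rewrite mem_iota lK mem_enum. Qed.

Lemma mem_rem_cat (D : eqType) (a b : D) (s1 s2 : seq D) : a \in s1 -> b \in s2 -> b \in rem a (s1 ++ s2).
Proof.
elim: s1 => //= c s1 ih; rewrite inE eq_sym; case: eqVneq => [_ _|_ /= a1] b2; first by rewrite mem_cat b2 orbT.
by rewrite inE ih ?orbT.
Qed.

Variables (q : nat) (dl : R).
Hypotheses (q0 : (0 < q)%N) (dl0 : 0 < dl).
Local Notation eps := (q%:R * dl).
Local Notation Smp := (Sm psh q dl dirs2).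
Local Notation gr := (grad psh q dl dirs2).

(** Each average moves the path by at most [eps] in the maximum norm, and there are [size dirs2] of
    them. *)
Lemma Sm_close f e r : mod_ok f e r -> (size dirs2)%:R * eps <= r -> forall w, `|Smp f w - f w| <= e.
Proof.
move=> fe hr w.
have h L w' c s : (forall w'', (forall t : R, 0 <= t <= T -> `|w'' t - w' t| <= s + (size L)%:R * eps) -> `|f w'' - c| <= e) ->
    0 <= s -> `|Sm psh q dl L f w' - c| <= e.
  elim: L w' s => [|a L ih] w' s /= hf s0.
    by apply: hf => t _; rewrite subrr normr0 mul0r addr0.
  apply: (Avg_ball q0 dl0) => u u0 ue; apply: (ih _ s) => // w'' hw; apply: hf => t ht.
  apply: (via (`|w'' t - psh a u w' t| + `|psh a u w' t - w' t|)).
    by apply: le_trans (ler_normD _ _); rewrite addrA subrK.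
  apply: le_trans (lerD (hw t ht) (lexx _)) _.
  rewrite -[(size L).+1%:R]natr1 mulrDl mul1r !addrA lerD2l -{2}(celladd0 w' a.1).
  apply: le_trans (celladd_move _ _ _ _ ht) _; rewrite subr0 normrZ ger0_norm//.
  apply: le_trans ue; apply: ler_piMr => //; apply: mxnorm_le => // i j; rewrite mxE.
  by case: (_ && _); rewrite ?normr1 ?normr0.
apply: (h _ _ _ 0) => // w'' hw; apply: fe => t ht.
by apply: le_trans (hw t ht) _; rewrite add0r.
Qed.

Lemma Sm_mod L f e r : mod_ok f e r -> mod_ok (Sm psh q dl L f) e r.
Proof.
move=> fe; elim: L => [//|a L ih] w w' hw /=.
rewrite /Avg -mulrBr -sumrB normrM gtr0_norm ?invr_gt0 ?ltr0n// mulrC ler_pdivrMr ?ltr0n//.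
apply: le_trans (ler_norm_sum _ _ _) _.
apply: (via (\sum_(u < q) e)); last by rewrite sumr_const card_ord mulr_natr.
by apply: ler_sum => u _; apply: ih => t ht; rewrite celladd_dist//; exact: hw.
Qed.

Lemma grad_mod a f e r : mod_ok f e r -> mod_ok (gr a f) (2 * e / eps) r.
Proof.
move=> fe w w' hw; rewrite /grad -mulrBl normrM [`|eps^-1|]gtr0_norm ?invr_gt0 ?mulr_gt0 ?ltr0n//.
rewrite ler_wpM2r ?invr_ge0 ?mulr_ge0 ?(ltW dl0)//.
have h := Sm_mod (rem a dirs2) fe.
have h1 := h _ _ hw.
have h2 : `|Sm psh q dl (rem a dirs2) f (psh a eps w) - Sm psh q dl (rem a dirs2) f (psh a eps w')| <= e.
  by apply: h => t ht; rewrite celladd_dist//; exact: hw.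
rewrite opprB addrACA -[X in `|_ + X|]opprB opprD opprK addrC addrA.
move: h1 h2; rewrite !ler_norml => /andP[? ?] /andP[? ?]; apply/andP; split; lra.
Qed.

Lemma walk_cell l (st : seq (bool * (nat * 'I_d))) w : all (fun s => s.2.1 == l) st ->
  walk psh dl st w = celladd w l (\sum_(s <- st) sgn dl s.1 *: delta_mx s.2.2 0).
Proof.
elim: st => [|s st ih] /=; first by rewrite big_nil celladd0.
by move=> /andP[/eqP sl /ih ->]; rewrite big_cons /psh sl celladdD addrC.
Qed.

(** A lattice walk from 0 towards [v]: in each coordinate as many steps of length [dl] with the sign
    of the entry as fit, so the end point misses [v] by at most [dl]. *)
Definition steps (l : nat) v : seq (bool * (nat * 'I_d)) :=
  flatten [seq nseq (Num.truncn (`|v j 0| / dl)) (0 <= v j 0, (l, j)) | j <- enum 'I_d].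

Lemma steps_all l v : all (fun s => s.2.1 == l) (steps l v).
Proof. by apply/allP => s /flattenP[st /mapP[j _ ->]] /nseqP[-> _] /=. Qed.

Lemma steps_sum l v (V : nmodType) (F : bool * (nat * 'I_d) -> V) :
  \sum_(s <- steps l v) F s = \sum_j F (0 <= v j 0, (l, j)) *+ Num.truncn (`|v j 0| / dl).
Proof.
rewrite /steps big_flatten big_map big_enum /=; apply: eq_bigr => j _.
by rewrite big_nseq iter_addr_0.
Qed.

Let approx v j := sgn dl (0 <= v j 0) *+ Num.truncn (`|v j 0| / dl).

Lemma approx_close v j : `|v j 0 - approx v j| <= dl.
Proof.
rewrite /approx; set x := v j 0; set n := Num.truncn _.
have xd : 0 <= `|x| / dl by rewrite divr_ge0// ltW.
have h1 : n%:R * dl <= `|x| by rewrite -ler_pdivlMr//; rewrite truncn_le.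
have h2 : `|x| < (n%:R + 1) * dl by rewrite -ltr_pdivrMr// natr1; exact: truncnS_gt.
rewrite /sgn -mulr_natl; have [x0|x0] := leP 0 x.
  by move: h1 h2; rewrite (ger0_norm x0) => h1 h2; rewrite ler_norml; apply/andP; split; lra.
by move: h1 h2; rewrite (ltr0_norm x0) => h1 h2; rewrite ler_norml; apply/andP; split; lra.
Qed.

Lemma steps_size l v : dl * (size (steps l v))%:R <= n1 v.
Proof.
have -> : (size (steps l v))%:R = \sum_j (Num.truncn (`|v j 0| / dl))%:R :> R by rewrite -sum1_size natr_sum steps_sum.
rewrite mulr_sumr /n1; apply: ler_sum => j _; rewrite big_ord1 mulrC -ler_pdivlMr// truncn_le.
by rewrite divr_ge0// ltW.
Qed.

(** The walk bound for the rounded vector, plus the price of rounding: [e0] from the modulus at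
    [dl], and [dl] times the gradient bound in each coordinate. *)
Lemma path_expansion (f : Omega T d -> R) C e0 l v w : (forall w, `|f w| <= C) -> mod_ok f e0 dl -> (l < K)%N ->
  `|Smp f (celladd w l v) - Smp f w - \sum_j v j 0 * gr (l, j) f w| <=
    4 * C / eps ^+ 2 * n1 v ^+ 2 + (e0 + d%:R * (2 * C / eps * dl)).
Proof.
move=> fC fe lK.
pose E : pred (nat * 'I_d)%type := fun a => a.1 == l.
have EL a : E a -> a \in dirs2 by case: a => l' j /eqP /= ->; rewrite mem_cat mem_dirs.
have E2 a b : E a -> E b -> b \in rem a dirs2.
  by case: a b => [l1 j1] [l2 j2] /eqP /= -> /eqP /= ->; apply: mem_rem_cat; exact: mem_dirs.
have := Sm_walk pshC pshD psh0 q0 dl0 fC EL E2 w (steps_all l v).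
rewrite (walk_cell _ (steps_all l v)) !steps_sum.
set v' := \sum_(j < d) _.
have v'E j : v' j 0 = approx v j.
  rewrite /v' summxE (bigD1 j)//= big1 ?addr0.
    by rewrite scalerMnl !mxE !eqxx mulr1.
  by move=> i ij; rewrite scalerMnl !mxE eq_sym (negbTE ij) mulr0.
set S' := \sum_(j < d) _ => h1.
have h2 : `|Smp f (celladd w l v) - Smp f (celladd w l v')| <= e0.
  apply: (Sm_mod dirs2 fe) => t ht; apply: le_trans (celladd_move _ _ _ _ ht) _.
  apply: mxnorm_le; first exact: ltW. by move=> i j; rewrite ord1 !mxE v'E; exact: approx_close.
have h3 : `|\sum_j v j 0 * gr (l, j) f w - S'| <= d%:R * (2 * C / eps * dl).
  rewrite /S' -sumrB; apply: le_trans (ler_norm_sum _ _ _) _.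
  apply: (via (\sum_(j < d) (2 * C / eps * dl))); last by rewrite sumr_const card_ord -[leLHS]mulr_natl.
  apply: ler_sum => j _; rewrite -mulrnAl -mulrBl normrM mulrC.
  by apply: ler_pM => //; [exact: grad_bound|exact: approx_close].
have h4 : 4 * C / eps ^+ 2 * (dl * (size (steps l v))%:R) ^+ 2 <= 4 * C / eps ^+ 2 * n1 v ^+ 2.
  apply: ler_wpM2l.
    by rewrite divr_ge0 ?sqr_ge0// mulr_ge0// (le_trans _ (fC w)).
  by rewrite lerXn2r ?nnegrE ?n1_ge0 ?steps_size// mulr_ge0// ltW.
move: h2 h3 (le_trans h1 h4); rewrite !ler_norml => /andP[? ?] /andP[? ?] /andP[? ?]; apply/andP; split; lra.
Qed.

End PathShifts.

(** The decision is a polynomial in the indicators of the tests: a sum over accepted patterns of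
    products over the tests. *)
Lemma measurable_finite_choice dX (X : measurableType dX) (R : realType) (F : finType) (B : F -> X -> bool)
    (G : {ffun F -> bool} -> bool) : (forall f, mfun (B f)) -> mfun (fun x => G [ffun f => B f x]).
Proof.
move=> mB.
pose S (x : X) : R := \sum_(b : {ffun F -> bool}) (if G b then \prod_f (if B f x == b f then 1 else 0) else 0).
have mS : mfun S.
  apply: mfun_sum => b; case: (G b); last exact: mcst.
  apply: measurable_prod => f _; apply: measurable_fun_ifT; try exact: mcst.
  case: (b f); last by under eq_fun do rewrite eqbF_neg; exact: measurable_neg.
  apply: eq_measurable_fun (mB f) => x _; exact/esym/eqb_id.
have SE x : S x = if G [ffun f => B f x] then 1 else 0.
  rewrite /S (bigD1 [ffun f => B f x])//= [X in _ + X]big1 ?addr0.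
    by case: ifP => // _; apply: big1 => f _; rewrite ffunE eqxx.
  move=> b bx; case: ifP => // _; apply/eqP/prodf_eq0. have [f hf] : exists f, B f x != b f.
    apply/existsP; apply: contraT; rewrite negb_exists => /forallP h; case/eqP: bx.
    by apply/ffunP => f; rewrite ffunE; have := h f; rewrite negbK => /eqP.
  by exists f => //; rewrite (negbTE hf).
rewrite (_ : (fun x => G _) = (fun x => 2^-1 <= S x)); first by apply: measurable_fun_ler => //; exact: mcst.
by apply/funext => x; rewrite SE; case: (G _); apply/esym; [apply: ltW; rewrite invf_lt1 ?ltr1n|apply/negbTE; rewrite -ltNge invr_gt0].
Qed.

Lemma bigmax_close (R : realType) (F : finType) (f0 : F) (u v : F -> R) (e : R) :
  (forall f, `|u f - v f| <= e) -> `|\big[Num.max/u f0]_f u f - \big[Num.max/v f0]_f v f| <= e.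
Proof.
move=> h.
have half (x y : F -> R) : (forall f, `|x f - y f| <= e) -> \big[Num.max/x f0]_f x f <= \big[Num.max/y f0]_f y f + e.
  move=> hxy; have xy f : x f <= \big[Num.max/y f0]_f y f + e.
    have := hxy f; rewrite ler_norml => /andP[_ h1]. by have := le_bigmax (y f0) y f; lra.
  by apply/bigmax_leP; split=> [|f _]; exact: xy.
rewrite ler_norml; apply/andP; split.
  have := half v u (fun f => _); have : forall f, `|v f - u f| <= e by move=> f; rewrite distrC.
  by move=> h' /(_ h'); lra.
by have := half u v h; lra.
Qed.

Lemma bigmax_attained (R : realType) (F : finType) (f0 : F) (u : F -> R) :
  exists f, \big[Num.max/u f0]_f u f = u f.
Proof.
elim: (index_enum F) => [|f r [f' e]]; first by exists f0; rewrite big_nil.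
by rewrite big_cons e /Num.max; case: ifP => _; [exists f'|exists f].
Qed.

Lemma n1_sqr_le (R : realType) d (v : 'cV[R]_d) : n1 v ^+ 2 <= d%:R * n2 v.
Proof.
have -> : n1 v = \sum_i `|v i 0| by apply: eq_bigr => i _; rewrite big_ord1.
have -> : n2 v = \sum_i `|v i 0| ^+ 2 by apply: eq_bigr => i _; rewrite big_ord1 real_normK// num_real.
exact: sqr_sum_le.
Qed.

Lemma Sm_mono (R : realType) (X : Type) (D : eqType) (sh : D -> R -> X -> X) q dl L (f h : X -> R) :
  (forall x, f x <= h x) -> forall x, Sm sh q dl L f x <= Sm sh q dl L h x.
Proof.
move=> fh; elim: L => [//|a L ih] x /=.
by rewrite /Avg ler_wpM2l ?invr_ge0//; apply: ler_sum => u _; exact: ih.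
Qed.

(** * The dynamic program and its smoothed values *)

Section Scheme.
Variables (R : realType) (T : R) (d m k : nat) (P : probability (Omega T m) R).
Hypotheses (T0 : 0 < T) (WP : is_wiener P).
Variables (K : nat) (s : nat -> R) (M : nat) (ka : nat -> nat).
Hypotheses (K0 : (0 < K)%N) (gs : is_grid T s M).
Variables (mu : R -> 'cV[R]_k -> 'cV[R]_d) (sigma : R -> 'cV[R]_k -> 'M[R]_(d, m)).
Variables (F : finType) (f0 : F) (ctl : F -> 'cV[R]_k).
Local Notation celladd := (@celladd R T d K).

Definition xi i f (y : 'cV[R]_m) : 'cV[R]_d := (s i.+1 - s i) *: mu (s i) (ctl f) + sigma (s i) (ctl f) *m y.
Definition inc i (w : Omega T m) : 'cV[R]_m := w (s i.+1) - w (s i).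

Let s_ge0 := is_grid_ge0 gs.
Let s_leT := is_grid_leT gs.
Let s_lt i : (i < M)%N -> s i < s i.+1. Proof. by case: gs => _ _; exact. Qed.

Lemma measurable_inc i a b : (i < M)%N -> mfunO T m (fun w => inc i w a b).
Proof.
move=> iM; rewrite ord1. by apply: measurable_mxB; apply: measurable_coord; rewrite s_ge0 ?s_leT ?(ltnW iM).
Qed.

Lemma measurable_xi i f dX (X : measurableType dX) (y : X -> 'cV[R]_m) :
  (forall a b, mfun (fun x => y x a b)) -> forall a b, mfun (fun x => xi i f (y x) a b).
Proof.
move=> my a b; rewrite (_ : (fun x => _) = (fun x => ((s i.+1 - s i) *: mu (s i) (ctl f)) a b + (sigma (s i) (ctl f) *m y x) a b)).
  apply: mfunD; first exact: mcst.
  by apply: (measurable_mulmx (F := fun=> sigma (s i) (ctl f))) => // a' b'; exact: mcst.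
by apply/funext => x; rewrite mxE.
Qed.

Lemma measurable_celladd dX (X : measurableType dX) (Z : X -> Omega T d) l (v : X -> 'cV[R]_d) :
  mfun Z -> (forall a b, mfun (fun x => v x a b)) -> mfun (fun x => celladd (Z x) l (v x)).
Proof.
move=> mZ mv; apply: measurable_Omega => t i ht.
rewrite (_ : (fun x => _) = (fun x => Z x t i 0 + ramp (coarse T K l) (coarse T K l.+1) t * v x i 0)).
  apply: mfunD; first exact: (mcomp (measurable_coord i ht) mZ). by apply: mfunM => //; exact: mcst.
by apply/funext => x; rewrite path_addE ?coarse_ge0 ?coarse_le ?(ltW T0)// !mxE.
Qed.

(** One step of the Bellman recursion for a fixed control: the Euler increment is added inside the
    coarse cell [ka i], and the mean is taken with the state frozen. *)
Definition cond (h : Omega T d -> R) i f (z : Omega T d) : R :=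
  \int[P]_w h (celladd z (ka i) (xi i f (inc i w))).

Section OneStep.
Variables (h : Omega T d -> R) (C : R) (i : nat).
Hypotheses (uh : UC h) (hC : forall z, `|h z| <= C) (iM : (i < M)%N).

Lemma measurable_next f z : mfunO T m (fun w => h (celladd z (ka i) (xi i f (inc i w)))).
Proof.
apply: mcomp; first exact: UC_measurable.
apply: (measurable_celladd (Z := fun=> z)); first exact: mcst.
by apply: measurable_xi => a b; exact: measurable_inc.
Qed.

Lemma next_integrable f z : Rint P (fun w => h (celladd z (ka i) (xi i f (inc i w)))).
Proof. by apply: bounded_integrable; [exact: measurable_next|move=> w; exact: hC]. Qed.

Lemma cond_bound f z : `|cond h i f z| <= C.
Proof.
have hh : (`|(cond h i f z)%:E| <= C%:E)%E.
  rewrite /cond fineK; last exact: integrable_fin_num (next_integrable f z).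
  apply: le_trans (le_abse_integral _ _ _) _ => //.
    by apply/EFinP; exact: measurable_next.
  rewrite -(int_prob_cst P C); apply: ge0_le_integral => //.
  - by apply/EFinP/mcomp => //; exact: measurable_next.
  - by move=> w _; rewrite lee_fin; exact: hC.
by move: hh; rewrite lee_fin.
Qed.

Lemma cond_mod f e r : mod_ok h e r -> mod_ok (cond h i f) e r.
Proof.
move=> he z z' hz; rewrite /cond -RintegralB//; try exact: next_integrable.
have hd w : `|h (celladd z (ka i) (xi i f (inc i w))) - h (celladd z' (ka i) (xi i f (inc i w)))| <= e.
  by apply: he => t ht; rewrite (celladd_dist T0 K0)//; exact: hz.
have hh : (`|(\int[P]_w (h (celladd z (ka i) (xi i f (inc i w))) - h (celladd z' (ka i) (xi i f (inc i w)))))%:E| <= e%:E)%E.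
  have ii := integrableB measurableT (next_integrable f z) (next_integrable f z').
  rewrite /Rintegral fineK; last exact: integrable_fin_num ii.
  apply: le_trans (le_abse_integral _ _ _) _ => //.
    by apply/EFinP/mfunB; exact: measurable_next.
  rewrite -(int_prob_cst P e); apply: ge0_le_integral => //.
  - by apply/EFinP/mcomp => //; apply: mfunB; exact: measurable_next.
  - by move=> w _; rewrite lee_fin; exact: hd.
by move: hh; rewrite lee_fin.
Qed.

End OneStep.

(** The shifts commute with the addition of the Euler increment, and a finite average commutes with
    the integral. *)
Lemma cond_Avg h C i f q dl a : (0 < q)%N -> 0 < dl -> UC h -> (forall z, `|h z| <= C) -> (i < M)%N ->
  cond (Avg (@psh R T d K) q dl a h) i f = Avg (@psh R T d K) q dl a (cond h i f).
Proof.
move=> q0 dl0 uh hC iM; apply/funext => z; rewrite /cond /Avg mulr_sumr.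
transitivity (\int[P]_w (\sum_(u < q) q%:R^-1 * h (celladd (psh K a (u%:R * dl) z) (ka i) (xi i f (inc i w))))).
  apply: eq_Rintegral => w _; rewrite mulr_sumr; apply: eq_bigr => u _; congr (_ * h _).
  by rewrite /psh (celladdC T0 K0).
rewrite Rintegral_lin//; first by move=> u; exact: next_integrable.
Qed.

Lemma cond_Sm h C i f q dl L : (0 < q)%N -> 0 < dl -> UC h -> (forall z, `|h z| <= C) -> (i < M)%N ->
  cond (Sm (@psh R T d K) q dl L h) i f = Sm (@psh R T d K) q dl L (cond h i f).
Proof.
move=> q0 dl0 uh hC iM; elim: L => [//|a L ih] /=.
rewrite (@cond_Avg _ C)// ?ih//; last exact: Sm_bound.
move=> e e0; have [r r0 hr] := uh e e0; exists r => //; exact: (Sm_mod T0 K0 dl q0 L hr).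
Qed.

Variables (g : Omega T d -> R) (Cg : R).
Hypotheses (ug : UC g) (gC : forall w, `|g w| <= Cg).

(** Backward recursion: [n] counts the steps still to go, so with [n.+1] steps to go the current
    step is [M - n.+1]. *)
Fixpoint value (n : nat) : Omega T d -> R :=
  if n is n'.+1 then fun z => \big[Num.max/cond (value n') (M - n'.+1) f0 z]_f cond (value n') (M - n'.+1) f z
  else g.

Let sub_lt n : (n < M)%N -> (M - n.+1 < M)%N.
Proof. by move=> nM; rewrite ltn_subrL /= (leq_ltn_trans _ nM). Qed.

Lemma value_mod_bound n : (n <= M)%N -> (forall z, `|value n z| <= Cg) /\ forall e r, 0 < r -> mod_ok g e r -> mod_ok (value n) e r.
Proof.
elim: n => [//|n ih] nM; have [hb hm] := ih (ltnW nM).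
have uv : UC (value n) by move=> e e0; have [r r0 hr] := ug e0; exists r => //; exact: hm.
split=> [z|e r r0 he z z' hz] /=.
  have h := cond_bound uv hb (sub_lt nM).
  set v := \big[_/_]_f _; have [f ->] : exists f, v = cond (value n) (M - n.+1) f z.
    exact: (bigmax_attained f0 (fun f => cond (value n) (M - n.+1) f z)).
  exact: h.
by apply: bigmax_close => f; exact: (cond_mod uv hb (sub_lt nM) f (hm e r r0 he)).
Qed.

Lemma value_bound n z : (n <= M)%N -> `|value n z| <= Cg.
Proof. by move=> nM; have [] := value_mod_bound nM. Qed.

Lemma value_mod n e r : (n <= M)%N -> 0 < r -> mod_ok g e r -> mod_ok (value n) e r.
Proof. by move=> nM; have [_] := value_mod_bound nM; exact. Qed.

Lemma value_UC n : (n <= M)%N -> UC (value n).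
Proof. by move=> nM e e0; have [r r0 hr] := ug e0; exists r => //; exact: value_mod. Qed.

Lemma cond_le_value n f z : cond (value n) (M - n.+1) f z <= value n.+1 z.
Proof. exact: (le_bigmax _ (fun f => cond (value n) (M - n.+1) f z)). Qed.

Lemma value_attained n z : exists f, value n.+1 z = cond (value n) (M - n.+1) f z.
Proof. exact: (bigmax_attained f0 (fun f => cond (value n) (M - n.+1) f z)).
Qed.

Section StateProcess.
Variable ff : nat -> Omega T m -> F.
Definition decided n := forall i, (i < n)%N -> forall f, measurable_fun [set: OmF T m (s i)] (fun w => ff i w == f).

(** The state is a polygonal path on the coarse grid: every fine increment is spread linearly over
    its whole coarse cell. Thus the state has finitely many degrees of freedom, which are the
    directions of the smoothing. *)
Fixpoint state i (w : Omega T m) : Omega T d :=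
  if i is i'.+1 then celladd (state i' w) (ka i') (xi i' (ff i' w) (inc i' w)) else zero_path T d.

Let decide_sum dX (X : measurableType dX) (u : X -> F) (G : F -> X -> R) :
  (forall f, mfun (fun x => u x == f)) -> (forall f, mfun (G f)) -> mfun (fun x => G (u x) x).
Proof.
move=> mu' mG; rewrite (_ : (fun x => _) = (fun x => \sum_f (if u x == f then G f x else 0))).
  by apply: mfun_sum => f; apply: measurable_fun_ifT => //; exact: mcst.
apply/funext => x; rewrite (bigD1 (u x))//= eqxx big1 ?addr0// => f fu.
by rewrite eq_sym (negbTE fu).
Qed.

Lemma measurable_state i : decided i -> (i <= M)%N -> measurable_fun [set: OmF T m (s i)] (fun w => state i w : Omega T d).
Proof.
elim: i => [|i ih] df iM; first exact: mcst.
have {}ih := ih (fun l li => df l (ltnW li)).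
have le1 : s i <= s i.+1 by apply/ltW/s_lt.
have m1 := @measurable_OmF_le R T m _ _ le1.
apply: measurable_celladd; first exact: (mcomp (ih (ltnW iM)) m1).
move=> a b; apply: (decide_sum (G := fun f (x : OmF T m (s i.+1)) => xi i f (inc i x) a b)).
  by move=> f; exact: (mcomp (df i (ltnSn i) f) m1).
move=> f; apply: measurable_xi => a' b'; rewrite ord1 /inc.
by apply: measurable_mxB; apply: measurable_coordF; rewrite ?s_ge0 ?lexx ?(ltnW iM).
Qed.

(** The state and the decision at step [i] depend on the past only, so [freeze_bounded] turns the
    next step into [cond]. *)
Lemma state_step (h : Omega T d -> R) C i : decided i.+1 -> UC h -> (forall z, `|h z| <= C) -> (i < M)%N ->
  (\int[P]_w (h (state i.+1 w))%:E = \int[P]_w (cond h i (ff i w) (state i w))%:E)%E.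
Proof.
move=> df uh hC iM.
have mh := UC_measurable T0 uh.
have mf : mfun (fun x : OmF T m (s i) * Vbox R m =>
    h (celladd (state i x.1) (ka i) (xi i (ff i x.1) (x.2 : 'cV[R]_m)))).
  apply: (mcomp mh); apply: measurable_celladd.
    exact: (mcomp (measurable_state (fun l li => df l (ltnW li)) (ltnW iM)) measurable_fst).
  move=> a b; apply: (decide_sum (u := fun x : OmF T m (s i) * Vbox R m => ff i x.1)
     (G := fun f (x : OmF T m (s i) * Vbox R m) => xi i f (x.2 : 'cV[R]_m) a b)).
    by move=> f; exact: (mcomp (df i (ltnSn i) f) measurable_fst).
  move=> f; apply: measurable_xi => a' b'; rewrite ord1. exact: (mcomp (measurable_Vcoord a') measurable_snd).
rewrite (freeze_bounded WP (s_ge0 (ltnW iM)) (s_lt iM) (s_leT iM) mf (fun x => hC _)).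
apply: eq_integral => w _; rewrite /cond /Rintegral fineK//.
exact: integrable_fin_num (next_integrable uh hC iM (ff i w) (state i w)).
Qed.

End StateProcess.

Definition best i (z : Omega T d) : F := odflt f0 [pick f | value (M - i) z == cond (value (M - i).-1) i f z].

Fixpoint best_state i (w : Omega T m) : Omega T d :=
  if i is i'.+1 then celladd (best_state i' w) (ka i') (xi i' (best i' (best_state i' w)) (inc i' w)) else zero_path T d.

Definition best_ff i w := best i (best_state i w).

Lemma state_best i w : state best_ff i w = best_state i w.
Proof.
elim: i => [//|i ih].
exact: (f_equal (fun z => celladd z (ka i) (xi i (best i (best_state i w)) (inc i w))) ih).
Qed.

Let idx i : (i < M)%N -> (M - i = (M - i).-1.+1)%N /\ (M - (M - i).-1.+1 = i)%N.
Proof. by move=> iM; lia. Qed.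

Lemma bestP i z : (i < M)%N -> value (M - i) z = cond (value (M - i).-1) i (best i z) z.
Proof.
move=> iM; rewrite /best; case: pickP => [f /eqP//|h].
have [e1 e2] := idx iM.
have [f hf] := value_attained (M - i).-1 z.
rewrite e2 -e1 in hf.
by move: (h f); move/eqP: hf => ->.
Qed.

Lemma measurable_best i f : (i < M)%N -> mfunO T d (fun z => best i z == f).
Proof.
move=> iM; have [e1 e2] := idx iM.
have nM : ((M - i).-1 <= M)%N by lia.
pose B f z := value (M - i) z == cond (value (M - i).-1) i f z.
have uv : UC (value (M - i)) by apply: value_UC; lia.
have uc f' : UC (cond (value (M - i).-1) i f').
  move=> e e0; have [r r0 hr] := value_UC nM e0; exists r => //.
  exact: (cond_mod (value_UC nM) (fun z => value_bound z nM) iM f' hr).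
have mB f' : mfun (B f') by apply: measurable_fun_eqr; apply: UC_measurable.
pose G (b : {ffun F -> bool}) := odflt f0 [pick f | b f] == f.
have := measurable_finite_choice R G mB; apply: eq_measurable_fun => z _.
by rewrite /G /best; congr (odflt f0 _ == f); apply: eq_pick => f' /=; rewrite ffunE.
Qed.

Lemma best_decided n : (n <= M)%N -> decided best_ff n.
Proof.
elim: n => [_ i //|n ih nM i]; rewrite ltnS leq_eqVlt => /orP[/eqP ->|iN] f; last exact: (ih (ltnW nM) i iN f).
have mS := measurable_state (ih (ltnW nM)) (ltnW nM).
apply: (mcomp (measurable_best f nM)); apply: eq_measurable_fun mS => w _.
exact: state_best.
Qed.

Lemma value_best : (value M (zero_path T d))%:E = (\int[P]_w (g (state best_ff M w))%:E)%E.
Proof.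
have h i : (i <= M)%N -> (value M (zero_path T d))%:E = (\int[P]_w (value (M - i) (state best_ff i w))%:E)%E.
  elim: i => [_|i ih iM]; first by rewrite subn0 /= int_prob_cst. have [e1 e2] := idx iM.
  have nM : ((M - i).-1 <= M)%N by lia. have -> : (M - i.+1 = (M - i).-1)%N by lia.
  rewrite (ih (ltnW iM)) (state_step (best_decided iM) (value_UC nM) (fun z => value_bound z nM) iM).
  by apply: eq_integral => w _; rewrite (bestP _ iM) /best_ff state_best.
by rewrite (h M (leqnn M)) subnn.
Qed.

Hypothesis kaK : forall i, (i < M)%N -> (ka i < K)%N.
Variables (Cm Cs : R).
Hypotheses (muC : forall t f, 0 <= t -> n2 (mu t (ctl f)) <= Cm)
  (sigmaC : forall t f, 0 <= t -> n2 (sigma t (ctl f)) <= Cs).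
Variables (q : nat) (dl e0 : R).
Hypotheses (q0 : (0 < q)%N) (dl0 : 0 < dl) (ge0 : mod_ok g e0 dl).
Local Notation eps := (q%:R * dl).
Local Notation pos z i f y := (celladd z (ka i) (xi i f y)).

(** The value with [M - i] steps to go, smoothed in all directions. Smoothing happens after the
    recursion, so [U] satisfies the dynamic programming inequality but not the equation. *)
Definition U i : Omega T d -> R := Sm (@psh R T d K) q dl (dirs2 d K) (value (M - i)).
(** The gradient of [U i.+1] in the coarse cell that is active during step [i]; evaluated along the
    path it becomes the dual integrand. *)
Definition slope i (z : Omega T d) : 'cV[R]_d :=
  \col_j grad (@psh R T d K) q dl (dirs2 d K) (ka i, j) (value (M - i.+1)) z.
Definition lin i f (z : Omega T d) (y : 'cV[R]_m) : R := (((slope i z)^T *m sigma (s i) (ctl f)) *m y) 0 0.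
(** The part of the centred one-step change of [U] that the linear martingale term does not
    explain. *)
Definition rest i f (z : Omega T d) (y : 'cV[R]_m) : R :=
  U i.+1 (pos z i f y) - cond (U i.+1) i f z - lin i f z y.

Let leM i : (M - i <= M)%N. Proof. exact: leq_subr. Qed.

Let vb n z (nM : (n <= M)%N) : `|value n z| <= Cg := value_bound z nM.
Let vu n (nM : (n <= M)%N) : UC (value n) := value_UC nM.

Lemma U_bound i z : `|U i z| <= Cg.
Proof. by apply: Sm_bound => // z'; exact: vb (leM i). Qed.

Lemma U_UC i : UC (U i).
Proof.
move=> e e_gt0; have [r r0 hr] := vu (leM i) e_gt0.
exists r => //; exact: (Sm_mod T0 K0 dl q0 (dirs2 d K) hr).
Qed.

(** The Bellman inequality for [value] is preserved by the averages, which are monotone and commute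
    with [cond]. *)
Lemma cond_U_le i f z : (i < M)%N -> cond (U i.+1) i f z <= U i z.
Proof.
move=> iM; rewrite /U (cond_Sm f (dirs2 d K) q0 dl0 (vu (leM i.+1)) (fun z => vb z (leM i.+1)) iM).
apply: Sm_mono => z'.
have e1 : (M - i = (M - i.+1).+1)%N by lia.
have e2 : (M - (M - i.+1).+1 = i)%N by lia.
by have := cond_le_value (M - i.+1) f z'; rewrite e2 -e1.
Qed.

Lemma slope_UC i j : UC (fun z => slope i z j 0).
Proof.
move=> e e_gt0; have he : 0 < e * eps / 2 by rewrite divr_gt0// !mulr_gt0// ltr0n.
have [r r0 hr] := vu (leM i.+1) he.
exists r => // z z' hz; rewrite /slope !mxE.
apply: le_trans (grad_mod T0 K0 q0 dl0 (ka i, j) hr hz) _.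
have eps_neq0 : eps != 0 by rewrite gt_eqF// mulr_gt0// ltr0n.
rewrite le_eqVlt; apply/orP; left; apply/eqP.
by rewrite mulrCA mulfV ?pnatr_eq0// mulr1 mulfK.
Qed.

Lemma slope_bound i z j : `|slope i z j 0| <= 2 * Cg / eps.
Proof.
by rewrite mxE; apply: grad_bound => // z'; exact: vb (leM _).
Qed.

(** Summing the identity that defines [rest] for a fixed control sequence; [cond_U_le] discards the
    nonpositive drift. The inequality holds for every [w], as pathwise duality requires. *)
Lemma U_path (fs : nat -> F) n w : (n <= M)%N -> U n (state (fun i _ => fs i) n w) <= U 0 (zero_path T d) +
    \sum_(i < n) (rest i (fs i) (state (fun i _ => fs i) i w) (inc i w) +
       lin i (fs i) (state (fun i _ => fs i) i w) (inc i w)).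
Proof.
elim: n => [|n ih] nM; first by rewrite big_ord0 addr0.
rewrite big_ord_recr /=; set z := state _ n w in ih *.
have h1 := ih (ltnW nM); have h2 := cond_U_le (fs n) z nM.
by rewrite /rest; lra.
Qed.

Section OneRemainder.
Variables (i : nat) (f : F) (z : Omega T d).
Hypothesis iM : (i < M)%N.
Let mi a b : mfunO T m (fun w => inc i w a b).
Proof. exact: (measurable_inc a b iM). Qed.

Lemma lin_mean : P.-integrable setT (fun w => (lin i f z (inc i w))%:E) /\ (\int[P]_w (lin i f z (inc i w))%:E = 0)%E.
Proof.
set r := (slope i z)^T *m sigma (s i) (ctl f).
have e w : lin i f z (inc i w) = \sum_a r 0 a * (w (s i.+1) a 0 - w (s i) a 0).
  by rewrite /lin mxE; apply: eq_bigr => a _; rewrite !mxE.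
have h a := @mean_mul_incr R T m P WP (s i) (s i.+1) (fun=> r 0 a) `|r 0 a| a (s_ge0 (ltnW iM)) (s_lt iM) (s_leT iM)
   (mcst _) (fun=> lexx _).
split.
  have ii : P.-integrable setT (fun w => \sum_a (r 0%R a * (w (s i.+1) a 0%R - w (s i) a 0%R))%:E)%E.
    by apply: integrable_sum => // a _; have [] := h a.
  by apply: eq_integrable ii => // w _; rewrite e sumEFin.
under eq_integral do rewrite e -sumEFin.
rewrite integral_sum//; last by move=> a; have [] := h a.
by rewrite big1// => a _; have [] := h a.
Qed.

Let icond := finite_measure_integrable_cst P (cond (U i.+1) i f z) measurableT.

Lemma U_next_integrable : Rint P (fun w => U i.+1 (pos z i f (inc i w))).
Proof. exact: (next_integrable (U_UC i.+1) (U_bound i.+1) iM f z). Qed.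

Lemma rest_integrable : Rint P (fun w => rest i f z (inc i w)).
Proof.
have [h _] := lin_mean.
have h1 := integrableB measurableT U_next_integrable icond.
exact: (integrableB measurableT h1 h).
Qed.

Lemma rest_mean : (\int[P]_w (rest i f z (inc i w))%:E = 0)%E.
Proof.
have [h1 h2] := lin_mean.
have h3 := integrableB measurableT U_next_integrable icond.
under eq_integral do rewrite /rest EFinB.
rewrite integralB// h2 sube0.
under eq_integral do rewrite EFinB.
rewrite integralB//; last exact: U_next_integrable.
rewrite int_prob_cst /cond /Rintegral fineK ?subee//; exact: integrable_fin_num U_next_integrable.
Qed.

Local Notation Dt := (s i.+1 - s i).
(** The second order bound of the smoothing times [d * 2], from the squared sum norm bounded by
    [d * n2] and from the splitting of [xi] into drift and noise. *)
Definition B1 : R := 4 * Cg / eps ^+ 2 * d%:R * 2.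
(** The rounding error of [path_expansion]; it does not shrink with the time step, but it does with
    [dl]. *)
Definition sm : R := e0 + d%:R * (2 * Cg / eps * dl).

Lemma Cg_ge0 : 0 <= Cg. Proof. exact: le_trans (gC (zero_path T d)). Qed.

Lemma B1_ge0 : 0 <= B1.
Proof. by rewrite /B1 !mulr_ge0// ?Cg_ge0// invr_ge0 sqr_ge0. Qed.

(** The Taylor bound at the Euler increment. The drift part of the first order term does not depend
    on [y], so only [lin] is left beside a constant. *)
Lemma expansion y :
  `|U i.+1 (pos z i f y) - (U i.+1 z + \sum_j (Dt *: mu (s i) (ctl f)) j 0 * slope i z j 0) - lin i f z y| <=
   (B1 * Cm * Dt ^+ 2 + sm) + B1 * Cs * n2 y.
Proof.
have hv := value_mod (leM i.+1) dl0 ge0.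
have := path_expansion T0 K0 q0 dl0 (xi i f y) z (fun z => vb z (leM i.+1)) hv (kaK iM).
rewrite -/(U i.+1) -/sm.
have -> : \sum_j xi i f y j 0 * grad (@psh R T d K) q dl (dirs2 d K) (ka i, j) (value (M - i.+1)) z =
   \sum_j (Dt *: mu (s i) (ctl f)) j 0 * slope i z j 0 + lin i f z y.
  rewrite /lin -mulmxA mxE -big_split /=; apply: eq_bigr => j _.
  by rewrite /xi [in LHS]mxE mulrDl [(slope i z)^T 0 j]mxE /slope [(\col_j _) j 0]mxE [X in _ + X]mulrC.
rewrite opprD !addrA => h; rewrite -[X in X - _ - _]/(_) opprD addrA; apply: le_trans h _.
have hn : n1 (xi i f y) ^+ 2 <= d%:R * 2 * (Cm * Dt ^+ 2 + Cs * n2 y).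
  apply: le_trans (n1_sqr_le _) _; rewrite -mulrA ler_wpM2l//.
  apply: le_trans (n2D _ _) _; rewrite -mulrDr ler_wpM2l//; apply: lerD.
    by rewrite n2Z mulrC ler_wpM2r ?sqr_ge0// muC// s_ge0// ltnW.
  by apply: le_trans (n2M _ _) _; rewrite ler_wpM2r ?n2_ge0// sigmaC// s_ge0// ltnW.
have c0 : 0 <= 4 * Cg / eps ^+ 2 by rewrite !mulr_ge0 ?Cg_ge0// invr_ge0 sqr_ge0.
have h' := ler_wpM2l c0 hn.
have e : 4 * Cg / eps ^+ 2 * (d%:R * 2 * (Cm * Dt ^+ 2 + Cs * n2 y)) = B1 * Cm * Dt ^+ 2 + B1 * Cs * n2 y.
  by rewrite /B1; ring.
by rewrite e in h'; move: h'; rewrite /sm; lra.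
Qed.

Hypotheses (Cm0 : 0 <= Cm) (Cs0 : 0 <= Cs) (e00 : 0 <= e0).
Let Dt0 : 0 <= Dt. Proof. by rewrite subr_ge0 ltW// s_lt. Qed.
Let DtT : Dt <= T.
Proof. by have := s_ge0 (ltnW iM); have := s_leT iM; lra. Qed.

Lemma sm_ge0 : 0 <= sm.
Proof.
have := Cg_ge0 => c0.
by rewrite /sm addr_ge0// !mulr_ge0 ?invr_ge0 ?mulr_ge0// ltW.
Qed.

(** The factor 5 collects the fourth moments of the noise: 4 from the fluctuation and 1 from the
    square of the mean, since [(16 * m) ^+ 2] is a quarter of [2 ^+ 10 * m ^+ 2]. *)
Definition B2 : R := 16 * (B1 * Cm * T) ^+ 2 + 5 * (2 ^+ 10 * m%:R ^+ 2) * (B1 * Cs) ^+ 2.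

(** The remainder is quadratic in an increment of size the root of the time step, so its square has
    a mean of the order of the squared time step. *)
Lemma rest_sqr : (\int[P]_w (rest i f z (inc i w) ^+ 2)%:E <= (B2 * Dt ^+ 2 + 16 * sm ^+ 2)%:E)%E.
Proof.
pose b0 := B1 * Cm * Dt ^+ 2 + sm; pose b1 := B1 * Cs.
have hB : 0 <= B1 * Cm by exact: mulr_ge0 B1_ge0 Cm0.
have b00 : 0 <= b0 by exact: addr_ge0 (mulr_ge0 hB (sqr_ge0 _)) sm_ge0.
have b10 : 0 <= b1 by exact: mulr_ge0 B1_ge0 Cs0.
pose c := U i.+1 z + \sum_j (Dt *: mu (s i) (ctl f)) j 0 * slope i z j 0.
pose Y w := U i.+1 (pos z i f (inc i w)) - c - lin i f z (inc i w).
have hY w : `|Y w| <= b0 + b1 * n2 (inc i w) by exact: expansion.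
pose EU := cond (U i.+1) i f z.
(* [rest] and the expansion error [Y] differ by a constant. As [rest] has mean zero, this constant
   is minus the mean of [Y] and is controlled by the mean of the bound on [Y]. *)
have hr w : rest i f z (inc i w) = Y w + (c - EU) by rewrite /rest /Y /EU; ring.
have mn2 : mfunO T m (fun w => n2 (inc i w)) by exact: measurable_n2.
have mrest : mfunO T m (fun w => rest i f z (inc i w)).
  by apply/EFinP; exact: measurable_int rest_integrable.
have mY : mfunO T m Y.
  apply: (eq_measurable_fun (fun w => rest i f z (inc i w) - (c - EU))).
    by move=> w _; rewrite hr addrK.
  by apply: mfunB => //; exact: mcst.
have iY : Rint P Y.
  have ib := finite_measure_integrable_cst P (c - EU) measurableT.
  by apply: eq_integrable (integrableB measurableT rest_integrable ib) => // w _; rewrite /= hr -EFinB addrK.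
have s0 := s_ge0 (ltnW iM).
have En2 : (\int[P]_w (n2 (inc i w))%:E <= (16 * m%:R * Dt)%:E)%E by exact: (incr_n2 WP s0 (s_lt iM) (s_leT iM)).
have En4 : (\int[P]_w (n2 (inc i w) ^+ 2)%:E <= (2 ^+ 10 * m%:R ^+ 2 * Dt ^+ 2)%:E)%E.
  exact: (incr_n2_sqr WP s0 (s_lt iM) (s_leT iM)).
set v2 : R := 16 * m%:R * Dt in En2; set v4 : R := 2 ^+ 10 * m%:R ^+ 2 * Dt ^+ 2 in En4.
have v20 : 0 <= v2 by rewrite /v2; apply: mulr_ge0 Dt0; apply: mulr_ge0 (ler0n _ _) (ler0n _ _).
have hcE : `|c - EU| <= b0 + b1 * v2.
  have e1 : (\int[P]_w (Y w)%:E = (EU - c)%:E)%E.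
    have ib := finite_measure_integrable_cst P (c - EU) measurableT.
    transitivity (\int[P]_w ((rest i f z (inc i w))%:E - (c - EU)%:E))%E.
      by apply: eq_integral => w _; rewrite hr -EFinB addrK.
    by rewrite integralB// ?rest_mean ?int_prob_cst ?sub0e -?EFinN ?opprB//; exact: rest_integrable.
  rewrite distrC -lee_fin -abse_EFin -e1.
  apply: le_trans (le_abse_integral _ measurableT _) _; first by apply/EFinP.
  apply: (via (\int[P]_w (b0 * 1 + b1 * n2 (inc i w))%:E)%E).
    apply: (@int_le _ _ _ P (fun w => `|Y w|)) => //.
    - exact: mcomp.
    - apply: mfunD; first exact: mcst.
      by apply: mfunM => //; exact: mcst.
    - by move=> w; rewrite mulr1.
  apply: le_trans (@int_le2 _ _ _ P b0 b1 (fun w => b0 * 1 + b1 * n2 (inc i w)) (fun=> 1) (fun w => n2 (inc i w)) _ _ _ b00 b10 _ _ _ _) _ => //.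
  - apply: mfunD; first exact: mcst.
    by apply: mfunM => //; exact: mcst.
  - by move=> w; rewrite addr_ge0// mulr_ge0// n2_ge0.
  - by move=> w; exact: n2_ge0.
  rewrite int_prob_cst mule1 (EFinD b0) (EFinM b1); apply: leeD2l.
  by apply: lee_wpmul2l => //; rewrite lee_fin.
have hsq w : rest i f z (inc i w) ^+ 2 <= (8 * b0 ^+ 2 + 4 * b1 ^+ 2 * v2 ^+ 2) * 1 + 4 * b1 ^+ 2 * (n2 (inc i w) ^+ 2).
  rewrite hr; have h1 := hY w; set x := n2 (inc i w) in h1 *. have x0 : 0 <= x by exact: n2_ge0.
  have q1 : Y w ^+ 2 <= 2 * b0 ^+ 2 + 2 * b1 ^+ 2 * x ^+ 2.
    rewrite -(real_normK (num_real (Y w))); apply: (via ((b0 + b1 * x) ^+ 2)).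
      by rewrite lerXn2r ?nnegrE// addr_ge0// mulr_ge0.
    by have := sqr_ge0 (b0 - b1 * x); rewrite !expr2; lra.
  have q2 : (c - EU) ^+ 2 <= 2 * b0 ^+ 2 + 2 * b1 ^+ 2 * v2 ^+ 2.
    rewrite -(real_normK (num_real (c - EU))); apply: (via ((b0 + b1 * v2) ^+ 2)).
      by rewrite lerXn2r ?nnegrE// addr_ge0// mulr_ge0.
    by have := sqr_ge0 (b0 - b1 * v2); rewrite !expr2; lra.
  have q3 : (Y w + (c - EU)) ^+ 2 <= 2 * Y w ^+ 2 + 2 * (c - EU) ^+ 2.
    by have := sqr_ge0 (Y w - (c - EU)); rewrite !expr2; lra.
  lra.
set k1 := 8 * b0 ^+ 2 + 4 * b1 ^+ 2 * v2 ^+ 2 in hsq; set k2 := 4 * b1 ^+ 2 in hsq.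
have k10 : 0 <= k1 by rewrite /k1; apply: addr_ge0; apply: mulr_ge0; rewrite ?sqr_ge0// mulr_ge0 ?sqr_ge0.
have k20 : 0 <= k2 by rewrite /k2 mulr_ge0 ?sqr_ge0.
apply: le_trans (@int_le2 _ _ _ P k1 k2 (fun w => rest i f z (inc i w) ^+ 2) (fun=> 1) (fun w => n2 (inc i w) ^+ 2) _ _ _ k10 k20 _ _ _ hsq) _.
- exact: mfunX.
- exact: mcst.
- exact: mfunX.
- by move=> w; exact: sqr_ge0.
- by move=> w; exact: ler01.
- by move=> w; exact: sqr_ge0.
rewrite int_prob_cst mule1; apply: (via (k1 + k2 * v4)%:E).
  by rewrite (EFinD k1) (EFinM k2); apply: leeD2l; apply: lee_wpmul2l; rewrite ?lee_fin.
rewrite lee_fin /k1 /k2.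
have b0sq : b0 ^+ 2 <= 2 * ((B1 * Cm * T) ^+ 2 * Dt ^+ 2) + 2 * sm ^+ 2.
  have hT : B1 * Cm * Dt ^+ 2 <= B1 * Cm * T * Dt by rewrite expr2 mulrA; apply: ler_wpM2r => //; apply: ler_wpM2l.
  have h0 : 0 <= B1 * Cm * Dt ^+ 2 by exact: mulr_ge0 hB (sqr_ge0 _).
  have h1 : (B1 * Cm * Dt ^+ 2) ^+ 2 <= (B1 * Cm * T) ^+ 2 * Dt ^+ 2.
    by rewrite -exprMn lerXn2r// nnegrE (le_trans h0).
  have := sqr_ge0 (B1 * Cm * Dt ^+ 2 - sm); rewrite /b0.
  move: h1; set u := B1 * Cm * Dt ^+ 2 => h1; rewrite !(expr2 (u + sm)) !(expr2 (u - sm)); move: h1; rewrite (expr2 u) (expr2 sm); lra.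
have v2sq : v2 ^+ 2 = 4^-1 * v4 by rewrite /v2 /v4; field.
rewrite v2sq /B2 -/b1.
have -> : (16 * (B1 * Cm * T) ^+ 2 + 5 * (2 ^+ 10 * m%:R ^+ 2) * b1 ^+ 2) * Dt ^+ 2 =
   16 * ((B1 * Cm * T) ^+ 2 * Dt ^+ 2) + 5 * (b1 ^+ 2 * v4) by rewrite /v4; ring.
have -> : 4 * b1 ^+ 2 * (4^-1 * v4) = b1 ^+ 2 * v4 by field.
rewrite -(mulrA 4 (b1 ^+ 2) v4); lra.
Qed.

End OneRemainder.

(** The remainders are orthogonal by [sq_step_scalar], so their second moments add up instead of
    their norms. *)
Lemma rest_sum_L2 (fs : nat -> F) n : 0 <= Cm -> 0 <= Cs -> 0 <= e0 -> (n <= M)%N ->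
  measurable_fun [set: OmF T m (s n)] (fun w => \sum_(i < n) rest i (fs i) (state (fun i _ => fs i) i w) (inc i w)) /\
  (\int[P]_w ((\sum_(i < n) rest i (fs i) (state (fun i _ => fs i) i w) (inc i w)) ^+ 2)%:E <=
    (\sum_(i < n) (B2 * (s i.+1 - s i) ^+ 2 + 16 * sm ^+ 2))%:E)%E.
Proof.
move=> Cm0 Cs0 e00.
have dec i : decided (fun i (_ : Omega T m) => fs i) i by move=> j _ f; exact: mcst.
have mst i (iM : (i <= M)%N) := measurable_state (dec i) iM.
have mS i j : mfun (fun z => slope i z j 0) by apply: UC_measurable => //; exact: slope_UC.
have mlin i f dX (X : measurableType dX) (Z : X -> Omega T d) (y : X -> 'cV[R]_m) :
    mfun Z -> (forall a b, mfun (fun x => y x a b)) -> mfun (fun x => lin i f (Z x) (y x)).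
  move=> mZ my; apply: (measurable_mulmx (F := fun x => (slope i (Z x))^T *m sigma (s i) (ctl f))) => // a b.
  apply: (measurable_mulmx (F := fun x => (slope i (Z x))^T) (G := fun=> sigma (s i) (ctl f))) => a' b'.
    by under eq_fun do rewrite mxE; rewrite ord1; exact: (mcomp (mS i b') mZ).
  exact: mcst.
have mcond i f : (i < M)%N -> mfun (cond (U i.+1) i f).
  move=> iM; apply: UC_measurable => // e e_gt0; have [r r0 hr] := U_UC i.+1 e_gt0; exists r => //.
  exact: (cond_mod (U_UC i.+1) (U_bound i.+1) iM f hr).
have mrest i f dX (X : measurableType dX) (Z : X -> Omega T d) (y : X -> 'cV[R]_m) : (i < M)%N ->
    mfun Z -> (forall a b, mfun (fun x => y x a b)) -> mfun (fun x => rest i f (Z x) (y x)).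
  move=> iM mZ my; apply: mfunB; last exact: mlin. apply: mfunB; last exact: (mcomp (mcond i f iM) mZ).
  apply: mcomp; first by apply: UC_measurable => //; exact: U_UC.
  by apply: measurable_celladd => //; apply: measurable_xi.
elim: n => [_|n ih nM].
  split; first by under eq_fun do rewrite big_ord0; exact: mcst.
  by rewrite big_ord0; under eq_integral do rewrite big_ord0 expr0n; rewrite integral0.
have [ih1 ih2] := ih (ltnW nM).
have le1 : s n <= s n.+1 by apply/ltW/s_lt.
have m1 := @measurable_OmF_le R T m _ _ le1.
split.
  apply: (eq_measurable_fun (fun w : OmF T m (s n.+1) => (\sum_(i < n) rest i (fs i) (state (fun i _ => fs i) i w) (inc i w)) +
     rest n (fs n) (state (fun i _ => fs i) n w) (inc n w))).
    by move=> w _; rewrite big_ord_recr.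
  apply: mfunD; first exact: (mcomp ih1 m1). apply: mrest => //; first exact: (mcomp (mst n (ltnW nM)) m1).
  move=> a b; rewrite ord1 /inc. by apply: measurable_mxB; apply: measurable_coordF; rewrite ?s_ge0 ?lexx ?(ltnW nM).
rewrite big_ord_recr /= EFinD.
under eq_integral do rewrite big_ord_recr /=.
have vn0 : 0 <= B2 * (s n.+1 - s n) ^+ 2 + 16 * sm ^+ 2.
  have h := rest_sqr (fs n) (zero_path T d) nM Cm0 Cs0 e00.
  rewrite -lee_fin; apply: le_trans h; apply: integral_ge0 => w _; rewrite lee_fin; exact: sqr_ge0.
have mr : mfun (fun x : OmF T m (s n) * Vbox R m =>
    rest n (fs n) (state (fun i _ => fs i) n x.1) (x.2 : 'cV[R]_m)).
  apply: mrest => //; first exact: (mcomp (mst n (ltnW nM)) measurable_fst).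
  by move=> a b; rewrite ord1; exact: (mcomp (measurable_Vcoord a) measurable_snd).
apply: le_trans (leeD2r _ ih2).
apply: (@sq_step_scalar R T m P WP (s n) (s n.+1) (s_ge0 (ltnW nM)) (s_lt nM) (s_leT nM)
  (fun w => \sum_(i < n) rest i (fs i) (state (fun i _ => fs i) i w) (inc i w))
  (fun w y => rest n (fs n) (state (fun i _ => fs i) n w) y) _ ih1 mr vn0).
- by move=> w; exact: rest_integrable.
- by move=> w; exact: rest_mean.
- by move=> w; exact: rest_sqr.
Qed.

Hypotheses (ka1 : forall i, (i < M)%N -> coarse T K (ka i) <= s i)
  (ka2 : forall i, (i < M)%N -> s i.+1 <= coarse T K (ka i).+1).
Variable ff : nat -> Omega T m -> F.
Local Notation st := (state ff).
Local Notation co := (coarse T K).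

Definition euler_drift (t : R) (w : Omega T m) : 'cV[R]_d :=
  \sum_(i < M) (Num.min (s i.+1) t - Num.min (s i) t) *: mu (s i) (ctl (ff i w)).
Definition euler_mart (t : R) (w : Omega T m) : 'cV[R]_d :=
  \sum_(i < M) sigma (s i) (ctl (ff i w)) *m (w (Num.min (s i.+1) t) - w (Num.min (s i) t)).
Definition euler t w := euler_drift t w + euler_mart t w.
(** What the first [n] Euler increments contribute up to the coarse node [l]. *)
Definition partial (n l : nat) (w : Omega T m) : 'cV[R]_d :=
  \sum_(i < M) (if (i < n)%N && (ka i < l)%N then xi i (ff i w) (inc i w) else 0).

Lemma co_le l l' : (l <= l')%N -> co l <= co l'.
Proof. by move=> h; rewrite /coarse ler_wpM2r ?invr_ge0// ler_wpM2l ?(ltW T0)// ler_nat. Qed.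

(** Fine cells do not cross coarse nodes, so stopping at [co l] or at [s n] keeps or drops each
    increment as a whole. *)
Lemma euler_partial n l w : (n <= M)%N -> (l <= K)%N -> euler (Num.min (co l) (s n)) w = partial n l w.
Proof.
move=> nM lK; rewrite /euler /euler_drift /euler_mart /partial -big_split /=; apply: eq_bigr => i _.
set u := Num.min (co l) (s n).
have [/andP[il kl]|h] := boolP ((i < n)%N && (ka i < l)%N).
  have h1 : s i.+1 <= u.
    rewrite le_min (le_trans (ka2 (ltn_ord i)) (co_le kl)) /= (is_grid_le gs)//.
  have h0 : s i <= u by apply: le_trans h1; apply: ltW; case: gs => _ _; apply.
  by rewrite (min_idPl h1) (min_idPl h0).
have h0 : u <= s i.
  move: h; rewrite negb_and -!leqNgt => /orP[h|h]; rewrite /u ge_min.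
    by rewrite (is_grid_le gs _ (ltnW (ltn_ord i))) ?h ?orbT.
  by rewrite (le_trans (co_le h) (ka1 (ltn_ord i))).
have h1 : u <= s i.+1 by apply: le_trans h0 _; apply: ltW; case: gs => _ _; apply.
by rewrite (min_idPr h1) (min_idPr h0) !subrr scale0r mulmx0 addr0.
Qed.

Lemma stateE n w (t : R) : (n <= M)%N -> 0 <= t <= T -> st n w t =
  \sum_(i < M) (if (i < n)%N then ramp (co (ka i)) (co (ka i).+1) t *: xi i (ff i w) (inc i w) else 0).
Proof.
move=> + ht; elim: n => [_|n ih nM]; first by rewrite big1.
rewrite [st n.+1 w]/= path_addE ?coarse_ge0 ?coarse_le ?(ltW T0)// ih ?(ltnW nM)//.
rewrite (bigD1 (Ordinal nM))//= ltnn add0r [in RHS](bigD1 (Ordinal nM))//= ltnSn addrC; congr (_ + _).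
apply: eq_bigr => i ni; have {}ni : (i : nat) != n by apply: contra ni => /eqP e; apply/eqP/val_inj.
by rewrite ltnS [(i <= n)%N]leq_eqVlt (negbTE ni).
Qed.

Lemma partial_diff n l w : (l < K)%N -> partial n l.+1 w - partial n l w =
  \sum_(i < M) (if (i < n)%N && (ka i == l) then xi i (ff i w) (inc i w) else 0).
Proof.
move=> lK; rewrite /partial -sumrB; apply: eq_bigr => i _; case: (i < n)%N => /=; last by rewrite subrr.
by rewrite ltnS; case: (ltngtP (ka i) l) => _; rewrite ?subrr ?subr0.
Qed.

(** Each increment is spread over one coarse cell, so the state interpolates the Euler process,
    stopped at [s n], between the coarse nodes. *)
Lemma state_polygon n w : (n <= M)%N -> st n w = polygon T co K (fun l => partial n l w).
Proof.
move=> nM; apply: omega_eq => t ht; rewrite stateE//.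
have [g0 gK gS] := coarse_grid T0 K0.
rewrite (polygonE g0 gK gS _ ht).
under [RHS]eq_bigr do rewrite partial_diff// scaler_sumr.
rewrite exchange_big /=; apply: eq_bigr => i _.
rewrite (bigD1 (Ordinal (kaK (ltn_ord i))))//= eqxx andbT big1 ?addr0.
  by case: ifP => // _; rewrite scaler0.
move=> l li; have {}li : (ka i == l) = false.
  by apply/negbTE; apply: contra li => /eqP e; apply/eqP/val_inj.
by rewrite li andbF scaler0.
Qed.

Lemma partial0 n w : partial n 0 w = 0.
Proof. by rewrite /partial big1// => i _; rewrite andbF. Qed.

End Scheme.

(** * Left-open step processes and Euler processes *)

Section LeftSteps.
Variables (R : realType) (T : R) (m : nat) (s : nat -> R) (M : nat).
Hypothesis gs : is_grid T s M.
Variables (p q : nat) (v : nat -> Omega T m -> 'M[R]_(p, q)).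

(** Left-open cells, as for simple processes, whereas [step] uses right-open cells as in
    [det_controls]. The two conventions differ at the grid times only, a null set. *)
Definition lstep (t : R) (w : Omega T m) : 'M[R]_(p, q) :=
  \sum_(i < M) (if s i < t <= s i.+1 then v i w else 0).

Lemma left_cell_uniq i l (t : R) : (i < M)%N -> (l < M)%N -> s i < t <= s i.+1 -> s l < t <= s l.+1 -> i = l.
Proof.
wlog il : i l / (i <= l)%N.
  by move=> h hi hl ci cl; case/orP: (leq_total i l) => ?; [|symmetry]; apply: h.
move=> hi hl /andP[_ h1] /andP[h2 _]; move: il; rewrite leq_eqVlt => /orP[/eqP//|il].
have : s i.+1 <= s l by rewrite (is_grid_le gs) // ltnW.
by move=> h3; move: (lt_le_trans h2 h1); rewrite ltNge h3.
Qed.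

Lemma lstepE i (t : R) w : (i < M)%N -> s i < t <= s i.+1 -> lstep t w = v i w.
Proof.
move=> iM h; rewrite /lstep (bigD1 (Ordinal iM))//= h big1 ?addr0// => l il.
case: ifPn => // hl; case/eqP: il; apply/val_inj; exact: (left_cell_uniq (ltn_ord l) iM hl h).
Qed.

Lemma lstep0 w : lstep 0 w = 0.
Proof.
rewrite /lstep big1// => i _; case: ifPn => // /andP[h _].
by have /andP[h2 _] := is_grid_bnd gs (ltnW (ltn_ord i)); move: (le_lt_trans h2 h); rewrite ltxx.
Qed.

Lemma left_cell_cover (t : R) : 0 < t -> t <= T -> exists2 i, (i < M)%N & s i < t <= s i.+1.
Proof.
move=> t0 tT; have [g0 gn _] := gs.
have ex : exists i, (i <= M)%N && (s i < t) by exists 0%N; rewrite g0.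
have ub : forall i, (i <= M)%N && (s i < t) -> (i <= M)%N by move=> i /andP[].
case: (ex_maxnP ex ub) => i /andP[iM it] hi.
have iM' : (i < M)%N.
  rewrite ltn_neqAle iM andbT; apply/eqP => e; move: it; rewrite e gn => h.
  by move: (lt_le_trans h tT); rewrite ltxx.
exists i => //; rewrite it leNgt; apply/negP => h.
by have := hi i.+1; rewrite iM' h ltnn => /(_ isT).
Qed.

Lemma lstep_jm : (forall i, (i < M)%N -> forall a b, mfunO T m (fun w => v i w a b)) ->
  jointly_measurable lstep.
Proof.
move=> mv a b; apply: measurable_funTS.
rewrite (_ : (fun x => _) = (fun x : R * Omega T m =>
    \sum_(i < M) (if s i < x.1 <= s i.+1 then v i x.2 a b else 0))); last first.
  by apply/funext => x; rewrite /lstep summxE; apply: eq_bigr => l _; case: ifP => // _; rewrite mxE.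
apply: mfun_sum => i; apply: measurable_fun_ifT.
- apply: measurable_and; [apply: measurable_fun_ltr|apply: measurable_fun_ler]; try exact: measurable_fst.
    exact: mcst.
  exact: mcst.
- exact: (mcomp (mv i (ltn_ord i) a b) measurable_snd).
- exact: mcst.
Qed.

Lemma lstep_bounded C : 0 <= C -> (forall i w, (i < M)%N -> n2 (v i w) <= C) -> forall t w, n2 (lstep t w) <= C.
Proof.
move=> C0 vC t w; have [/existsP[i h]|h] := boolP [exists i : 'I_M, s i < t <= s i.+1].
  by rewrite (lstepE _ (ltn_ord i) h); exact: vC.
by rewrite /lstep big1 ?n20// => i _; case: ifPn => // hi; case/existsP: h; exists i.
Qed.

Lemma lstep_adapted_raw : (forall i, (i < M)%N -> forall a b, F_measurable (s i) (fun w => v i w a b)) -> adapted lstep.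
Proof.
move=> mv t ht a b.
have [t0|t0] := ltP 0 t.
  have [i iM h] := left_cell_cover t0 (proj2 (andP ht)).
  rewrite (_ : (fun w => _) = (fun w => v i w a b)); last by apply/funext => w; rewrite (lstepE _ iM h).
  by apply: F_measurable_le (mv i iM a b); apply: ltW; case/andP: h.
have -> : t = 0 by apply/eqP; rewrite eq_le t0; case/andP: ht.
by apply/F_measurableP; under eq_fun do rewrite lstep0 mxE; exact: mcst.
Qed.

Lemma lstep_adapted P : (forall i, (i < M)%N -> forall a b, F_measurable (s i) (fun w => v i w a b)) -> ae_adapted P lstep.
Proof. by move=> mv; apply/ae_adaptedP => t ht a b; apply: aeF_raw; exact: lstep_adapted_raw. Qed.

Lemma lstep_cover (t : R) w : 0 <= t <= T ->
  (t \in [seq s i | i <- iota 0 M.+1]) \/ exists i, [/\ (i < M)%N, s i < t < s i.+1 & lstep t w = v i w].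
Proof.
move=> /andP[t0 tT].
have mem i : (i <= M)%N -> s i \in [seq s i | i <- iota 0 M.+1].
  by move=> iM; apply: map_f; rewrite mem_iota /= add0n ltnS.
move: t0; rewrite le_eqVlt => /orP[/eqP <-|t0].
  by left; have := mem 0%N isT; case: gs => -> _ _.
have [i iM /[dup] h /andP[h1 h2]] := left_cell_cover t0 tT.
move: h2; rewrite le_eqVlt => /orP[/eqP ->|h2]; first by left; exact: mem.
by right; exists i; rewrite h1 h2; split => //; exact: lstepE.
Qed.

End LeftSteps.

Section GridIndicator.
Variables (R : realType) (T : R) (m : nat) (P : probability (Omega T m) R).

Lemma jm_grid (L : seq R) (B : R) : jm (fun (t : R) (_ : Omega T m) => if t \in L then B else 0).
Proof.
apply: measurable_funTS; apply: measurable_fun_ifT; try exact: mcst.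
elim: L => [|x L ih]; first exact: mcst.
rewrite (_ : (fun y => _) = (fun y : R * Omega T m => (y.1 == x) || (y.1 \in L))).
  apply: measurable_or => //; apply: measurable_fun_eqr; [exact: measurable_fst|exact: mcst].
by apply/funext => y; rewrite inE.
Qed.

Lemma D2_grid (L : seq R) (B : R) : 0 <= B -> (D2 P (fun t _ => if t \in L then B else 0%R) = 0)%E.
Proof.
move=> B0; rewrite /D2.
have z : (\int[leb]_(t in `[0%R, T]) (if t \in L then B else 0%R)%:E = 0)%E.
  have cL : countable [set` L] by exact/finite_set_countable/finite_seq.
  have nL : (@lebesgue_measure R [set` L] = 0)%E by exact: countable_lebesgue_measure0.
  have mL : measurable ([set` L] : set (measurableTypeR R)) by exact: countable_measurable.
  apply/eqP; rewrite eq_le; apply/andP; split; last first.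
    by apply: integral_ge0 => t _; rewrite lee_fin; case: ifP.
  apply: (via (\int[leb]_(t in setT) (B * \1_[set` L] t)%:E)%E).
    have e t : (if t \in L then B else 0) = B * \1_[set` L] t.
      by rewrite indicE mem_setE; case: (t \in L); rewrite ?mulr1 ?mulr0.
    under eq_integral do rewrite e. apply: ge0_subset_integral => //.
    - apply/EFinP; apply: mfunM; first exact: mcst.
      exact: measurable_indic.
    - by move=> t _; rewrite lee_fin mulr_ge0// indicE.
  under eq_integral do rewrite EFinM.
  rewrite ge0_integralZl_EFin//; last by apply/EFinP; exact: measurable_indic.
  rewrite integral_indic// setIT [X in (B%:E * X)%E](_ : _ = 0%E) ?mule0//; exact: nL.
under eq_integral do rewrite z.
exact: integral0.
Qed.

End GridIndicator.

Lemma null_union (R : realType) dX (X : measurableType dX) (P : probability X R) (U : set X) (p : R) (Q : X -> Prop) :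
  measurable U -> (P U <= p%:E)%E -> {ae P, forall w, Q w} ->
  exists U', [/\ measurable U', (P U' <= p%:E)%E & forall w, ~ U' w -> ~ U w /\ Q w].
Proof.
move=> mU pU [V [mV V0 hV]]; exists (U `|` V); split; first exact: measurableU.
  apply: le_trans (measureU2 P mU mV) _; rewrite [X in (_ + X)%E](_ : _ = 0%E) ?adde0//; exact: V0.
move=> w hw; split; first by move=> h; apply: hw; left.
by apply: contrapT => h; apply: hw; right; exact: hV.
Qed.

Lemma union_bound (R : realType) dX (X : measurableType dX) (P : probability X R) (b : R) (Q : nat -> X -> Prop) n :
  (forall l, (l < n)%N -> exists U, [/\ measurable U, (P U <= b%:E)%E & forall w, ~ U w -> Q l w]) ->
  exists U, [/\ measurable U, (P U <= (n%:R * b)%:E)%E & forall w, ~ U w -> forall l, (l < n)%N -> Q l w].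
Proof.
elim: n => [|n ih] h.
  by exists set0; split => //; rewrite measure0 mul0r.
have [|U1 [m1 p1 h1]] := ih; first by move=> l ln; apply: h; exact: ltnW.
have [U2 [m2 p2 h2]] := h n (ltnSn n).
exists (U1 `|` U2); split; first exact: measurableU.
  apply: le_trans (measureU2 P m1 m2) _; rewrite -natr1 mulrDl mul1r EFinD; exact: leeD.
move=> w hw l; rewrite ltnS leq_eqVlt => /orP[/eqP ->|ln].
  by apply: h2 => hh; apply: hw; right.
by apply: h1 => // hh; apply: hw; left.
Qed.

Section EulerDrift.
Variables (R : realType) (T : R) (d m k : nat).
Hypothesis T0 : 0 < T.
Variables (s : nat -> R) (M : nat).
Hypotheses (gs : is_grid T s M).
Variables (mu : R -> 'cV[R]_k -> 'cV[R]_d).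
Variables (F : finType) (ctl : F -> 'cV[R]_k) (ff : nat -> Omega T m -> F).
Local Notation muv := (fun i w => mu (s i) (ctl (ff i w))).

Let s_ge0 := is_grid_ge0 gs.
Let s_leT := is_grid_leT gs.
Let s_lt i : (i < M)%N -> s i < s i.+1. Proof. by case: gs => _ _; exact. Qed.

Lemma Rintegral_cell (a b t : R) : 0 <= a -> a <= b -> 0 <= t ->
  (@lebesgue_measure R).-integrable `[0, t] (fun u => ((if a < u <= b then 1 else 0) : R)%:E) /\
  \int[leb]_(u in `[0, t]) (if a < u <= b then 1 else 0) = Num.min b t - Num.min a t.
Proof.
move=> a0 ab t0.
have e (u : R) : (if a < u <= b then 1 else 0) = \1_(`]a, b]%classic : set R) u :> R.
  by rewrite indicE mem_setE/= in_itv/=; case: ifP.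
have mI : measurable (`[0, t]%classic : set (measurableTypeR R)) by exact: measurable_itv.
have mJ : measurable (`]a, b]%classic : set (measurableTypeR R)) by exact: measurable_itv.
have -> : (fun u => ((if a < u <= b then 1 else 0) : R)%:E) = (fun u => (\1_(`]a, b]%classic : set R) u)%:E).
  by apply/funext => u; rewrite e.
split.
  apply: (le_integrable mI (g := cst 1%:E)).
  - by apply/EFinP; exact: measurable_funTS.
  - by move=> u _ /=; rewrite lee_fin indicE; case: (_ \in _); rewrite ?normr1 ?normr0.
  - apply/integrableP; split; first exact: mcst.
    rewrite integral_cst//= lebesgue_measure_itv /= lte_fin.
    by case: ifP => _; rewrite ?mule0 ?ltry// normr1 mul1e -EFinB ltry.
rewrite /Rintegral; under eq_integral do rewrite e.
rewrite integral_indic//=.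
have -> : `]a, b] `&` `[0, t] = `]Num.min a t, Num.min b t]%classic :> set R.
  apply/seteqP; split => u /=; rewrite !in_itv/= => h.
    by move: h => [/andP[h1 h2] /andP[h3 h4]]; rewrite gt_min h1 le_min h2 h4.
  move: h; rewrite gt_min le_min => /andP[h1 /andP[h2 h3]]; rewrite h2 h3 !andbT.
  move: h1; rewrite [t < u]ltNge h3 orbF => h1; rewrite h1; split => //.
  by apply: ltW; exact: le_lt_trans a0 h1.
have : (leb (`]Num.min a t, Num.min b t]%classic : set R) = (Num.min b t - Num.min a t)%:E)%E.
  rewrite lebesgue_measure_itv /= lte_fin; case: ltP => h; first by rewrite -EFinB.
  have -> : Num.min b t = Num.min a t; last by rewrite subrr.
  by apply/le_anti; rewrite h /= le_min !ge_min ab lexx orbT.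
by move=> ->.
Qed.

Lemma drift_euler (t : R) w : 0 <= t <= T -> drift (lstep s M muv) w t = euler_drift s M mu ctl ff t w.
Proof.
move=> /andP[t0 tT]; apply/matrixP => a b; rewrite ord1 mxE /euler_drift summxE.
have hc (i : 'I_M) := Rintegral_cell (s_ge0 (ltnW (ltn_ord i))) (ltW (s_lt (ltn_ord i))) t0.
transitivity (\int[leb]_(u in `[0, t])
    (\sum_(i < M) mu (s i) (ctl (ff i w)) a 0 * (if s i < u <= s i.+1 then 1 else 0))).
  apply: eq_Rintegral => u _; rewrite /lstep summxE; apply: eq_bigr => i _.
  by case: ifP => _; rewrite ?mulr1 ?mulr0// mxE.
rewrite Rintegral_lin; [|exact: measurable_itv|by move=> i; exact: (hc i).1].
by apply: eq_bigr => i _; rewrite (hc i).2 mxE mulrC.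
Qed.

Lemma min_sub_mono (a b u t : R) : a <= b -> u <= t -> Num.min b u - Num.min a u <= Num.min b t - Num.min a t.
Proof. by move=> ab ut; rewrite /Num.min; case: ltP => h1; case: ltP => h2; case: ltP => h3; case: ltP => h4; lra. Qed.

(** The lengths of the cells intersected with the time interval from [u] to [t] add up to
    [t - u]. *)
Lemma euler_drift_osc (u t C : R) w : 0 <= u -> u <= t -> t <= T -> (forall r f, 0 <= r -> `|mu r (ctl f)| <= C) ->
  `|euler_drift s M mu ctl ff t w - euler_drift s M mu ctl ff u w| <= C * (t - u).
Proof.
move=> u0 ut tT muC; rewrite /euler_drift -sumrB.
have C0 : 0 <= C by apply: le_trans (muC 0 (ff 0%N w) (lexx _)).
apply: le_trans (ler_norm_sum _ _ _) _.
apply: (via (\sum_(i < M) C * ((Num.min (s i.+1) t - Num.min (s i) t) - (Num.min (s i.+1) u - Num.min (s i) u)))).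
  apply: ler_sum => i _; rewrite -scalerBl normrZ mulrC ger0_norm.
    by rewrite ler_wpM2r ?muC// ?s_ge0 ?(ltnW (ltn_ord i))// subr_ge0 min_sub_mono// ltW// s_lt.
  by rewrite subr_ge0 min_sub_mono// ltW// s_lt.
rewrite -mulr_sumr ler_wpM2l// sumrB.
have tel (r : R) : 0 <= r -> r <= T -> \sum_(i < M) (Num.min (s i.+1) r - Num.min (s i) r) = r.
  move=> r0 rT; rewrite -(big_mkord xpredT (fun i => Num.min (s i.+1) r - Num.min (s i) r)) telescope_sumr//.
  by have [-> -> _] := gs; rewrite (min_idPr rT) (min_idPl r0) subr0.
by rewrite !tel// ?(le_trans u0)// (le_trans ut).
Qed.

End EulerDrift.

Section DecidedValues.
Variables (R : realType) (T : R) (m : nat) (s : nat -> R) (F : finType) (ff : nat -> Omega T m -> F).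

Lemma decided_F M i (G : F -> R) : decided s ff M -> (i < M)%N -> F_measurable (s i) (fun w => G (ff i w)).
Proof.
move=> df iM; apply/F_measurableP.
rewrite (_ : (fun w => _) = (fun w : OmF T m (s i) => \sum_f (if ff i w == f then G f else 0))).
  by apply: mfun_sum => f; apply: measurable_fun_ifT; [exact: df|exact: mcst|exact: mcst].
apply/funext => w; rewrite (bigD1 (ff i w))//= eqxx big1 ?addr0// => f fu.
by rewrite eq_sym (negbTE fu).
Qed.

End DecidedValues.

Section EulerComparison.
Variables (R : realType) (T : R) (d m k : nat) (P : probability (Omega T m) R).
Hypotheses (T0 : 0 < T) (WP : is_wiener P).
Variables (K : nat) (s : nat -> R) (M : nat) (ka : nat -> nat).
Hypotheses (K0 : (0 < K)%N) (gs : is_grid T s M) (kaK : forall i, (i < M)%N -> (ka i < K)%N)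
  (ka1 : forall i, (i < M)%N -> coarse T K (ka i) <= s i)
  (ka2 : forall i, (i < M)%N -> s i.+1 <= coarse T K (ka i).+1).
Variables (mu : R -> 'cV[R]_k -> 'cV[R]_d) (sigma : R -> 'cV[R]_k -> 'M[R]_(d, m)).
Variables (F : finType) (ctl : F -> 'cV[R]_k) (ff : nat -> Omega T m -> F).
Hypothesis df : decided s ff M.
Variables (Cm Cs : R).
Hypotheses (muC : forall t f, 0 <= t -> enorm (mu t (ctl f)) <= Cm)
  (sigmaC : forall t f, 0 <= t -> enorm (sigma t (ctl f)) <= Cs).
Local Notation muv := (fun i w => mu (s i) (ctl (ff i w))).
Local Notation sigv := (fun i w => sigma (s i) (ctl (ff i w))).
Local Notation eu := (euler s M mu sigma ctl ff).
Local Notation co := (coarse T K).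

Let s_ge0 := is_grid_ge0 gs.
Let s_leT := is_grid_leT gs.
Let s_lt i : (i < M)%N -> s i < s i.+1. Proof. by case: gs => _ _; exact. Qed.
Let Cm0 : 0 <= Cm.
Proof. by move: (fun w => muC (ff 0%N w) (lexx 0)) => /(_ (zero_path T m)); exact: le_trans (enorm_ge0 _). Qed.
Let Cs0 : 0 <= Cs.
Proof. by move: (fun w => sigmaC (ff 0%N w) (lexx 0)) => /(_ (zero_path T m)); exact: le_trans (enorm_ge0 _). Qed.

Let n2C p q (x : 'M[R]_(p, q)) C : enorm x <= C -> n2 x <= C ^+ 2.
Proof.
move=> h; rewrite -enorm_sqr lerXn2r ?nnegrE ?enorm_ge0//; exact: le_trans (enorm_ge0 _) h.
Qed.

Lemma euler_simple : exists S : simple_process T m d, sp_eval S = lstep s M sigv /\ sp_integral S = euler_mart s M sigma ctl ff.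
Proof.
have tm (i : 'I_M) : [/\ 0 <= s i, s i <= s i.+1 & s i.+1 <= T].
  by split; [apply: s_ge0; exact: ltnW|apply: ltW; exact: s_lt|exact: s_leT].
have ad (i : 'I_M) a b : F_measurable (s i) (fun w => sigv i w a b).
  exact: (decided_F (fun f => sigma (s i) (ctl f) a b) df (ltn_ord i)).
have bd : exists C : R, forall (i : 'I_M) w, enorm (sigv i w) <= C.
  by exists Cs => i w; apply: sigmaC; apply: s_ge0; exact: ltnW.
by exists (SimpleProcess tm ad bd).
Qed.

Lemma lstep_good : good P (lstep s M sigv) (Cs ^+ 2).
Proof.
split.
- apply: lstep_jm => i iM a b; apply: F_measurableT (s_leT (ltnW iM)) _.
  exact: (decided_F (fun f => sigma (s i) (ctl f) a b) df iM).
- move=> t w _; apply: lstep_bounded => //; first exact: sqr_ge0.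
  by move=> i w' iM; apply/n2C/sigmaC/s_ge0/ltnW.
- apply: lstep_adapted => // i iM a b; exact: (decided_F (fun f => sigma (s i) (ctl f) a b) df iM).
Qed.

Lemma lstep_drift : jointly_measurable (lstep s M muv) /\ bounded_by (lstep s M muv) (Cm ^+ 2).
Proof.
split.
- apply: lstep_jm => i iM a b; apply: F_measurableT (s_leT (ltnW iM)) _.
  exact: (decided_F (fun f => mu (s i) (ctl f) a b) df iM).
- move=> t w _; apply: lstep_bounded => //; first exact: sqr_ge0.
  by move=> i w' iM; apply/n2C/muC/s_ge0/ltnW.
Qed.

(** The Euler martingale is the explicit integral of a simple process; the chosen version [ito]
    agrees with it by locality on the whole space. *)
Lemma ae_euler : {ae P, forall w, forall t : R, 0 <= t <= T -> dproc P (lstep s M muv) (lstep s M sigv) w t = eu t w}.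
Proof.
have [S [hS hI]] := euler_simple.
have [Y [iY eY]] := path_of_simple P T0 S; rewrite hS in iY.
have h : {ae P, forall w, setT w -> ito P (lstep s M sigv) w = Y w}.
  by apply: (ito_local T0 WP lstep_good lstep_good (itoP T0 WP lstep_good) iY measurableT) => t ht; exact: aeW.
apply: filterS h => w hw t ht.
have [jb bb] := lstep_drift.
apply: etrans (dprocE T0 jb bb lstep_good w ht) _; rewrite (drift_euler gs mu ctl ff w ht) /euler; congr (_ + _).
by rewrite (hw I) eY// hI.
Qed.

Section Near.
Variable alpha : R -> Omega T m -> 'cV[R]_k.
Hypothesis fol : forall i (t : R) w, (i < M)%N -> s i <= t < s i.+1 -> alpha t w = ctl (ff i w).
Variables (Cb C : R).
Hypotheses (jb : jointly_measurable (fun t w => mu t (alpha t w)))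
  (bb : bounded_by (fun t w => mu t (alpha t w)) (Cm ^+ 2))
  (gH : good P (fun t w => sigma t (alpha t w)) (Cs ^+ 2)).

(** A bound for both coefficient differences that holds always; it is charged at grid times only,
    where it integrates to zero. *)
Definition gap_cst : R := (d * 1)%:R * (1 + 4 * Cm ^+ 2) + 4 * Cs ^+ 2.

Lemma gap_cst_ge0 : 0 <= gap_cst.
Proof. by rewrite addr_ge0// mulr_ge0 ?addr_ge0 ?mulr_ge0 ?sqr_ge0. Qed.

(** Inside a cell the control is constant, so the coefficients of the two processes differ only
    through their dependence on time. *)
Lemma near_euler (e lam : R) : 0 <= e -> 0 < lam -> (forall i (t : R) f, (i < M)%N -> s i < t < s i.+1 ->
     n1 (mu t (ctl f) - mu (s i) (ctl f)) <= e /\ n2 (sigma t (ctl f) - sigma (s i) (ctl f)) <= e) ->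
  exists U : set (Omega T m), [/\ measurable U,
    (P U <= (((432 * m%:R) / (lam / 2) ^+ 2 + (lam / 2)^-1) * (e * T))%:E)%E &
    forall w, ~ U w -> forall t : R, 0 <= t <= T -> `|controlled P mu sigma alpha w t - eu t w| <= lam].
Proof.
move=> e0 lam0 he.
have [jb' bb'] := lstep_drift; have gH' := lstep_good.
pose L := [seq s i | i <- iota 0 M.+1].
pose I (t : R) (_ : Omega T m) : R := if t \in L then gap_cst else 0.
pose Kf (t : R) (w : Omega T m) : R := 1 * e + 1 * I t w.
have jI : jm I by exact: jm_grid.
have I0 (t : R) w : 0 <= I t w by rewrite /I; case: ifP => // _; exact: gap_cst_ge0.
have jK : jm Kf.
  apply: mfunD; apply: mfunM; try exact: mcst; exact: jI.
have K_ge (t : R) w : 0 <= Kf t w by rewrite /Kf !mul1r addr_ge0.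
have b1 p q (x y : 'M[R]_(p, q)) c : n2 x <= c ^+ 2 -> n2 y <= c ^+ 2 -> n2 (x - y) <= 4 * c ^+ 2.
  by move=> h1 h2; apply: le_trans (n2B _ _) _; lra.
have hn2 (t : R) w : 0 <= t <= T -> n2 (sigma t (alpha t w) - lstep s M sigv t w) <= Kf t w.
  move=> ht; have [tL|[i [iM hi ->]]] := lstep_cover gs sigv w ht.
    apply: le_trans (b1 _ _ _ _ _ (good_bnd gH w ht) (good_bnd gH' w ht)) _.
    by rewrite /Kf /I tL !mul1r /gap_cst addrA lerDr addr_ge0// mulr_ge0// addr_ge0// mulr_ge0// sqr_ge0.
  have /andP[h1 h2] := hi.
  rewrite (fol w iM (introT andP (conj (ltW h1) h2))); apply: le_trans (he i t _ iM hi).2 _.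
  by rewrite /Kf !mul1r lerDl.
have hn1 (t : R) w : 0 <= t <= T -> n1 (mu t (alpha t w) - lstep s M muv t w) <= Kf t w.
  move=> ht; have [tL|[i [iM hi ->]]] := lstep_cover gs muv w ht.
    apply: le_trans (n1_le_n2 _) _. have h := b1 _ _ _ _ _ (bb w ht) (bb' t w ht).
    apply: (via ((d * 1)%:R * (1 + 4 * Cm ^+ 2))); first by rewrite ler_wpM2l// lerD2l.
    by rewrite /Kf /I tL !mul1r /gap_cst addrCA lerDl addr_ge0// mulr_ge0// sqr_ge0.
  have /andP[h1 h2] := hi.
  rewrite (fol w iM (introT andP (conj (ltW h1) h2))); apply: le_trans (he i t _ iM hi).1 _.
  by rewrite /Kf !mul1r lerDl.
have D2K : (D2 P Kf <= (e * T)%:E)%E.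
  apply: (via (1%:E * D2 P (fun _ _ => e) + 1%:E * D2 P I)%E).
    apply: D2_le2 => //; exact: jm_cst.
  by rewrite D2_cst// D2_grid ?gap_cst_ge0// mule0 adde0 mul1e.
have [U [mU pU hU]] := dproc_close T0 WP jb bb jb' bb' gH gH' jK hn2 hn1 lam0 D2K.
have [U' [mU' pU' hU']] := null_union mU pU ae_euler.
exists U'; split => // w hw t ht; have [nU e_] := hU' w hw.
have h := hU w nU t ht.
by rewrite -(e_ t ht); exact: h.
Qed.

End Near.

(** Fourth moments bound the failure in one coarse cell by a multiple of [K ^- 2], hence the failure
    in any of the [K] cells by a multiple of [K^-1], for every fine grid. *)
Lemma euler_mart_tight (lam : R) : 0 < lam -> exists U : set (Omega T m), [/\ measurable U,
    (P U <= (K%:R * (lam ^- 2 * (d%:R ^+ 2 * (2 ^+ 12 * (m%:R * Cs ^+ 2 * (T / K%:R)) ^+ 2))))%:E)%E &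
    forall w, ~ U w -> forall l, (l < K)%N -> forall t : R, co l <= t <= co l.+1 ->
      n2 (euler_mart s M sigma ctl ff t w - euler_mart s M sigma ctl ff (co l) w) <= lam].
Proof.
move=> lam0; have [S [hS hI]] := euler_simple; rewrite -hI.
apply: union_bound => l lK.
have cT : co l.+1 <= T by have [_ e _] := coarse_grid T0 K0; rewrite -[leRHS]e; exact: (co_le T0 K lK).
have sub (t : R) : co l <= t <= co l.+1 -> 0 <= t <= T.
  by move=> /andP[h1 h2]; rewrite (le_trans (coarse_ge0 T0 K l) h1) (le_trans h2).
have hc : co l <= co l <= co l.+1 by rewrite lexx coarse_le.
have mI (t : R) : co l <= t <= co l.+1 -> forall i j, mfunO T m (fun w => (sp_integral S t w - sp_integral S (co l) w) i j).
  move=> ht i j. by apply: measurable_mxB; apply: measurable_sp_integral => //; exact: sub.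
apply: (sup_bound (X := fun w t => sp_integral S t w - sp_integral S (co l) w)) => //.
- exact: coarse_lt.
- move=> w.
  have cw : {within `[co l, co l.+1], continuous (fun t => sp_integral S t w)}.
    apply: continuous_subspaceW (sp_integral_continuous (S := S) (w := w)) => t /=.
    by rewrite !in_itv/=; exact: sub.
  by move=> t; apply: cvgB; [exact: cw|exact: cvg_cst].
- move=> L hL; rewrite -(coarse_gap T K l).
  apply: simple_max4 => //; rewrite ?coarse_ge0 ?coarse_lt//; last exact: sqr_ge0.
  move=> t w; rewrite hS; apply: lstep_bounded => //; first exact: sqr_ge0.
  by move=> i w' iM; apply/n2C/sigmaC/s_ge0/ltnW.
Qed.

End EulerComparison.

Local Notation nested T K s M ka := (forall i, (i < M)%N -> [/\ (ka i < K)%N, coarse T K (ka i) <= s i & s i.+1 <= coarse T K (ka i).+1]).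
Local Notation mesh_le s M eta := (forall i, (i < M)%N -> s i.+1 - s i <= eta).

(** * Nested grids and the closeness of state and path *)

Section FineGrids.
Variables (R : realType) (T : R).
Hypothesis T0 : 0 < T.

Lemma grid_cells (s : nat -> R) M K : (0 < K)%N -> is_grid T s M ->
  (forall l, (l <= K)%N -> exists2 j, (j <= M)%N & s j = coarse T K l) ->
  forall i, (i < M)%N -> exists l, [/\ (l < K)%N, coarse T K l <= s i & s i.+1 <= coarse T K l.+1].
Proof.
move=> K0 gs hc i iM; have [g0 gM gS] := gs; have [c0 cK cS] := coarse_grid T0 K0.
have /andP[si0 siT] := is_grid_bnd gs (ltnW iM).
have ex : exists l, (l <= K)%N && (coarse T K l <= s i) by exists 0%N; rewrite c0.
have ub : forall l, (l <= K)%N && (coarse T K l <= s i) -> (l <= K)%N by move=> l /andP[].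
case: (ex_maxnP ex ub) => l /andP[lK cl] hl.
have siT' : s i < T by have /andP[_ h] := is_grid_bnd gs iM; exact: lt_le_trans (gS i iM) h.
have lK' : (l < K)%N.
  rewrite ltn_neqAle lK andbT; apply/eqP => e; move: cl; rewrite e cK => h.
  by move: (le_lt_trans h siT'); rewrite ltxx.
exists l; split => //; have [j jM ej] := hc l.+1 lK'; rewrite -ej (is_grid_le gs)//.
rewrite -(is_grid_lt gs) ?(ltnW iM)// ej ltNge; apply/negP => h.
by have := hl l.+1; rewrite lK' h ltnn => /(_ isT).
Qed.

(** The fine grid collects the coarse nodes, a uniform grid of mesh at most [eta] and the prescribed
    times. *)
Lemma ex_fine_grid K (eta : R) (L : seq R) : (0 < K)%N -> 0 < eta -> {in L, forall x, 0 <= x <= T} ->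
  exists s M (ka : nat -> nat), [/\ is_grid T s M, nested T K s M ka, mesh_le s M eta &
    forall x, x \in L -> exists2 j, (j <= M)%N & s j = x].
Proof.
move=> K0 eta0 hL.
have [N1 N10 hN] : exists2 N1, (0 < N1)%N & T / N1%:R <= eta.
  exists (Num.truncn (T / eta)).+1 => //.
  by rewrite ler_pdivrMr ?ltr0n// mulrC -ler_pdivrMr//; apply: ltW; exact: truncnS_gt.
pose pts N := [seq coarse T N l | l <- iota 0 N.+1].
have pts_bnd N : (0 < N)%N -> {in pts N, forall x, 0 <= x <= T}.
  move=> N0 x /mapP[l]; rewrite mem_iota /= add0n ltnS => lN ->. exact: (is_grid_bnd (coarse_grid T0 N0)).
have hL' : {in L ++ (pts K ++ pts N1), forall x, 0 <= x <= T}.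
  move=> x; rewrite !mem_cat => /orP[/hL//|/orP[/pts_bnd|/pts_bnd]]; exact.
have [s [M [gs hs]]] := ex_grid T0 hL'.
have mem_pts N l : (l <= N)%N -> coarse T N l \in pts N by move=> lN; apply: map_f; rewrite mem_iota.
have cK l : (l <= K)%N -> exists2 j, (j <= M)%N & s j = coarse T K l.
  by move=> lK; apply: hs; rewrite !mem_cat mem_pts// orbT.
have cN l : (l <= N1)%N -> exists2 j, (j <= M)%N & s j = coarse T N1 l.
  by move=> lK; apply: hs; rewrite !mem_cat mem_pts// !orbT.
have /choice[ka hka] : forall i, exists l, (i < M)%N -> [/\ (l < K)%N, coarse T K l <= s i & s i.+1 <= coarse T K l.+1].
  move=> i; have [iM|_] := boolP (i < M)%N; last by exists 0%N.
  by have [l hl] := grid_cells K0 gs cK iM; exists l.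
exists s, M, ka; split => //.
  move=> i iM; have [l [lN h1 h2]] := grid_cells N10 gs cN iM.
  by apply: le_trans hN; rewrite -(coarse_gap T N1 l); lra.
by move=> x xL; apply: hs; rewrite mem_cat xL.
Qed.

End FineGrids.

Lemma two_gaps (R : realType) (x y z l0 r : R) : 0 <= r -> z <= x + y -> x <= r -> y <= l0 -> z <= l0 + 2 * r.
Proof. by lra. Qed.

Lemma three_gaps (R : realType) (x y z y1 z1 l0 r : R) : z <= x + y -> x <= r -> y <= l0 ->
  z1 <= y1 + z -> y1 <= r -> z1 <= l0 + 2 * r.
Proof. by lra. Qed.

Section StateClose.
Variables (R : realType) (T : R) (d : nat).
Hypothesis T0 : 0 < T.
Variables (K : nat).
Hypothesis K0 : (0 < K)%N.
Local Notation co := (coarse T K).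

(* The coarse polygon of a path stopped at time u. *)
Definition coarse_path (u : R) (z : Omega T d) : Omega T d := polygon T co K (fun l => z (Num.min (co l) u)).

Lemma polygon_dist (x y : nat -> 'cV[R]_d) (r : R) : x 0%N = 0 -> y 0%N = 0 ->
  (forall l, (l <= K)%N -> `|x l - y l| <= r) -> forall t : R, 0 <= t <= T ->
  `|polygon T co K x t - polygon T co K y t| <= r.
Proof.
move=> x0 y0 h t ht; have [c0 cK cS] := coarse_grid T0 K0.
have [l lK htl] := grid_find c0 cK T0 ht.
rewrite !(polygon_itv c0 cK cS _ lK htl) x0 y0 !subr0.
have /andP[] := ramp01 t (coarse_lt T0 K0 l); move: (ramp _ _ _) => a a0 a1.
have -> : x l + a *: (x l.+1 - x l) - (y l + a *: (y l.+1 - y l)) = (1 - a) *: (x l - y l) + a *: (x l.+1 - y l.+1).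
  by apply/matrixP => i j; rewrite !mxE; ring.
apply: le_trans (ler_normD _ _) _; rewrite !normrZ (ger0_norm a0) ger0_norm ?subr_ge0//.
have h1 := h l (ltnW lK); have h2 := h l.+1 lK.
have b0 : 0 <= 1 - a by rewrite subr_ge0.
have := ler_wpM2l b0 h1; have := ler_wpM2l a0 h2; lra.
Qed.

Variables (m k : nat) (s : nat -> R) (M : nat) (ka : nat -> nat).
Hypotheses (gs : is_grid T s M)
  (hka : forall i, (i < M)%N -> [/\ (ka i < K)%N, co (ka i) <= s i & s i.+1 <= co (ka i).+1]).
Variables (mu : R -> 'cV[R]_k -> 'cV[R]_d) (sigma : R -> 'cV[R]_k -> 'M[R]_(d, m)).
Variables (F : finType) (ctl : F -> 'cV[R]_k) (ff : nat -> Omega T m -> F).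
Local Notation eu := (euler s M mu sigma ctl ff).
Local Notation st := (state K s ka mu sigma ctl ff).

Let kaK i (iM : (i < M)%N) : (ka i < K)%N. Proof. by have [] := hka iM. Qed.
Let ka1 i (iM : (i < M)%N) : co (ka i) <= s i. Proof. by have [] := hka iM. Qed.
Let ka2 i (iM : (i < M)%N) : s i.+1 <= co (ka i).+1. Proof. by have [] := hka iM. Qed.

(** The state at step [n] can be recovered, up to the Euler error, from the path observed up to time
    [s n]. This is what makes an adapted integrand out of the slopes. *)
Lemma state_coarse_path n (z : Omega T d) w (lam : R) : (n <= M)%N ->
  (forall t : R, 0 <= t <= T -> `|z t - eu t w| <= lam) ->
  forall t : R, 0 <= t <= T -> `|coarse_path (s n) z t - st n w t| <= lam.
Proof.
move=> nM h t ht; rewrite (state_polygon T0 s K0 mu sigma ctl kaK ff w nM).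
have [c0 cK _] := coarse_grid T0 K0.
have /andP[sn0 snT] := is_grid_bnd gs nM.
apply: polygon_dist => //.
- by rewrite c0 (min_idPl sn0) path_start.
- exact: partial0.
- move=> l lK; rewrite -(euler_partial T0 gs mu sigma ctl ka1 ka2 ff w nM lK).
  by apply: h; rewrite le_min coarse_ge0// sn0 /= ge_min snT orbT.
Qed.

(** A state polygon misses the path by the Euler error plus at most two oscillations of the Euler
    process over a coarse cell. *)
Lemma state_near n (z : Omega T d) w (lam r : R) : n = M ->
  (forall t : R, 0 <= t <= T -> `|z t - eu t w| <= lam) ->
  (forall l (t : R), (l < K)%N -> co l <= t <= co l.+1 -> `|eu t w - eu (co l) w| <= r) ->
  forall t : R, 0 <= t <= T -> `|st n w t - z t| <= lam + 2 * r.
Proof.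
move=> nM h1 h2 t ht; rewrite (state_polygon T0 s K0 mu sigma ctl kaK ff w (eq_leq nM)).
have [c0 cK cS] := coarse_grid T0 K0; have [_ sM _] := gs.
have bnd l : (l <= K)%N -> 0 <= co l <= T by exact: (is_grid_bnd (coarse_grid T0 K0)).
have pe l : (l <= K)%N -> partial s M ka mu sigma ctl ff n l w = eu (co l) w.
  move=> lK; rewrite -(euler_partial T0 gs mu sigma ctl ka1 ka2 ff w (eq_leq nM) lK) nM sM.
  by congr (eu _ w); apply/min_idPl; case/andP: (bnd l lK).
apply: (polygon_close c0 cK cS T0) => //; first exact: partial0.
move=> l u lK hu; rewrite !pe// ?(ltnW lK)//.
have hu' : 0 <= u <= T.
  move: hu => /andP[a b]; have /andP[a' _] := bnd l (ltnW lK); have /andP[_ b'] := bnd l.+1 lK.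
  by rewrite (le_trans a')// (le_trans b).
have q1 := h2 l u lK hu; have q2 := h2 l (co l.+1) lK; rewrite coarse_le// lexx in q2.
have {}q2 := q2 isT; have q3 := h1 u hu'.
have r0 : 0 <= r by apply: le_trans q1.
have tri (a b c : 'cV[R]_d) : `|a - c| <= `|a - b| + `|b - c| by apply: le_trans (ler_normD _ _); rewrite addrA subrK.
have q1' : `|eu (co l) w - eu u w| <= r by rewrite distrC.
have q3' : `|eu u w - z u| <= lam by rewrite distrC.
have t1 := tri (eu (co l) w) (eu u w) (z u).
have t2 := tri (eu (co l.+1) w) (eu (co l) w) (z u).
by split; [exact: two_gaps r0 t1 q1' q3'|exact: three_gaps t1 q1' q3' t2 q2].
Qed.

End StateClose.

(** * The dual integrand *)

Section Feedback.
Variables (R : realType) (T : R) (d : nat).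
Hypothesis T0 : 0 < T.
Variables (K : nat) (s : nat -> R) (M : nat).
Hypotheses (K0 : (0 < K)%N) (gs : is_grid T s M).
Variables (p : nat -> Omega T d -> 'cV[R]_d) (Bp : R).
Hypotheses (p_UC : forall i j, UC (fun z => p i z j 0)) (pB : forall i z j, `|p i z j 0| <= Bp).

(** On each fine cell the slope is evaluated at the coarse polygon of the path stopped at the left
    end of the cell, hence adapted to the canonical filtration of [Omega T d]; it refers to no
    control. *)
Definition feedback : R -> Omega T d -> 'cV[R]_d := lstep s M (fun i z => p i (coarse_path K (s i) z)).

Lemma measurable_coarse_path (u : R) : 0 <= u -> measurable_fun [set: OmF T d u] (fun z : OmF T d u => coarse_path K u z : Omega T d).
Proof.
move=> u0; have [c0 cK cS] := coarse_grid T0 K0.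
apply: measurable_Omega => t i ht.
rewrite (_ : (fun x => _) = (fun z : OmF T d u => \sum_(l < K) ramp (coarse T K l) (coarse T K l.+1) t *
   ((z : Omega T d) (Num.min (coarse T K l.+1) u) i 0 - (z : Omega T d) (Num.min (coarse T K l) u) i 0))); last first.
  apply/funext => z; rewrite /coarse_path (polygonE c0 cK cS _ ht) summxE.
  by apply: eq_bigr => l _; rewrite !mxE.
apply: mfun_sum => l; apply: mfunM; first exact: mcst.
have bnd l' : 0 <= Num.min (coarse T K l') u <= u by rewrite le_min (coarse_ge0 T0) u0 ge_min lexx orbT.
by apply: mfunB; apply: measurable_coordF; exact: bnd.
Qed.

Let p_n2 i z : n2 (p i z) <= d%:R * Bp ^+ 2.
Proof.
rewrite /n2; apply: (via (\sum_(j < d) Bp ^+ 2)); last by rewrite sumr_const card_ord mulr_natl.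
apply: ler_sum => j _; rewrite big_ord1 -(real_normK (num_real _)) lerXn2r ?nnegrE//.
exact: le_trans (normr_ge0 _) (pB i z j).
Qed.

Lemma feedback_n2 t z : n2 (feedback t z) <= d%:R * Bp ^+ 2.
Proof. by apply: (lstep_bounded gs) => [|i z' _]; [rewrite mulr_ge0// sqr_ge0|exact: p_n2]. Qed.

Lemma feedback_dual : @dual_integrands R T d feedback.
Proof.
have ad i : (i < M)%N -> forall a b, F_measurable (s i) (fun z => p i (coarse_path K (s i) z) a b).
  move=> iM a b; apply/F_measurableP; rewrite ord1.
  apply: (mcomp (UC_measurable T0 (p_UC i a))); apply: measurable_coarse_path.
  by have /andP[] := is_grid_bnd gs (ltnW iM).
split.
- apply: lstep_jm => i iM a b; apply: F_measurableT (ad i iM a b).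
  by have /andP[] := is_grid_bnd gs (ltnW iM).
- exact: (lstep_adapted_raw gs).
- exists (Num.sqrt (d%:R * Bp ^+ 2)) => t z _; rewrite /enorm ler_wsqrtr//; exact: feedback_n2.
Qed.

Section OneControl.
Variables (m k : nat) (P : probability (Omega T m) R).
Hypothesis WP : is_wiener P.
Variables (ka : nat -> nat).
Variables (mu : R -> 'cV[R]_k -> 'cV[R]_d) (sigma : R -> 'cV[R]_k -> 'M[R]_(d, m)).
Variables (F : finType) (ctl : F -> 'cV[R]_k) (fs : nat -> F).
Variables (Cs : R).
Hypothesis sigmaC : forall t f, 0 <= t -> n2 (sigma t (ctl f)) <= Cs.
Local Notation Z := (state K s ka mu sigma ctl (fun i (_ : Omega T m) => fs i)).

Let s_ge0 := is_grid_ge0 gs.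
Let s_leT := is_grid_leT gs.
Let s_lt i : (i < M)%N -> s i < s i.+1. Proof. by case: gs => _ _; exact. Qed.

(** The discrete counterpart, with the slope taken at the state rather than at the polygon of the
    controlled path; it produces exactly the terms [lin]. *)
Definition feedback_val i (w : Omega T m) : 'M[R]_(1, m) := (p i (Z i w))^T *m sigma (s i) (ctl (fs i)).
Definition feedback_sum (w : Omega T m) : R := \sum_(i < M) (feedback_val i w *m inc s i w) 0 0.

Let Bv : R := d%:R * Bp ^+ 2 * Cs.
Let Cs0 : 0 <= Cs. Proof. exact: le_trans (n2_ge0 _) (sigmaC (fs 0%N) (lexx 0)). Qed.
Let Bv0 : 0 <= Bv. Proof. exact: mulr_ge0 (mulr_ge0 (ler0n R d) (sqr_ge0 Bp)) Cs0. Qed.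

Lemma feedback_val_n2 i w : (i < M)%N -> n2 (feedback_val i w) <= Bv.
Proof.
move=> iM; apply: le_trans (n2M _ _) _; rewrite n2_tr; apply: ler_pM; rewrite ?n2_ge0//.
by apply: sigmaC; apply: s_ge0; exact: ltnW.
Qed.

Lemma feedback_val_F i a b : (i < M)%N -> F_measurable (s i) (fun w => feedback_val i w a b).
Proof.
move=> iM; apply/F_measurableP.
have dec : decided s (fun i (_ : Omega T m) => fs i) i by move=> j _ f; exact: mcst.
have mZ := measurable_state T0 ka K0 gs mu sigma ctl dec (ltnW iM).
apply: (measurable_mulmx (F := fun w : OmF T m (s i) => (p i (Z i w))^T) (G := fun=> sigma (s i) (ctl (fs i)))) => a' b'.
  by under eq_fun do rewrite mxE; rewrite ord1; exact: (mcomp (UC_measurable T0 (p_UC i b')) mZ).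
exact: mcst.
Qed.

Lemma feedback_simple : exists S : simple_process T m 1, sp_eval S = lstep s M feedback_val /\
  forall w, sp_integral S T w 0 0 = feedback_sum w.
Proof.
have tm (i : 'I_M) : [/\ 0 <= s i, s i <= s i.+1 & s i.+1 <= T].
  by split; [apply: s_ge0; exact: ltnW|apply: ltW; exact: s_lt|exact: s_leT].
have bd : exists C : R, forall (i : 'I_M) w, enorm (feedback_val i w) <= C.
  by exists (Num.sqrt Bv) => i w; rewrite /enorm ler_wsqrtr//; exact: feedback_val_n2.
exists (SimpleProcess tm (fun i a b => feedback_val_F a b (ltn_ord i)) bd); split => // w.
rewrite /sp_integral /= summxE; apply: eq_bigr => i _; rewrite /inc.
by rewrite (min_idPl (s_leT (ltn_ord i))) (min_idPl (s_leT (ltnW (ltn_ord i)))).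
Qed.

Variables (X : Omega T m -> Omega T d) (a : R -> 'cV[R]_k) (C : R).
Hypotheses (ga : good P (fun t w => (feedback t (X w))^T *m sigma t (a t)) C)
  (fol : forall i (t : R), (i < M)%N -> s i <= t < s i.+1 -> a t = ctl (fs i))
  (aC : forall t : R, 0 <= t <= T -> n2 (sigma t (a t)) <= Cs).
Variables (U : set (Omega T m)) (pU kap e1 : R).
Hypotheses (mU : measurable U) (PU : (P U <= pU%:E)%E) (kap0 : 0 <= kap) (e10 : 0 <= e1)
  (hU : forall w, ~ U w -> forall i j, (i < M)%N -> `|p i (coarse_path K (s i) (X w)) j 0 - p i (Z i w) j 0| <= kap)
  (he : forall i (t : R) f, (i < M)%N -> s i < t < s i.+1 -> n2 (sigma t (ctl f) - sigma (s i) (ctl f)) <= e1).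

(** [ito_L2] reduces the claim to the integrands. The error has three sources: slopes at nearby
    paths ([kap]), the variation of [sigma] inside a cell ([e1]), and the exceptional event, where
    only boundedness is used. *)
Lemma feedback_close :
  (\int[P]_w ((ito P (fun t w => (feedback t (X w))^T *m sigma t (a t)) w T 0 0 - feedback_sum w) ^+ 2)%:E <=
   (144 * m%:R * ((2 * (d%:R * kap ^+ 2 * Cs) + 2 * (d%:R * Bp ^+ 2 * e1)) * T + 4 * Bv * (pU * T)))%:E)%E.
Proof.
have [S [hS hI]] := feedback_simple.
have [Y [iY eY]] := path_of_simple P T0 S; rewrite hS in iY.
have hT : 0 <= T <= T by rewrite lexx ltW.
have h1 := ito_L2 T0 WP (itoP T0 WP ga) iY hT.
apply: (via (\int[P]_w (n2 (ito P (fun t w => (feedback t (X w))^T *m sigma t (a t)) w T - Y w T))%:E)%E).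
  have mi := is_ito_meas (itoP T0 WP ga) hT; have mY := is_ito_meas iY hT.
  have e w : feedback_sum w = Y w T 0 0 by rewrite eY// hI. apply: int_le => //.
  - apply: mfunX; apply: mfunB; first exact: mi.
    by rewrite (funext e); exact: mY.
  - exact: measurable_n2B.
  - by move=> w; exact: sqr_ge0.
  - by move=> w; rewrite e; apply: le_trans (n2_entry _ 0 0); rewrite !mxE.
apply: le_trans h1 _.
pose L := [seq s i | i <- iota 0 M.+1].
pose G (t : R) (_ : Omega T m) : R := if t \in L then 4 * Bv else 0.
pose I (t : R) (w : Omega T m) : R := \1_U w.
pose c1 := 2 * (d%:R * kap ^+ 2 * Cs) + 2 * (d%:R * Bp ^+ 2 * e1).
have c10 : 0 <= c1.
  exact: addr_ge0 (mulr_ge0 (ler0n R 2) (mulr_ge0 (mulr_ge0 (ler0n R d) (sqr_ge0 kap)) Cs0))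
    (mulr_ge0 (ler0n R 2) (mulr_ge0 (mulr_ge0 (ler0n R d) (sqr_ge0 Bp)) e10)).
have B40 : 0 <= 4 * Bv by exact: mulr_ge0 (ler0n R 4) Bv0.
(* The crude bound [4 * Bv] is charged on [U] and at the grid times; elsewhere the error is at most
   [c1]. *)
pose K1 (t : R) (w : Omega T m) : R := (4 * Bv) * I t w + 1 * G t w.
pose K2 (t : R) (w : Omega T m) : R := 1 * c1 + 1 * K1 t w.
have I0 (t : R) w : 0 <= I t w by rewrite /I indicE.
have G0 (t : R) w : 0 <= G t w by rewrite /G; case: ifP.
have K10 (t : R) w : 0 <= K1 t w by exact: addr_ge0 (mulr_ge0 B40 (I0 t w)) (mulr_ge0 ler01 (G0 t w)).
have m1 : measurable_fun [set: _] (fun w : Omega T m => \1_U w : R) by exact: measurable_indic.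
have jI : jm I by apply: measurable_funTS; exact: (mcomp m1 measurable_snd).
have jG : jm G by exact: jm_grid.
have jK1 : jm K1 by apply: mfunD; apply: mfunM => //; exact: mcst.
have jK2 : jm K2.
  apply: mfunD; first by apply: mfunM; exact: mcst. by apply: mfunM => //; exact: mcst.
have jS : jointly_measurable (lstep s M feedback_val).
  apply: lstep_jm => i iM b c; apply: F_measurableT (feedback_val_F b c iM); exact: (s_leT (ltnW iM)).
have bS (t : R) w : n2 (lstep s M feedback_val t w) <= Bv.
  by apply: (lstep_bounded gs) => // i w' iM; exact: feedback_val_n2.
have bH (t : R) w : 0 <= t <= T -> n2 ((feedback t (X w))^T *m sigma t (a t)) <= Bv.
  move=> ht; apply: le_trans (n2M _ _) _; rewrite n2_tr; apply: ler_pM; rewrite ?n2_ge0//.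
    exact: feedback_n2.
  exact: aC.
have b4 (t : R) w : 0 <= t <= T -> n2 ((feedback t (X w))^T *m sigma t (a t) - lstep s M feedback_val t w) <= 4 * Bv.
  by move=> ht; apply: le_trans (n2B _ _) _; have := bH t w ht; have := bS t w; lra.
have main (t : R) w : 0 <= t <= T ->
    n2 ((feedback t (X w))^T *m sigma t (a t) - lstep s M feedback_val t w) <= K2 t w.
  move=> ht; rewrite /K2 /K1 !mul1r. have [tL|[i [iM hi e]]] := lstep_cover gs feedback_val w ht.
    by apply: le_trans (b4 t w ht) _; rewrite /G tL addrA lerDr; exact: addr_ge0 c10 (mulr_ge0 B40 (I0 t w)).
  have [wU|wU] := pselect (U w).
    by apply: le_trans (b4 t w ht) _; rewrite /I indicE mem_set// mulr1 addrCA lerDl; exact: addr_ge0 c10 (G0 t w).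
  apply: (via c1); last by rewrite lerDl; exact: addr_ge0 (mulr_ge0 B40 (I0 t w)) (G0 t w).
  have /andP[h1' h2'] := hi. rewrite e (fol iM (introT andP (conj (ltW h1') h2'))) /feedback_val /feedback.
  rewrite (lstepE gs _ (X w) iM (introT andP (conj h1' (ltW h2')))).
  set p1 := p i (coarse_path _ _ _); set p2 := p i (Z i w).
  have -> : p1^T *m sigma t (ctl (fs i)) - p2^T *m sigma (s i) (ctl (fs i)) =
     (p1 - p2)^T *m sigma t (ctl (fs i)) + p2^T *m (sigma t (ctl (fs i)) - sigma (s i) (ctl (fs i))).
    by rewrite linearB /= mulmxBl mulmxBr addrA subrK.
  have t0 : 0 <= t by case/andP: ht.
  apply: le_trans (n2D _ _) _; apply: lerD; rewrite ler_wpM2l//; apply: le_trans (n2M _ _) _; rewrite n2_tr.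
    apply: ler_pM; rewrite ?n2_ge0//; last exact: sigmaC.
    rewrite /n2; apply: (via (\sum_(j < d) kap ^+ 2)); last by rewrite sumr_const card_ord mulr_natl.
    apply: ler_sum => j _; rewrite big_ord1 -(real_normK (num_real _)) lerXn2r ?nnegrE//.
    by rewrite !mxE; exact: hU.
  by apply: ler_pM; rewrite ?n2_ge0//; [exact: p_n2|exact: he].
have E0 : (D2 P I <= (pU * T)%:E)%E.
  rewrite /D2 /I; under eq_integral do rewrite integral_cst//= lebesgue_measure_itv /= lte_fin T0 sube0.
  rewrite ge0_integralZr//; last first.
  - by rewrite lee_fin ltW.
  - exact/EFinP.
  rewrite integral_indic// setIT EFinM; apply: lee_wpmul2r => //; by rewrite lee_fin ltW.
have E1 : (D2 P K1 <= (4 * Bv * (pU * T))%:E)%E.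
  apply: (via ((4 * Bv)%:E * D2 P I + 1%:E * D2 P G)%E).
    by apply: D2_le2.
  rewrite D2_grid// mule0 adde0 (EFinM (4 * Bv)); apply: lee_wpmul2l => //.
have jH := good_jm ga.
have E2 : (D2 P (fun t w => n2 ((feedback t (X w))^T *m sigma t (a t) - lstep s M feedback_val t w)) <=
    (c1 * T + 4 * Bv * (pU * T))%:E)%E.
  apply: (via (D2 P K2)).
    apply: D2_le => //; first by apply: jm_n2; exact: jointly_measurableB. by move=> t w _; exact: n2_ge0.
  apply: (via (1%:E * D2 P (fun _ _ => c1) + 1%:E * D2 P K1)%E).
    apply: D2_le2 => //; first exact: jm_cst. by move=> t w _; rewrite /K2 !mul1r addr_ge0.
  by rewrite D2_cst// !mul1e EFinD leeD2l.
rewrite (EFinM (144 * m%:R)); apply: lee_wpmul2l; last exact: E2.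
rewrite lee_fin; exact: mulr_ge0 (ler0n R 144) (ler0n R m).
Qed.

End OneControl.
End Feedback.

Lemma int_le_dist dX (Y : measurableType dX) (R : realType) (P : probability Y R) (u v : Y -> R) (e : R) :
  Rint P u -> Rint P v -> (\int[P]_w `|u w - v w|%:E <= e%:E)%E ->
  (\int[P]_w (u w)%:E <= \int[P]_w (v w)%:E + e%:E)%E.
Proof.
move=> iu iv h; have iw := integrableB measurableT iu iv.
have -> : (\int[P]_w (u w)%:E = \int[P]_w (v w)%:E + \int[P]_w ((u w)%:E - (v w)%:E))%E.
  by rewrite -integralD//; apply: eq_integral => w _; rewrite -EFinB -EFinD addrC subrK.
rewrite leeD2l//; apply: le_trans h; apply: le_trans (lee_abs _) _.
by apply: le_trans (le_abse_integral P measurableT _) _; [case/integrableP: iw|].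
Qed.

Lemma ereal_gap (R : realType) (p b c : \bar R) (e : R) : b \is a fin_num -> p \is a fin_num ->
  (p - (e / 2)%:E < c)%E -> (c <= b + (e / 2)%:E)%E -> (p - e%:E <= b)%E.
Proof.
case: b p => [b||] [p||]// _ _ h1 h2; have := lt_le_trans h1 h2.
by rewrite -EFinB -EFinD lte_fin -EFinB lee_fin; lra.
Qed.

Lemma expectationE dX (Y : measurableType dX) (R : realType) (P : probability Y R) (u : Y -> R) :
  'E_P[u]%E = (\int[P]_w (u w)%:E)%E.
Proof. by rewrite unlock. Qed.

(** * Controlled processes and their approximation *)

Section Control.
Variables (R : realType) (T : R) (d m k : nat) (P : probability (Omega T m) R).
Hypotheses (T0 : 0 < T) (WP : is_wiener P).
Variable A : set 'cV[R]_k.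
Hypotheses (cA : compact A) (A0 : A !=set0).
Variables (mu : R -> 'cV[R]_k -> 'cV[R]_d) (sigma : R -> 'cV[R]_k -> 'M[R]_(d, m)).
Variables (Cm Cs Lm Ls delta0 : R).
Hypotheses (muC : forall t a, 0 <= t -> A a -> enorm (mu t a) <= Cm)
  (sigmaC : forall t a, 0 <= t -> A a -> enorm (sigma t a) <= Cs)
  (muA : forall t, 0 <= t -> {within A, continuous (mu t)})
  (sigmaA : forall t, 0 <= t -> {within A, continuous (sigma t)}) (d0 : 0 < delta0 <= 1)
  (muL : forall s t a, 0 <= s -> 0 <= t -> A a -> enorm (mu t a - mu s a) <= Lm * (`|t - s| `^ delta0))
  (sigmaL : forall s t a, 0 <= s -> 0 <= t -> A a -> enorm (sigma t a - sigma s a) <= Ls * (`|t - s| `^ delta0)).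
Implicit Types alpha : R -> Omega T m -> 'cV[R]_k.
Local Notation adm := (@admissible R T m k A).
Local Notation X alpha := (controlled P mu sigma alpha).
Local Notation bb alpha := (fun t w => mu t (alpha t w)).
Local Notation HH alpha := (fun t w => sigma t (alpha t w)).
Variables (g : Omega T d -> R) (Cg : R).
Hypotheses (ug : UC g) (gC : forall w, `|g w| <= Cg).

Lemma mu_jm alpha : adm alpha -> jointly_measurable (bb alpha).
Proof. exact: (coef_jm T0 cA muA d0 muL). Qed.

Lemma mu_bnd alpha : adm alpha -> bounded_by (bb alpha) (Cm ^+ 2).
Proof. exact: (coef_bounded muC). Qed.

Lemma mu_ad alpha : adm alpha -> ae_adapted P (bb alpha).
Proof. exact: (coef_adapted P cA muA). Qed.

Lemma sigma_good alpha : adm alpha -> good P (HH alpha) (Cs ^+ 2).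
Proof.
move=> ha; split; first exact: (coef_jm T0 cA sigmaA d0 sigmaL).
  exact: (coef_bounded sigmaC).
exact: (coef_adapted P cA sigmaA).
Qed.

Lemma measurable_X alpha : adm alpha -> mfunO T m (X alpha).
Proof. by move=> ha; exact: (measurable_dproc T0 WP (mu_jm ha) (mu_bnd ha) (sigma_good ha)). Qed.

Lemma X_adapted alpha (t : R) i : adm alpha -> 0 <= t <= T -> aeF P t (fun w => X alpha w t i 0).
Proof. by move=> ha; exact: (dproc_adapted T0 WP i (mu_jm ha) (mu_bnd ha) (mu_ad ha) (sigma_good ha)). Qed.

Lemma integrand_good (phi : R -> Omega T d -> 'cV[R]_d) alpha : @dual_integrands R T d phi -> adm alpha ->
  exists C, good P (fun t w => (phi t (X alpha w))^T *m sigma t (alpha t w)) C.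
Proof.
move=> [jphi aphi [Cp hCp]] ha; have [js bs as_] := sigma_good ha.
have mX := measurable_X ha.
exists (Cp ^+ 2 * Cs ^+ 2); split.
- move=> i j; apply: (eq_measurable_fun (fun x : R * Omega T m =>
     \sum_c phi x.1 (X alpha x.2) c i * sigma x.1 (alpha x.1 x.2) c j)).
    by move=> x _; rewrite mxE; apply: eq_bigr => c _; rewrite mxE.
  apply: mfun_sum => c; apply: mfunM; last exact: js.
  have := onT_measurable (K := fun t w => phi t w c i) (jphi c i) => h.
  apply: (eq_measurable_fun (fun x : R * Omega T m => onT (fun t w => phi t w c i) (X alpha x.2, x.1))).
    by move=> x; rewrite inE => -[/=]; rewrite in_itv/= => hx _; rewrite /onT /= hx.
  apply: measurable_funTS; apply: (mcomp h); apply: measurable_fun_pair.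
    exact: (mcomp mX measurable_snd).
  exact: measurable_fst.
- move=> t w ht; apply: le_trans (n2M _ _) _; rewrite n2_tr.
  apply: ler_pM; rewrite ?n2_ge0//; last exact: bs. have h := hCp t (X alpha w) ht.
  by rewrite -enorm_sqr lerXn2r ?nnegrE ?enorm_ge0// (le_trans (enorm_ge0 _) h).
apply/ae_adaptedP => t ht i j.
have -> : (fun w => ((phi t (X alpha w))^T *m sigma t (alpha t w)) i j) =
    (fun w => \sum_c phi t (X alpha w) c i * sigma t (alpha t w) c j).
  by apply/funext => w; rewrite mxE; apply: eq_bigr => c _; rewrite mxE.
apply: aeF_sum => c; apply: aeFM; last by move/ae_adaptedP: as_ => /(_ t ht).
have [t0 tT] := andP ht.
apply: (aeF_comp (C := Cp) (f := fun w => phi t w c i) tT mX).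
- by move=> s l /andP[s0 st]; apply: (aeF_le st); apply: (X_adapted l ha); rewrite s0 (le_trans st).
- exact: aphi.
- by move=> w; apply: le_trans (entry_mxnorm _ _ _) _; apply: le_trans (mxnorm_enorm _) _; exact: hCp.
Qed.

Lemma X_local alpha alpha' (E : set (Omega T m)) : adm alpha -> adm alpha' -> measurable E ->
  (forall w, E w -> forall t : R, 0 <= t <= T -> alpha t w = alpha' t w) ->
  {ae P, forall w, E w -> X alpha w = X alpha' w}.
Proof.
move=> ha ha' mE hE.
have gH := sigma_good ha; have gH' := sigma_good ha'.
have h : {ae P, forall w, E w -> ito P (HH alpha) w = ito P (HH alpha') w}.
  apply: (ito_local T0 WP gH gH' (itoP T0 WP gH) (itoP T0 WP gH') mE) => t ht.
  by apply: aeW => w Ew; rewrite hE.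
apply: filterS h => w hw Ew.
have b : forall (t : R), 0 <= t <= T -> mu t (alpha t w) = mu t (alpha' t w) by move=> u hu; rewrite hE.
exact: (dproc_ext (b := bb alpha) (b' := bb alpha') b (hw Ew)).
Qed.

Lemma M_local (phi : R -> Omega T d -> 'cV[R]_d) alpha alpha' (E : set (Omega T m)) :
  @dual_integrands R T d phi -> adm alpha -> adm alpha' -> measurable E ->
  (forall w, E w -> forall t : R, 0 <= t <= T -> alpha t w = alpha' t w) -> {ae P, forall w, E w ->
     ito P (fun t w => (phi t (X alpha w))^T *m sigma t (alpha t w)) w =
     ito P (fun t w => (phi t (X alpha' w))^T *m sigma t (alpha' t w)) w}.
Proof.
move=> hphi ha ha' mE hE.
have [C gdC] := integrand_good hphi ha; have [C' gdC'] := integrand_good hphi ha'.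
apply: (ito_local T0 WP gdC gdC' (itoP T0 WP gdC) (itoP T0 WP gdC') mE) => t ht.
apply: filterS (X_local ha ha' mE hE) => w hw Ew.
exact: (f_equal2 (fun x y => (phi t x)^T *m sigma t y) (hw Ew) (hE w Ew t ht)).
Qed.

Definition follows (F : finType) (ctl : F -> 'cV[R]_k) (ff : nat -> Omega T m -> F) s M alpha :=
  forall i (t : R) w, (i < M)%N -> s i <= t < s i.+1 -> alpha t w = ctl (ff i w).

(** The mesh depends on [lam] and [e] only; it is uniform over grids, finite control sets and
    decision processes. *)
Lemma near_all (lam e : R) : 0 < lam -> 0 < e -> exists2 eta : R, 0 < eta &
  forall s M (F : finType) (ctl : F -> 'cV[R]_k) ff alpha, is_grid T s M ->
    mesh_le s M eta -> (forall f, A (ctl f)) -> decided s ff M -> adm alpha -> follows ctl ff s M alpha ->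
    exists U : set (Omega T m), [/\ measurable U, (P U <= e%:E)%E & forall w, ~ U w -> forall t : R, 0 <= t <= T ->
      `|X alpha w t - euler s M mu sigma ctl ff t w| <= lam].
Proof.
move=> lam0 e0.
have [c c0 cE] : exists2 c : R, 0 < c & 432 * m%:R / (lam / 2) ^+ 2 + (lam / 2)^-1 <= c.
  set x := (X in exists2 c : R, _ & X <= c); exists (`|x| + 1); first exact: ltr_wpDl (normr_ge0 _) ltr01.
  by apply: le_trans (ler_norm x) _; rewrite lerDl ler01.
pose e1 := e / (c * T).
have e10 : 0 < e1 by rewrite divr_gt0// mulr_gt0.
have [d1 d10 h1] := coef_unif T cA muA d0 muL e10.
have [d2 d20 h2] := coef_unif T cA sigmaA d0 sigmaL e10.
exists (Num.min d1 d2 / 2); first by rewrite divr_gt0// lt_min d10.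
move=> s M F ctl ff alpha gs mesh ctlA df ha fol.
have sg := sigma_good ha.
have [|U [mU pU hU]] := near_euler T0 WP gs df (fun t f t0 => muC t0 (ctlA f)) (fun t f t0 => sigmaC t0 (ctlA f)) fol
   (mu_jm ha) (mu_bnd ha) sg (ltW e10) lam0.
  move=> i t f iM /andP[t1 t2].
  have /andP[si0 siT] := is_grid_bnd gs (ltnW iM); have /andP[_ si1T] := is_grid_bnd gs iM.
  have ht : 0 <= t <= T by rewrite (le_trans si0 (ltW t1)) (le_trans (ltW t2)).
  have hd : `|t - s i| < Num.min d1 d2.
    rewrite gtr0_norm ?subr_gt0//; have := mesh i iM. have : 0 < Num.min d1 d2 by rewrite lt_min d10. by lra.
  move: hd; rewrite lt_min => /andP[hd1 hd2].
  have z0 (x : R) : 0 < x -> `|ctl f - ctl f| < x by rewrite subrr normr0. split.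
    by apply: (h1 t (s i) (ctl f) (ctl f) ht _ (ctlA f) (ctlA f) hd1 (z0 _ d10)).1; rewrite si0 siT.
  by apply: (h2 t (s i) (ctl f) (ctl f) ht _ (ctlA f) (ctlA f) hd2 (z0 _ d20)).2; rewrite si0 siT.
exists U; split => //; apply: le_trans pU _; rewrite lee_fin.
have eT : e1 * T = e / c by rewrite /e1; field; rewrite !gt_eqF.
rewrite eT; apply: le_trans (ler_wpM2r (ltW (divr_gt0 e0 c0)) cE) _.
by rewrite mulrC divfK// gt_eqF.
Qed.

(** [K] is fixed first, to make the oscillation over coarse cells small, and the mesh afterwards, to
    make the Euler error small. *)
Lemma close_all (r e : R) : 0 < r -> 0 < e -> exists K : nat, (0 < K)%N /\ exists2 eta : R, 0 < eta &
  forall s M ka (F : finType) (ctl : F -> 'cV[R]_k) ff alpha, is_grid T s M ->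
    nested T K s M ka -> mesh_le s M eta -> (forall f, A (ctl f)) ->
    decided s ff M -> adm alpha -> follows ctl ff s M alpha ->
    exists U : set (Omega T m), [/\ measurable U, (P U <= e%:E)%E & forall w, ~ U w -> forall t : R, 0 <= t <= T ->
      `|state K s ka mu sigma ctl ff M w t - X alpha w t| <= r].
Proof.
move=> r0 e0.
pose rho := r / 8; have rho0 : 0 < rho by rewrite divr_gt0.
pose cc := (rho ^+ 2) ^- 2 * (d%:R ^+ 2 * (2 ^+ 12 * (m%:R * Cs ^+ 2 * T) ^+ 2)).
have cc0 : 0 <= cc.
  rewrite /cc; apply: mulr_ge0; first by rewrite invr_ge0 sqr_ge0.
  by apply: mulr_ge0 (sqr_ge0 _) (mulr_ge0 _ (sqr_ge0 _)); exact: exprn_ge0.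
(* The first term makes the failure probability [cc / K] at most [e / 2]; the second keeps the drift
   over a coarse cell below [rho]. Then [r = r / 2 + 2 * (rho + rho)]. *)
have [K1 hK1] : exists K1 : nat, cc / (e / 2) + `|Cm| * T / rho <= K1%:R.
  by exists (Num.truncn (cc / (e / 2) + `|Cm| * T / rho)).+1; apply: ltW; exact: truncnS_gt.
have e20 : 0 < e / 2 by rewrite divr_gt0.
have [eta eta0 near] := near_all (divr_gt0 r0 (ltr0Sn R 1)) e20.
exists K1.+1; split => //; exists eta => // s M ka F ctl ff alpha gs hka mesh ctlA df ha fol.
set K := K1.+1; have K0 : (0 < K)%N by [].
have KR : 0 < K%:R :> R by rewrite ltr0n.
have hK : cc / (e / 2) + `|Cm| * T / rho <= K%:R by apply: le_trans hK1 _; rewrite ler_nat.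
have q1 : 0 <= cc / (e / 2) by rewrite divr_ge0// ltW.
have q2 : 0 <= `|Cm| * T / rho by rewrite divr_ge0 ?mulr_ge0// ltW.
have [U1 [m1 p1 h1]] := near s M F ctl ff alpha gs mesh ctlA df ha fol.
have [U2 [m2 p2 h2]] := euler_mart_tight T0 WP K0 gs df (fun t f t0 => sigmaC t0 (ctlA f)) (exprn_gt0 2 rho0).
exists (U1 `|` U2); split; first exact: measurableU.
  apply: le_trans (measureU2 P m1 m2) _; apply: le_trans (leeD p1 p2) _; rewrite -EFinD lee_fin.
  have -> : K%:R * ((rho ^+ 2) ^- 2 * (d%:R ^+ 2 * (2 ^+ 12 * (m%:R * Cs ^+ 2 * (T / K%:R)) ^+ 2))) = cc / K%:R.
    rewrite /cc; field; rewrite (gt_eqF KR) (gt_eqF rho0) //=.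
  have : cc / K%:R <= e / 2.
    rewrite ler_pdivrMr// mulrC -ler_pdivrMr//; lra.
  lra.
move=> w hw t ht.
have n1_ : ~ U1 w by move=> h; apply: hw; left.
have n2_ : ~ U2 w by move=> h; apply: hw; right.
have -> : r = r / 2 + 2 * (rho + rho) by rewrite /rho; field.
apply: (state_near T0 K0 gs hka (erefl M) (h1 w n1_)) => // l u lK /[dup] hu /andP[lu ul].
have cT : coarse T K l.+1 <= T by have /andP[] := is_grid_bnd (coarse_grid T0 K0) lK.
have c0 : 0 <= coarse T K l by exact: coarse_ge0.
have hm : `|euler_mart s M sigma ctl ff u w - euler_mart s M sigma ctl ff (coarse T K l) w| <= rho.
  have := h2 w n2_ l lK u hu => h.
  by rewrite -(ler_pXn2r (n := 2))// ?nnegrE ?(ltW rho0)//; apply: le_trans (mxnorm_n2 _) h.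
have hd : `|euler_drift s M mu ctl ff u w - euler_drift s M mu ctl ff (coarse T K l) w| <= rho.
  have muC' (v : R) f : 0 <= v -> `|mu v (ctl f)| <= Cm.
    by move=> v0; apply: le_trans (mxnorm_enorm _) (muC v0 (ctlA f)).
  apply: le_trans (euler_drift_osc gs ff w c0 lu (le_trans ul cT) muC') _. apply: (via (`|Cm| * (T / K%:R))).
    apply: ler_pM; rewrite ?subr_ge0 ?ler_norm//.
      by apply: le_trans (muC' 0 (ff 0%N w) (lexx _)).
    by rewrite -(coarse_gap T K l) lerD2r.
  rewrite mulrA ler_pdivrMr// [leRHS]mulrC -ler_pdivrMr//; lra.
rewrite /euler opprD addrACA; apply: le_trans (ler_normD _ _) _; exact: lerD.
Qed.

(** On a cell of the given partition the new control is a net point close to the old control at the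
    last sampling time before the cell begins, hence known when the cell begins. *)
Lemma nearby_sample (n' : nat) (r : nat -> R) (n : nat) (tp : nat -> R) (h : R) (N : set 'cV[R]_k) alpha l :
  let dl := T / n'.+1%:R in (forall j, (j <= n')%N -> dl * j%:R <= r j < dl * j.+1%:R) ->
  0 < h -> h <= dl -> is_partition T h n tp -> is_net h A N -> adm alpha -> (l <= n)%N ->
  exists vl : Omega T m -> 'cV[R]_k, [/\ forall i j, F_measurable (tp l) (fun w => vl w i j),
     forall w, N (vl w) & forall (t : R) w, in_cell T tp n l t ->
       t <= 2 * dl \/ exists j, [/\ (j <= n')%N, `|r j - t| < 4 * dl & enorm (alpha (r j) w - vl w) <= h]].
Proof.
move=> dl hr h0 hdl [tp0 tpn tpS tph] [/finite_seqP[s sN] NA net] [jal aal Aal] ln.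
have gr : is_grid T tp n by [].
have /andP[tl0 tlT] := is_grid_bnd gr ln.
have dl0 : 0 < dl by rewrite divr_gt0.
have tcell (t : R) : in_cell T tp n l t -> t <= tp l + dl.
  move=> /andP[_]; case: ifPn => [lln ht|].
    by have := tph l lln; lra.
  by rewrite -leqNgt => nl; have -> : l = n by [apply/eqP; rewrite eqn_leq ln]; rewrite tpn; lra.
have [x Ax] := A0; have [y Ny _] := net x Ax.
(* A cell that begins before the first sample gets an arbitrary net point; all its times are at most
   [2 * dl]. *)
have [lt0|ge0] := ltP (tp l) (r 0%N).
  exists (fun=> y); split => [i j|//|t w cl].
    by apply/F_measurableP; exact: mcst.
  left; have := tcell t cl; have /andP[_] := hr 0%N isT; rewrite mulr1; lra.
have sne : s != [::] by apply/eqP => s0; move: Ny; rewrite sN s0.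
have ex : exists j, (j <= n')%N && (r j <= tp l) by exists 0%N.
have ub : forall j, (j <= n')%N && (r j <= tp l) -> (j <= n')%N by move=> j /andP[].
case: (ex_maxnP ex ub) => j /andP[jn rj] hj.
have /andP[rj1 rj2] := hr j jn.
have rj0 : 0 <= r j by apply: le_trans rj1; rewrite mulr_ge0// ltW.
have rjT : r j <= T by exact: le_trans rj tlT.
(* The cell adds at most another [dl], so its times are within [3 * dl] of the sample: this is the
   reason for windows of width [4 * dl]. *)
have tlj : tp l <= r j + 2 * dl.
  have [jn'|nj] := ltnP j n'.
    have : tp l < r j.+1.
      rewrite ltNge; apply/negP => hh; have := hj j.+1; rewrite jn' hh ltnn => /(_ isT). by [].
    have /andP[_] := hr j.+1 jn'; move: rj1; rewrite -!natr1 !mulrDr !mulr1; lra.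
  have -> : j = n' by apply/eqP; rewrite eqn_leq jn. have := hr n' (leqnn _) => /andP[+ _].
  have : dl * n'.+1%:R = T by rewrite /dl divfK// pnatr_eq0. by rewrite -natr1 mulrDr mulr1; move: tlT; lra.
exists (fun w => nearest h s (alpha (r j) w)); split.
- move=> i b; apply/F_measurableP; apply: measurable_nearest => i' b'; apply/F_measurableP.
  by apply: F_measurable_le rj _; apply: aal; rewrite rj0.
- by move=> w; rewrite sN /=; exact: nearest_mem.
- move=> t w cl; right; exists j; split => //.
    have := tcell t cl; have /andP[] := cl; rewrite ltr_norml => h1 _ h2. by apply/andP; split; lra.
  have [z Nz hz] := net (alpha (r j) w) (Aal _ w (introT andP (conj rj0 rjT))).
  by apply: nearest_close hz; move: Nz; rewrite sN.
Qed.

(** The sampling times are chosen once for [alpha], before the partition and the net, so that [h0]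
    serves every partition and net of size at most [h0]. *)
Lemma approx_control (e : R) alpha : 0 < e -> adm alpha -> exists2 h0 : R, 0 < h0 &
  forall h n tp N, 0 < h -> h <= h0 -> is_partition T h n tp -> is_net h A N ->
  exists v : nat -> Omega T m -> 'cV[R]_k,
    [/\ forall l, (l <= n)%N -> forall i j, F_measurable (tp l) (fun w => v l w i j),
        forall l w, (l <= n)%N -> N (v l w) &
       (\int[P]_w (`|g (X alpha w) - g (X (fun t w => step T tp n (fun l => v l w) t) w)|)%:E <= e%:E)%E].
Proof.
move=> e0 ha; have [jal aal Aal] := ha.
have [k0 k00 hk] := expectation_close T0 WP ug gC e0.
have [Bm Bm0 gapm] := coef_gap T cA muC muA d0 muL.
have [Bs Bs0 gaps] := coef_gap T cA sigmaC sigmaA d0 sigmaL.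
pose B := Bm + Bs.
have B0 : 0 <= B by rewrite addr_ge0.
pose eta := k0 / (3 * T).
have eta0 : 0 < eta by rewrite divr_gt0// mulr_gt0.
have [dm dm0 hdm] := gapm eta eta0; have [ds ds0 hds] := gaps eta eta0.
(* Half of the control tolerance is left for the net, as [h <= dc], and half for the oscillation of
   [alpha] since the sample. *)
pose dc := Num.min dm ds / 2.
have dc0 : 0 < dc by rewrite divr_gt0// lt_min dm0.
have dcm : 2 * dc <= dm by rewrite mulrC divfK// ge_min lexx.
have dcs : 2 * dc <= ds by rewrite mulrC divfK// ge_min lexx orbT.
pose c1 := B / dc.
have c10 : 0 <= c1 by rewrite divr_ge0// ltW.
pose eta2 := k0 / (3 * (c1 + 1)).
have eta20 : 0 < eta2 by rewrite divr_gt0// mulr_gt0// ltr_wpDl.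
have [n0 hn0] : exists n0 : nat, 6 * B * T / k0 <= n0%:R :> R.
  by exists (Num.truncn (6 * B * T / k0)).+1; apply: ltW; exact: truncnS_gt.
have [CA hCA] : exists CA : R, forall a i j, A a -> `|a i j| <= CA.
  have [M [_ hM]] := compact_bounded cA; exists (M + 1) => a i j Aa.
  by apply: le_trans (entry_mxnorm _ _ _) _; apply: hM => //; rewrite ltrDl.
have CA0 : 0 <= `|CA| by [].
have [n' n0n' [r [hr hsum]]] := sample_points P T0 (f := entries alpha) (C := `|CA|) (fun x => jal x.1 x.2) CA0
   (fun x t w ht => le_trans (hCA _ x.1 x.2 (Aal t w ht)) (ler_norm CA)) n0 eta20.
set dl := T / n'.+1%:R in hr hsum.
have dl0 : 0 < dl by rewrite divr_gt0.
have Bdl : 2 * B * dl <= k0 / 3.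
  have n0' : n0%:R <= n'.+1%:R :> R by rewrite ler_nat leqW. have n'0 : 0 < n'.+1%:R :> R by rewrite ltr0n.
  rewrite /dl mulrA ler_pdivrMr//; move: (le_trans hn0 n0'); rewrite ler_pdivrMr//.
  set x := n'.+1%:R; set b := B * T; rewrite -mulrA -/b -(mulrA 2 B T) -/b; nra.
exists (Num.min dl dc); first by rewrite lt_min dl0.
move=> h n tp N h0; rewrite le_min => /andP[hdl hdc] hp hN.
have gr : is_grid T tp n by case: hp.
have /choice[v hv] : forall l, exists vl : Omega T m -> 'cV[R]_k, (l <= n)%N ->
   [/\ forall i j, F_measurable (tp l) (fun w => vl w i j), forall w, N (vl w) &
     forall (t : R) w, in_cell T tp n l t ->
       t <= 2 * dl \/ exists j, [/\ (j <= n')%N, `|r j - t| < 4 * dl & enorm (alpha (r j) w - vl w) <= h]].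
  move=> l; have [ln|_] := boolP (l <= n)%N; last by exists (fun=> 0).
  by have [vl hvl] := nearby_sample hr h0 hdl hp hN ha ln; exists vl.
have NA : N `<=` A by case: hN.
have mv l : (l <= n)%N -> forall i j, F_measurable (tp l) (fun w => v l w i j) by move=> /hv[].
have Nv l w : (l <= n)%N -> N (v l w) by move=> /hv[].
exists v; split => //.
pose al' := fun (t : R) (w : Omega T m) => step T tp n (fun l => v l w) t.
have ha' : adm al' by apply: (step_admissible gr mv) => l w ln; exact/NA/Nv.
pose W (j : 'I_n'.+1) := window (entries alpha) (4 * dl) (r j).
pose K1 (t : R) (w : Omega T m) : R := \sum_j W j t w.
pose K2 (t : R) (w : Omega T m) : R := if t <= 2 * dl then 1 else 0.
pose K' (t : R) w : R := c1 * K1 t w + B * K2 t w.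
pose K (t : R) w : R := 1 * eta + 1 * K' t w.
have rT j : (j <= n')%N -> 0 <= r j <= T by move=> jn; rewrite (sample_ge0 T0 hr jn) (sample_leT T0 hr jn).
have jW (j : 'I_n'.+1) : jm (W j) by apply: jm_window; [move=> x; exact: jal|apply: rT; rewrite -ltnS].
have W0 (j : 'I_n'.+1) t w : 0 <= W j t w by exact: window_ge0.
have jK1 : jm K1 by apply: mfun_sum => j; exact: jW.
have jK2 : jm K2.
  apply: measurable_funTS; apply: measurable_fun_ifT; try exact: mcst.
  by apply: measurable_fun_ler; [exact: measurable_fst|exact: mcst].
have jK' : jm K' by apply: mfunD; apply: mfunM => //; exact: mcst.
have jK : jm K.
  apply: mfunD; first by apply: mfunM; exact: mcst. by apply: mfunM => //; exact: mcst.
have K10 (t : R) w : 0 <= K1 t w by apply: sumr_ge0.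
have K20 (t : R) w : 0 <= K2 t w by rewrite /K2; case: ifP.
have K'0 (t : R) w : 0 <= K' t w by rewrite addr_ge0// mulr_ge0.
(* A Chebyshev argument in time: where the two controls are not close, the window of the active
   sample is at least [dc], so the bound [B] is at most [c1] times that window. *)
have key (t : R) w (q1 q2 : nat) (dd Bf : R) (x y : 'M[R]_(q1, q2)) : 2 * dc <= dd -> 0 <= Bf -> Bf <= B -> 0 <= t <= T ->
   (n1 (x - y) <= eta + (if `|alpha t w - al' t w| < dd then 0 else Bf) /\
    n2 (x - y) <= eta + (if `|alpha t w - al' t w| < dd then 0 else Bf)) ->
   n1 (x - y) <= K t w /\ n2 (x - y) <= K t w.
  move=> hdd Bf0 BfB ht. suff hK : eta + (if `|alpha t w - al' t w| < dd then 0 else Bf) <= K t w.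
    by move=> [h1 h2]; split; exact: le_trans hK.
  rewrite /K !mul1r lerD2l; case: ifPn => [_|]; first exact: K'0. rewrite -leNgt => hal.
  have [l ln cl] := cell_cover gr ht. have [_ _ /(_ t w cl)] := hv l ln. case=> [t2|[j [jn rjt hj]]].
    apply: le_trans BfB _; rewrite /K' /K2 t2 mulr1 lerDr; exact: mulr_ge0.
  have ej : al' t w = v l w by exact: (stepE gr _ ln cl).
  have hW : dc <= W (Ordinal (jn : (j < n'.+1)%N)) t w.
    rewrite /W /window /= rjt spread_entries.
    have hsp : `|alpha (r j) w - alpha t w| <= \sum_a \sum_b `|alpha (r j) w a b - alpha t w a b|.
      have -> : \sum_a \sum_b `|alpha (r j) w a b - alpha t w a b| = n1 (alpha (r j) w - alpha t w).
        by apply: eq_bigr => a' _; apply: eq_bigr => b' _; rewrite !mxE.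
      by apply: mxnorm_le; [exact: n1_ge0|exact: n1_entry].
    apply: le_trans hsp.
    have tri : `|alpha t w - v l w| <= `|alpha (r j) w - alpha t w| + `|alpha (r j) w - v l w|.
      rewrite (distrC (alpha (r j) w)); apply: le_trans (ler_normD _ _). by rewrite addrA subrK.
    have := mxnorm_enorm (alpha (r j) w - v l w); rewrite ej in hal; lra.
  apply: (via (c1 * dc)); first by rewrite /c1 divfK// gt_eqF.
  apply: (via (c1 * K1 t w)); last by rewrite lerDl mulr_ge0.
  rewrite ler_wpM2l//; apply: le_trans hW _; rewrite /K1 (bigD1 (Ordinal (jn : (j < n'.+1)%N)))//= lerDl.
  by apply: sumr_ge0 => i _; exact: W0.
(* A third of [k0] each for the continuity error [eta], the windows, and the initial time of length
   [2 * dl]. *)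
have D2K : (D2 P K <= k0%:E)%E.
  have e1 : (D2 P K <= 1%:E * D2 P (fun _ _ => eta) + 1%:E * D2 P K')%E.
    apply: D2_le2 => //; try exact: jm_cst; try (by move=> ? ? _; exact: K'0); try (by move=> ? ? _; exact: ltW).
    by move=> t w _; rewrite /K addr_ge0// mul1r// ltW.
  have e2 : (D2 P K' <= c1%:E * D2 P K1 + B%:E * D2 P K2)%E by apply: D2_le2 => // t w _; rewrite ?K10 ?K20 ?K'0.
  have e3 : (D2 P K1 <= eta2%:E)%E.
    apply: le_trans _ hsum; rewrite le_eqVlt; apply/orP; left; apply/eqP.
    by apply: D2_sum => // j t w _; exact: W0.
  have e4 : (D2 P K2 <= (2 * dl)%:E)%E by apply: D2_initial => //; rewrite mulr_ge0// ltW.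
  apply: le_trans e1 _; rewrite D2_cst// !mul1e.
  apply: (via ((eta * T)%:E + (c1%:E * eta2%:E + B%:E * (2 * dl)%:E))%E).
    apply: leeD2l; apply: le_trans e2 _; apply: leeD; apply: lee_wpmul2l; rewrite ?lee_fin//.
  rewrite -!EFinM -!EFinD lee_fin.
  have -> : eta * T = k0 / 3 by rewrite /eta invfM mulrA -mulrA mulVf ?mulr1// gt_eqF.
  have : c1 * eta2 <= k0 / 3.
    rewrite /eta2 invfM (mulrA k0) mulrCA -{2}(mulr1 (k0 / 3)) ler_wpM2l//.
      by rewrite divr_ge0// ltW.
    by rewrite ler_pdivrMr ?ltr_wpDl// mul1r lerDl.
  by move: Bdl; rewrite (mulrCA B) mulrA; lra.
have gs := sigma_good ha.
have gs' := sigma_good ha'.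
apply: (hk (fun t w => mu t (alpha t w)) (fun t w => mu t (al' t w)) _ _ (Cm ^+ 2) (Cm ^+ 2) (Cs ^+ 2) (Cs ^+ 2) K) => //.
- exact: (mu_jm).
- exact: (mu_bnd).
- exact: (mu_jm).
- exact: (mu_bnd).
- move=> t w ht; have [_ _ Aal'] := ha'.
  by apply: (key t w _ _ ds Bs _ _ _ _ _ ht (hds t _ _ ht (Aal t w ht) (Aal' t w ht))).2 => //; rewrite /B lerDr.
- move=> t w ht; have [_ _ Aal'] := ha'.
  by apply: (key t w _ _ dm Bm _ _ _ _ _ ht (hdm t _ _ ht (Aal t w ht) (Aal' t w ht))).1 => //; rewrite /B lerDl.
Qed.

(** * The lower bound for a fixed dual integrand *)

Section DualLowerBound.
Variables (tp : nat -> R) (n : nat) (N : set 'cV[R]_k).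
Hypotheses (gr : is_grid T tp n) (fN : finite_set N) (N0 : N !=set0) (NA : N `<=` A).
Variable phi : R -> Omega T d -> 'cV[R]_d.
Hypothesis hphi : @dual_integrands R T d phi.

Definition dual_mart alpha w : R := ito P (fun t w => (phi t (X alpha w))^T *m sigma t (alpha t w)) w T 0 0.

Lemma dual_mart_mean alpha : adm alpha -> P.-integrable setT (fun w => (dual_mart alpha w)%:E) /\
  (\int[P]_w (dual_mart alpha w)%:E = 0)%E.
Proof.
move=> ha; have [C gC'] := integrand_good hphi ha.
have hT : 0 <= T <= T by rewrite ltW/=.
exact: (ito_mean T0 WP 0 (itoP T0 WP gC') hT).
Qed.

Lemma g_integrable alpha : adm alpha -> P.-integrable setT (fun w => (g (X alpha w))%:E).
Proof.
move=> ha; apply: (@bounded_integrable _ _ _ P (fun w => g (X alpha w)) Cg) => //.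
apply: mcomp; first exact: UC_measurable.
exact: (measurable_X).
Qed.

Lemma step_cst_admissible c : (forall l, (l <= n)%N -> N (c l)) -> adm (fun t _ => step T tp n c t).
Proof.
move=> cN; apply: (step_admissible (v := fun l _ => c l) gr).
  by move=> l ln i j; apply/F_measurableP; exact: mcst.
by move=> l w ln; exact/NA/cN.
Qed.

Lemma gap_integrable alpha : adm alpha -> Rint P (fun w => g (X alpha w) - dual_mart alpha w).
Proof. by move=> ha; have [i _] := dual_mart_mean ha; exact: (integrableB measurableT (g_integrable ha) i). Qed.

Lemma pathwise_sup_integrable : Rint P (pathwise_sup P mu sigma g N n tp phi).
Proof.
have [F [f0 [c [cN cd dc]]]] := finite_det_controls gr fN N0.
pose z (f : F) w := g (X (fun t _ => step T tp n (c f) t) w) - dual_mart (fun t _ => step T tp n (c f) t) w.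
have iz f : Rint P (z f) by apply/gap_integrable/step_cst_admissible => l _; exact: cN.
apply: eq_integrable (bigmax_integrable f0 iz) => // w _ /=; congr EFin.
apply/esym; apply: (@sup_bigmax R (R -> 'cV[R]_k) (det_controls T N n tp)
  (fun a => g (X (fun t _ => a t) w) - dual_mart (fun t _ => a t) w) F f0 (fun f => step T tp n (c f))) => // a.
by move=> /(det_controls_step gr)[v vN ->]; have [f _ ->] := dc v vN; exists f.
Qed.

(** The gain minus the dual martingale of the adapted control is compared almost surely with the
    maximum over deterministic controls; subtracting the martingale leaves the expectation
    unchanged. *)
Lemma expectation_le_dual (v : nat -> Omega T m -> 'cV[R]_k) :
  (forall l, (l <= n)%N -> forall i j, F_measurable (tp l) (fun w => v l w i j)) ->
  (forall l w, (l <= n)%N -> N (v l w)) ->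
  (\int[P]_w (g (X (fun t w => step T tp n (fun l => v l w) t) w))%:E <=
   \int[P]_w (pathwise_sup P mu sigma g N n tp phi w)%:E)%E.
Proof.
move=> mv vN; set al' := fun (t : R) (w : Omega T m) => _.
have ha' : adm al' by apply: (step_admissible gr mv) => l w ln; exact/NA/vN.
have [F [f0 [c [cN cd dc]]]] := finite_det_controls gr fN N0.
have [iM M0] := dual_mart_mean ha'.
have ig := g_integrable ha'.
have -> : (\int[P]_w (g (X al' w))%:E = \int[P]_w (g (X al' w) - dual_mart al' w)%:E)%E.
  by under [RHS]eq_integral do rewrite EFinB; rewrite integralB//= M0 sube0.
apply: int_le_ae; [exact: gap_integrable|exact: pathwise_sup_integrable|].
have hf f : adm (fun t _ => step T tp n (c f) t) by apply/step_cst_admissible => l _; exact: cN.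
(* Finitely many events that cover the space, so the almost sure identities on each of them combine
   into one. *)
pose E (f : F) := [set w : Omega T m | forall l, (l <= n)%N -> v l w = c f l].
have mE f : measurable (E f).
  have mS : mfunO T m (fun w => \sum_(l < n.+1) n2 (v l w - c f l)).
    apply: mfun_sum => l; apply: measurable_n2 => i j. apply: measurable_mxB => //.
    have ln : (l <= n)%N by rewrite -ltnS.
    by apply: F_measurableT (mv l ln i j); have /andP[] := is_grid_bnd gr ln.
  rewrite (_ : E f = (fun w => \sum_(l < n.+1) n2 (v l w - c f l)) @^-1` [set 0]).
    by have := mS measurableT [set 0] (measurable_set1 0); rewrite setTI.
  apply/seteqP; split=> w /=.
    by move=> h; rewrite big1// => l _; rewrite h ?subrr ?n20// -ltnS.
  move=> h l ln; apply/eqP; rewrite -subr_eq0; apply/eqP/n2_eq0. have l1 : (l < n.+1)%N by [].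
  exact: (psumr_eq0P (fun i _ => n2_ge0 _) h (i := Ordinal l1) isT).
have hE f w : E f w -> forall t : R, 0 <= t <= T -> al' t w = step T tp n (c f) t.
  by move=> Ew t _; congr (_ t); exact: eq_step.
have h1 : {ae P, forall w, forall f, E f w -> X al' w = X (fun t _ => step T tp n (c f) t) w}.
  apply: filter_forall => f. exact: (X_local ha' (hf f) (mE f) (hE f)).
have h2 : {ae P, forall w, forall f, E f w -> dual_mart al' w = dual_mart (fun t _ => step T tp n (c f) t) w}.
  apply: filter_forall => f. apply: filterS (M_local hphi ha' (hf f) (mE f) (hE f)) => w hw Ew.
  exact: (f_equal (fun z : Omega T 1 => z T 0 0) (hw Ew)).
apply: filterS2 h1 h2 => w h1 h2.
have [f hfv _] := dc (fun l => v l w) (fun l ln => vN l w ln).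
rewrite (h1 f hfv) (h2 f hfv).
pose z (f : F) w := g (X (fun t _ => step T tp n (c f) t) w) - dual_mart (fun t _ => step T tp n (c f) t) w.
have -> : pathwise_sup P mu sigma g N n tp phi w = \big[Num.max/z f0 w]_f z f w.
  apply: (@sup_bigmax R (R -> 'cV[R]_k) (det_controls T N n tp)
    (fun a => g (X (fun t _ => a t) w) - dual_mart (fun t _ => a t) w) F f0 (fun f => step T tp n (c f))) => // a.
  by move=> /(det_controls_step gr)[v' vN' ->]; have [f' _ ->] := dc v' vN'; exists f'.
exact: (le_bigmax _ (z ^~ w)).
Qed.

End DualLowerBound.

(** * The upper bound *)

Let sigmaC2 (F : finType) (ctl : F -> 'cV[R]_k) : (forall f, A (ctl f)) -> forall t f, 0 <= t -> n2 (sigma t (ctl f)) <= Cs ^+ 2.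
Proof.
by move=> ctlA t f t0; have h := sigmaC t0 (ctlA f); rewrite -enorm_sqr lerXn2r ?nnegrE ?enorm_ge0// (le_trans (enorm_ge0 _) h).
Qed.

Let muC2 (F : finType) (ctl : F -> 'cV[R]_k) : (forall f, A (ctl f)) -> forall t f, 0 <= t -> n2 (mu t (ctl f)) <= Cm ^+ 2.
Proof.
by move=> ctlA t f t0; have h := muC t0 (ctlA f); rewrite -enorm_sqr lerXn2r ?nnegrE ?enorm_ge0// (le_trans (enorm_ge0 _) h).
Qed.

Let Cg0 : 0 <= Cg. Proof. exact: le_trans (normr_ge0 _) (gC (zero_path T d)). Qed.

Lemma frac_half (c e : R) : 0 <= c -> 0 < e -> e / 2 + 2 * c * (e / (4 * c + 1)) <= e.
Proof.
move=> c0 e0; rewrite [leRHS](splitr e) lerD2l mulrA ler_pdivrMr ?ltr_wpDl ?mulr_ge0//.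
have := mulr_ge0 (ltW e0) c0; lra.
Qed.

(** Packaged so that [K] and [eta] are chosen once, before the grid, the finite control set and the
    decisions are known. *)
Definition state_close K eta e := forall s M ka (F : finType) (ctl : F -> 'cV[R]_k) ff alpha, is_grid T s M ->
    nested T K s M ka -> mesh_le s M eta -> (forall f, A (ctl f)) ->
    decided s ff M -> adm alpha -> follows ctl ff s M alpha ->
    Rint P (fun w => g (state K s ka mu sigma ctl ff M w)) /\
    (\int[P]_w `|g (state K s ka mu sigma ctl ff M w) - g (X alpha w)|%:E <= e%:E)%E.

Lemma state_gap (e : R) : 0 < e -> exists K : nat, (0 < K)%N /\ exists2 eta : R, 0 < eta &
  state_close K eta e.
Proof.
move=> e0; have e20 : 0 < e / 2 by rewrite divr_gt0.
have [r r0 hr] := ug e20.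
have p0 : 0 < e / (4 * Cg + 1) by rewrite divr_gt0// ltr_wpDl// mulr_ge0.
have [K [K0 [eta eta0 H]]] := close_all r0 p0.
exists K; split=> //; exists eta => // s M ka F ctl ff alpha gs hka mesh ctlA df ha fol.
have [U [mU PU hU]] := H s M ka F ctl ff alpha gs hka mesh ctlA df ha fol.
have mg := UC_measurable T0 ug.
have mZ : mfunO T m (fun w => state K s ka mu sigma ctl ff M w).
  have := measurable_state T0 ka K0 gs mu sigma ctl df (leqnn M). by case: gs => _ -> _.
have mX := measurable_X ha.
have m1 := mcomp mg mZ; have m2 := mcomp mg mX.
split.
  exact: (@bounded_integrable _ _ _ P (fun w => g (state K s ka mu sigma ctl ff M w)) Cg m1 (fun w => gC _)).
apply: le_trans (int_close m1 m2 (fun w => gC _) (fun w => gC _) mU PU (ltW e20) _) _.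
  by move=> w nU; apply: hr => t ht; exact: hU.
by rewrite lee_fin; exact: frac_half.
Qed.

Lemma small_poly (a b c e : R) : 0 <= a -> 0 <= b -> 0 <= c -> 0 < e ->
  exists2 x : R, 0 < x & a * x ^+ 2 + b * x + c * x <= e.
Proof.
move=> a0 b0 c0 e0; have D0 : 0 < a + b + c + 1 by lra.
exists (Num.min 1 (e / (a + b + c + 1))); first by rewrite lt_min ltr01 divr_gt0.
set x := Num.min _ _; have x1 : x <= 1 by rewrite ge_min lexx.
have x0 : 0 <= x by rewrite le_min ler01 divr_ge0 ?ltW.
have xe : x * (a + b + c + 1) <= e by rewrite -ler_pdivlMr// ge_min lexx orbT.
have xx : x ^+ 2 <= x by rewrite expr2 ler_piMl.
have := ler_wpM2l a0 xx; lra.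
Qed.

(** [eta] depends on [eps] but not on [q] and [dl]: the modulus and the bound of the slope involve
    only the product [q * dl]. *)
Lemma mart_gap K (eps e : R) : (0 < K)%N -> 0 < eps -> 0 < e -> exists2 eta : R, 0 < eta &
  forall s M ka (F : finType) (f0 : F) (ctl : F -> 'cV[R]_k) q dl (fs : nat -> F) (a : R -> 'cV[R]_k),
    is_grid T s M -> nested T K s M ka -> mesh_le s M eta -> (forall f, A (ctl f)) ->
    (0 < q)%N -> 0 < dl -> q%:R * dl = eps -> adm (fun t _ => a t) ->
    follows ctl (fun i (_ : Omega T m) => fs i) s M (fun t _ => a t) ->
    forall p, p = slope P K s M ka mu sigma f0 ctl g q dl ->
    (\int[P]_w ((dual_mart (feedback K s M p) (fun t _ => a t) w -
       feedback_sum K s M p ka mu sigma ctl fs w) ^+ 2)%:E <= e%:E)%E.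
Proof.
move=> K0 eps0 e0; pose Bp : R := 2 * Cg / eps.
have q0 (b c : R) : 0 <= b -> 0 <= 144 * m%:R * (2 * (d%:R * b)) * T.
  by move=> b0; apply: mulr_ge0 (ltW T0); apply: mulr_ge0; apply: mulr_ge0 => //; exact: mulr_ge0.
have q1 : 0 <= 144 * m%:R * (4 * (d%:R * Bp ^+ 2 * Cs ^+ 2)) * T.
  by apply: mulr_ge0 (ltW T0); apply: mulr_ge0; apply: mulr_ge0 => //; apply: mulr_ge0 (sqr_ge0 _); apply: mulr_ge0 (sqr_ge0 _).
have [x x0 hx] := small_poly (q0 _ 0 (sqr_ge0 Cs)) (q0 _ 0 (sqr_ge0 Bp)) q1 e0.
have ke0 : 0 < x * eps / 2 by rewrite divr_gt0 ?mulr_gt0.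
have [lam lam0 hlam] := ug ke0.
have [eta1 eta10 near] := near_all lam0 x0.
have [eta2 eta20 unif] := coef_unif T cA sigmaA d0 sigmaL x0.
exists (Num.min eta1 (eta2 / 2)); first by rewrite lt_min eta10 divr_gt0.
move=> s M ka F f0 ctl q dl fs a gs hka mesh ctlA qpos dl0 qdl ha fol p ep.
have mesh1 i : (i < M)%N -> s i.+1 - s i <= eta1 by move=> /mesh; rewrite le_min => /andP[].
have mesh2 i : (i < M)%N -> s i.+1 - s i <= eta2 / 2 by move=> /mesh; rewrite le_min => /andP[].
have pUC i j : UC (fun z => p i z j 0) by rewrite ep; exact: (slope_UC P T0 ka K0 gs mu sigma f0 ctl ug gC qpos dl0 i j).
have pB i z j : `|p i z j 0| <= Bp.
  by rewrite ep /Bp -qdl; exact: (slope_bound P T0 ka K0 gs mu sigma f0 ctl ug gC qpos dl0 i z j).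
have phiD := feedback_dual T0 K0 gs pUC pB.
have [C ga] := integrand_good phiD ha.
have df : decided s (fun i (_ : Omega T m) => fs i) M by move=> j _ f; exact: mcst.
have [U [mU PU hU]] := near s M F ctl _ _ gs mesh1 ctlA df ha fol.
have aC (t : R) : 0 <= t <= T -> n2 (sigma t (a t)) <= Cs ^+ 2.
  move=> ht; have [_ _ aA] := ha; have Aa := aA t point ht; have /andP[t0 _] := ht.
  exact: (@sigmaC2 unit (fun=> a t) (fun=> Aa) t tt t0).
have fol' i (t : R) : (i < M)%N -> s i <= t < s i.+1 -> a t = ctl (fs i) by move=> iM ht; exact: (fol i t point).
have hU' w : ~ U w -> forall i j, (i < M)%N ->
    `|p i (coarse_path K (s i) (X (fun t _ => a t) w)) j 0 - p i (state K s ka mu sigma ctl (fun i _ => fs i) i w) j 0| <= x.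
  (* The slope is a difference quotient at scale [eps], so a modulus [x * eps / 2] of the value
     functions becomes the modulus [x] of the slope. *)
  move=> nU i j iM. have gm : mod_ok (fun z => p i z j 0) x lam.
    have vm := value_mod P T0 ka K0 gs mu sigma f0 ctl ug gC (leq_subr i.+1 M) lam0 hlam.
    have -> : x = 2 * (x * eps / 2) / (q%:R * dl) by rewrite qdl; field; rewrite gt_eqF.
    move=> z z' hz; rewrite ep /slope !mxE. exact: (grad_mod T0 K0 qpos dl0 (ka i, j) vm hz).
  apply: gm => t ht. exact: (state_coarse_path T0 K0 gs hka (ltnW iM) (hU w nU) ht).
have he i (t : R) f : (i < M)%N -> s i < t < s i.+1 -> n2 (sigma t (ctl f) - sigma (s i) (ctl f)) <= x.
  move=> iM /andP[h1 h2]. have si := is_grid_bnd gs (ltnW iM); have si1 := is_grid_bnd gs iM.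
  have [] // := unif t (s i) (ctl f) (ctl f) _ si (ctlA f) (ctlA f) _ _.
  - by case/andP: si => si _; case/andP: si1 => _ si1; apply/andP; split; apply: ltW; [exact: le_lt_trans si h1|exact: lt_le_trans h2 si1].
  - by rewrite gtr0_norm ?subr_gt0//; have := mesh2 i iM; lra.
  - by rewrite subrr normr0.
have := feedback_close T0 K0 gs pUC pB WP (sigmaC2 ctlA) ga fol' aC mU PU (ltW x0) (ltW x0) hU' he.
move/le_trans; apply; rewrite lee_fin; apply: le_trans hx; lra.
Qed.

(** The squared time steps sum to at most [eta * T], which fixes [eta]; the lattice step is chosen
    once the grid is known. *)
Lemma rest_gap K (eps e : R) : (0 < K)%N -> 0 < eps -> 0 < e -> exists2 eta : R, 0 < eta &
  forall s M ka (F : finType) (f0 : F) (ctl : F -> 'cV[R]_k),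
    is_grid T s M -> (forall i, (i < M)%N -> (ka i < K)%N) -> mesh_le s M eta -> (forall f, A (ctl f)) ->
    exists q dl, [/\ (0 < q)%N, 0 < dl, q%:R * dl = eps & forall fs : nat -> F,
      let r w := \sum_(i < M) rest P K s M ka mu sigma f0 ctl g q dl i (fs i)
        (state K s ka mu sigma ctl (fun i (_ : Omega T m) => fs i) i w) (inc s i w) in
      mfun r /\ (\int[P]_w (r w ^+ 2)%:E <= e%:E)%E].
Proof.
move=> K0 eps0 e0.
pose b1 : R := 4 * Cg / eps ^+ 2 * d%:R * 2.
pose b2 : R := 16 * (b1 * Cm ^+ 2 * T) ^+ 2 + 5 * (2 ^+ 10 * m%:R ^+ 2) * (b1 * Cs ^+ 2) ^+ 2.
have b20 : 0 <= b2.
  by apply: addr_ge0; apply: mulr_ge0 (sqr_ge0 _) => //; apply: mulr_ge0 => //; apply: mulr_ge0 (sqr_ge0 _); exact: exprn_ge0.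
have bT : 0 <= b2 * T by apply: mulr_ge0 b20 (ltW T0).
have e20 : 0 < e / 2 by rewrite divr_gt0.
have [x x0 hx] := small_poly (lexx 0) bT (lexx 0) e20.
exists x => // s M ka F f0 ctl gs hka mesh ctlA.
have M0 : 0 <= 16 * M%:R :> R by exact: mulr_ge0.
(* Rounding contributes [16 * sm ^+ 2] at each of the [M] steps, so the bound [y] on [sm], and
   through it [dl], depends on [M]. *)
have [y y0 hy] := small_poly M0 (lexx 0) (lexx 0) e20.
have y20 : 0 < y / 2 by rewrite divr_gt0.
have [r r0 hr] := ug y20.
pose c : R := d%:R * (2 * Cg / eps).
have c0 : 0 <= c by apply: mulr_ge0 => //; apply: mulr_ge0; [exact: mulr_ge0|rewrite invr_ge0 ltW].
pose dm := Num.min r (y / 2 / (c + 1)).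
have dm0 : 0 < dm by rewrite lt_min r0 divr_gt0// ltr_wpDl.
have [q hq] : exists q : nat, eps / dm <= q.+1%:R by exists (Num.truncn (eps / dm)); exact/ltW/truncnS_gt.
have q0 : 0 < q.+1%:R :> R by rewrite ltr0n.
exists q.+1, (eps / q.+1%:R).
have qe : q.+1%:R * (eps / q.+1%:R) = eps by rewrite mulrCA divff ?gt_eqF// mulr1.
have dld : eps / q.+1%:R <= dm by rewrite ler_pdivrMr// mulrC -ler_pdivrMr.
have dl0 : 0 < eps / q.+1%:R by rewrite divr_gt0.
split=> // fs rr.
have hr' : mod_ok g (y / 2) (eps / q.+1%:R).
  by move=> z z' hz; apply: hr => t ht; apply: le_trans (hz t ht) (le_trans dld _); rewrite ge_min lexx.
have [m1 h1] := rest_sum_L2 T0 WP K0 gs f0 ug gC hka (muC2 ctlA) (sigmaC2 ctlA) (ltn0Sn q) dl0 hr' fs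
  (sqr_ge0 Cm) (sqr_ge0 Cs) (ltW y20) (leqnn M).
split; first by move: m1; case: (gs) => _ -> _.
apply: le_trans h1 _; rewrite lee_fin.
have sm_le : sm d Cg q.+1 (eps / q.+1%:R) (y / 2) <= y.
  rewrite /sm /= qe. rewrite [leRHS](splitr y) lerD2l mulrA -/c; apply: le_trans (ler_wpM2l c0 dld) _.
  apply: (via (c * (y / 2 / (c + 1)))); first by rewrite ler_wpM2l// ge_min lexx orbT.
  by rewrite mulrA ler_pdivrMr ?ltr_wpDl// mulrC ler_wpM2l ?(ltW y20)// lerDl.
have sm0 : 0 <= sm d Cg q.+1 (eps / q.+1%:R) (y / 2).
  by rewrite /sm /= qe mulrA -/c; apply: addr_ge0 (ltW y20) (mulr_ge0 c0 (ltW dl0)).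
have sm2 : sm d Cg q.+1 (eps / q.+1%:R) (y / 2) ^+ 2 <= y ^+ 2 by rewrite lerXn2r ?nnegrE// ltW.
have -> : B2 T d m Cg (Cm ^+ 2) (Cs ^+ 2) q.+1 (eps / q.+1%:R) = b2 by rewrite /B2 /B1 qe.
apply: (via (\sum_(i < M) (b2 * x * (s i.+1 - s i) + 16 * y ^+ 2))).
  apply: ler_sum => i _; apply: lerD; last by rewrite ler_wpM2l.
  rewrite -mulrA; apply: ler_wpM2l b20 _ _ _; rewrite expr2. apply: ler_wpM2r; last exact: mesh.
  by rewrite subr_ge0 ltW//; case: gs => _ _; exact.
rewrite big_split /= -mulr_sumr -(big_mkord predT (fun i => s i.+1 - s i)) telescope_sumr//.
rewrite sumr_const card_ord; have [-> -> _] := gs.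
move: hx hy; rewrite !mul0r add0r !addr0 => hx hy.
have -> : b2 * x * (T - 0) + 16 * y ^+ 2 *+ M = b2 * T * x + 16 * M%:R * y ^+ 2 by rewrite -mulr_natl; ring.
by rewrite [leRHS](splitr e) lerD.
Qed.

Lemma measurable_feedback_sum K s M (p : nat -> Omega T d -> 'cV[R]_d) (Bp : R) ka (F : finType) (ctl : F -> 'cV[R]_k) (fs : nat -> F) :
  (0 < K)%N -> is_grid T s M -> (forall i j, UC (fun z : Omega T d => p i z j 0)) ->
  (forall i z j, `|p i z j 0| <= Bp) -> (forall f, A (ctl f)) ->
  mfun (feedback_sum K s M p ka mu sigma ctl fs).
Proof.
move=> K0 gs pUC pB ctlA; apply: mfun_sum => i; under eq_fun do rewrite mxE.
have si := is_grid_bnd gs (ltnW (ltn_ord i)); have si1 := is_grid_bnd gs (ltn_ord i).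
have [/andP[_ s1] /andP[_ s2]] := (si, si1).
apply: mfun_sum => b; apply: mfunM.
  by apply: F_measurableT s1 _; exact: (feedback_val_F T0 K0 gs pUC ka mu sigma ctl fs).
rewrite /inc. by apply: measurable_mxB; exact: measurable_coord.
Qed.

(** The maximisers of the dynamic program, read along the state, form an admissible step control;
    its controlled path is close to the state, so its gain is almost the value. *)
Lemma value_le_primal K eta e : state_close K eta e ->
  forall s M ka (F : finType) (f0 : F) (ctl : F -> 'cV[R]_k), (0 < K)%N -> is_grid T s M ->
    nested T K s M ka -> mesh_le s M eta -> (forall f, A (ctl f)) ->
  ((value P K s M ka mu sigma f0 ctl g M (zero_path T d))%:E <= primal_value P mu sigma g A + e%:E)%E.
Proof.
move=> H s M ka F f0 ctl K0 gs hka mesh ctlA.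
rewrite (value_best T0 WP ka K0 gs mu sigma f0 ctl ug gC).
set ff := best_ff P K s M ka mu sigma f0 ctl g.
have df : decided s ff M := best_decided P T0 ka K0 gs mu sigma f0 ctl ug gC (leqnn M).
pose v l (w : Omega T m) := if (l < M)%N then ctl (ff l w) else ctl f0.
pose alpha t w := step T s M (v ^~ w) t.
have ha : adm alpha.
  apply: (step_admissible gs) => [l lM i j|l w lM]; last by rewrite /v; case: ifP.
  rewrite /v; case: (boolP (l < M)%N) => lM'; last by apply/F_measurableP; exact: mcst.
  exact: (decided_F (fun f => ctl f i j) df lM').
have fol : follows ctl ff s M alpha.
  move=> i t w iM ht; rewrite /alpha (stepE gs _ (ltnW iM)) ?/v ?iM//. by rewrite /in_cell iM.
have [i1 h1] := H s M ka F ctl ff alpha gs hka mesh ctlA df ha fol.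
have i2 := g_integrable ha.
apply: le_trans (int_le_dist i1 i2 h1) _; apply: leeD2r.
by apply: ereal_sup_ubound; exists alpha => //; rewrite unlock.
Qed.

(** The inequality [norm_le_sqr] in place of Cauchy-Schwarz, at the price of a factor 2. *)
Lemma L1_le_L2 (f : Omega T m -> R) (x : R) : 0 < x -> Rint P f ->
  (\int[P]_w (f w ^+ 2)%:E <= (x ^+ 2)%:E)%E -> (\int[P]_w `|f w|%:E <= (2 * x)%:E)%E.
Proof.
move=> x0 fi h; have mf : mfun f by apply/EFinP; case/integrableP: fi.
have m2 : mfun (fun w => x^-1 * f w ^+ 2) by apply: mfunM; [exact: mcst|exact: mfunX].
apply: (via (\int[P]_w (x + x^-1 * f w ^+ 2)%:E)%E).
  apply: int_le => //.
  - exact: mcomp.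
  - exact: mfunD.
  - by move=> w; exact: norm_le_sqr.
under eq_integral do rewrite EFinD.
rewrite ge0_integralD//; last 3 first.
- by move=> w _; rewrite lee_fin ltW.
- by move=> w _; rewrite lee_fin; apply: mulr_ge0 (sqr_ge0 _); rewrite invr_ge0 ltW.
- exact/EFinP.
rewrite int_prob_cst; under eq_integral do rewrite EFinM.
rewrite ge0_integralZl//; last 3 first.
- by apply/EFinP; exact: mfunX.
- by move=> w _; rewrite lee_fin sqr_ge0.
- by rewrite lee_fin invr_ge0 ltW.
apply: (via (x%:E + x^-1%:E * (x ^+ 2)%:E)%E).
  by rewrite leeD2l// lee_wpmul2l// lee_fin invr_ge0 ltW.
by rewrite -EFinM -EFinD lee_fin expr2 mulKf ?gt_eqF//; lra.
Qed.

Lemma pathwise_arith (e1 V U0 UM gZ gX F D r : R) : `|U0 - V| <= e1 -> `|UM - gZ| <= e1 ->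
  UM <= U0 + (r + F) -> gX - D <= V + 2 * e1 + (`|gZ - gX| + `|D - F| + `|r|).
Proof.
move=> h1 h2 h3.
have := ler_norm (U0 - V); have := ler_norm (gZ - UM); rewrite distrC in h2.
have := ler_norm r; have := ler_norm (F - D); rewrite (distrC F D).
have := ler_norm (gX - gZ); rewrite (distrC gX); lra.
Qed.

(** The order of quantifiers is the point: one [V] and one [phi] serve all deterministic controls,
    and only the error [E] depends on the control. *)
Lemma fine_scheme (e : R) : 0 < e -> exists K : nat, (0 < K)%N /\ exists2 eta : R, 0 < eta &
  forall s M ka (F : finType) (f0 : F) (ctl : F -> 'cV[R]_k), is_grid T s M ->
    nested T K s M ka -> mesh_le s M eta -> (forall f, A (ctl f)) ->
  exists V : R, (V%:E <= primal_value P mu sigma g A + e%:E)%E /\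
  exists2 phi, @dual_integrands R T d phi & forall (fs : nat -> F) (a : R -> 'cV[R]_k), adm (fun t _ => a t) ->
    (forall i (t : R), (i < M)%N -> s i <= t < s i.+1 -> a t = ctl (fs i)) ->
    exists E : Omega T m -> R, [/\ Rint P E, (\int[P]_w (E w)%:E <= e%:E)%E, forall w, 0 <= E w &
      forall w, g (X (fun t _ => a t) w) - dual_mart phi (fun t _ => a t) w <= V + E w].
Proof.
move=> e0; pose e1 := e / 8; have e10 : 0 < e1 by rewrite divr_gt0.
have [r r0 hr] := ug e10.
have [K [K0 [eta1 eta10 H1]]] := state_gap e10.
pose eps := r / ((size (dirs2 d K))%:R + 1).
have D0 : 0 < (size (dirs2 d K))%:R + 1 :> R by rewrite ltr_wpDl.
have eps0 : 0 < eps by rewrite divr_gt0.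
have epsr : (size (dirs2 d K))%:R * eps <= r by rewrite /eps mulrA ler_pdivrMr// mulrC ler_wpM2l ?(ltW r0)// lerDl.
have e120 : 0 < e1 ^+ 2 by rewrite exprn_gt0.
have [eta2 eta20 H2] := mart_gap K0 eps0 e120.
have [eta3 eta30 H3] := rest_gap K0 eps0 e120.
exists K; split => //; exists (Num.min eta1 (Num.min eta2 eta3)); first by rewrite !lt_min eta10 eta20 eta30.
move=> s M ka F f0 ctl gs hka mesh ctlA.
have mesh1 i : (i < M)%N -> s i.+1 - s i <= eta1 by move=> /mesh; rewrite !le_min => /and3P[].
have mesh2 i : (i < M)%N -> s i.+1 - s i <= eta2 by move=> /mesh; rewrite !le_min => /and3P[].
have mesh3 i : (i < M)%N -> s i.+1 - s i <= eta3 by move=> /mesh; rewrite !le_min => /and3P[].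
have kaK i : (i < M)%N -> (ka i < K)%N by move=> /hka[].
have [q [dl [q0 dl0 qdl H4]]] := H3 s M ka F f0 ctl gs kaK mesh3 ctlA.
set V := value P K s M ka mu sigma f0 ctl g M (zero_path T d).
(* Two smoothing errors, at time 0 and at time [T], are added to the value; with the primal error
   this makes [3 * e1], at most [e]. *)
exists (V + 2 * e1); split.
  have := value_le_primal H1 f0 K0 gs hka mesh1 ctlA; rewrite -/V => hV.
  rewrite EFinD; apply: (via (primal_value P mu sigma g A + e1%:E + (2 * e1)%:E)%E); first exact: leeD2r.
  by rewrite -addeA leeD2l// -EFinD lee_fin /e1; lra.
set p := slope P K s M ka mu sigma f0 ctl g q dl.
have pUC i j : UC (fun z => p i z j 0) by exact: (slope_UC P T0 ka K0 gs mu sigma f0 ctl ug gC q0 dl0 i j).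
have pB i z j : `|p i z j 0| <= 2 * Cg / eps.
  by rewrite -qdl; exact: (slope_bound P T0 ka K0 gs mu sigma f0 ctl ug gC q0 dl0 i z j).
have phiD := feedback_dual T0 K0 gs pUC pB.
exists (feedback K s M p) => // fs a ha fol.
have fol' : follows ctl (fun i (_ : Omega T m) => fs i) s M (fun t _ => a t) by move=> i t w iM ht; exact: fol.
have df : decided s (fun i (_ : Omega T m) => fs i) M by move=> j _ f; exact: mcst.
have [i1 h1] := H1 s M ka F ctl _ _ gs hka mesh1 ctlA df ha fol'.
have h2 := H2 s M ka F f0 ctl q dl fs a gs hka mesh2 ctlA q0 dl0 qdl ha fol' p erefl.
have [m3 h3] := H4 fs.
pose Z w := state K s ka mu sigma ctl (fun i (_ : Omega T m) => fs i) M w.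
pose D w := dual_mart (feedback K s M p) (fun t _ => a t) w - feedback_sum K s M p ka mu sigma ctl fs w.
set rr := fun w => _ in m3.
have iD : Rint P D.
  apply: (L2_integrable (V := e1 ^+ 2)) h2; apply: mfunB.
    have [iM _] := dual_mart_mean phiD ha. by apply/EFinP; case/integrableP: iM.
  exact: measurable_feedback_sum pUC pB ctlA.
have ir : Rint P rr by exact: L2_integrable m3 h3.
have i2 := g_integrable ha.
have ig := integrableB measurableT i1 i2.
have L1 (f : Omega T m -> R) : Rint P f -> (\int[P]_w (f w ^+ 2)%:E <= (e1 ^+ 2)%:E)%E ->
    (\int[P]_w `|f w|%:E <= (2 * e1)%:E)%E.
  exact: L1_le_L2.
exists (fun w => `|g (Z w) - g (X (fun t _ => a t) w)| + `|D w| + `|rr w|).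
have ia : Rint P (fun w => `|g (Z w) - g (X (fun t _ => a t) w)|) by exact: integrable_norm ig.
have ib : Rint P (fun w => `|D w|) by exact: integrable_norm iD.
have ic : Rint P (fun w => `|rr w|) by exact: integrable_norm ir.
split.
- exact: integrableD (integrableD measurableT ia ib) ic.
- under eq_integral do rewrite !EFinD.
  rewrite integralD//; last exact: integrableD ia ib. rewrite integralD//.
  apply: (via (e1%:E + (2 * e1)%:E + (2 * e1)%:E)%E).
    by apply: leeD; [apply: leeD => //; exact: L1|exact: L1].
  by rewrite -!EFinD lee_fin /e1; lra.
- by move=> w; rewrite !addr_ge0.
- move=> w.
  (* The pathwise inequality for [U], in which [lin] sums to the discrete martingale; three errors
     remain: terminal state against path, discrete against continuous martingale, and remainders. *)
  have hU := U_path P T0 ka K0 gs mu sigma f0 ctl ug gC q0 dl0 fs w (leqnn M).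
  have hs : (size (dirs2 d K))%:R * (q%:R * dl) <= r by rewrite qdl.
  have hV := value_mod P T0 ka K0 gs mu sigma f0 ctl ug gC (leq_subr 0 M) r0 hr.
  have c1 := Sm_close T0 K0 q0 dl0 hV hs (zero_path T d). have c2 := Sm_close T0 K0 q0 dl0 hr hs (Z w).
  rewrite big_split /= -/(rr w) -/(Z w) in hU.
  rewrite {1}/U subnn in hU; rewrite subn0 in c1; rewrite /U subn0 -/V in hU.
  have c3 : \sum_(i < M) lin P K s M ka mu sigma f0 ctl g q dl i (fs i)
      (state K s ka mu sigma ctl (fun i0 (_ : Omega T m) => fs i0) i w) (inc s i w) =
      feedback_sum K s M p ka mu sigma ctl fs w by [].
  rewrite c3 in hU. rewrite /D; refine (pathwise_arith _ _ c1 c2 hU).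
Qed.

(** The fine grid contains the nodes of the partition, so a deterministic control is constant on the
    fine cells. *)
Lemma step_follows tp n s M (F : finType) (ctl : F -> 'cV[R]_k) (f0 : F) (c : nat -> 'cV[R]_k) :
  is_grid T tp n -> is_grid T s M -> (forall l, (l <= n)%N -> exists2 j, (j <= M)%N & s j = tp l) ->
  (forall l, (l <= n)%N -> exists f, ctl f = c l) ->
  exists fs : nat -> F, forall i (t : R), (i < M)%N -> s i <= t < s i.+1 -> step T tp n c t = ctl (fs i).
Proof.
move=> gr gs fine surj.
exists (fun i => odflt f0 [pick f | ctl f == step T tp n c (s i)]) => i t iM /andP[h1 h2].
have si := is_grid_bnd gs (ltnW iM).
have [l ln il] := cell_cover gr si.
have siT : s i < T by have [_ <- _] := gs; rewrite (is_grid_lt gs) // ltnW.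
(* The last cell of the partition is the single point [T], and [s i] lies strictly before it. *)
have lln : (l < n)%N.
  move: il; rewrite /in_cell ltn_neqAle ln andbT; case: eqVneq => // -> /andP[].
  by have [_ -> _] := gr; rewrite leNgt siT.
have [j jM ej] := fine l.+1 lln.
move: il; rewrite /in_cell lln => /andP[l1 l2].
have ij : (i < j)%N by rewrite -(is_grid_lt gs (ltnW iM) jM) ej.
have tl : t < tp l.+1 by apply: lt_le_trans h2 _; rewrite -ej (is_grid_le gs).
rewrite (stepE gr c ln (t := t)) ?(stepE gr c ln (t := s i)) /in_cell ?lln ?l1 ?l2 ?tl ?(le_trans l1 h1)//.
case: pickP => /= [f /eqP //|h].
by have [f ef] := surj l ln; have := h f; rewrite ef eqxx.
Qed.

(** The finite control set of the scheme is the net itself. Being contained in [A], it gives a value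
    no larger than the primal one up to the error, whatever the size of [h]. *)
Lemma dual_le_primal (h : R) n tp N : 0 < h -> is_partition T h n tp -> is_net h A N ->
  (dual_value P mu sigma g N n tp <= primal_value P mu sigma g A)%E.
Proof.
move=> h0 [tp0 tpT tpS _] [fN NA netN]; apply/lee_addgt0Pr => e e0.
have gr : is_grid T tp n by split.
have N0 : N !=set0 by have [x Ax] := A0; have [y Ny _] := netN x Ax; exists y.
have [F1 [f1 [c [cN cd dc]]]] := finite_det_controls gr fN N0.
have [sN eN] := (finite_seqP N).1 fN.
pose ctl (f : seq_sub sN) : 'cV[R]_k := ssval f.
have inN x : N x <-> x \in sN by rewrite eN.
have [y0 Ny0] := N0.
pose f0 : seq_sub sN := SeqSub ((inN y0).1 Ny0).
have ctlA f : A (ctl f) by apply/NA/inN; exact: (ssvalP f).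
have n10 : 0 < #|F1|%:R + 1 :> R by rewrite ltr_wpDl.
have e10 : 0 < e / (#|F1|%:R + 1) by rewrite divr_gt0.
have [K [K0 [eta eta0 H]]] := fine_scheme e10.
(* One share of the error for [V] and one for each of the finitely many deterministic controls. *)
set e1 := e / _ in e10 H.
pose L := [seq tp i | i <- iota 0 n.+1].
have LT : {in L, forall x, 0 <= x <= T}.
  by move=> x /mapP[i]; rewrite mem_iota add0n => /andP[_ iN] ->; exact: (is_grid_bnd gr).
have [s [M [ka [gs hka mesh hL]]]] := ex_fine_grid T0 K0 eta0 LT.
have [V [hV [phi phiD Hphi]]] := H s M ka _ f0 ctl gs hka mesh ctlA.
have adm1 f : adm (fun t _ => step T tp n (c f) t) by exact: (step_cst_admissible gr NA (fun l _ => cN f l)).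
have /boolp.choice[E hE] (f : F1) : exists E : Omega T m -> R, [/\ Rint P E,
    (\int[P]_w (E w)%:E <= e1%:E)%E, forall w, 0 <= E w & forall w, g (X (fun t _ => step T tp n (c f) t) w) -
      dual_mart phi (fun t _ => step T tp n (c f) t) w <= V + E w].
  have fine l : (l <= n)%N -> exists2 j, (j <= M)%N & s j = tp l.
    by move=> ln; apply: hL; apply: map_f; rewrite mem_iota.
  have surj l : (l <= n)%N -> exists f', ctl f' = c f l by move=> _; exists (SeqSub ((inN _).1 (cN f l))).
  have [fs hfs] := step_follows f0 gr gs fine surj. exact: (Hphi fs _ (adm1 f) hfs).
have iE f : Rint P (E f) by have [] := hE f.
have E0 f w : 0 <= E f w by have [_ _ + _] := hE f; exact.
have iS : Rint P (fun w => \sum_f E f w).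
  have := integrable_sum measurableT (index_enum F1) (P := predT) (fun f _ => iE f).
  by apply: eq_integrable => // w _ /=; rewrite sumEFin.
have ib : Rint P (fun w => V + \sum_f E f w).
  exact: integrableD (finite_measure_integrable_cst P V measurableT) iS.
have ip := pathwise_sup_integrable gr fN N0 NA phiD.
(* The supremum of the errors is bounded by their sum, which is affordable because the control set
   is finite and fixed before the scheme is refined. *)
have main w : pathwise_sup P mu sigma g N n tp phi w <= V + \sum_f E f w.
  have z_le f : g (X (fun t _ => step T tp n (c f) t) w) -
      dual_mart phi (fun t _ => step T tp n (c f) t) w <= V + \sum_f E f w.
    have [_ _ _ /(_ w) h1] := hE f; apply: le_trans h1 _.
    by rewrite lerD2l (bigD1 f)//= lerDl; apply: sumr_ge0 => i _; exact: E0.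
  rewrite /pathwise_sup (@sup_bigmax R (R -> 'cV[R]_k) (det_controls T N n tp)
    (fun a => g (X (fun t _ => a t) w) - dual_mart phi (fun t _ => a t) w) F1 f1 (fun f => step T tp n (c f))) //.
    exact: bigmax_le.
  by move=> a /(det_controls_step gr)[v vN ->]; have [f _ ->] := dc v vN; exists f.
apply: (via (\int[P]_w (pathwise_sup P mu sigma g N n tp phi w)%:E)%E).
  by apply: ereal_inf_lbound; exists phi => //; rewrite unlock.
apply: le_trans (int_le_ae ip ib (aeW _ main)) _.
under eq_integral do rewrite EFinD.
rewrite integralD//; last exact: (finite_measure_integrable_cst P V measurableT).
rewrite int_prob_cst.
have hS : (\int[P]_w (\sum_f E f w)%:E <= (#|F1|%:R * e1)%:E)%E.
  under eq_integral do rewrite -sumEFin. rewrite ge0_integral_sum//; last 2 first.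
  - by move=> f; case/integrableP: (iE f).
  - by move=> f w _; rewrite lee_fin; exact: E0.
  apply: (via (\sum_(f : F1) e1%:E)%E); first by apply: lee_sum => f _; have [] := hE f.
  by rewrite sumEFin sumr_const mulr_natl.
apply: le_trans (leeD hV hS) _; rewrite -addeA leeD2l// -EFinD lee_fin /e1.
have -> : e / (#|F1|%:R + 1) + #|F1|%:R * (e / (#|F1|%:R + 1)) = e by field; rewrite gt_eqF.
by [].
Qed.

Lemma primal_fin : primal_value P mu sigma g A \is a fin_num.
Proof.
have bnd alpha : adm alpha -> ((- Cg)%:E <= \int[P]_w (g (X alpha w))%:E)%E /\ (\int[P]_w (g (X alpha w))%:E <= Cg%:E)%E.
  move=> ha; have ig := g_integrable ha. have ic c := finite_measure_integrable_cst P c measurableT.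
  split; rewrite -(int_prob_cst P).
    by apply: (@int_le_ae _ _ _ P (fun=> - Cg) (fun w => g (X alpha w)) (ic _) ig (aeW _ _)) => w; have := gC (X alpha w); rewrite ler_norml => /andP[].
  by apply: (@int_le_ae _ _ _ P (fun w => g (X alpha w)) (fun=> Cg) ig (ic _) (aeW _ _)) => w; have := gC (X alpha w); rewrite ler_norml => /andP[].
have [x Ax] := A0.
have hx : adm (fun _ _ => x).
  split=> // t ht a b. by apply/F_measurableP; exact: mcst.
rewrite fin_numElt; apply/andP; split.
  have [h1 _] := bnd _ hx; apply: lt_le_trans (ltNyr (- Cg)) (le_trans h1 _).
  by apply: ereal_sup_ubound; exists (fun _ _ => x) => //; rewrite unlock.
apply: le_lt_trans (ltry Cg); apply: ge_ereal_sup => _ [alpha ha <-]; rewrite unlock.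
by have [] := bnd _ ha.
Qed.

(** Half of [e] for the choice of an almost optimal control, half for its replacement by a step
    control with values in the net; [h0] is found before the dual integrand is given. *)
Lemma primal_le_dual (e : R) : 0 < e -> exists2 h0 : R, 0 < h0 &
  forall h n tp N, 0 < h -> h <= h0 -> is_partition T h n tp -> is_net h A N ->
  (primal_value P mu sigma g A - e%:E <= dual_value P mu sigma g N n tp)%E.
Proof.
move=> e0; have e20 : 0 < e / 2 by rewrite divr_gt0.
have [_ [alpha ha <-] hs] := ub_ereal_sup_adherent e20 primal_fin; rewrite [ltRHS]expectationE in hs.
have [h0 h00 H] := approx_control e20 ha.
exists h0 => // h n tp N hp hh part net.
have [v [vF vN hv]] := H h n tp N hp hh part net.
have [tp0 tpT tpS _] := part; have gr : is_grid T tp n by split.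
have [fN NA netN] := net.
have N0 : N !=set0 by have [x Ax] := A0; have [y Ny _] := netN x Ax; exists y.
apply: le_ereal_inf_tmp => _ [phi phiD <-]; rewrite unlock.
have hle := expectation_le_dual gr fN N0 NA phiD vF vN.
apply: le_trans hle.
set al' := fun (t : R) (w : Omega T m) => _ in hv *.
have ha' : adm al' by apply: (step_admissible gr vF) => l w ln; exact/NA/vN.
have i1 := g_integrable ha.
have i2 := g_integrable ha'.
have hd : (\int[P]_w (g (X alpha w))%:E <= \int[P]_w (g (X al' w))%:E + (e / 2)%:E)%E. exact: int_le_dist i1 i2 hv.
exact: ereal_gap (integrable_fin_num measurableT i2) primal_fin hs hd.
Qed.

End Control.

Lemma cvg_right_squeeze (R : realType) (f : R -> \bar R) (p : \bar R) : p \is a fin_num ->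
  (forall h, 0 < h -> (f h <= p)%E) ->
  (forall e : R, 0 < e -> exists2 h0 : R, 0 < h0 & forall h, 0 < h -> h <= h0 -> (p - e%:E <= f h)%E) ->
  f h @[h --> 0^'+] --> p.
Proof.
case: p => [p||]// _ up low; apply/fine_cvgP; split.
  have [h0 h00 H] := low 1 ltr01. near=> h. have hp : 0 < h by near: h; exact: nbhs_right_gt.
  have hh : h <= h0 by near: h; exact: nbhs_right_le. by have := up h hp; have := H h hp hh; case: (f h).
apply/cvgrPdist_le => e e0; have [h0 h00 H] := low e e0.
near=> h.
have hp : 0 < h by near: h; exact: nbhs_right_gt.
have hh : h <= h0 by near: h; exact: nbhs_right_le.
have := up h hp; have := H h hp hh => /=; case: (f h) => [v||]//=.
by rewrite -EFinD !lee_fin => h1 h2; rewrite ger0_norm ?subr_ge0//; lra.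
Unshelve. all: by end_near.
Qed.

Theorem theorem3p9 (R : realType) (T : R) (d m k : nat)
    (P0 : probability (Omega T m) R)
    (A : set 'cV[R]_k)
    (n : R -> nat) (tp : R -> nat -> R) (N : R -> set 'cV[R]_k)
    (mu : R -> 'cV[R]_k -> 'cV[R]_d)
    (sigma : R -> 'cV[R]_k -> 'M[R]_(d, m))
    (g : Omega T d -> R) (delta0 : R) :
  0 < T ->
  is_wiener P0 ->
  compact A -> A !=set0 ->
  (forall h, 0 < h -> is_partition T h (n h) (tp h)) ->
  (forall h, 0 < h -> is_net h A (N h)) ->
  (exists C : R, forall t a, 0 <= t -> A a -> enorm (mu t a) <= C) ->
  (exists C : R, forall t a, 0 <= t -> A a -> enorm (sigma t a) <= C) ->
  (exists C : R, forall w, `|g w| <= C) ->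
  (forall t, 0 <= t -> {within A, continuous (mu t)}) ->
  (forall t, 0 <= t -> {within A, continuous (sigma t)}) ->
  0 < delta0 <= 1 ->
  (exists L : R, forall s t a, 0 <= s -> 0 <= t -> A a ->
    enorm (mu t a - mu s a) <= L * (`|t - s| `^ delta0)) ->
  (exists L : R, forall s t a, 0 <= s -> 0 <= t -> A a ->
    enorm (sigma t a - sigma s a) <= L * (`|t - s| `^ delta0)) ->
  (forall e : R, 0 < e -> exists2 delta : R, 0 < delta &
    forall w w' : Omega T d, path_dist w w' < delta -> `|g w - g w'| < e) ->
  dual_value P0 mu sigma g (N h) (n h) (tp h) @[h --> 0^'+]
    --> primal_value P0 mu sigma g A.

Proof.
move=> T0 WP cA A0 hpart hnet [Cm muC] [Cs sigmaC] [Cg gC] muA sigmaA d0 [Lm muL] [Ls sigmaL] hug.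
have ug : UC g by exact: UC_path_dist (ltW T0) hug.
apply: cvg_right_squeeze (primal_fin T0 WP cA A0 muC sigmaC muA sigmaA d0 muL sigmaL ug gC) _ _ => [h h0|e e0].
  exact: (dual_le_primal T0 WP cA A0 muC sigmaC muA sigmaA d0 muL sigmaL ug gC h0 (hpart h h0) (hnet h h0)).
have [h0 h00 H] := primal_le_dual T0 WP cA A0 muC sigmaC muA sigmaA d0 muL sigmaL ug gC e0.
by exists h0 => // h hp hh; exact: (H h _ _ _ hp hh (hpart h hp) (hnet h hp)).
Qed.
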